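(* Let $\lambda$ be a stable functional on $\mathsf V_x$, $S$ the associated maximal torus of $G=\mathrm U_n$, and $\epsilon_f$ the character of $S(F)$ (factoring through $S(F)/S_{1/2}\cong C_\lambda$) attached to the toral invariant of $(S,G)$. Let $D$ be the discriminant of $\overline V$. Then for every $i$ $$\epsilon_f(c_i)=\left(\frac{-1}{q}\right)^{d_i(n-d_i)}\cdot\Big(\prod_j(-1)^{d_j-1}\Big)^{d_i}\cdot\left(\frac{\eta_i}{q^{d_i}}\right)^{n}\cdot\left(\frac{D}{q}\right)^{d_i}.$$
   Context: $F$ is a non-archimedean local field with residue field $k$ of size $q$ and characteristic $p>2$, $\Gamma=\mathrm{Gal}(\bar F/F)$. $E/F$ is a ramified quadratic extension, $e\mapsto\bar e$ its conjugation, $\varpi_F$ a uniformizer of $F$, $\varpi_E$ a uniformizer of $E$ with $\overline{\varpi_E}=-\varpi_E$. $G=\mathrm U_n$ is the unitary group of $V=E^n$ with $\langle x,y\rangle=x_1\bar y_n+\dots+x_n\bar y_1$, $\mathfrak g$ its Lie algebra. Let $\Lambda=\mathcal O_E^n$ and let $x$ be the corresponding point of the Bruhat–Tits building of $G$ over $F$: $G_x=G(F)\cap\mathrm{GL}_n(\mathcal O_E)$, and $G_{x,r/2}$ ($r\ge1$) is the kernel of reduction mod $\varpi_E^r$; similarly $\mathfrak g_{x,r/2}$. $\overline V=\Lambda/\varpi_E\Lambda=k^n$ with the reduced symmetric form; its discriminant $D$ is the Gram determinant, modulo squares. $\mathsf V_x=\mathfrak g_{x,1/2}/\mathfrak g_{x,1}$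 is identified (via $\varpi_EA$) with self-adjoint operators $A$ on $\overline V$, and with its dual via $(X,Y)\mapsto\mathrm{Tr}(\varpi_F^{-1}XY)$. A functional $\lambda$, viewed as a self-adjoint matrix, is stable (finite stabilizer and closed orbit under $\mathrm O_n$) iff its characteristic polynomial $p_\lambda$ has distinct roots in $\bar k$. Write $p_\lambda=\prod_ip_i$ with $p_i$ irreducible over $k$ of degree $d_i$, $k_i=k[T]/p_i$; $F_i$ (resp. $E_i$) is the unramified extension of $F$ (resp. $E$) of degree $d_i$. $C_\lambda=\prod_i\mu_2(k_i)$ is the stabilizer of $\lambda$ in $\mathrm O_n(k)$ and $c_i\in C_\lambda$ is $-1$ in the $i$-th factor and $1$ elsewhere. $\left(\frac{\cdot}{q^d}\right)$ is the quadratic character of the field with $q^d$ elements. Choose a lift $\tilde\lambda\in\mathfrak g_{x,1/2}$ of $\lambda$; $S=Z_G(\tilde\lambda)$ is a maximal torus with $S(F)=\prod_i\ker(N:E_i^\times\to F_i^\times)$, $S_{1/2}=S(F)\cap G_{x,1/2}$, $S(F)/S_{1/2}\cong C_\lambda$. There is an orthogonal $\tilde\lambda$-stable decomposition $V=\bigoplus_iV_i$ with $V_i\cong E_i$ and form $\mathrm{Tr}_{E_i/E}(\eta_ix\bar y)$ on $V_i$, $\eta_i\in F_i^\times$ ($\bar y$ the conjugation of $E_i/F_i$); $\eta_i$ also denotes its image in $F_i^\times/N_{E_i/F_i}(E_i^\times)\cong k_{F_i}^\times/k_{F_i}^{\times2}$. For a root $\alpha\in R(S,G)$ let $F_\alpha\supset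 F_{\pm\alpha}$ be the fixed fields of the stabilizers in $\Gamma$ of $\alpha$ and $\{\pm\alpha\}$; here every $F_\alpha/F_{\pm\alpha}$ is ramified quadratic, with quadratic character $\kappa_\alpha$ of $F_{\pm\alpha}^\times$ and nontrivial automorphism $\tau_\alpha$. The toral invariant is $f(\alpha)=\kappa_\alpha([X_\alpha,\tau_\alpha X_\alpha]/H_\alpha)$ for any $0\ne X_\alpha\in\mathfrak g_\alpha(F_\alpha)$, with $H_\alpha=d\alpha^\vee(1)$. The character $\epsilon_f$ of $S(F)$ is trivial on $S_{1/2}$, and $\epsilon_f(\gamma)=\prod_{\alpha\in R(S,G)/\Gamma,\ \alpha(\gamma)\ne1}f(\alpha)$ for $\gamma\in C_\lambda$. *)

(* Defs.v *)
From HB Require Import structures.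
From mathcomp Require Import all_boot all_order all_algebra all_fingroup all_field.
From mathcomp Require Import boolp classical_sets functions cardinality fsbigop.

Set Implicit Arguments.
Unset Strict Implicit.
Unset Printing Implicit Defensive.

Import Order.TTheory GRing.Theory Num.Theory.
Local Open Scope classical_set_scope.
Local Open Scope ring_scope.

(** * Non-archimedean local fields *)

(* A valuation is a function [v : K -> int] whose value at 0 is irrelevant;
   [vge v m x] is "v(x) >= m" with the convention v(0) = +oo. *)
Definition vge (K : fieldType) (v : K -> int) (m : int) (x : K) : bool :=
  (x == 0) || (m <= v x).

Definition uniformizer (K : fieldType) (v : K -> int) (x : K) : Prop :=
  x != 0 /\ v x = 1.

Record normalized_valuation (K : fieldType) (v : K -> int) : Prop := {
  val_mul : forall x y, x != 0 -> y != 0 -> v (x * y) = v x + v y;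
  val_add : forall m x y, vge v m x -> vge v m y -> vge v m (x + y);
  val_unif : exists x, uniformizer v x }.

Definition complete_valuation (K : fieldType) (v : K -> int) : Prop :=
  forall u : nat -> K,
    (forall m : int, exists N : nat, forall i j : nat,
        (N <= i)%N -> (N <= j)%N -> vge v m (u i - u j)) ->
    exists l : K, forall m : int, exists N : nat, forall i : nat,
        (N <= i)%N -> vge v m (u i - l).

(* [res : K -> k] is the reduction map from the valuation ring to the residue
   field; its values outside the valuation ring are irrelevant. *)
Record residue_map (K k : fieldType) (v : K -> int) (res : K -> k) : Prop := {
  res_one : res 1 = 1;
  res_add : forall x y, vge v 0 x -> vge v 0 y -> res (x + y) = res x + res y;
  res_mul : forall x y, vge v 0 x -> vge v 0 y -> res (x * y) = res x * res y;
  res_ker : forall x, vge v 0 x -> (res x == 0) = vge v 1 x;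
  res_surj : forall a, exists2 x, vge v 0 x & res x = a }.

Record local_field (K : fieldType) (k : finFieldType) (v : K -> int)
    (res : K -> k) : Prop := {
  lf_val : normalized_valuation v;
  lf_complete : complete_valuation v;
  lf_res : residue_map v res }.

(* [v'] extends [v] along [f : K -> K'] with ramification index [e]. *)
Definition val_ext (K K' : fieldType) (f : K -> K') (v : K -> int)
    (v' : K' -> int) (e : nat) : Prop :=
  forall x, x != 0 -> v' (f x) = v x *+ e.

(* The residue maps are compatible along [f], with induced map [rho] on residue
   fields. *)
Definition res_ext (K K' k k' : fieldType) (f : K -> K') (rho : k -> k')
    (v : K -> int) (res : K -> k) (res' : K' -> k') : Prop :=
  forall x, vge v 0 x -> res' (f x) = rho (res x).

Definition algebraic_ext (K L : fieldType) (f : {rmorphism K -> L}) : Prop :=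
  forall x : L, exists2 p : {poly K}, p != 0 & root (map_poly f p) x.

Record separable_closure (K L : fieldType) (f : {rmorphism K -> L}) : Prop := {
  sep_alg : forall x : L,
    exists2 p : {poly K}, separable_poly p & root (map_poly f p) x;
  sep_closed : forall p : {poly L},
    separable_poly p -> (1 < size p)%N -> exists x, root p x }.

(* Quadratic character of a finite field, extended by 0 at 0. *)
Definition qchar (K : finFieldType) (x : K) : int :=
  if x == 0 then 0 else if [exists y : K, y ^+ 2 == x] then 1 else -1.

(** * Unitary groups and their Lie algebras *)

(* [<x, y> = x_1 c(y_n) + ... + x_n c(y_1)] over a commutative ring with an
   involution [c]; the case [c = id] is the symmetric form. *)
Section Form.
Variables (A : comPzRingType) (c : A -> A) (n : nat).

Definition herm (x y : 'cV[A]_n) : A :=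
  \sum_(i < n) x i ord0 * c (y (rev_ord i) ord0).

(* Invertibility is automatic, the form being perfect. *)
Definition isom_grp : set 'M[A]_n :=
  [set g | forall x y, herm (g *m x) (g *m y) = herm x y].

Definition isom_lie : set 'M[A]_n :=
  [set X | forall x y, herm (X *m x) y + herm x (X *m y) = 0].

Definition isom_cent (T : 'M[A]_n) : set 'M[A]_n :=
  [set g | isom_grp g /\ g *m T = T *m g].

Definition gram : 'M[A]_n :=
  \matrix_(i, j) herm (delta_mx i ord0) (delta_mx j ord0).

End Form.

Definition mx_bracket (A : comPzRingType) (n : nat) (X Y : 'M[A]_n) : 'M[A]_n :=
  X *m Y - Y *m X.

(** * Stability of self-adjoint matrices under the orthogonal group *)

Inductive polyfun (K : fieldType) (n : nat) : ('M[K]_n -> K) -> Prop :=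
| polyfun_coord i j : polyfun (fun X => X i j)
| polyfun_const a : polyfun (fun=> a)
| polyfun_add f g : polyfun f -> polyfun g -> polyfun (fun X => f X + g X)
| polyfun_mul f g : polyfun f -> polyfun g -> polyfun (fun X => f X * g X).

Definition zariski_closed (K : fieldType) (n : nat) (Z : set 'M[K]_n) : Prop :=
  exists P : set ('M[K]_n -> K),
    P `<=` @polyfun K n /\ Z = [set X | forall f, P f -> f X = 0].

Definition On_orbit (K : fieldType) (n : nat) (X : 'M[K]_n) : set 'M[K]_n :=
  [set Y | exists2 g, isom_grp id g & g *m X = Y *m g].

(* Stability is geometric: the condition is on points over an algebraic closure
   [rho : k -> kbar]. Closedness in the self-adjoint matrices and in all
   matrices agree, the former being a linear subspace. *)
Definition stable (k kbar : fieldType) (rho : {rmorphism k -> kbar}) (n : nat)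
    (X : 'M[k]_n) : Prop :=
  finite_set (isom_cent id (map_mx rho X)) /\
  zariski_closed (On_orbit (map_mx rho X)).

(** * Filtration at the point x of the building given by the lattice O_E^n *)

Section Filtration.
Variables (F : fieldType) (k : finFieldType) (vF : F -> int) (resF : F -> k).
Variables (E : fieldExtType F) (vE : E -> int) (resE : E -> k).
Variables (bar : {lrmorphism E -> E}) (n : nat).

(* [lie_filt r] is g_{x, r/2}; [grp_filt r] is G_{x, r/2} for [r >= 1]. *)
Definition lie_filt (r : nat) : set 'M[E]_n :=
  [set X | isom_lie bar X /\ forall i j, vge vE r (X i j)].

Definition grp_filt (r : nat) : set 'M[E]_n :=
  [set g | isom_grp bar g /\ forall i j, vge vE r ((g - 1%:M) i j)].

(* [lam], whose values outside g_{x, 1/2} are irrelevant, is a k-linear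
   functional on V_x = g_{x, 1/2} / g_{x, 1}. *)
Record functional (lam : 'M[E]_n -> k) : Prop := {
  fun_add : forall X Y, lie_filt 1 X -> lie_filt 1 Y ->
    lam (X + Y) = lam X + lam Y;
  fun_scale : forall (a : F) X, vge vF 0 a -> lie_filt 1 X ->
    lam (a%:A *: X) = resF a * lam X;
  fun_quot : forall X, lie_filt 2 X -> lam X = 0 }.

(* [Y] in g_{x, 1/2} lifts the element of V_x corresponding to [lam] under the
   pairing (X, Y) |-> Tr (piF^-1 X Y). *)
Definition lifts (piF : F) (lam : 'M[E]_n -> k) (Y : 'M[E]_n) : Prop :=
  lie_filt 1 Y /\
  forall X, lie_filt 1 X -> lam X = resE ((piF^-1)%:A * \tr (X *m Y)).

(* The self-adjoint operator A over k with Y = piE A. *)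
Definition red_op (piE : E) (Y : 'M[E]_n) : 'M[k]_n :=
  map_mx resE (piE^-1 *: Y).

End Filtration.

(** * Geometric points, roots and toral invariant *)

(* [L] is a separable closure of [F] containing [E] through [iota]. The algebra
   E (x)_F L is realised as [L * L], via
   e (x) x |-> (iota e * x, iota (bar e) * x). *)
Section Toral.
Variables (F : fieldType) (E : fieldExtType F) (bar : {lrmorphism E -> E}).
Variables (L : fieldType) (iota : {rmorphism E -> L}) (n : nat).

Local Notation EL := (L * L)%type.

Definition toEL (e : E) : EL := (iota e, iota (bar e)).

(* bar (x) id *)
Definition barEL (x : EL) : EL := (x.2, x.1).

(* id (x) sigma : the two components are exchanged exactly when sigma exchanges
   the embeddings [iota] and [iota \o bar] of E. *)
Definition galEL (sigma : L -> L) (x : EL) : EL :=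
  if `[< forall e, sigma (iota e) = iota e >] then (sigma x.1, sigma x.2)
  else (sigma x.2, sigma x.1).

Definition gal_mx (sigma : L -> L) (X : 'M[EL]_n) : 'M[EL]_n :=
  map_mx (galEL sigma) X.

Definition scaleL (a : L) (X : 'M[EL]_n) : 'M[EL]_n := ((a, a) : EL) *: X.

(* Membership in Gal(L / F). *)
Definition Gal (sigma : {rmorphism L -> L}) : Prop :=
  bijective sigma /\ forall a : F, sigma (iota a%:A) = iota a%:A.

(* [T] in g(F) is the element whose centralizer is the torus S. *)
Variable T : 'M[E]_n.

Definition torusF : set 'M[E]_n := isom_cent bar T.
Definition torusL : set 'M[EL]_n := isom_cent barEL (map_mx toEL T).

(* g_alpha(L) = { X | Ad(s) X = alpha(s) X for all s in S(L) } *)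
Definition root_space (alpha : 'M[EL]_n -> L) : set 'M[EL]_n :=
  [set X | isom_lie barEL X /\
     forall s, torusL s -> s *m X = scaleL (alpha s) (X *m s)].

(* R(S, G): the nontrivial weights of S on g, as functions on S(L) extended by
   0. S(L) is Zariski dense in S, and a function with a nonzero weight space is
   automatically an algebraic character. *)
Definition is_root (alpha : 'M[EL]_n -> L) : Prop :=
  [/\ forall s, ~ torusL s -> alpha s = 0,
      exists2 s, torusL s & alpha s != 1
    & exists2 X, X != 0 & root_space alpha X].

Definition rootN (alpha : 'M[EL]_n -> L) : 'M[EL]_n -> L :=
  fun s => (alpha s)^-1.

(* beta = sigma alpha, that is beta(s) = sigma (alpha (sigma^-1 s)) *)
Definition gal_root (sigma : L -> L) (alpha beta : 'M[EL]_n -> L) : Prop :=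
  forall s, beta (gal_mx sigma s) = sigma (alpha s).

Definition gal_orbit (alpha : 'M[EL]_n -> L) : set ('M[EL]_n -> L) :=
  [set beta | exists2 sigma, Gal sigma & gal_root sigma alpha beta].

Definition stab (alpha : 'M[EL]_n -> L) : set {rmorphism L -> L} :=
  [set sigma | Gal sigma /\ gal_root sigma alpha alpha].

(* Elements of Gal(L / F) sending alpha to - alpha; on F_alpha they all induce
   the automorphism tau_alpha. *)
Definition flip (alpha : 'M[EL]_n -> L) : set {rmorphism L -> L} :=
  [set sigma | Gal sigma /\ gal_root sigma alpha (rootN alpha)].

Definition Falpha (alpha : 'M[EL]_n -> L) : set L :=
  [set x | forall sigma, stab alpha sigma -> sigma x = x].

(* g_alpha(F_alpha) *)
Definition root_spaceF (alpha : 'M[EL]_n -> L) : set 'M[EL]_n :=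
  [set X | root_space alpha X /\
     forall sigma, stab alpha sigma -> gal_mx sigma X = X].

(* The quadratic character of F_{+-alpha}^* attached to F_alpha / F_{+-alpha}
   by class field theory: its kernel is the group of norms. *)
Definition kappa (alpha : 'M[EL]_n -> L) (a : L) : int :=
  if `[< exists y sigma, [/\ Falpha alpha y, y != 0, flip alpha sigma
                          & a = y * sigma y] >] then 1 else -1.

(* A cocharacter mu of S with its differential [H] = d mu (1): an algebraic
   homomorphism is a Laurent polynomial sum_e t^e M_e, and H = sum_e e M_e. *)
Definition cocharacter (mu : L -> 'M[EL]_n) (H : 'M[EL]_n) : Prop :=
  [/\ forall t, t != 0 -> torusL (mu t),
      forall t u, t != 0 -> u != 0 -> mu (t * u) = mu t *m mu u
    & exists r : seq (int * 'M[EL]_n),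
        (forall t, t != 0 -> mu t = \sum_(e <- r) scaleL (t ^ e.1) e.2) /\
        H = \sum_(e <- r) e.2 *~ e.1].

(* [H] is H_alpha = d alpha^vee (1), where the coroot alpha^vee is the
   cocharacter such that <alpha, alpha^vee> = 2 and the reflection
   s |-> s alpha^vee(alpha(s))^-1 of S is induced by an element [w] of G. *)
Definition coroot_diff (alpha : 'M[EL]_n -> L) (H : 'M[EL]_n) : Prop :=
  exists mu : L -> 'M[EL]_n,
    [/\ cocharacter mu H,
        forall t, t != 0 -> alpha (mu t) = t ^+ 2
      & exists2 w, isom_grp barEL w &
          forall s, torusL s -> w *m s = s *m mu (alpha s)^-1 *m w].

(* [a] = [X, tau_alpha X] / H_alpha for some nonzero X in g_alpha(F_alpha). *)
Definition toral_ratio (alpha : 'M[EL]_n -> L) : set L :=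
  [set a | exists X sigma H,
     [/\ root_spaceF alpha X, X != 0, flip alpha sigma, coroot_diff alpha H
       & mx_bracket X (gal_mx sigma X) = scaleL a H]].

Definition toral_inv (alpha : 'M[EL]_n -> L) : int :=
  kappa alpha (xget 0 (toral_ratio alpha)).

(* The Galois orbits of roots alpha with alpha(gamma) <> 1. *)
Definition root_orbits (gamma : 'M[E]_n) : set (set ('M[EL]_n -> L)) :=
  [set O | exists alpha, [/\ is_root alpha, alpha (map_mx toEL gamma) != 1
                           & O = gal_orbit alpha]].

Variable vE : E -> int.

(* eps is the character epsilon_f of S(F). The group C_lambda = S(F)/S_{1/2} is
   embedded in S(F) as its 2-torsion (the elements acting by +-1 on each V_i),
   and the last clause gives epsilon_f on it. *)
Record toral_char (eps : 'M[E]_n -> int) : Prop := {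
  tc_mul : forall g h, torusF g -> torusF h -> eps (g *m h) = eps g * eps h;
  tc_triv : forall g, torusF g -> grp_filt vE bar 1 g -> eps g = 1;
  tc_val : forall g, torusF g -> g *m g = 1%:M ->
    eps g = \big[*%R/1]_(O \in root_orbits g) toral_inv (xget (fun=> 0) O) }.

End Toral.

(** * The decomposition of V *)

Section Decomposition.
Variables (F : fieldType) (k : finFieldType) (vF : F -> int) (resF : F -> k).
Variables (E : fieldExtType F) (vE : E -> int) (resE : E -> k).
Variables (bar : {lrmorphism E -> E}) (piE : E).

(* The unramified extensions F_i / F and E_i / E of degree d, with common
   residue field k_i. E_i / E being Galois, it is a splitting field. *)
Record unram_pair (d : nat) : Type := UnramPair {
  up_F : fieldExtType F;
  up_E : splittingFieldType E;
  up_k : finFieldType;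
  up_vF : up_F -> int;
  up_vE : up_E -> int;
  up_resF : up_F -> up_k;
  up_resE : up_E -> up_k;
  up_incl : {rmorphism up_F -> up_E};
  up_rho : {rmorphism k -> up_k};
  up_bar : {rmorphism up_E -> up_E};
  up_lfF : local_field up_vF up_resF;
  up_lfE : local_field up_vE up_resE;
  up_dimF : \dim {: up_F} = d;
  up_dimE : \dim {: up_E} = d;
  up_unramF : val_ext (in_alg up_F) vF up_vF 1;
  up_unramE : val_ext (in_alg up_E) vE up_vE 1;
  up_rhoF : res_ext (in_alg up_F) up_rho vF resF up_resF;
  up_rhoE : res_ext (in_alg up_E) up_rho vE resE up_resE;
  up_resEF : res_ext up_incl id up_vF up_resF up_resE;
  up_inclF : forall a : F, up_incl a%:A = (a%:A : E)%:A;
  up_barF : forall x, up_bar (up_incl x) = up_incl x;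
  up_barE : forall e : E, up_bar e%:A = (bar e)%:A }.

(* Image of [eta] under
   F_i^* / N(E_i^* ) = O_{F_i}^* / (squares) = k_i^* / (squares),
   as a representative in k_i. *)
Definition eta_bar d (B : unram_pair d) (eta : up_F B) : up_k B :=
  xget 0 [set a | exists u z,
    [/\ u != 0, up_vF u = 0, z != 0,
        up_incl B eta = up_incl B u * (z * up_bar B z) & a = up_resF u]].

Variable n : nat.

(* V = (+)_i V_i, where V_i is the image of [phi i : E_i -> V] on which [Y]
   acts by multiplication by [theta i]. The factor p_i of the characteristic
   polynomial of the reduction of piE^-1 Y is the one having the reduction of
   piE^-1 theta_i as a root. *)
Record orth_decomp (Y : 'M[E]_n) (m : nat) (p : 'I_m -> {poly k})
    (B : forall i, unram_pair (size (p i)).-1)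
    (phi : forall i, {linear up_E (B i) -> 'cV[E]_n})
    (theta : forall i, up_E (B i)) (eta : forall i, up_F (B i)) : Prop := {
  od_eta : forall i, eta i != 0;
  od_span : forall v : 'cV[E]_n,
    exists x : forall i, up_E (B i), v = \sum_(i < m) phi i (x i);
  od_free : forall x : forall i, up_E (B i),
    \sum_(i < m) phi i (x i) = 0 -> forall i, x i = 0;
  od_orth : forall i j x y, i != j -> herm bar (phi i x) (phi j y) = 0;
  od_form : forall i x y, (herm bar (phi i x) (phi i y))%:A =
    galTrace 1 {: up_E (B i)} (up_incl (B i) (eta i) * x * up_bar (B i) y);
  od_stable : forall i x, Y *m phi i x = phi i (theta i * x);
  od_factor : forall i, vge (@up_vE _ (B i)) 0 (piE^-1 *: theta i) /\
    root (map_poly (up_rho (B i)) (p i)) (up_resE (piE^-1 *: theta i)) }.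

End Decomposition.

(* The element c_i of C_lambda, contained in
   k[A] = k[T] / (prod_j p_j) = prod_j k_j:
   the value at A of a polynomial that is -1 mod p_i and 1 mod p_j, j <> i. *)
Definition is_ci (k : fieldType) (n : nat) (A : 'M[k]_n) (m : nat)
    (p : 'I_m -> {poly k}) (i : 'I_m) (c : 'M[k]_n) : Prop :=
  exists u : {poly k},
    [/\ c = \sum_(l < size u) u`_l *: A ^+ l, p i %| u + 1
      & forall j, j != i -> p j %| u - 1].

(* Main.v *)
(** Let [M] be an unramified extension of [E] containing all eigenvalues of [lamt], with its
Frobenius [phi] (which acts on the residue field [k^N] by [x |-> x^q]) and its conjugation. The
forms [Tr (eta_i x y)] yield an orthogonal eigenbasis [v_a] of [M^n] permuted by [phi] through a
permutation [pi] whose cycles are the blocks [V_i], with units [h_a = <v_a, v_a>] fixed by the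
conjugation. The roots are the [alpha_ab] ([a <> b]), the group [Gal(L/F)] acts on them through
the powers of [pi] and through [alpha_ab |-> alpha_ba], and a root vector in
[g_alpha(F_alpha)] shows that [f(alpha_ab)] is [kappa_alpha (- h_a h_b)]. As
[F_alpha/F_(+-alpha)] is ramified quadratic, this is
[(- h_a h_b)^((q^l - 1)/2)] in the residue field, with [l] the length of the [pi]-orbit of [(a, b)];
hence the product over the roots with [alpha(c_i) <> 1] telescopes to
[prod_(a in V_i, b notin V_i) (- h_a h_b)^((q - 1)/2)]. Finally [prod_(a in V_i) h_a] has the same
quadratic character as [eta_i], and [prod_a h_a = D det(W)^2] with [W] the matrix of the [v_a],
where [phi (det W) = sgn(pi) det W] gives [det(W)^(q-1) = sgn(pi) = prod_j (-1)^(d_j - 1)]. *)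
Require Import Defs.
From HB Require Import structures.
From mathcomp Require Import all_boot all_order all_algebra all_fingroup all_field.
From mathcomp Require Import boolp classical_sets functions cardinality fsbigop.
From mathcomp Require Import qpoly qfpoly zify ring.

Set Implicit Arguments.
Unset Strict Implicit.
Unset Printing Implicit Defensive.

Import Order.TTheory GRing.Theory Num.Theory.
Local Open Scope ring_scope.


(** * Extension of automorphisms to the separable closure *)

(** The invariants are phrased through bare automorphisms of [L]: [Falpha] is a fixed set and
    [kappa] a norm condition. Their computation rests on two facts: automorphisms of [M] extend to
    [L], and what Gal(L/M) fixes lies in [M]. Both come from Zorn's lemma applied to graphs of
    partial automorphisms.

    The conjugation of [E] exchanges the factors of E ⊗ L = L × L, so first components identify G(L)
    with GL_n(L) and roots with ratios of eigenvalues. A root with alpha(c_i) ≠ 1 has its two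
    indices in different blocks, and no power of [pi] can exchange them. Hence a Galois element that
    fixes the root is trivial on [E], and one that negates it conjugates [E]: this is why F_alpha /
    F_(+-alpha) is ramified.

    Stability enters through the finiteness of the stabilizer, which forces distinct eigenvalues.
    The lift [g] of c_i is arbitrary, whereas the product formula for [eps] concerns elements of
    order two; so [g] is compared with the involution that is -1 on V_i, their product lying in
    S_(1/2). All signs are finally compared in [kbar], where Euler's criterion makes characters into
    powers. *)

Section Extension.
Variables (F L : fieldType) (f : {rmorphism F -> L}).
Hypothesis hL : separable_closure f.

(** A partial automorphism over [F] is encoded by its graph, an [F]-subalgebra of L × L meeting 0 ×
    L trivially. Unions of chains are then immediate, and the inverse map is the exchange of
    coordinates. *)
Record pgraph (G : set (L * L)) : Prop := {
  pg_base : forall a, G (f a, f a);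
  pg_sub : forall x y, G x -> G y -> G (x - y);
  pg_mul : forall x y, G x -> G y -> G (x * y);
  pg_fun : forall b, G (0, b) -> b = 0 }.

(** Such a polynomial packs one over the domain of the partial map (via [fst]) together with its
    image (via [snd]). *)
Definition over (G : set (L * L)) (h : {poly L * L}) := forall i, G h`_i.

Section Graph.
Variable G : set (L * L).
Hypothesis pG : pgraph G.

Lemma pg0 : G 0.
Proof. by have := pg_base pG 0; rewrite rmorph0. Qed.

Lemma pg1 : G 1.
Proof. by have := pg_base pG 1; rewrite rmorph1. Qed.

Lemma pg_opp x : G x -> G (- x).
Proof. by move=> Gx; rewrite -sub0r; apply: (pg_sub pG) => //; apply: pg0. Qed.

Lemma pg_add x y : G x -> G y -> G (x + y).
Proof. by move=> Gx Gy; rewrite -[y]opprK; apply: (pg_sub pG) => //; apply: pg_opp. Qed.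

Lemma pg_sum I (r : seq I) (P : pred I) (E : I -> L * L) :
  (forall i, P i -> G (E i)) -> G (\sum_(i <- r | P i) E i).
Proof.
by move=> h; apply: (big_ind G) => //; [apply: pg0|apply: pg_add].
Qed.

Lemma pg_horner (q : {poly F}) x : G x ->
  G ((map_poly f q).[x.1], (map_poly f q).[x.2]).
Proof.
move=> Gx; elim/poly_ind: q => [|q c IH].
  by rewrite rmorph0 !horner0; apply: pg0.
rewrite rmorphD rmorphM /= map_polyX map_polyC !hornerMXaddC.
apply: (@pg_add (_ * x.1, _ * x.2) (_, _)); last exact: (pg_base pG).
by apply: (@pg_mul _ pG (_, _) (x.1, x.2)) => //; rewrite -surjective_pairing.
Qed.

(** [x.1] is algebraic over [F]. Once powers of X are split off, it is a root of some [q] with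
    nonzero constant term, so its inverse is a polynomial in it; [pg_fun] carries the same relation
    over to [x.2]. The domain is therefore a field. *)
Lemma pg_inv x : G x -> x.1 != 0 -> x.2 != 0 /\ G (x.1^-1, x.2^-1).
Proof.
move=> Gx x0.
have [p sp px] := sep_alg hL x.1.
have p0 : p != 0 by apply: contraTneq sp => ->; rewrite unlock /= deriv0 coprimep0 -size_poly_eq1 size_poly0.
have [r [q /implyP qr0 Ep]] := multiplicity_XsubC p 0.
have {}qr0 := qr0 p0.
have qx : (map_poly f q).[x.1] = 0.
  move: px; rewrite Ep rmorphM rmorphXn rmorphB /= map_polyX map_polyC /= rmorph0 subr0.
  by rewrite rootE hornerM hornerXn mulf_eq0 expf_eq0 (negbTE x0) andbF orbF => /eqP.
have [q' Eq] : exists q', q = q' * 'X + (q.[0])%:P.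
  have /factor_theorem[q' E] : root (q - (q.[0])%:P) 0.
    by rewrite rootE hornerD hornerN hornerC subrr.
  by exists q'; rewrite subr0 in E; rewrite -E subrK.
have fq0 : f q.[0] != 0 by rewrite fmorph_eq0.
have E y : (map_poly f q).[y] = (map_poly f q').[y] * y + f q.[0].
  by rewrite {1}Eq rmorphD rmorphM /= map_polyX map_polyC hornerMXaddC.
have q2 : (map_poly f q).[x.2] = 0.
  by apply: (pg_fun pG); rewrite -qx; apply: pg_horner.
have E1 : (map_poly f q').[x.1] * x.1 = - f q.[0] by apply/eqP; rewrite -subr_eq0 opprK -E qx.
have E2 : (map_poly f q').[x.2] * x.2 = - f q.[0] by apply/eqP; rewrite -subr_eq0 opprK -E q2.
have x2 : x.2 != 0.
  by apply: contraNneq fq0 => x20; rewrite x20 mulr0 in E2; rewrite -oppr_eq0 -E2.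
split=> //.
have inv y : y != 0 -> (map_poly f q').[y] * y = - f q.[0] ->
    y^-1 = (map_poly f q').[y] * f (- q.[0]^-1).
  by move=> y0 Ey; apply: (mulIf y0); rewrite mulVf // mulrAC Ey rmorphN fmorphV mulrNN mulfV.
rewrite !inv //.
apply: (@pg_mul _ pG (_, _) (_, _)); first exact: pg_horner.
exact: (pg_base pG).
Qed.

Lemma overC a : G a -> over G a%:P.
Proof. by move=> Ga i; rewrite coefC; case: eqP => // _; apply: pg0. Qed.

Lemma overX : over G 'X.
Proof. by move=> i; rewrite coefX; case: eqP => _; [apply: pg1|apply: pg0]. Qed.

Lemma over_sub h1 h2 : over G h1 -> over G h2 -> over G (h1 - h2).
Proof. by move=> o1 o2 i; rewrite coefB; apply: (pg_sub pG). Qed.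

Lemma over_mul h1 h2 : over G h1 -> over G h2 -> over G (h1 * h2).
Proof.
by move=> o1 o2 i; rewrite coefM; apply: pg_sum => j _; apply: (pg_mul pG).
Qed.

Lemma over_exp h n : over G h -> over G (h ^+ n).
Proof.
move=> oh; elim: n => [|n IH]; last by rewrite exprS; apply: over_mul.
by rewrite expr0; apply/overC/pg1.
Qed.

Lemma over_map (q : {poly F}) (y : L) : exists h : {poly L * L},
  [/\ over G h, map_poly fst h = map_poly f q & map_poly snd h = map_poly f q].
Proof.
exists (\poly_(i < size q) (f q`_i, f q`_i)); split.
- by move=> i; rewrite coef_poly; case: ifP => _; [apply: (pg_base pG)|apply: pg0].
- apply/polyP=> i; rewrite !coef_map coef_poly /=; case: ltnP => //= h.
  by rewrite nth_default // rmorph0.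
- apply/polyP=> i; rewrite !coef_map coef_poly /=; case: ltnP => //= h.
  by rewrite nth_default // rmorph0.
Qed.

(** The minimal polynomial of [y] over the domain. Separability is asked of its image, which has to
    acquire a root in [L]. *)
Definition is_minp (y : L) (m : {poly L * L}) := [/\ over G m, m \is monic,
  (map_poly fst m).[y] = 0, separable_poly (map_poly snd m) &
  forall h, over G h -> (map_poly fst h).[y] = 0 -> exists q, h = q * m].

(** Coefficients lie in L × L, which is not a field: [m] is a polynomial over [G] of least size
    vanishing at [y], made monic with [pg_inv], and division by it is done by hand, one leading term
    [t] at a time. It divides a separable polynomial over [F], whence its separability. *)
Lemma minp_exists (y : L) : exists m, is_minp y m.
Proof.
have [p sp py] := sep_alg hL y.
have [hp [op p1 p2]] := over_map p y.
have p0 : p != 0 by apply: contraTneq sp => ->; rewrite unlock /= deriv0 coprimep0 -size_poly_eq1 size_poly0.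
pose P s := `[< exists h, [/\ over G h, h != 0, (map_poly fst h).[y] = 0 & size h = s] >].
have exP : exists s, P s.
  exists (size hp); apply/asboolP; exists hp; split=> //; last by rewrite p1; apply/eqP.
  by apply: contra_neq p0 => hp0; apply/eqP; rewrite -(map_poly_eq0 f) -p1 hp0 rmorph0.
case: (ex_minnP exP) => s /asboolP[m0 [om0 m00 m0y sm0]] smin.
have lc : lead_coef m0 != 0 by rewrite lead_coef_eq0.
have lc1 : (lead_coef m0).1 != 0.
  apply: contra_neq lc => l1; have Gl : G (lead_coef m0) by apply: om0.
  by rewrite (surjective_pairing (lead_coef m0)) l1 in Gl *; rewrite (pg_fun pG Gl).
have [lc2 Gi] := pg_inv (om0 _ : G (lead_coef m0)) lc1.
pose c := ((lead_coef m0).1^-1, (lead_coef m0).2^-1).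
have cE : c * lead_coef m0 = 1 by congr pair; rewrite /= mulVf.
pose m := c%:P * m0.
have mm : m \is monic.
  have sz : (size m <= size m0)%N by rewrite /m mul_polyC size_scale_leq.
  have k : m`_(size m0).-1 = 1 by rewrite /m mul_polyC coefZ cE.
  have sm : size m = size m0.
    apply/eqP; rewrite eqn_leq sz /= -(prednK (_ : 0 < size m0)%N) ?size_poly_gt0 //.
    by rewrite ltnNge; apply: contra_neqN (oner_neq0 (L * L)%type) => /leq_sizeP/(_ _ (leqnn _)) <-.
  by apply/eqP; rewrite /lead_coef sm.
have om : over G m by apply: over_mul => //; apply: overC.
have my : (map_poly fst m).[y] = 0 by rewrite rmorphM hornerM m0y mulr0.
have szm : size m = s.
  apply/eqP; rewrite eqn_leq; apply/andP; split; first by rewrite -sm0 /m mul_polyC size_scale_leq.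
  by apply: smin; apply/asboolP; exists m; split=> //; apply: monic_neq0.
have div h : over G h -> (map_poly fst h).[y] = 0 -> exists q, h = q * m.
  have [n] := ubnP (size h); elim: n h => // n IH h sh oh hy.
  have [->|h0] := eqVneq h 0; first by exists 0; rewrite mul0r.
  have sle : (s <= size h)%N by apply: smin; apply/asboolP; exists h.
  have sm1 : (0 < size m)%N by rewrite size_poly_gt0 monic_neq0.
  pose t := (lead_coef h)%:P * 'X^(size h - s).
  have ot : over G t by apply: over_mul; [apply/overC/oh|apply/over_exp/overX].
  have [|||q Eq] := IH (h - t * m).
  - apply: (@leq_ltn_trans (size h).-1); last first.
      by case: (size h) (size_poly_gt0 h) sh => //; rewrite h0.
    apply/leq_sizeP => j hj; rewrite coefB /t -mulrA mul_polyC coefZ coefXnM.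
    have hs : (0 < size h)%N by rewrite size_poly_gt0.
    have s0 : (0 < s)%N by rewrite -szm.
    have -> : (j < size h - s)%N = false.
      by apply/negbTE; rewrite -leqNgt; apply: leq_trans hj; rewrite -subn1 leq_sub2l.
    have [jE|jne] := eqVneq j (size h).-1.
      have -> : (j - (size h - s) = (size m).-1)%N.
        rewrite szm jE -subn1 -(subn1 s); move: (size h) sle s0 => a; clear; lia.
      by rewrite -/(lead_coef m) (monicP mm) mulr1 jE subrr.
    have hj' : (size h <= j)%N.
      by rewrite -(prednK hs) ltn_neqAle eq_sym jne.
    by rewrite !nth_default ?mulr0 ?subrr // szm; move: (size h) sle s0 hj' => a; clear; lia.
  - by apply: over_sub => //; apply: over_mul.
  - by rewrite rmorphB rmorphM /= hornerD hornerN hornerM my mulr0 subr0.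
  by exists (q + t); rewrite mulrDl -Eq subrK.
exists m; split=> //.
have [q Eq] : exists q, hp = q * m by apply: div => //; rewrite p1; apply/eqP.
have : separable_poly (map_poly f p) by rewrite separable_map.
by rewrite -p2 Eq rmorphM separable_mul => /and3P[].
Qed.

Lemma size_minp_snd y m : is_minp y m -> size (map_poly snd m) = size m.
Proof.
case=> _ mm _ _ _; rewrite size_map_poly_id0 //.
by rewrite (monicP mm) oner_neq0.
Qed.

Lemma size_minp_gt1 y m : is_minp y m -> (1 < size m)%N.
Proof.
move=> hm; rewrite -(size_minp_snd hm); case: (hm) => om mm my _ _.
rewrite ltnNge; apply: contra_eqN my => sm.
have sm1 : size m = 1.
  by apply/eqP; rewrite eqn_leq -{1}(size_minp_snd hm) sm size_poly_gt0 monic_neq0.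
have -> : m = 1.
  by rewrite (size1_polyC (eq_leq sm1)); have := monicP mm; rewrite /lead_coef sm1 /= => ->.
by rewrite rmorph1 hornerC oner_neq0.
Qed.

Definition adjoin y y' : set (L * L) :=
  [set z | exists2 h, over G h & z = ((map_poly fst h).[y], (map_poly snd h).[y'])].

Lemma adjoin_sub y y' : (G `<=` adjoin y y')%classic.
Proof.
move=> x Gx; exists x%:P; first exact: overC.
by rewrite !map_polyC !hornerC -surjective_pairing.
Qed.

Lemma adjoin_gen y y' : adjoin y y' (y, y').
Proof. by exists 'X; [apply: overX|rewrite !map_polyX !hornerX]. Qed.

(** Single-valued: a relation satisfied by [y] is a multiple of [m], so its image vanishes at
    [y']. *)
Lemma adjoin_pgraph y y' m : is_minp y m -> root (map_poly snd m) y' ->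
  pgraph (adjoin y y').
Proof.
move=> [om mm my sm div] my'; split.
- by move=> a; apply/adjoin_sub/(pg_base pG).
- move=> _ _ [h1 o1 ->] [h2 o2 ->]; exists (h1 - h2); first exact: over_sub.
  by rewrite !rmorphB !hornerD !hornerN.
- move=> _ _ [h1 o1 ->] [h2 o2 ->]; exists (h1 * h2); first exact: over_mul.
  by rewrite !rmorphM !hornerM.
- move=> b [h oh [h1 ->]]; have [q ->] := div _ oh (esym h1).
  by rewrite rmorphM hornerM (eqP my') mulr0.
Qed.

End Graph.

Lemma minp_root G (pG : pgraph G) y m : is_minp G y m ->
  exists y', root (map_poly snd m) y'.
Proof.
move=> hm; case: (hm) => _ _ _ sm _; apply: (sep_closed hL sm).
by rewrite (size_minp_snd hm); apply: (size_minp_gt1 hm).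
Qed.

Definition swap_graph (G : set (L * L)) : set (L * L) := [set x | G (x.2, x.1)].

(** Single-valuedness of the inverse is injectivity of a field homomorphism, supplied by
    [pg_inv]. *)
Lemma swap_pgraph G : pgraph G -> pgraph (swap_graph G).
Proof.
move=> pG; split=> [a|x y|x y|b] /=; rewrite /swap_graph /=.
- exact: (pg_base pG).
- exact: (@pg_sub _ pG (_, _) (_, _)).
- exact: (@pg_mul _ pG (_, _) (_, _)).
- move=> Gb; apply/eqP; apply: contraT => b0.
  by have /= [] := pg_inv pG Gb b0; rewrite eqxx.
Qed.

(** A maximal graph has full domain, since any [y] can be adjoined, and full range by the same
    argument for the swapped graph. *)
Theorem extend_aut G0 : pgraph G0 -> exists s : {rmorphism L -> L},
  [/\ bijective s, forall a, s (f a) = f a & forall x, G0 x -> s x.1 = x.2].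
Proof.
move=> pG0; pose P (G : set (L * L)) := G = set0 \/ (pgraph G /\ (G0 `<=` G)%classic).
have [|G [PG Gmax]] := @Zorn_bigcup _ P.
  move=> C CP Ctot; have [allE|/existsNP[G1 /not_implyP[CG1 G1n]]] :=
      pselect (forall G, C G -> G = set0).
    by left; rewrite bigcup0.
  right; have [//|[pG1 G01]] := CP _ CG1.
  have two x y : (\bigcup_(X in C) X)%classic x -> (\bigcup_(X in C) X)%classic y ->
      exists G, [/\ C G, pgraph G, G x & G y].
    move=> [A CA Ax] [B CB By]; have [sAB|sBA] := Ctot _ _ CA CB.
      exists B; split=> //; last exact: sAB.
      by have [E|[]//] := CP _ CB; rewrite E in By.
    exists A; split=> //; last exact: sBA.
    by have [E|[]//] := CP _ CA; rewrite E in Ax.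
  split; first split.
  - by move=> a; exists G1 => //; apply: (pg_base pG1).
  - by move=> x y Cx Cy; have [G [CG pG Gx Gy]] := two _ _ Cx Cy; exists G => //; apply: (pg_sub pG).
  - by move=> x y Cx Cy; have [G [CG pG Gx Gy]] := two _ _ Cx Cy; exists G => //; apply: (pg_mul pG).
  - by move=> b Cb; have [G [CG pG Gx Gy]] := two _ _ Cb Cb; apply: (pg_fun pG).
  by move=> x G0x; exists G1 => //; apply: G01.
have [pG G0G] : pgraph G /\ (G0 `<=` G)%classic.
  case: PG => // G_0; exfalso; apply: (Gmax G0); last by right; split.
  rewrite G_0; split; first exact: sub0set.
  by move=> /(_ 0 (pg0 pG0)).
have maxE G' : pgraph G' -> (G `<=` G')%classic -> (G' `<=` G)%classic.
  move=> pG' GG'; apply: contrapT => nG'; apply: (Gmax G'); last first.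
    by right; split=> //; apply: subset_trans GG'.
  by split.
have dom y : exists y', G (y, y').
  have [m hm] := minp_exists pG y; have [y' my'] := minp_root pG hm.
  exists y'; apply: (maxE _ (adjoin_pgraph pG hm my')); first exact: adjoin_sub.
  exact: adjoin_gen.
have cod y' : exists y, G (y, y').
  have pG' := swap_pgraph pG.
  have [m hm] := minp_exists pG' y'; have [y my] := minp_root pG' hm.
  exists y; apply: (maxE _ (swap_pgraph (adjoin_pgraph pG' hm my))); last first.
    exact: (adjoin_gen pG').
  by move=> x Gx; apply: (adjoin_sub pG'); rewrite /swap_graph /= -surjective_pairing.
have [s sG] := choice dom; have [t tG] := choice cod.
have funG a b c : G (a, b) -> G (a, c) -> b = c.
  move=> Gb Gc; apply/eqP; rewrite -subr_eq0; apply/eqP/(pg_fun pG).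
  by have := pg_sub pG Gb Gc; rewrite -[_ - _]/(a - a, b - c) subrr.
have injG a b c : G (a, c) -> G (b, c) -> a = b.
  move=> Ga Gb; apply/eqP; rewrite -subr_eq0; apply/eqP/(pg_fun (swap_pgraph pG)).
  by have := pg_sub pG Ga Gb; rewrite -[_ - _]/(a - b, c - c) subrr.
have s1 : s 1 = 1 by apply: (funG 1) => //; apply: (pg1 pG).
have sB : {morph s : x y / x - y}.
  by move=> x y; apply: (funG (x - y)) => //; apply: (@pg_sub _ pG (_, _) (_, _)).
have sM : {morph s : x y / x * y}.
  by move=> x y; apply: (funG (x * y)) => //; apply: (@pg_mul _ pG (_, _) (_, _)).
pose sA := GRing.isZmodMorphism.Build L L s sB.
pose sM' := GRing.isMonoidMorphism.Build L L s (conj s1 sM).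
pose s' : {rmorphism L -> L} := HB.pack s sA sM'.
exists s'; split.
- exists t => x /=; first exact: (injG _ _ (s x)).
  exact: (funG (t x)).
- by move=> a; apply: (funG (f a)) => //; apply: (pg_base pG).
- by move=> x /G0G Gx; apply: (funG x.1) => //; rewrite -surjective_pairing.
Qed.

Record subfield_set (K : set L) : Prop := {
  sf_base : forall a, K (f a);
  sf_sub : forall x y, K x -> K y -> K (x - y);
  sf_mul : forall x y, K x -> K y -> K (x * y) }.

(** Over the identity graph on [K], the minimal polynomial of [y] is separable and not linear, so it
    has a second root, to which [y] can be sent. *)
Corollary moving_aut (K : set L) (y : L) : subfield_set K -> ~ K y ->
  exists s : {rmorphism L -> L},
  [/\ bijective s, forall a, s (f a) = f a, forall x, K x -> s x = x & s y != y].
Proof.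
move=> hK nKy; pose G : set (L * L) := fun x => K x.1 /\ x.2 = x.1.
have pG : pgraph G.
  split=> [a|x y0 [Kx ex] [Ky ey]|x y0 [Kx ex] [Ky ey]|b []//].
  - by split=> //; apply: (sf_base hK).
  - by split; [apply: (sf_sub hK)|rewrite /= ex ey].
  - by split; [apply: (sf_mul hK)|rewrite /= ex ey].
have [m hm] := minp_exists pG y; case: (hm) => om mm my sm _.
have m12 : map_poly fst m = map_poly snd m.
  by apply/polyP=> i; rewrite !coef_map; case: (om i) => _ h; apply: (esym h).
have [q Eq] : exists q, map_poly snd m = q * ('X - y%:P).
  by apply/factor_theorem; rewrite -m12; apply/eqP.
(* With a constant cofactor [m] would be X + m_0, and then y = - m_0 would lie in [K]. *)
have sq : (1 < size q)%N.
  have m20 : map_poly snd m != 0 by rewrite -size_poly_gt0 (size_minp_snd hm) ltnW ?(size_minp_gt1 hm).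
  have q0 : q != 0 by apply: contra_neq m20 => q0; rewrite Eq q0 mul0r.
  have := size_minp_snd hm; rewrite Eq size_mul ?polyXsubC_eq0 // size_XsubC addn2 /=.
  move=> sqm; rewrite ltnNge; apply/negP => sq1; apply: nKy.
  have sm2 : size m = 2%N.
    by apply/eqP; rewrite eqn_leq (size_minp_gt1 hm) andbT -sqm.
  have Em : m = 'X + (m`_0)%:P.
    apply/polyP=> i; rewrite coefD coefX coefC; case: i => [|[|i]] /=; rewrite ?add0r ?addr0 //.
      by have := monicP mm; rewrite /lead_coef sm2.
    by rewrite nth_default ?sm2.
  move: my; rewrite Em rmorphD /= map_polyX map_polyC hornerD hornerX hornerC => /eqP.
  rewrite addr_eq0 => /eqP ->; rewrite -sub0r.
  by apply: (sf_sub hK); [have := sf_base hK 0; rewrite rmorph0|case: (om 0%N)].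
have /(sep_closed hL)/(_ sq)[y' qy'] : separable_poly q.
  by move: sm; rewrite Eq separable_mul => /and3P[].
have y'y : y' != y.
  apply: contraTneq qy' => ->; move: sm; rewrite Eq separable_mul => /and3P[_ _].
  by rewrite coprimep_XsubC.
have my' : root (map_poly snd m) y' by rewrite Eq rootM qy'.
have [s [bs sF sG]] := extend_aut (adjoin_pgraph pG hm my').
exists s; split=> // [x Kx|].
  by apply: (sG (x, x)); apply: (adjoin_sub pG).
by have /= -> := sG _ (adjoin_gen pG y y').
Qed.

End Extension.

(** * Valued fields and Hensel lifting *)

(** The unramified extension below has its residue map into the algebraically closed [kbar], where
    it is not onto. Hence no surjectivity here; completeness is assumed separately. *)
Record valued (K kappa : fieldType) (v : K -> int) (res : K -> kappa) : Prop := {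
  vd_val : normalized_valuation v;
  vd_one : res 1 = 1;
  vd_add : forall x y, vge v 0 x -> vge v 0 y -> res (x + y) = res x + res y;
  vd_mul : forall x y, vge v 0 x -> vge v 0 y -> res (x * y) = res x * res y;
  vd_ker : forall x, vge v 0 x -> (res x == 0) = vge v 1 x }.

Lemma valued_local (K : fieldType) (k : finFieldType) (v : K -> int) (res : K -> k) :
  local_field v res -> valued v res.
Proof. by case=> hv _ []. Qed.

Section Valued.
Variables (K kappa : fieldType) (v : K -> int) (res : K -> kappa).
Hypothesis hv : valued v res.
Implicit Types (x y : K) (m n : int).

Let vM := val_mul (vd_val hv).

Lemma vge0 m : vge v m 0.
Proof. by rewrite /vge eqxx. Qed.

Lemma vgeE m x : x != 0 -> vge v m x = (m <= v x).
Proof. by rewrite /vge => /negbTE ->. Qed.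

Lemma v1 : v 1 = 0.
Proof.
have := vM (oner_neq0 K) (oner_neq0 K); rewrite mulr1.
by rewrite -[in LHS](addr0 (v 1)) => /addrI.
Qed.

Lemma vN x : v (- x) = v x.
Proof.
have [->|x0] := eqVneq x 0; first by rewrite oppr0.
have n0 : (-1 : K) != 0 by rewrite oppr_eq0 oner_neq0.
have vn1 : v (-1) = 0.
  by have := vM n0 n0; rewrite mulrNN mulr1 v1; lia.
by rewrite -mulN1r vM // vn1 add0r.
Qed.

Lemma vgeN m x : vge v m (- x) = vge v m x.
Proof. by rewrite /vge oppr_eq0 vN. Qed.

Lemma vge_add m x y : vge v m x -> vge v m y -> vge v m (x + y).
Proof. exact: (val_add (vd_val hv)). Qed.

Lemma vge_sub m x y : vge v m x -> vge v m y -> vge v m (x - y).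
Proof. by move=> hx hy; apply: vge_add => //; rewrite vgeN. Qed.

Lemma vge_sum m I (r : seq I) (P : pred I) (G : I -> K) :
  (forall i, P i -> vge v m (G i)) -> vge v m (\sum_(i <- r | P i) G i).
Proof.
by move=> h; apply: (big_ind (fun x => vge v m x)) => //; [apply: vge0|move=> *; apply: vge_add].
Qed.

Lemma vge_mul m n x y : vge v m x -> vge v n y -> vge v (m + n) (x * y).
Proof.
rewrite /vge mulf_eq0; case: eqVneq => //= x0; case: eqVneq => //= y0.
by move=> hx hy; rewrite vM // lerD.
Qed.

Lemma vge_mull m x y : vge v 0 x -> vge v m y -> vge v m (x * y).
Proof. by move=> hx hy; rewrite -[m]add0r; apply: vge_mul. Qed.

Lemma vge_mulr m x y : vge v m x -> vge v 0 y -> vge v m (x * y).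
Proof. by move=> hx hy; rewrite mulrC; apply: vge_mull. Qed.

Lemma vge_le m n x : m <= n -> vge v n x -> vge v m x.
Proof. by rewrite /vge => mn /orP[->//|nx]; rewrite (le_trans mn nx) orbT. Qed.

Lemma vge10 x : vge v 1 x -> vge v 0 x.
Proof. exact: vge_le. Qed.

Lemma vge_1 : vge v 0 1.
Proof. by rewrite /vge v1 lexx orbT. Qed.

Lemma vge_exp x e : vge v 0 x -> vge v 0 (x ^+ e).
Proof.
by move=> hx; elim: e => [|e IH]; rewrite ?expr0 ?vge_1 // exprS; apply: vge_mull.
Qed.

Lemma vge_nat e : vge v 0 e%:R.
Proof.
by elim: e => [|e IH]; rewrite ?vge0 // -addn1 natrD; apply: vge_add => //; apply: vge_1.
Qed.

Lemma vge_prod I (r : seq I) (P : pred I) (G : I -> K) :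
  (forall i, P i -> vge v 0 (G i)) -> vge v 0 (\prod_(i <- r | P i) G i).
Proof.
by move=> h; apply: (big_ind (fun x => vge v 0 x)) => //; [apply: vge_1|move=> *; apply: vge_mull].
Qed.

Lemma vge_all0 x : (forall m : nat, vge v m x) -> x = 0.
Proof.
move=> h; apply/eqP; apply: contraT => x0; have := h `|v x|.+1.
by rewrite vgeE //; lia.
Qed.

Lemma vX x e : x != 0 -> v (x ^+ e) = v x *+ e.
Proof.
move=> x0; elim: e => [|e IH]; first by rewrite expr0 v1.
by rewrite exprS mulrS vM ?expf_neq0 // IH.
Qed.

Lemma vV x : x != 0 -> v x^-1 = - v x.
Proof.
move=> x0; have := vM x0 (invr_neq0 x0); rewrite mulfV // v1.
by move=> h; lia.
Qed.

Lemma res0 : res 0 = 0.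
Proof. by apply/eqP; rewrite (vd_ker hv) ?vge0. Qed.

Lemma resN x : vge v 0 x -> res (- x) = - res x.
Proof.
move=> hx; apply/eqP; rewrite -addr_eq0 -(vd_add hv) ?vgeN //.
by rewrite addNr res0.
Qed.

Lemma resB x y : vge v 0 x -> vge v 0 y -> res (x - y) = res x - res y.
Proof. by move=> hx hy; rewrite (vd_add hv) ?vgeN // resN. Qed.

Lemma resX x e : vge v 0 x -> res (x ^+ e) = res x ^+ e.
Proof.
move=> hx; elim: e => [|e IH]; first by rewrite !expr0 (vd_one hv).
by rewrite !exprS (vd_mul hv) ?IH // vge_exp.
Qed.

Lemma res_sum I (r : seq I) (P : pred I) (G : I -> K) :
  (forall i, P i -> vge v 0 (G i)) ->
  res (\sum_(i <- r | P i) G i) = \sum_(i <- r | P i) res (G i).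
Proof.
move=> h; pose R x (z : kappa) := vge v 0 x /\ res x = z.
suff [] : R (\sum_(i <- r | P i) G i) (\sum_(i <- r | P i) res (G i)) by [].
apply: (big_ind2 R) => [|x1 y1 x2 y2 [h1 <-] [h2 <-]|i Pi]; rewrite /R.
- by rewrite vge0 res0.
- by rewrite (vd_add hv) //; split=> //; apply: vge_add.
- by split=> //; apply: h.
Qed.

Lemma res_prod I (r : seq I) (P : pred I) (G : I -> K) :
  (forall i, P i -> vge v 0 (G i)) ->
  res (\prod_(i <- r | P i) G i) = \prod_(i <- r | P i) res (G i).
Proof.
move=> h; pose R x (z : kappa) := vge v 0 x /\ res x = z.
suff [] : R (\prod_(i <- r | P i) G i) (\prod_(i <- r | P i) res (G i)) by [].
apply: (big_ind2 R) => [|x1 y1 x2 y2 [h1 <-] [h2 <-]|i Pi]; rewrite /R.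
- by rewrite vge_1 (vd_one hv).
- by rewrite (vd_mul hv) //; split=> //; apply: vge_mull.
- by split=> //; apply: h.
Qed.

Lemma res_nat e : res e%:R = e%:R.
Proof.
elim: e => [|e IH]; first by rewrite res0.
by rewrite -addn1 !natrD (vd_add hv) ?vge_nat ?vge_1 // IH (vd_one hv).
Qed.

Lemma res_unit x : vge v 0 x -> res x != 0 -> x != 0 /\ v x = 0.
Proof.
move=> hx; rewrite (vd_ker hv) // => n1.
have x0 : x != 0 by apply: contraNneq n1 => ->; rewrite vge0.
by split=> //; move: hx n1; rewrite !vgeE //; lia.
Qed.

Lemma unit_res x : x != 0 -> v x = 0 -> vge v 0 x /\ res x != 0.
Proof.
move=> x0 vx; have hx : vge v 0 x by rewrite vgeE ?vx.
by split=> //; rewrite (vd_ker hv) // vgeE // vx.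
Qed.

Lemma res_eq x y : vge v 0 x -> vge v 0 y -> (res x == res y) = vge v 1 (x - y).
Proof. by move=> hx hy; rewrite -subr_eq0 -resB // (vd_ker hv) // vge_sub. Qed.

Definition vpoly m (p : {poly K}) := forall i, vge v m p`_i.

Lemma vpolyC m x : vge v m x -> vpoly m x%:P.
Proof. by move=> hx i; rewrite coefC; case: eqP => // _; apply: vge0. Qed.

Lemma vpolyX : vpoly 0 'X.
Proof. by move=> i; rewrite coefX; apply: vge_nat. Qed.

Lemma vpolyD m p q : vpoly m p -> vpoly m q -> vpoly m (p + q).
Proof. by move=> hp hq i; rewrite coefD; apply: vge_add. Qed.

Lemma vpolyN m p : vpoly m p -> vpoly m (- p).
Proof. by move=> hp i; rewrite coefN vgeN. Qed.

Lemma vpolyM m n p q : vpoly m p -> vpoly n q -> vpoly (m + n) (p * q).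
Proof. by move=> hp hq i; rewrite coefM; apply: vge_sum => j _; apply: vge_mul. Qed.

Lemma vpoly0M p q : vpoly 0 p -> vpoly 0 q -> vpoly 0 (p * q).
Proof. by move=> hp hq; rewrite -[0]addr0; apply: vpolyM. Qed.

Lemma vpoly_deriv p : vpoly 0 p -> vpoly 0 p^`().
Proof.
by move=> hp i; rewrite coef_deriv -mulr_natr; apply: vge_mulr => //; apply: vge_nat.
Qed.

Lemma vpoly_prod I (r : seq I) (P : pred I) (G : I -> {poly K}) :
  (forall i, P i -> vpoly 0 (G i)) -> vpoly 0 (\prod_(i <- r | P i) G i).
Proof.
move=> h; apply: (big_ind (vpoly 0)) => //; last exact: vpoly0M.
by rewrite -polyC1; apply/vpolyC/vge_1.
Qed.

Lemma vge_horner m p x : vpoly m p -> vge v 0 x -> vge v m p.[x].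
Proof.
move=> hp hx; rewrite horner_coef; apply: vge_sum => i _.
by apply: vge_mulr => //; apply: vge_exp.
Qed.

Lemma coef_res p i : (map_poly res p)`_i = res p`_i.
Proof. by rewrite coef_map_id0 // res0. Qed.

Lemma res_polyD p q : vpoly 0 p -> vpoly 0 q ->
  map_poly res (p + q) = map_poly res p + map_poly res q.
Proof.
by move=> hp hq; apply/polyP=> i; rewrite coefD !coef_res coefD (vd_add hv).
Qed.

Lemma res_polyC x : map_poly res x%:P = (res x)%:P.
Proof. by apply/polyP=> i; rewrite coef_res !coefC; case: eqP => // _; rewrite res0. Qed.

Lemma res_polyX : map_poly res 'X = 'X.
Proof. by apply/polyP=> i; rewrite coef_res !coefX res_nat. Qed.

Lemma res_polyM p q : vpoly 0 p -> vpoly 0 q ->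
  map_poly res (p * q) = map_poly res p * map_poly res q.
Proof.
move=> hp hq; apply/polyP=> i; rewrite coef_res !coefM res_sum; last first.
  by move=> j _; apply: vge_mull.
by apply: eq_bigr => j _; rewrite (vd_mul hv) // !coef_res.
Qed.

Lemma res_poly_prod I (r : seq I) (G : I -> {poly K}) :
  (forall i, vpoly 0 (G i)) ->
  map_poly res (\prod_(i <- r) G i) = \prod_(i <- r) map_poly res (G i).
Proof.
move=> h; elim: r => [|a r IH]; first by rewrite !big_nil -polyC1 res_polyC (vd_one hv).
by rewrite !big_cons res_polyM ?IH //; apply: vpoly_prod.
Qed.

Lemma res_deriv p : vpoly 0 p -> map_poly res p^`() = (map_poly res p)^`().
Proof.
move=> hp; apply/polyP=> i; rewrite coef_res !coef_deriv coef_res -(mulr_natr p`__) -[RHS]mulr_natr.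
by rewrite (vd_mul hv) ?res_nat // vge_nat.
Qed.

Lemma res_horner p x : vpoly 0 p -> vge v 0 x -> res p.[x] = (map_poly res p).[res x].
Proof.
move=> hp hx; rewrite horner_coef res_sum; last first.
  by move=> i _; apply: vge_mull => //; apply: vge_exp.
rewrite (@horner_coef_wide _ (size p)) ?size_poly //.
by apply: eq_bigr => i _; rewrite (vd_mul hv) ?vge_exp // resX // coef_res.
Qed.

Lemma monic_res p : p \is monic ->
  map_poly res p \is monic /\ size (map_poly res p) = size p.
Proof.
move=> mp; have sz : size (map_poly res p) = size p.
  by rewrite size_map_poly_id0 // (monicP mp) (vd_one hv) oner_neq0.
split=> //; rewrite /(_ \is _) /= /lead_coef sz coef_res.
by apply/eqP; have := monicP mp; rewrite /lead_coef => ->; rewrite (vd_one hv).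
Qed.

(** The Gauss norm is attained at a coefficient, and dividing by it makes the polynomial
    primitive. *)
Lemma min_coef (p : {poly K}) : p != 0 ->
  exists i, p`_i != 0 /\ vpoly (v p`_i) p.
Proof.
move=> p0; have [i0 hi0] : exists i : 'I_(size p), p`_i != 0.
  have s0 : ((size p).-1 < size p)%N by rewrite prednK // size_poly_gt0.
  by exists (Ordinal s0); rewrite /= -/(lead_coef p) lead_coef_eq0.
have [i pi imin] := @arg_minP _ _ _ i0 (fun i : 'I_(size p) => p`_i != 0) (fun i => v p`_i) hi0.
exists i; split=> // j; rewrite /vge; case: eqVneq => //= pj.
have sj : (j < size p)%N by apply: contraR pj; rewrite -leqNgt => h; rewrite nth_default.
exact: (imin (Ordinal sj)).
Qed.

(** Taylor expansion with integral second-order remainder: the source of both uniqueness and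
    convergence in Hensel's lemma. *)
Lemma horner_diff p x y : vpoly 0 p -> vge v 0 x -> vge v 0 y ->
  exists2 r, vge v 0 r & p.[x] - p.[y] = (x - y) * (p^`().[y] + (x - y) * r).
Proof.
move=> hp hx hy; elim/poly_ind: p hp => [|p c IH] hp.
  by exists 0; [apply: vge0|rewrite deriv0 !horner0; ring].
have hp' : vpoly 0 p.
  by move=> i; have := hp i.+1; rewrite coefD coefMX coefC /= addr0.
have [r hr E] := IH hp'.
exists (p^`().[y] + r * x).
  apply: vge_add; last exact: vge_mull.
  by apply: vge_horner => //; apply: vpoly_deriv.
rewrite derivMXaddC !hornerMXaddC !hornerD hornerMX.
have -> : p.[x] * x + c - (p.[y] * y + c) = (p.[x] - p.[y]) * x + p.[y] * (x - y) by ring.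
by rewrite E; ring.
Qed.

(** In [horner_diff] the second factor reduces to the derivative at [res y], which is nonzero, so x
    - y must vanish. *)
Lemma hensel_unique p x y : vpoly 0 p -> vge v 0 x -> vge v 0 y ->
  p.[x] = 0 -> p.[y] = 0 -> res x = res y ->
  (map_poly res p)^`().[res y] != 0 -> x = y.
Proof.
move=> hp hx hy px py rxy dp; apply/eqP; rewrite -subr_eq0.
have [r hr E] := horner_diff hp hx hy.
move: E; rewrite px py subrr => /esym/eqP; rewrite mulf_eq0 => /orP[//|/eqP E].
have hd : vge v 0 p^`().[y] by apply: vge_horner => //; apply: vpoly_deriv.
have : res (p^`().[y] + (x - y) * r) = 0 by rewrite E res0.
have hxy : vge v 1 (x - y) by rewrite -res_eq // rxy.
have hxyr : vge v 1 ((x - y) * r) by apply: vge_mulr.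
rewrite (vd_add hv) //; last exact: vge10.
rewrite (res_horner (vpoly_deriv hp)) // res_deriv // => /eqP.
have /eqP -> : res ((x - y) * r) == 0 by rewrite (vd_ker hv) // vge10.
by rewrite addr0 (negbTE dp).
Qed.

Hypothesis hc : complete_valuation v.

Lemma hensel p x0 : vpoly 0 p -> vge v 0 x0 -> (map_poly res p).[res x0] = 0 ->
  (map_poly res p)^`().[res x0] != 0 ->
  exists x, [/\ vge v 0 x, res x = res x0 & p.[x] = 0].
Proof.
move=> hp hx0 rp dp.
have hd0 : vge v 0 p^`().[x0] by apply: vge_horner => //; apply: vpoly_deriv.
have rd : res p^`().[x0] != 0 by rewrite (res_horner (vpoly_deriv hp)) // res_deriv.
have [d0 vd] := res_unit hd0 rd.
pose c := (p^`().[x0])^-1.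
have hc0 : vge v 0 c by rewrite vgeE ?invr_eq0 // vV // vd.
(* Newton's iteration with the derivative frozen at [x0]: one digit is gained per step, which
   suffices, and no further inverse is needed. *)
pose u (n : nat) := iter n (fun x => x - c * p.[x]) x0.
have hu (n : nat) : vge v 1 (u n - x0) /\ vge v n.+1%:Z p.[u n].
  elim: n => [|n [IH1 IH2]].
    by rewrite /= subrr vge0 -(vd_ker hv) ?res_horner ?rp //; apply: vge_horner.
  have hun : vge v 0 (u n) by rewrite -(subrK x0 (u n)); apply: vge_add => //; apply: vge10.
  have hcp : vge v n.+1%:Z (- (c * p.[u n])) by rewrite vgeN; apply: vge_mull.
  have hun1 : vge v 0 (u n.+1) by apply: vge_add => //; apply: vge_le hcp.
  split.
    rewrite /= -/(u n) -addrA addrCA addrC; apply: vge_add => //.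
    exact: vge_le hcp.
  have [r hr E] := horner_diff hp hun1 hun.
  have [r' hr' E'] := horner_diff (vpoly_deriv hp) hun hx0.
  have Eu : u n.+1 - u n = - (c * p.[u n]) by rewrite /= -/(u n); ring.
  have cd : c * p^`().[x0] = 1 by rewrite mulVf.
  (* Here 1 - c p'(u_n) is rewritten as - c (p'(u_n) - p'(x0)), so that every term of the second
     factor has positive valuation. *)
  have -> : p.[u n.+1] = p.[u n] *
     (- c * ((u n - x0) * (p^`()^`().[x0] + (u n - x0) * r')) + (c * c * p.[u n]) * r).
    rewrite -[LHS](subrK p.[u n]) E Eu -E'.
    rewrite -[X in _ + X]mul1r -[X in _ + X * _]cd; ring.
  have -> : n.+2%:Z = n.+1%:Z + 1 by rewrite -[n.+2]addn1 PoszD.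
  apply: vge_mul => //; apply: vge_add.
    apply: vge_mull; first by rewrite vgeN.
    apply: vge_mulr => //; apply: vge_add; last first.
      by apply: vge_mull => //; apply: vge10.
    by apply: vge_horner => //; do 2!apply: vpoly_deriv.
  apply: vge_mulr => //; apply: vge_mull; first exact: vge_mull.
  by apply: vge_le IH2.
have diff (n i : nat) : (n <= i)%N -> vge v n.+1%:Z (u i - u n).
  elim: i => [|i IH]; first by rewrite leqn0 => /eqP ->; rewrite subrr vge0.
  rewrite leq_eqVlt => /orP[/eqP ->|]; first by rewrite subrr vge0.
  rewrite ltnS => ni; rewrite /= -/(u i) -addrAC; apply: vge_add; first exact: IH.
  rewrite vgeN; apply: vge_mull => //; apply: vge_le (hu i).2.
  by rewrite lez_nat ltnS.
have [|l hl] := hc (u := u).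
  move=> m; exists `|m|%N => i j hi hj.
  have -> : u i - u j = (u i - u `|m|%N) - (u j - u `|m|%N) by ring.
  by apply: (@vge_le _ `|m|.+1%:Z); [lia|apply: vge_sub; apply: diff].
have hl0 : vge v 1 (l - x0).
  have [N hN] := hl 1.
  have -> : l - x0 = (u N - x0) - (u N - l) by ring.
  by apply: vge_sub; [apply: (hu N).1|apply: hN].
have hli : vge v 0 l by rewrite -(subrK x0 l); apply: vge_add => //; apply: vge10.
exists l; split=> //; first by apply/eqP; rewrite res_eq.
apply: vge_all0 => m; have [N hN] := hl m%:Z.
pose i := maxn N m.
have hui : vge v 0 (u i).
  by rewrite -(subrK x0 (u i)); apply: vge_add => //; apply: vge10; apply: (hu i).1.
have [r hr E] := horner_diff hp hui hli.
have -> : p.[l] = p.[u i] - (p.[u i] - p.[l]) by ring.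
apply: vge_sub.
  apply: vge_le (hu i).2; rewrite lez_nat; apply: leq_trans (leqnSn _).
  exact: leq_maxr.
rewrite E; apply: vge_mulr; first by apply: hN; apply: leq_maxl.
apply: vge_add; first by apply: vge_horner => //; apply: vpoly_deriv.
apply: vge_mull => //; apply: vge_sub => //.
Qed.

End Valued.

Lemma irr_root_dvd (k k' : fieldType) (rho : {rmorphism k -> k'}) (p g : {poly k}) (a : k') :
  irreducible_poly p -> root (map_poly rho p) a -> root (map_poly rho g) a -> p %| g.
Proof.
move=> ip pa ga; have := irreducible_poly_coprime g ip.
case: (boolP (p %| g)) => // _ /= cpg.
have : coprimep (map_poly rho p) (map_poly rho g) by rewrite coprimep_map.
by move=> /coprimep_root/(_ pa); rewrite (eqP ga) eqxx.
Qed.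

Section GaussExt.
Variables (K K' kappa kappa' : fieldType) (v : K -> int) (res : K -> kappa)
  (v' : K' -> int) (res' : K' -> kappa').
Variables (f : {rmorphism K -> K'}) (rho : {rmorphism kappa -> kappa'}).
Hypotheses (hv : valued v res) (hv' : valued v' res').
Hypotheses (hext : val_ext f v v' 1) (hres : res_ext f rho v res res').

Lemma vge_ext m x : vge v' m (f x) = vge v m x.
Proof.
by rewrite /vge fmorph_eq0; case: eqVneq => //= x0; rewrite hext // mulr1n.
Qed.

Lemma vpoly_ext m p : vpoly v m p -> vpoly v' m (map_poly f p).
Proof. by move=> hp i; rewrite coef_map vge_ext. Qed.

Lemma res_poly_ext p : vpoly v 0 p ->
  map_poly res' (map_poly f p) = map_poly rho (map_poly res p).
Proof.
move=> hp; apply/polyP=> i.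
by rewrite (coef_res hv') !coef_map (coef_res hv) hres.
Qed.

Variables (t : K') (pb : {poly kappa}).
Hypotheses (ht : vge v' 0 t) (ip : irreducible_poly pb)
  (pbt : root (map_poly rho pb) (res' t)).

(** The powers of [t] below the degree of [pb] are orthonormal: a primitive [g] of smaller degree
    has a reduction that [pb] does not divide, so [g(t)] is a unit. *)
Lemma gauss_val (g : {poly K}) : g != 0 -> (size g < size pb)%N ->
  [/\ (map_poly f g).[t] != 0 & exists i, [/\ g`_i != 0, vpoly v (v g`_i) g &
    v' (map_poly f g).[t] = v g`_i]].
Proof.
move=> g0 sg; have [i [gi hg]] := min_coef v g0.
pose g1 := (g`_i)^-1 *: g.
have hg1 : vpoly v 0 g1.
  move=> j; rewrite coefZ -(addNr (v g`_i)); apply: (vge_mul hv) => //.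
  by rewrite vgeE ?invr_eq0 // (vV hv).
have ht1 : vge v' 0 (map_poly f g1).[t] by apply: (vge_horner hv') => //; apply: vpoly_ext.
have r1 : res' (map_poly f g1).[t] != 0.
  rewrite (res_horner hv') //; last exact: vpoly_ext.
  rewrite res_poly_ext //; apply/negP => gt.
  have : map_poly res g1 != 0.
    apply/eqP => /polyP/(_ i); rewrite (coef_res hv) coefZ mulVf // coef0 (vd_one hv).
    by move/eqP; rewrite oner_eq0.
  move=> /dvdp_leq/(_ (irr_root_dvd ip pbt gt)); rewrite leqNgt.
  by rewrite (leq_ltn_trans (size_poly _ _)) // (leq_ltn_trans (size_scale_leq _ _)).
have [n0 n1] := res_unit hv' ht1 r1.
have E : (map_poly f g).[t] = f g`_i * (map_poly f g1).[t].
  by rewrite -hornerZ -map_polyZ /= scalerA mulfV // scale1r.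
split; first by rewrite E mulf_neq0 // fmorph_eq0.
exists i; split=> //; rewrite E (val_mul (vd_val hv')) ?fmorph_eq0 // n1 addr0.
by rewrite hext // mulr1n.
Qed.

Lemma gauss_vge m (g : {poly K}) : (size g < size pb)%N ->
  vge v' m (map_poly f g).[t] <-> vpoly v m g.
Proof.
move=> sg; split; last by move=> hg; apply: (vge_horner hv') => //; apply: vpoly_ext.
have [->|g0] := eqVneq g 0; first by move=> _ i; rewrite coef0 vge0.
have [n0 [i [gi hg E]]] := gauss_val g0 sg.
by rewrite vgeE // E => mi j; apply: vge_le (hg j).
Qed.

Lemma gauss_inj (g : {poly K}) : (size g < size pb)%N -> (map_poly f g).[t] = 0 -> g = 0.
Proof.
move=> sg gt; apply/eqP; apply: contraT => g0; have [] := gauss_val g0 sg.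
by rewrite gt eqxx.
Qed.

End GaussExt.

(** * Frobenius conjugates over the finite field [k] *)

Section FiniteConj.
Variables (k : finFieldType) (kbar : closedFieldType) (rho : {rmorphism k -> kbar}).
Local Notation q := #|k|.
Implicit Types (x y : kbar).

Lemma q_gt1 : (1 < q)%N.
Proof. exact: card_finNzRing_gt1. Qed.

Lemma q_gt0 : (0 < q)%N.
Proof. exact: ltnW q_gt1. Qed.

Lemma frobD x y : (x + y) ^+ q = x ^+ q + y ^+ q.
Proof.
have [p pp pk] := finPcharP k.
have pkb : p \in [pchar kbar] by rewrite (fmorph_pchar rho).
apply: exprDn_pchar.
rewrite (eq_pnat _ (pcharf_eq pkb)).
have := card_pprimeChar pk; rewrite -[#|pPrimeCharType pk|]/#|k| => ->.
by rewrite pnatX pnat_id.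
Qed.

Lemma frobN x : (- x) ^+ q = - x ^+ q.
Proof.
have h := frobD x (- x); rewrite subrr expr0n in h.
have q0 := q_gt0; rewrite eqn0Ngt q0 /= in h.
by apply/eqP; rewrite -addr_eq0 addrC -h.
Qed.

Lemma frob_sum I (r : seq I) (P : pred I) (G : I -> kbar) :
  (\sum_(i <- r | P i) G i) ^+ q = \sum_(i <- r | P i) G i ^+ q.
Proof.
apply: (big_morph (fun x => x ^+ q) frobD).
by rewrite expr0n eqn0Ngt q_gt0.
Qed.

Lemma frob_rho (c : k) : rho c ^+ q = rho c.
Proof. by rewrite -rmorphXn expf_card. Qed.

Lemma frob_fix x : x ^+ q = x -> exists c, x = rho c.
Proof.
move=> hx; have /(congr1 (map_poly rho)) := finField_genPoly k.
rewrite rmorphB rmorphXn /= map_polyX rmorph_prod => /(congr1 (fun p => p.[x])).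
rewrite hornerD hornerN hornerXn hornerX hx subrr horner_prod => /esym/eqP.
rewrite prodf_seq_eq0 => /hasP[c _ /=].
rewrite rmorphB /= map_polyX map_polyC hornerXsubC subr_eq0 => /eqP ->.
by exists c.
Qed.

Lemma frob_horner (g : {poly k}) x r :
  (map_poly rho g).[x ^+ (q ^ r)] = (map_poly rho g).[x] ^+ (q ^ r).
Proof.
elim: r => [|r IH]; first by rewrite expn0 !expr1.
rewrite expnSr !exprM -IH !horner_coef frob_sum; apply: eq_bigr => i _.
by rewrite exprMn coef_map frob_rho; congr (_ * _); rewrite -!exprM; congr (_ ^+ _); rewrite -mulnA (mulnC i).
Qed.

Lemma frob_inj r : injective (fun x => x ^+ (q ^ r)).
Proof.
elim: r => [|r IH] x y; first by rewrite expn0 !expr1.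
rewrite expnSr !exprM => E; apply: IH; apply/eqP; rewrite -subr_eq0.
have : (x ^+ (q ^ r) - y ^+ (q ^ r)) ^+ q == 0 by rewrite frobD frobN E subrr.
by rewrite expf_eq0 => /andP[].
Qed.

Lemma frob_period x e s : x ^+ (q ^ e) = x -> x ^+ (q ^ (s * e)) = x.
Proof.
by move=> h; elim: s => [|s IH]; rewrite ?expr1 // mulSn expnD exprM h.
Qed.

(* Galois descent for the conjugates of [x] over [k]. *)
Lemma conj_poly x e : x ^+ (q ^ e) = x -> exists g : {poly k},
  map_poly rho g = \prod_(r < e) ('X - (x ^+ (q ^ r))%:P).
Proof.
move=> hx; set P := \prod_(r < e) _.
have frobM (g h : {poly kbar}) : map_poly (fun z => z ^+ q) (g * h) =
    map_poly (fun z => z ^+ q) g * map_poly (fun z => z ^+ q) h.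
  have q0 : (0 : kbar) ^+ q = 0 by rewrite expr0n eqn0Ngt q_gt0.
  apply/polyP=> i; rewrite coef_map_id0 // !coefM frob_sum; apply: eq_bigr => j _.
  by rewrite exprMn !coef_map_id0.
have frob1 y : map_poly (fun z => z ^+ q) ('X - y%:P) = 'X - (y ^+ q)%:P.
  have q0 : (0 : kbar) ^+ q = 0 by rewrite expr0n eqn0Ngt q_gt0.
  apply/polyP=> i; rewrite coef_map_id0 // !coefB !coefX !coefC frobD frobN.
  by case: i => [|[|i]] /=; rewrite ?expr1n ?q0.
have frobprod s : map_poly (fun z => z ^+ q) (\prod_(r < s) ('X - (x ^+ (q ^ r))%:P)) =
    \prod_(r < s) ('X - (x ^+ (q ^ r.+1))%:P).
  elim: s => [|s IH].
    rewrite !big_ord0; apply/polyP=> i; rewrite coef_map_id0 ?expr0n ?eqn0Ngt ?q_gt0 //.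
    by rewrite coef1; case: (i == 0%N); rewrite ?expr1n ?expr0n ?eqn0Ngt ?q_gt0.
  by rewrite !big_ord_recr /= frobM IH frob1 -exprM -expnSr.
have PF : map_poly (fun z => z ^+ q) P = P.
  rewrite /P frobprod; case: e hx @P => [|e] hx P; first by rewrite !big_ord0.
  rewrite big_ord_recr big_ord_recl /= hx mulrC expn0 expr1; congr (_ * _).
have hc i : exists c, P`_i = rho c.
  apply: frob_fix; rewrite -[in RHS]PF coef_map_id0 //.
  by rewrite expr0n eqn0Ngt q_gt0.
have [c hcE] := choice hc.
exists (\poly_(i < size P) c i); apply/polyP=> i; rewrite coef_map coef_poly.
case: ltnP => h; first by rewrite hcE.
by rewrite nth_default //; exact: rmorph0.
Qed.

(** The quotient by [g] is a field with q^d elements, in which X^(q^d) = X; hence [g] divides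
    X^(q^d) - X. *)
Lemma irr_root_period (g : {poly k}) x : irreducible_poly g -> g \is monic ->
  root (map_poly rho g) x -> x ^+ (q ^ (size g).-1) = x.
Proof.
move=> ig mg gx; have mi : monic_irreducible_poly g by split.
have s1 : (1 < size g)%N by case: ig.
have cq : #|{poly %/ g with mi}| = (q ^ (size g).-1)%N by rewrite card_qfpoly.
have : in_qpoly g ('X ^+ (q ^ (size g).-1) - 'X) = 0.
  rewrite -cq rmorphB rmorphXn /=.
  by rewrite (@expf_card {poly %/ g with mi} (in_qpoly g 'X)) subrr.
move=> /(congr1 val) /=; rewrite (mk_monicE mi) => h.
have : Pdiv.Ring.rdvdp g ('X ^+ (q ^ (size g).-1) - 'X) by apply/eqP.
rewrite -dvdpE => /dvdpP[u Eu].
have : (map_poly rho ('X ^+ (q ^ (size g).-1) - 'X)).[x] = 0.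
  by rewrite Eu rmorphM hornerM (eqP gx) mulr0.
rewrite rmorphB rmorphXn /= map_polyX hornerD hornerN hornerXn hornerX => /eqP.
by rewrite subr_eq0 => /eqP.
Qed.

Definition frob_orbit x e := [seq x ^+ (q ^ r) | r <- iota 0 e].

(** The product on the right descends to [k] by [conj_poly]; irreducibility makes [g] divide it, and
    both are monic of degree d. *)
Lemma irr_root_conj (g : {poly k}) x : irreducible_poly g -> g \is monic ->
  root (map_poly rho g) x ->
  map_poly rho g = \prod_(r < (size g).-1) ('X - (x ^+ (q ^ r))%:P).
Proof.
move=> ig mg gx; have [g' Eg'] := conj_poly (irr_root_period ig mg gx).
rewrite -Eg'; set d := (size g).-1 in Eg' *.
have s1 : (1 < size g)%N by case: ig.
have gg' : g %| g'.
  apply: (irr_root_dvd ig gx); rewrite Eg' -(prednK (_ : 0 < d)%N); last by rewrite /d; case: (size g) s1 => [|[]].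
  by rewrite big_ord_recl expn0 expr1 rootM root_XsubC eqxx.
have sg' : size g' = size g.
  rewrite -(size_map_poly rho) Eg' size_prod_XsubC -[index_enum _]enumT size_enum_ord.
  by rewrite /d prednK // ltnW.
have mg' : g' \is monic by rewrite -(map_monic rho) Eg' monic_prod_XsubC.
by congr map_poly; apply/eqP; rewrite -eqp_monic // -dvdp_size_eqp // sg'.
Qed.

Hypothesis k_odd : (2 < q)%N.

(** X^m - 1 is separable because m = q^N - 1 equals -1 in [kbar]; its m roots form a cyclic
    group. *)
Lemma exists_prim N : (0 < N)%N -> exists a : kbar, (q ^ N).-1.-primitive_root a.
Proof.
move=> N0; set m := (q ^ N).-1.
have qN : (2 < q ^ N)%N.
  by apply: leq_trans k_odd _; rewrite -{1}(expn1 q) leq_exp2l ?q_gt1.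
have m0 : (0 < m)%N by rewrite /m -subn1 subn_gt0 ltnW.
have mk : (m%:R : kbar) != 0.
  have -> : m%:R = -1 :> kbar.
    apply/eqP; rewrite -addr_eq0 natr1 /m prednK; last by apply: ltn_trans qN.
    have [p pp pk] := finPcharP k.
    have pkb : p \in [pchar kbar] by rewrite (fmorph_pchar rho).
    rewrite -(dvdn_pcharf pkb); apply: dvdn_trans (dvdn_exp N0 (dvdnn q)).
    have := card_pprimeChar pk; rewrite -[#|pPrimeCharType pk|]/#|k| => E.
    rewrite E; apply: dvdn_exp => //; rewrite lt0n; apply: contraTneq k_odd => E0.
    by rewrite E E0.
  by rewrite oppr_eq0 oner_eq0.
have [rs Ers] := closed_field_poly_normal ('X^m - 1 : {poly kbar}).
have mon : ('X^m - 1 : {poly kbar}) \is monic.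
  by apply: monicXnsubC.
rewrite (monicP mon) scale1r in Ers.
have urs : uniq rs.
  by rewrite -separable_prod_XsubC -Ers cyclotomic.separable_Xn_sub_1.
have srs : size rs = m.
  by have := size_XnsubC (1 : kbar) m0; rewrite Ers size_prod_XsubC => -[].
have ars : all m.-unity_root rs.
  apply/allP=> z zr; rewrite /root_of_unity Ers root_prod_XsubC //.
have /hasP[a _ pa] := cyclic.has_prim_root m0 ars urs (eq_leq (esym srs)).
by exists a.
Qed.
End FiniteConj.

(** * Unramified extensions *)

Section Unramified.
Variables (E : fieldType) (k : finFieldType) (v : E -> int) (res : E -> k).
Variables (kbar : closedFieldType) (rho : {rmorphism k -> kbar}).
Hypotheses (hv : valued v res) (hc : complete_valuation v).
Variables (pb : {poly k}) (a : kbar) (P : {poly E}).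
Hypotheses (ipb : irreducible_poly pb) (pba : root (map_poly rho pb) a).
Hypotheses (mP : P \is monic) (vP : vpoly v 0 P) (rP : map_poly res P = pb).

Lemma size_lift : size P = size pb.
Proof. by rewrite -rP; have [_ ->] := monic_res hv mP. Qed.

(** Gauss's lemma. Both factors are made primitive; reduction can only lower degrees, so the induced
    factorization of [pb] keeps them, and irreducibility of [pb] decides. *)
Lemma lift_irreducible : irreducible_poly P.
Proof.
split; first by rewrite size_lift; case: ipb.
move=> g sg /dvdpP[h EP].
have P0 : P != 0 by apply: monic_neq0.
have g0 : g != 0 by apply: contra_neq P0 => g0; rewrite EP g0 mulr0.
have h0 : h != 0 by apply: contra_neq P0 => h0; rewrite EP h0 mul0r.
have content (f : {poly E}) : f != 0 -> exists c f1, [/\ c != 0, f = c *: f1, vpoly v 0 f1,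
    map_poly res f1 != 0 & exists i, f1`_i = 1].
  move=> f0; have [i [fi hf]] := min_coef v f0.
  exists f`_i, ((f`_i)^-1 *: f).
  have i1 : ((f`_i)^-1 *: f)`_i = 1 by rewrite coefZ mulVf.
  have vf1 : vpoly v 0 ((f`_i)^-1 *: f).
    move=> j; rewrite coefZ -(addNr (v f`_i)); apply: (vge_mul hv) => //.
    by rewrite vgeE ?invr_eq0 // (vV hv).
  split=> //; [by rewrite scalerA mulfV ?scale1r| |by exists i].
  apply/eqP => /polyP/(_ i); rewrite (coef_res hv) i1 coef0 (vd_one hv).
  by move/eqP; rewrite oner_eq0.
have [c [g1 [c0 Eg vg1 rg1 _]]] := content g g0.
have [e [h1 [e0 Eh vh1 rh1 _]]] := content h h0.
have ce0 : e * c != 0 by rewrite mulf_neq0.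
have EP' : P = (e * c) *: (h1 * g1) by rewrite EP Eg Eh -scalerAl -scalerAr scalerA.
have rgh : map_poly res (h1 * g1) != 0 by rewrite (res_polyM hv) // mulf_neq0.
(* At most 0 by the leading coefficient 1 of [P], at least 0 by a coefficient where the primitive
   product is a unit. *)
have vce : v (e * c) = 0.
  apply/eqP; rewrite eq_le; apply/andP; split.
    have P1 : (e * c) * (h1 * g1)`_(size P).-1 = 1 by rewrite -coefZ -EP'; apply: monicP.
    have w0 : (h1 * g1)`_(size P).-1 != 0.
      by apply: contra_eq_neq P1 => ->; rewrite mulr0 eq_sym oner_neq0.
    have := vpoly0M hv vh1 vg1 (size P).-1.
    have := congr1 v P1; rewrite (val_mul (vd_val hv)) // (v1 hv) vgeE //.
    move: (v (e * c)) (v (h1 * g1)`__) => i1 i2; clear; lia.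
  have [i ri] : exists i, (map_poly res (h1 * g1))`_i != 0.
    by exists (size (map_poly res (h1 * g1))).-1; rewrite -/(lead_coef _) lead_coef_eq0.
  rewrite (coef_res hv) in ri.
  have [n0 n1] := res_unit hv (vpoly0M hv vh1 vg1 i) ri.
  have := vP i; rewrite EP' coefZ vgeE ?mulf_neq0 // (val_mul (vd_val hv)) //.
  by rewrite n1 addr0.
have vg2 : vpoly v 0 ((e * c) *: g1).
  by move=> i; rewrite coefZ; apply: (vge_mull hv) => //; rewrite vgeE ?vce.
have Eb : pb = map_poly res h1 * map_poly res ((e * c) *: g1).
  by rewrite -(res_polyM hv) // -scalerAr -EP' rP.
have szb : (size pb <= size (map_poly res h1) + (size (map_poly res ((e * c) *: g1))).-1)%N.
  apply: leq_trans (_ : _ <= (size (map_poly res h1) + (size (map_poly res ((e * c) *: g1)))).-1)%N _.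
    by rewrite Eb; apply: size_polyMleq.
  by case: (size (map_poly res ((e*c) *: g1))) => [|s]; rewrite ?addn0 ?leq_pred // addnS.
have szP : size P = (size h + size g).-1 by rewrite EP size_mul.
have shl : (size (map_poly res h1) <= size h)%N.
  by apply: leq_trans (size_poly _ _) _; rewrite Eh size_scale.
have sgl : (size (map_poly res ((e * c) *: g1)) <= size g)%N.
  by apply: leq_trans (size_poly _ _) _; rewrite Eg !size_scale.
have sg0 : (0 < size g)%N by rewrite size_poly_gt0.
have Esz := size_lift.
have sgE : size (map_poly res ((e * c) *: g1)) = size g.
  move: szb szP shl sgl sg0 Esz sg.
  move: (size pb) (size P) (size h) (size g) (size (map_poly _ _)) (size (map_poly _ _)).
  clear; move=> x1 x2 x3 x4 x5 x6; lia.
have gpb : map_poly res ((e * c) *: g1) %= pb.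
  by apply: ipb.2; [rewrite sgE|rewrite Eb dvdp_mulIr].
by rewrite -(dvdp_size_eqp (_ : g %| P)) ?EP ?dvdp_mulIr // -EP size_lift -(eqp_size gpb) sgE.
Qed.

Definition lift_mi : monic_irreducible_poly P := (lift_irreducible, mP).

Definition ur := {poly %/ P with lift_mi}.
HB.instance Definition _ := GRing.Field.on ur.

Definition ur_of (g : {poly E}) : ur := in_qpoly P g.

Fact ur_of_zmod : zmod_morphism ur_of.
Proof. exact: (rmorphB (in_qpoly P)). Qed.
Fact ur_of_monoid : monoid_morphism ur_of.
Proof. by split; [exact: (rmorph1 (in_qpoly P))|exact: (rmorphM (in_qpoly P))]. Qed.
HB.instance Definition _ := GRing.isZmodMorphism.Build {poly E} ur ur_of ur_of_zmod.
HB.instance Definition _ := GRing.isMonoidMorphism.Build {poly E} ur ur_of ur_of_monoid.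

Definition ur_emb (c : E) : ur := ur_of c%:P.

Fact ur_emb_zmod : zmod_morphism ur_emb.
Proof. by move=> x y; rewrite /ur_emb polyCB; apply: (rmorphB ur_of). Qed.
Fact ur_emb_monoid : monoid_morphism ur_emb.
Proof.
split=> [|x y]; first exact: (rmorph1 ur_of).
by rewrite /ur_emb polyCM; apply: (rmorphM ur_of).
Qed.
HB.instance Definition _ := GRing.isZmodMorphism.Build E ur ur_emb ur_emb_zmod.
HB.instance Definition _ := GRing.isMonoidMorphism.Build E ur ur_emb ur_emb_monoid.

Definition ur_gen : ur := ur_of 'X.
Definition ur_poly (x : ur) : {poly E} := polyn x.

Lemma size_ur_poly x : (size (ur_poly x) < size P)%N.
Proof.
have h : (size (ur_poly x) < size (mk_monic P))%N := size_mk_monic x.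
by rewrite (mk_monicE lift_mi) in h.
Qed.

Lemma ur_ofK x : ur_of (ur_poly x) = x.
Proof.
by apply/val_inj => /=; rewrite Pdiv.CommonRing.rmodp_small //; apply: size_mk_monic.
Qed.

Lemma ur_polyK (g : {poly E}) : (size g < size P)%N -> ur_poly (ur_of g) = g.
Proof. by move=> h; rewrite /ur_poly /= (mk_monicE lift_mi) Pdiv.CommonRing.rmodp_small. Qed.

Lemma ur_polyE g : ur_poly (ur_of g) = Pdiv.Ring.rmodp g P.
Proof. by rewrite /ur_poly /= (mk_monicE lift_mi). Qed.

Lemma ur_poly_emb c : ur_poly (ur_emb c) = c%:P.
Proof.
by rewrite ur_polyK // (leq_ltn_trans (size_polyC_leq1 _)) //; case: lift_mi => [[]].
Qed.

Lemma ur_poly0 : ur_poly 0 = 0.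
Proof. by []. Qed.

Lemma ur_polyB x y : ur_poly (x - y) = ur_poly x - ur_poly y.
Proof. by []. Qed.

Lemma ur_polyD x y : ur_poly (x + y) = ur_poly x + ur_poly y.
Proof. by []. Qed.

Lemma ur_embM c x : ur_poly (ur_emb c * x) = c *: ur_poly x.
Proof.
have -> : ur_emb c * x = ur_of (c%:P * ur_poly x).
  by rewrite -{1}(ur_ofK x); apply: esym; apply: (rmorphM ur_of).
rewrite ur_polyK mul_polyC //.
by apply: leq_ltn_trans (size_scale_leq _ _) (size_ur_poly x).
Qed.

Lemma ur_of_horner g : ur_of g = (map_poly ur_emb g).[ur_gen].
Proof.
elim/poly_ind: g => [|g c IH]; first by rewrite !rmorph0 horner0.
by rewrite rmorphD rmorphM /= IH rmorphD rmorphM /= map_polyX map_polyC hornerMXaddC.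
Qed.

Definition ur_embR : {rmorphism E -> ur} := ur_emb.

Section Lift.
Variables (K : fieldType) (f : {rmorphism E -> K}) (t : K).
Hypothesis ft : root (map_poly f P) t.

Definition ur_lift (x : ur) : K := (map_poly f (ur_poly x)).[t].

Lemma ur_lift_of g : ur_lift (ur_of g) = (map_poly f g).[t].
Proof.
rewrite /ur_lift ur_polyE [in RHS](Pdiv.RingMonic.rdivp_eq mP g).
by rewrite rmorphD rmorphM hornerD hornerM (eqP ft) mulr0 add0r.
Qed.

Fact ur_lift_zmod : zmod_morphism ur_lift.
Proof. by move=> x y; rewrite /ur_lift ur_polyB rmorphB hornerD hornerN. Qed.
Fact ur_lift_monoid : monoid_morphism ur_lift.
Proof.
split=> [|x y]; first by rewrite -(rmorph1 ur_of) ur_lift_of rmorph1 hornerC.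
by rewrite -{1}(ur_ofK x) -{1}(ur_ofK y) -rmorphM /= ur_lift_of rmorphM hornerM.
Qed.
HB.instance Definition _ := GRing.isZmodMorphism.Build ur K ur_lift ur_lift_zmod.
HB.instance Definition _ := GRing.isMonoidMorphism.Build ur K ur_lift ur_lift_monoid.

Definition ur_lift_RM : {rmorphism ur -> K} := ur_lift.

Lemma ur_lift_emb c : ur_lift (ur_emb c) = f c.
Proof. by rewrite /ur_lift ur_poly_emb map_polyC hornerC. Qed.

Lemma ur_lift_gen : ur_lift ur_gen = t.
Proof. by rewrite /ur_gen ur_lift_of map_polyX hornerX. Qed.
End Lift.

(** The Gauss norm of the representative of degree less than that of [P]; it is multiplicative
    because [pb] is irreducible. *)
Definition ur_v (x : ur) : int :=
  xget 0 (fun m => exists i, [/\ (ur_poly x)`_i != 0, m = v (ur_poly x)`_i & vpoly v m (ur_poly x)]).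

Definition ur_res (x : ur) : kbar := (map_poly rho (map_poly res (ur_poly x))).[a].

Lemma ur_emb1 : ur_emb 1 = 1.
Proof. exact: (rmorph1 ur_emb). Qed.

Lemma ur_res_emb c : ur_res (ur_emb c) = rho (res c).
Proof. by rewrite /ur_res ur_poly_emb (res_polyC hv) map_polyC hornerC. Qed.

Lemma ur_poly_eq0 x : (ur_poly x == 0) = (x == 0).
Proof. by []. Qed.

Lemma ur_vge m x : vge ur_v m x <-> vpoly v m (ur_poly x).
Proof.
have [->|x0] := eqVneq x 0.
  by rewrite vge0; split=> // _ i; rewrite coef0 vge0.
rewrite vgeE // /ur_v; case: xgetP => [e _ [i [xi ei hx]]|].
  split=> [me j|hm]; first by apply: vge_le (hx j).
  by have := hm i; rewrite vgeE // ei.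
have x0' : ur_poly x != 0 by rewrite ur_poly_eq0.
have [i [xi hx]] := min_coef v x0'.
by move=> /(_ (v (ur_poly x)`_i)) []; exists i.
Qed.

(** Since [P] is monic, division does not leave the integral polynomials; Horner's scheme carries it
    out. *)
Lemma divP_int g : vpoly v 0 g -> exists u r, [/\ vpoly v 0 r,
  vpoly v 0 u, (size r < size P)%N & g = u * P + r].
Proof.
have sP : (1 < size P)%N by case: lift_irreducible.
elim/poly_ind: g => [|g c IH] hg.
  have v0 : vpoly v 0 0 by move=> i; rewrite coef0 vge0.
  by exists 0, 0; rewrite mul0r addr0 size_poly0 ltnW.
have [|u [r [hr hu sr ->]]] := IH; first by move=> i; have := hg i.+1; rewrite coefD coefMX coefC /= addr0.
have hcv : vge v 0 c by have := hg 0%N; rewrite coefD coefMX coefC /= add0r.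
(* The coefficient of [r] in degree deg P - 1, which sits in degree deg P after multiplication by X
   and is removed by [b] times [P]. *)
pose b := r`_(size P).-2.
exists (u * 'X + b%:P), (r * 'X + c%:P - b%:P * P); split.
- apply: (vpolyD hv); last first.
    by apply: (vpolyN hv); apply: (vpoly0M hv) => //; apply: vpolyC; apply: hr.
  apply: (vpolyD hv); last exact: vpolyC.
  by apply: (vpoly0M hv) => //; apply: (vpolyX hv).
- apply: (vpolyD hv); last by apply: vpolyC; apply: hr.
  by apply: (vpoly0M hv) => //; apply: (vpolyX hv).
- rewrite -(prednK (ltnW sP)) ltnS; apply/leq_sizeP => j hj.
  rewrite coefB coefD coefMX coefC mul_polyC coefZ.
  have j0 : (j == 0)%N = false by case: j hj => //; case: (size P) sP => [|[]].
  rewrite j0 addr0; move: hj; rewrite leq_eqVlt => /orP[/eqP <-|hj].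
    by rewrite -/(lead_coef P) (monicP mP) mulr1 /b subrr.
  have hj' : (size P <= j)%N by rewrite -(prednK (ltnW sP)).
  rewrite (nth_default _ hj') mulr0 subr0 nth_default // -ltnS prednK.
    exact: leq_trans sr hj'.
  by apply: leq_trans hj'; apply: ltnW.
- by ring.
Qed.

Lemma ur_of_int g : vpoly v 0 g ->
  vpoly v 0 (ur_poly (ur_of g)) /\ ur_res (ur_of g) = (map_poly rho (map_poly res g)).[a].
Proof.
move=> hg; have [u [r [hr hu sr Eg]]] := divP_int hg.
have Er : ur_poly (ur_of g) = r.
  by rewrite ur_polyE Eg Pdiv.RingMonic.rmodp_addl_mul_small.
rewrite /ur_res Er; split=> //.
rewrite Eg (res_polyD hv) //; last exact: (vpoly0M hv).
rewrite (res_polyM hv) // rP rmorphD rmorphM hornerD hornerM (eqP pba) mulr0 add0r //.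
Qed.

Lemma ur_mul_int x y : vpoly v 0 (ur_poly x) -> vpoly v 0 (ur_poly y) ->
  vpoly v 0 (ur_poly (x * y)) /\ ur_res (x * y) = ur_res x * ur_res y.
Proof.
move=> hx hy; have [] := ur_of_int (vpoly0M hv hx hy).
have -> : ur_of (ur_poly x * ur_poly y) = x * y 
  by rewrite -[x in RHS]ur_ofK -[y in RHS]ur_ofK; apply: (rmorphM ur_of).
move=> h1 ->; split=> //; by rewrite (res_polyM hv) // rmorphM hornerM.
Qed.

(** If the residue vanishes, [pb] divides a reduction of smaller degree, which is then 0. *)
Lemma ur_res_eq0 x : vpoly v 0 (ur_poly x) ->
  (ur_res x == 0) <-> vpoly v 1 (ur_poly x).
Proof.
move=> hx; split=> [rx i|hx1].
  have r0 : map_poly res (ur_poly x) = 0.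
    apply/eqP; apply: contraT => n0.
    have := dvdp_leq n0 (irr_root_dvd ipb pba rx); rewrite leqNgt -size_lift.
    by rewrite (leq_ltn_trans (size_poly _ _) (size_ur_poly x)).
  rewrite -(vd_ker hv) //; have /polyP/(_ i) := r0.
  by rewrite (coef_res hv) coef0 => ->.
suff -> : ur_res x = 0 by [].
rewrite /ur_res; have -> : map_poly res (ur_poly x) = 0.
  apply/polyP=> i; rewrite (coef_res hv) coef0; apply/eqP.
  by rewrite (vd_ker hv).
by rewrite rmorph0 horner0.
Qed.

Lemma ur_unit x : x != 0 -> exists c y, [/\ c != 0, x = ur_emb c * y,
  vpoly v 0 (ur_poly y) & ur_res y != 0].
Proof.
move=> x0; have x0' : ur_poly x != 0 by rewrite ur_poly_eq0.
have [i [xi hx]] := min_coef v x0'.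
have hy : vpoly v 0 (ur_poly (ur_emb ((ur_poly x)`_i)^-1 * x)).
  move=> j; rewrite ur_embM coefZ -(addNr (v (ur_poly x)`_i)); apply: (vge_mul hv) => //.
  by rewrite vgeE ?invr_eq0 // (vV hv).
exists (ur_poly x)`_i, (ur_emb ((ur_poly x)`_i)^-1 * x); split=> //.
  by rewrite mulrA -rmorphM mulfV // rmorph1 mul1r.
apply/negP => /(ur_res_eq0 hy)/(_ i); rewrite ur_embM coefZ mulVf //.
by rewrite vgeE ?oner_eq0 // (v1 hv).
Qed.

Lemma ur_v_unit y : vpoly v 0 (ur_poly y) -> ur_res y != 0 -> ur_v y = 0.
Proof.
move=> hy ry; have y0 : y != 0.
  apply: contra_neq ry => ->; rewrite /ur_res ur_poly0. by rewrite !map_poly0; exact: horner0.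
have /ur_vge : vpoly v 0 (ur_poly y) by [].
have n1 : ~~ vge ur_v 1 y by apply/negP => /ur_vge/(ur_res_eq0 hy); apply/negP.
by move: n1; rewrite !vgeE //; lia.
Qed.

Lemma ur_vZ c y : c != 0 -> y != 0 -> ur_v (ur_emb c * y) = v c + ur_v y.
Proof.
move=> c0 y0; have cy0 : ur_emb c * y != 0 by rewrite mulf_neq0 // fmorph_eq0.
have shift m : vge ur_v (v c + m) (ur_emb c * y) <-> vge ur_v m y.
  rewrite !ur_vge; split=> h i; last by rewrite ur_embM coefZ; apply: (vge_mul hv); [rewrite vgeE|apply: h].
  have := h i; rewrite ur_embM coefZ /vge mulf_eq0 (negbTE c0) /=.
  case: eqVneq => //= yi0; rewrite (val_mul (vd_val hv)) //.
  by rewrite lerD2l.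
have [H1 _] := shift (ur_v (ur_emb c * y) - v c); have [_ H2] := shift (ur_v y).
rewrite !vgeE // in H1 H2; apply/eqP; rewrite eq_le H2 // andbT -lerBlDl H1 //.
by rewrite addrC subrK.
Qed.

Lemma ur_v_emb c : c != 0 -> ur_v (ur_emb c) = v c.
Proof.
move=> c0; rewrite -(mulr1 (ur_emb c)) ur_vZ ?oner_neq0 //.
rewrite -ur_emb1 ur_v_unit ?addr0 ?ur_res_emb ?(vd_one hv) ?rmorph1 ?oner_neq0 //.
by rewrite -ur_emb1 ur_poly_emb; apply/vpolyC/(vge_1 hv).
Qed.

Lemma ur_valued : valued ur_v ur_res.
Proof.
split.
- split.
  + move=> x y x0 y0; have [c [x' [c0 Ex hx rx]]] := ur_unit x0.
    have [e [y' [e0 Ey hy ry]]] := ur_unit y0.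
    have [hxy rxy] := ur_mul_int hx hy.
    have x'0 : x' != 0 by apply: contra_neq x0 => x'0; rewrite Ex x'0 mulr0.
    have y'0 : y' != 0 by apply: contra_neq y0 => y'0; rewrite Ey y'0 mulr0.
    have -> : x * y = ur_emb (c * e) * (x' * y') by rewrite Ex Ey rmorphM; ring.
    rewrite ur_vZ ?mulf_neq0 // {1}Ex {1}Ey !ur_vZ // !ur_v_unit ?rxy ?mulf_neq0 //.
    by rewrite !addr0 (val_mul (vd_val hv)).
  + move=> m x y /ur_vge hx /ur_vge hy; apply/ur_vge; rewrite ur_polyD.
    exact: (vpolyD hv).
  + have [x [x0 vx]] := val_unif (vd_val hv).
    by exists (ur_emb x); split; rewrite ?fmorph_eq0 // ur_v_emb.
- by rewrite -ur_emb1 ur_res_emb (vd_one hv) rmorph1.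
- move=> x y /ur_vge hx /ur_vge hy.
  by rewrite /ur_res ur_polyD (res_polyD hv) // rmorphD hornerD.
- by move=> x y /ur_vge hx /ur_vge hy; case: (ur_mul_int hx hy).
- move=> x /ur_vge hx; apply/idP/idP => [/(ur_res_eq0 hx)/ur_vge //|/ur_vge hx1].
  exact/ur_res_eq0.
Qed.

Lemma ur_val_ext : val_ext ur_emb v ur_v 1.
Proof. by move=> x x0; rewrite ur_v_emb // mulr1n. Qed.

Lemma ur_res_ext : res_ext ur_emb rho v res ur_res.
Proof.
by move=> x _; rewrite ur_res_emb.
Qed.

Lemma ur_gen_int : vge ur_v 0 ur_gen.
Proof. by apply/ur_vge/(ur_of_int _).1/(vpolyX hv). Qed.

Lemma ur_res_gen : ur_res ur_gen = a.
Proof.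
by rewrite (ur_of_int (vpolyX hv)).2 (res_polyX hv) map_polyX hornerX.
Qed.

Lemma ur_root : root (map_poly ur_emb P) ur_gen.
Proof.
rewrite rootE -ur_of_horner; apply/eqP/val_inj.
by rewrite -[LHS]/(ur_poly (ur_of P)) ur_polyE Pdiv.RingMonic.rmodpp.
Qed.

(** The norm is the worst one among finitely many coefficients, so limits are taken
    coefficientwise. *)
Lemma ur_complete : complete_valuation ur_v.
Proof.
move=> u hu.
have hl i : exists l, forall m : int, exists N : nat, forall j : nat,
    (N <= j)%N -> vge v m ((ur_poly (u j))`_i - l).
  apply: hc => m; have [N hN] := hu m; exists N => j1 j2 h1 h2.
  by have /ur_vge/(_ i) := hN _ _ h1 h2; rewrite ur_polyB coefB.
have [l hlE] := choice hl; set s := size P.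
pose lp := \poly_(i < s.-1) l i.
have sP : (1 < size P)%N by case: lift_irreducible.
have slp : (size lp < s)%N by rewrite (leq_ltn_trans (size_poly _ _)) // ltn_predL ltnW.
exists (ur_of lp) => m.
have [N hN] := choice (fun i => hlE i m).
exists (\max_(i < s) N i)%N => j hj; apply/ur_vge => i.
rewrite ur_polyB ur_polyK // coefB coef_poly.
have [hi|hi] := ltnP i s.-1.
  have si : (i < s)%N by apply: leq_trans hi (leq_pred _).
  by apply: hN; apply: leq_trans hj; apply: (leq_bigmax (Ordinal si)).
rewrite subr0 nth_default ?vge0 //; apply: leq_trans hi.
by rewrite -ltnS prednK ?size_ur_poly // ltnW.
Qed.

End Unramified.

(** Interface hiding the quotient ring: [un_span] and [un_lift] say that maps out of it correspond
    to roots of [P], which is how Frobenius, conjugation and embedding are all produced. *)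
Record unr (E kappa kappa' : fieldType) (v : E -> int) (res : E -> kappa)
  (rho : kappa -> kappa') (a : kappa') (P : {poly E}) := Unr {
  un_M :> fieldType;
  un_v : un_M -> int;
  un_res : un_M -> kappa';
  un_emb : {rmorphism E -> un_M};
  un_gen : un_M;
  un_valued : valued un_v un_res;
  un_complete : complete_valuation un_v;
  un_vext : val_ext un_emb v un_v 1;
  un_rext : res_ext un_emb rho v res un_res;
  un_int : vge un_v 0 un_gen;
  un_rgen : un_res un_gen = a;
  un_root : root (map_poly un_emb P) un_gen;
  un_span : forall x, exists g, x = (map_poly un_emb g).[un_gen];
  un_lift : forall (K : fieldType) (f : {rmorphism E -> K}) (t : K), root (map_poly f P) t ->
    exists h : {rmorphism un_M -> K}, (forall c, h (un_emb c) = f c) /\ h un_gen = t }.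

Lemma unr_exists (E : fieldType) (k : finFieldType) (v : E -> int) (res : E -> k)
    (kbar : closedFieldType) (rho : {rmorphism k -> kbar}) (pb : {poly k}) (a : kbar)
    (P : {poly E}) : valued v res -> complete_valuation v ->
  irreducible_poly pb -> root (map_poly rho pb) a -> P \is monic -> vpoly v 0 P ->
  map_poly res P = pb -> inhabited (unr v res rho a P).
Proof.
move=> hv hc ipb pba mP vP rP; constructor.
have hM := @ur_valued _ _ _ _ _ rho hv pb a P ipb pba mP vP rP.
apply: (Unr (un_emb := ur_embR hv ipb mP vP rP) hM (un_gen := ur_gen hv ipb mP vP rP)).
- exact: ur_complete.
- by move=> x x0; apply: (ur_val_ext hv ipb pba mP vP rP x0).
- exact: ur_res_ext.
- exact: (ur_gen_int hv ipb pba).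
- exact: ur_res_gen.
- exact: ur_root.
- by move=> x; exists (ur_poly x); rewrite -ur_of_horner ur_ofK.
- move=> K f t ft; exists (ur_lift_RM hv ipb mP vP rP ft); split; [exact: ur_lift_emb|exact: ur_lift_gen].
Qed.

(** * The ramified quadratic extension *)

Section Ultra.
Variables (K kappa : fieldType) (v : K -> int) (res : K -> kappa).
Hypothesis hv : valued v res.

Lemma ultra (x y : K) : x != 0 -> vge v (v x + 1) y -> x + y != 0 /\ v (x + y) = v x.
Proof.
move=> x0 hy.
have xy0 : x + y != 0.
  apply: contraTneq hy => E; have -> : y = - x by apply/eqP; rewrite -addr_eq0 addrC E.
  by rewrite (vgeN hv) vgeE //; lia.
split=> //; apply/eqP; rewrite eq_le; apply/andP; split.
  rewrite leNgt; apply/negP => lt.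
  have : vge v (v x + 1) (x + y - y).
    by apply: (vge_sub hv) => //; rewrite vgeE //; move: lt; lia.
  by rewrite addrK vgeE //; lia.
rewrite -vgeE //; apply: (vge_add hv); first by rewrite vgeE.
by apply: vge_le hy; lia.
Qed.
End Ultra.

Section Ramified.
Variables (F : fieldType) (k : finFieldType) (vF : F -> int) (resF : F -> k).
Hypothesis hF : local_field vF resF.
Hypothesis k2 : (2%:R : k) != 0.
Variables (E : fieldExtType F) (vE : E -> int) (resE : E -> k).
Hypothesis hE : local_field vE resE.
Hypothesis hdim : \dim {: E} = 2%N.
Hypothesis hram : val_ext (in_alg E) vF vE 2.
Hypothesis hres : res_ext (in_alg E) id vF resF resE.
Variables (bar : {lrmorphism E -> E}) (piE : E).
Hypothesis hpiE : uniformizer vE piE.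
Hypothesis hbar : bar piE = - piE.

Let hvE := valued_local hE.

Lemma two_unitE : (2%:R : E) != 0 /\ vE 2%:R = 0.
Proof. by apply: (res_unit hvE); rewrite ?(vge_nat hvE) // (res_nat hvE). Qed.

Lemma bar_alg (a : F) : bar a%:A = a%:A.
Proof. by rewrite linearZ rmorph1. Qed.

(** [bar] fixes [F] and negates [piE], so [piE] is not in [F] as 2 is invertible; the degree is
    2. *)
Lemma E_decomp (x : E) : exists a b : F, x = a%:A + b *: piE.
Proof.
have [p0 _] := hpiE; have [n2 _] := two_unitE.
have npi : piE \notin <[1]>%VS.
  apply/negP => /vlineP[a Ea]; move: hbar; rewrite {1}Ea bar_alg -Ea => E0.
  have : 2%:R * piE == 0 by rewrite mulr2n mulrDl !mul1r {2}E0 subrr.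
  by rewrite mulf_eq0 (negbTE n2) (negbTE p0).
have free2 : free [:: piE; 1].
  by rewrite free_cons seq1_free oner_neq0 andbT span_seq1.
have full : (<<[:: piE; 1%R]>> = {:E})%VS.
  apply/eqP; rewrite eqEdim subvf /= hdim; move: free2; rewrite /free => /eqP ->.
  by [].
have : x \in <<[:: piE; 1%R]>>%VS by rewrite full memvf.
rewrite span_cons span_seq1 => /memv_addP[_ /vlineP[b ->] [_ /vlineP[a ->] ->]].
by exists a, b; rewrite addrC.
Qed.

Lemma barK x : bar (bar x) = x.
Proof.
have [a [b ->]] := E_decomp x.
by rewrite !rmorphD /= !bar_alg !linearZ /= hbar rmorphN /= hbar opprK.
Qed.

Lemma bar_fix x : bar x = x -> exists a : F, x = a%:A.
Proof.
have [a [b Ex]] := E_decomp x; rewrite {1}Ex rmorphD /= bar_alg linearZ /= hbar => H.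
exists a; rewrite Ex; have [n2 _] := two_unitE.
have : 2%:R * (b *: piE) == 0.
  move: H; rewrite Ex => /addrI; rewrite scalerN => H.
  by rewrite mulr2n mulrDl !mul1r -{1}H addNr.
by rewrite mulf_eq0 (negbTE n2) => /eqP ->; rewrite addr0.
Qed.

(** In x = a + b [piE] the two terms have valuations of opposite parity, so the smaller one decides,
    whatever the sign of the second. *)
Lemma v_bar x : vE (bar x) = vE x.
Proof.
have [a [b ->]] := E_decomp x; have [p0 vp] := hpiE.
have va : a != 0 -> (a%:A : E) != 0 /\ vE a%:A = vF a *+ 2.
  by move=> a0; split; [rewrite scaler_eq0 (negbTE a0) oner_eq0|apply: hram].
have vb : b != 0 -> b *: piE != 0 /\ vE (b *: piE) = vF b *+ 2 + 1.
  move=> b0; split; first by rewrite scaler_eq0 (negbTE b0).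
  rewrite -mulr_algl (val_mul (vd_val hvE)) ?vp //; first by congr (_ + _); apply: hram.
  by rewrite scaler_eq0 (negbTE b0) oner_eq0.
rewrite rmorphD /= bar_alg linearZ /= hbar scalerN.
have [->|b0] := eqVneq b 0; first by rewrite scale0r subr0 addr0.
have [b1 b2] := vb b0.
have [->|a0] := eqVneq a 0; first by rewrite !scale0r !add0r (vN hvE).
have [a1 a2] := va a0.
have [lt|lt] : vE a%:A < vE (b *: piE) \/ vE (b *: piE) < vE a%:A by rewrite a2 b2; move: (vF a) (vF b) => z1 z2; clear; lia.
  have h : vge vE (vE a%:A + 1) (b *: piE) by rewrite vgeE // lezD1.
  have h' : vge vE (vE a%:A + 1) (- (b *: piE)) by rewrite (vgeN hvE).
  by rewrite (ultra hvE a1 h).2 (ultra hvE a1 h').2.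
have h : vge vE (vE (b *: piE) + 1) a%:A by rewrite vgeE // lezD1.
have b1' : - (b *: piE) != 0 by rewrite oppr_eq0.
have h' : vge vE (vE (- (b *: piE)) + 1) a%:A by rewrite (vN hvE).
by rewrite addrC (ultra hvE b1' h').2 addrC (ultra hvE b1 h).2 (vN hvE).
Qed.

Lemma vge_bar m x : vge vE m (bar x) = vge vE m x.
Proof. by rewrite /vge fmorph_eq0 v_bar. Qed.

(** The difference is 2 b [piE], integral and of odd valuation, hence of valuation at least 1. *)
Lemma res_bar x : vge vE 0 x -> resE (bar x) = resE x.
Proof.
move=> hx; have [n2 v2] := two_unitE; have [p0 vp] := hpiE.
have [a [b Ex]] := E_decomp x.
have Ed : x - bar x = 2%:R * (b *: piE).
  rewrite Ex rmorphD /= bar_alg linearZ /= hbar scalerN.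
  by rewrite opprD opprK addrACA subrr add0r mulr2n mulrDl !mul1r.
have hd : vge vE 0 (2%:R * (b *: piE)) by rewrite -Ed (vge_sub hvE) // vge_bar.
apply/eqP; rewrite eq_sym (res_eq hvE) ?vge_bar // Ed.
have [->|b0] := eqVneq b 0; first by rewrite scale0r mulr0 vge0.
have bp0 : b *: piE != 0 by rewrite scaler_eq0 (negbTE b0).
have vb : vE (b *: piE) = vF b *+ 2 + 1.
  rewrite -mulr_algl (val_mul (vd_val hvE)) ?vp //; first by congr (_ + _); apply: hram.
  by rewrite scaler_eq0 (negbTE b0) oner_eq0.
move: hd; rewrite !vgeE ?mulf_neq0 // (val_mul (vd_val hvE)) // v2 vb add0r; move: (vF b) => z; clear; lia.
Qed.

(** Lifts are taken in [F], so that conjugation and Galois elements leave them fixed. *)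
Lemma res_lift (a : k) : exists x : F, vge vE 0 (x%:A : E) /\ resE x%:A = a.
Proof.
have [x hx rx] := res_surj (lf_res hF) a; exists x.
have E0 := hres hx; rewrite rx in E0; split=> //.
have [->|x0] := eqVneq x 0; first by rewrite scale0r vge0.
rewrite vgeE; last by rewrite scaler_eq0 (negbTE x0) oner_eq0.
have -> : vE x%:A = vF x *+ 2 by apply: hram.
by move: hx; rewrite vgeE //; lia.
Qed.

Variables (L : fieldType) (iota : {rmorphism E -> L}).

(** The square of [piE] lies in [F], so [s] sends [iota piE] to itself or to its opposite. *)
Lemma gal_E (s : {rmorphism L -> L}) : Defs.Gal iota s ->
  (forall e, s (iota e) = iota e) \/ (forall e, s (iota e) = iota (bar e)).
Proof.
move=> [_ sF]; have [a Ea] : exists a : F, piE ^+ 2 = a%:A.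
  by apply: bar_fix; rewrite rmorphXn /= hbar sqrrN.
have : (s (iota piE) - iota piE) * (s (iota piE) + iota piE) = 0.
  by rewrite -subr_sqr -!rmorphXn Ea sF subrr.
move/eqP; rewrite mulf_eq0 subr_eq0 addr_eq0 => /orP[]/eqP sp; [left|right] => e;
    have [x [y ->]] := E_decomp e.
  by rewrite -(mulr_algl y) !rmorphD !rmorphM /= !sF sp.
rewrite -(mulr_algl y) !rmorphD !rmorphM /= !sF sp !bar_alg hbar rmorphN //.
Qed.

Lemma iota_bar_neq : ~ (forall e, iota (bar e) = iota e).
Proof.
move=> /(_ piE); rewrite hbar => /fmorph_inj/eqP; rewrite eq_sym -addr_eq0 -mulr2n -mulr_natl.
by rewrite mulf_eq0 (negbTE (two_unitE.1)); apply/negP; case: hpiE.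
Qed.
End Ramified.

(* The unramified extension of degree [N], with residue field of [#|k| ^ N] elements
   inside [kbar], its Frobenius [ud_phi] and the extension [ud_bar] of the conjugation. *)
Record urdata (F : fieldType) (E : fieldExtType F) (k : finFieldType) (v : E -> int)
  (res : E -> k) (bar : E -> E) (kbar : closedFieldType) (rho : {rmorphism k -> kbar})
  (L : fieldType) (iota : {rmorphism E -> L}) (N : nat) := URData {
  ud_M :> fieldType;
  ud_v : ud_M -> int;
  ud_res : ud_M -> kbar;
  ud_emb : {rmorphism E -> ud_M};
  ud_phi : {rmorphism ud_M -> ud_M};
  ud_bar : {rmorphism ud_M -> ud_M};
  ud_incl : {rmorphism ud_M -> L};
  ud_valued : valued ud_v ud_res;
  ud_complete : complete_valuation ud_v;
  ud_vext : val_ext ud_emb v ud_v 1;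
  ud_rext : res_ext ud_emb rho v res ud_res;
  ud_surj : forall x, x ^+ (#|k| ^ N) = x -> exists2 y, vge ud_v 0 y & ud_res y = x;
  ud_phi_emb : forall c, ud_phi (ud_emb c) = ud_emb c;
  ud_phi_v : forall x, ud_v (ud_phi x) = ud_v x;
  ud_phi_res : forall x, vge ud_v 0 x -> ud_res (ud_phi x) = ud_res x ^+ #|k|;
  ud_bar_emb : forall c, ud_bar (ud_emb c) = ud_emb (bar c);
  ud_bar_v : forall x, ud_v (ud_bar x) = ud_v x;
  ud_bar_res : forall x, vge ud_v 0 x -> ud_res (ud_bar x) = ud_res x;
  ud_barK : forall x, ud_bar (ud_bar x) = x;
  ud_comm : forall x, ud_phi (ud_bar x) = ud_bar (ud_phi x);
  ud_incl_emb : forall c, ud_incl (ud_emb c) = iota c;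
  ud_gal : forall s : {rmorphism L -> L}, Defs.Gal iota s -> exists r,
    ((forall e, s (iota e) = iota e) /\ forall x, s (ud_incl x) = ud_incl (iter r ud_phi x)) \/
    ((forall e, s (iota e) = iota (bar e)) /\
       forall x, s (ud_incl x) = ud_incl (iter r ud_phi (ud_bar x)));
  ud_ext : forall r (b : bool), exists2 s : {rmorphism L -> L}, Defs.Gal iota s &
    forall x, s (ud_incl x) = ud_incl (iter r ud_phi (if b then ud_bar x else x));
  ud_fixed : forall y, (forall s : {rmorphism L -> L}, Defs.Gal iota s ->
    (forall x, s (ud_incl x) = ud_incl x) -> s y = y) -> exists x, y = ud_incl x }.

(** A period e < d of [x] would give, by [conj_poly], a polynomial of degree e over [k] vanishing at
    [x], which [g] cannot divide. *)
Lemma conj_uniq (k : finFieldType) (kbar : closedFieldType) (rho : {rmorphism k -> kbar})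
    (g : {poly k}) (x : kbar) : irreducible_poly g -> g \is monic ->
  root (map_poly rho g) x -> uniq (frob_orbit k x (size g).-1).
Proof.
move=> ig mg gx; set q := #|k|; set d := (size g).-1.
have s1 : (1 < size g)%N by case: ig.
have main e : (0 < e < d)%N -> x ^+ (q ^ e) != x.
  move=> /andP[e0 ed]; apply/eqP => he; have [g' Eg'] := conj_poly rho he.
  have gg' : g %| g'.
    apply: (irr_root_dvd ig gx); rewrite Eg' -(prednK e0).
    by rewrite big_ord_recl expn0 expr1 rootM root_XsubC eqxx.
  have g'0 : g' != 0 by rewrite -(map_poly_eq0 rho) Eg' monic_neq0 // monic_prod_XsubC.
  have := dvdp_leq g'0 gg'; rewrite -(size_map_poly rho g') Eg' size_prod_XsubC.
  rewrite -[index_enum _]enumT size_enum_ord => h; move: ed; rewrite /d.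
  by rewrite ltnNge -ltnS prednK ?h // ltnW.
rewrite map_inj_in_uniq ?iota_uniq // => r s; rewrite !mem_iota !add0n /=.
wlog rs : r s / (r <= s)%N.
  by case: (leqP r s) => [/[swap]/[apply]//|/ltnW sr /(_ _ _ sr) H hr hs E]; rewrite (H hs hr).
move=> hr hs E; apply/eqP; apply: contraT => ne.
have rs' : (0 < s - r < d)%N by rewrite subn_gt0 ltn_neqAle ne rs (leq_ltn_trans (leq_subr _ _)).
have := main _ rs'; suff -> : x ^+ (q ^ (s - r)) = x by rewrite eqxx.
by apply: (@frob_inj k kbar rho r); rewrite /= -exprM -expnD subnK.
Qed.

Lemma irr_separable (k : finFieldType) (kbar : closedFieldType) (rho : {rmorphism k -> kbar})
    (g : {poly k}) : irreducible_poly g -> g \is monic -> separable_poly g.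
Proof.
move=> ig mg; have : size (map_poly rho g) != 1.
  by rewrite size_map_poly neq_ltn; case: ig => ->; rewrite orbT.
move=> /closed_rootP[x gx].
rewrite -(separable_map rho) (irr_root_conj ig mg gx).
have -> : \prod_(r < (size g).-1) ('X - (x ^+ (#|k| ^ r))%:P) =
    \prod_(y <- frob_orbit k x (size g).-1) ('X - y%:P).
  by rewrite /frob_orbit big_map -[X in iota 0 X]subn0 -/(index_iota 0 _) big_mkord.
by rewrite separable_prod_XsubC (conj_uniq ig mg gx).
Qed.

Lemma separable_deriv_root (k : fieldType) (g : {poly k}) (x : k) : separable_poly g ->
  root g x -> g^`().[x] != 0.
Proof.
rewrite unlock => /coprimep_root h gx; exact: h.
Qed.

Lemma min_irr (k : fieldType) (kb : fieldType) (rho : {rmorphism k -> kb})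
    (x : kb) (g : {poly k}) : g != 0 -> root (map_poly rho g) x ->
  exists h, [/\ irreducible_poly h, h \is monic & root (map_poly rho h) x].
Proof.
move=> g0 gx.
pose Q s := `[< exists h : {poly k}, [/\ h != 0, root (map_poly rho h) x & size h = s] >].
have exQ : exists s, Q s by exists (size g); apply/asboolP; exists g.
case: (ex_minnP exQ) => s /asboolP[h [h0 hx sh]] smin.
have sh1 : (1 < size h)%N.
  rewrite ltnNge; apply/negP => s1; move: hx; rewrite (size1_polyC s1) map_polyC rootC /=.
  by rewrite fmorph_eq0 => c0; move: h0; rewrite (size1_polyC s1) (eqP c0) eqxx.
have lc0 : lead_coef h != 0 by rewrite lead_coef_eq0.
exists ((lead_coef h)^-1 *: h); split.
- split; first by rewrite size_scale ?invr_eq0.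
  move=> u su; rewrite dvdpZr ?invr_eq0 // => uh.
  have uE : u %= h.
    have /dvdpP[w Ew] := uh.
    have w0 : w != 0 by apply: contra_neq h0 => w0; rewrite Ew w0 mul0r.
    have u0 : u != 0 by apply: contra_neq h0 => u0; rewrite Ew u0 mulr0.
    have su0 : (0 < size u)%N by rewrite size_poly_gt0.
    have sw0 : (0 < size w)%N by rewrite size_poly_gt0.
    have Es : s = (size w + size u).-1 by rewrite -sh Ew size_mul.
    move: hx; rewrite Ew rmorphM rootM => /orP[wx|ux].
      have : (s <= size w)%N by apply: smin; apply/asboolP; exists w.
      move: Es su su0 sw0; move: (size u) (size w) => a b; clear; lia.
    have : (s <= size u)%N by apply: smin; apply/asboolP; exists u.
    move=> sle; rewrite -dvdp_size_eqp // -?Ew // sh.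
    by rewrite eqn_leq sle andbT -sh dvdp_leq.
  by rewrite (eqp_trans uE) // eqp_sym eqp_scale ?invr_eq0.
- by rewrite monicE lead_coefZ mulVf.
- by rewrite map_polyZ /= rootZ // fmorph_eq0 invr_eq0.
Qed.

(** The root [a] generates the multiplicative group of the field with q^N elements. Its order q^N -
    1 divides q^d - 1, d being its degree, so d is N; and every element of that field is 0 or a
    power of [a]. *)
Lemma exists_conway (k : finFieldType) (kbar : closedFieldType) (rho : {rmorphism k -> kbar})
    (N : nat) : (2 < #|k|)%N -> (0 < N)%N ->
  exists (g : {poly k}) (a : kbar), [/\ irreducible_poly g, g \is monic, size g = N.+1,
    root (map_poly rho g) a & forall x, x ^+ (#|k| ^ N) = x ->
    exists h : {poly k}, x = (map_poly rho h).[a]].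
Proof.
move=> k_odd N0; have [a pa] := exists_prim rho k_odd N0; set q := #|k| in pa *.
have q1 : (1 < q)%N := q_gt1 k.
have qN0 : (0 < q ^ N)%N by rewrite expn_gt0 ltnW.
have aN : a ^+ (q ^ N) = a by rewrite -{1}(prednK qN0) exprS (prim_expr_order pa) mulr1.
have [g' Eg'] := conj_poly rho aN.
have g'0 : g' != 0 by rewrite -(map_poly_eq0 rho) Eg' monic_neq0 // monic_prod_XsubC.
have sg' : size g' = N.+1.
  by rewrite -(size_map_poly rho) Eg' size_prod_XsubC -[index_enum _]enumT size_enum_ord.
have g'a : root (map_poly rho g') a.
  by rewrite Eg' -(prednK N0) big_ord_recl expn0 expr1 rootM root_XsubC eqxx.
have [g [ig mg ga]] := min_irr g'0 g'a.
have s1 : (1 < size g)%N by case: ig.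
exists g, a; split=> //.
  apply/eqP; rewrite eqn_leq -{1}sg' (dvdp_leq g'0 (irr_root_dvd ig ga g'a)) /=.
  rewrite -(prednK (ltnW s1)) ltnS; set d := (size g).-1.
  have d0 : (0 < d)%N by rewrite /d -ltnS prednK // ltnW.
  have qd1 : (1 < q ^ d)%N by rewrite -(expn0 q) ltn_exp2l.
  have qd0 := ltnW qd1.
  have a0 : a != 0.
    by rewrite (prim_root_eq0 pa) -lt0n -ltnS prednK // -(expn0 q) ltn_exp2l.
  have : a ^+ (q ^ d).-1 = 1.
    apply: (mulfI a0); rewrite -exprS prednK // mulr1.
    exact: (irr_root_period ig mg ga).
  move/eqP; rewrite -(prim_order_dvd pa) => /dvdn_leq.
  have -> : (0 < (q ^ d).-1)%N by rewrite -ltnS prednK.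
  move=> /(_ isT); rewrite -ltnS !prednK // leq_exp2l //.
move=> x xN; have [->|x0] := eqVneq x 0; first by exists 0; rewrite rmorph0 horner0.
have x1 : x ^+ (q ^ N).-1 = 1.
  by apply: (mulfI x0); rewrite -exprS prednK // xN mulr1.
have [i ->] := prim_rootP pa x1.
by exists 'X^i; rewrite map_polyXn hornerXn.
Qed.

(** * Existence of the unramified extension with its Frobenius and conjugation *)

Section Existence.
Variables (F : fieldType) (k : finFieldType) (vF : F -> int) (resF : F -> k).
Hypothesis hF : local_field vF resF.
Hypothesis k2 : (2%:R : k) != 0.
Variables (E : fieldExtType F) (vE : E -> int) (resE : E -> k).
Hypothesis hE : local_field vE resE.
Hypothesis hdim : \dim {: E} = 2%N.
Hypothesis hram : val_ext (in_alg E) vF vE 2.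
Hypothesis hres : res_ext (in_alg E) id vF resF resE.
Variables (bar : {lrmorphism E -> E}) (piE : E).
Hypothesis hpiE : uniformizer vE piE.
Hypothesis hbar : bar piE = - piE.
Variables (L : fieldType) (iota : {rmorphism E -> L}).
Hypothesis hL : separable_closure (iota \o in_alg E).
Variables (kbar : closedFieldType) (rho : {rmorphism k -> kbar}).

Let hvE := valued_local hE.

Lemma card_k_odd : (2 < #|k|)%N.
Proof.
have q1 := q_gt1 k; rewrite ltn_neqAle q1 andbT; apply/negP => /eqP q2.
have [p pp pk] := finPcharP k.
have := card_pprimeChar pk; rewrite -[#|pPrimeCharType pk|]/#|k| -q2 => E2.
have : (p %| 2)%N by rewrite E2 dvdn_exp //; case: (logn p 2) E2.
rewrite dvdn_prime2 // => /eqP Ep; move: pk; rewrite Ep inE => /andP[_].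
by rewrite (negbTE k2).
Qed.

(** Coefficients in [F] make [P] invariant under conjugation and under Gal(L/F), which therefore
    permute its roots. *)
Lemma lift_poly (g : {poly k}) : g \is monic -> exists P : {poly E},
  [/\ P \is monic, vpoly vE 0 P, map_poly resE P = g & forall i, exists c : F, P`_i = c%:A].
Proof.
move=> mg; have [l hl] := choice (res_lift hF k2 hdim hram hres).
pose d := (size g).-1.
pose P : {poly E} := 'X^d + \poly_(i < d) (l g`_i)%:A.
have Pi i : P`_i = if (i < d)%N then (l g`_i)%:A else (i == d)%:R.
  rewrite coefD coefXn coef_poly; case: ltnP => h; last by rewrite addr0.
  by rewrite (ltn_eqF h) add0r.
have sg : (0 < size g)%N by rewrite size_poly_gt0 monic_neq0.
exists P; split.
- by rewrite monicE lead_coefDl ?lead_coefXn // size_polyXn ltnS size_poly.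
- by move=> i; rewrite Pi; case: ifP => _; [case: (hl g`_i)|apply: (vge_nat hvE)].
- apply/polyP=> i; rewrite (coef_res hvE) Pi; case: ltnP => h; first by case: (hl g`_i).
  rewrite (res_nat hvE); move: h; rewrite leq_eqVlt eq_sym => /orP[/eqP ->|h].
    by rewrite eqxx -/(lead_coef g) (monicP mg).
  by rewrite gtn_eqF // nth_default // -(prednK sg).
- move=> i; rewrite Pi; case: ifP => _; first by exists (l g`_i).
  by exists (i == d)%:R; rewrite scaler_nat.
Qed.

Lemma lift_any (h : {poly k}) : exists g : {poly E}, vpoly vE 0 g /\ map_poly resE g = h.
Proof.
have [l hl] := choice (res_lift hF k2 hdim hram hres).
exists (\poly_(i < size h) (l h`_i)%:A); split.
  by move=> i; rewrite coef_poly; case: ifP => _; [case: (hl h`_i)|apply: vge0].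
apply/polyP=> i; rewrite (coef_res hvE) coef_poly; case: ltnP => hi; first by case: (hl h`_i).
by rewrite (res0 hvE) nth_default.
Qed.

Lemma iter_rmorph (M : fieldType) (phi : {rmorphism M -> M}) r :
  exists h : {rmorphism M -> M}, forall x, h x = iter r phi x.
Proof.
elim: r => [|r [h IH]]; first by exists idfun.
by exists (phi \o h) => x /=; rewrite IH.
Qed.

(** Each map is given by the image of the generator [w]: [phi] sends it to the root [w'] of [P]
    lifting a^q, [bM] fixes it while conjugating [E], and [incl] sends it to a root in [L].
    Identities between these maps reduce to [E] and [w], where roots are told apart by residues. *)
Lemma urdata_exists N : (0 < N)%N -> inhabited (urdata vE resE bar rho iota N).
Proof.
move=> N0; have [pb [a [ipb mpb spb pba surj]]] := exists_conway rho card_k_odd N0.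
have [P [mP vP rP PF]] := lift_poly mpb.
set q := #|k| in surj *.
have [M] := unr_exists (rho := rho) hvE (lf_complete hE) ipb pba mP vP rP.
pose emb := un_emb M; pose w := un_gen M; pose vM := @un_v _ _ _ _ _ _ _ _ M.
pose rM := @un_res _ _ _ _ _ _ _ _ M.
have hM : valued vM rM := un_valued M.
have hw : vge vM 0 w := un_int M.
have rw : rM w = a := un_rgen M.
have cM : complete_valuation vM := @un_complete _ _ _ _ _ _ _ _ M.
have vext : val_ext emb vE vM 1 := @un_vext _ _ _ _ _ _ _ _ M.
have rext : res_ext emb rho vE resE rM := @un_rext _ _ _ _ _ _ _ _ M.
have rPM : map_poly rM (map_poly emb P) = map_poly rho pb.
  by rewrite (res_poly_ext hvE hM rext) // rP.
have vPM : vpoly vM 0 (map_poly emb P).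
  exact: (vpoly_ext vext).
have uni x y : vge vM 0 x -> vge vM 0 y -> (map_poly emb P).[x] = 0 ->
    (map_poly emb P).[y] = 0 -> rM x = rM y -> x = y.
  move=> hx hy Px Py rxy; apply: (hensel_unique hM vPM) => //.
  rewrite rPM; apply: separable_deriv_root.
    by rewrite separable_map; apply: (irr_separable rho ipb mpb).
  by rewrite rootE -rPM -(res_horner hM vPM hy) Py (res0 hM).
have [w' [hw' rw' Pw']] : exists w', [/\ vge vM 0 w', rM w' = a ^+ q & (map_poly emb P).[w'] = 0].
  have [y hy ry] : exists2 y, vge vM 0 y & rM y = a ^+ q.
    exists (w ^+ q); first by apply: (vge_exp hM); exact: hw.
    by rewrite (resX hM _ hw) rw.
  have raq : root (map_poly rho pb) (a ^+ q).
    have := frob_horner rho pb a 1; rewrite expn1 (eqP pba) expr0n eqn0Ngt q_gt0.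
    by rewrite rootE => ->.
  have [||x [hx rx Px]] := hensel hM cM vPM hy.
  - by rewrite rPM ry; apply/eqP.
  - rewrite rPM ry; apply: separable_deriv_root => //.
    by rewrite separable_map; apply: (irr_separable rho ipb mpb).
  by exists x; rewrite rx ry.
have [phi [phiE phiw]] := un_lift M (f := emb) (introT eqP Pw').
have Pbar (f : {rmorphism E -> L}) : (forall c : F, f c%:A = iota c%:A) -> map_poly f P = map_poly iota P.
  by move=> fE; apply/polyP=> i; rewrite !coef_map; have [c ->] := PF i; rewrite /= fE.
have Pw := un_root M.
pose embbar : {rmorphism E -> M} := emb \o bar.
have Pbw : root (map_poly embbar P) w.
  suff -> : map_poly embbar P = map_poly emb P by [].
  by apply/polyP=> i; rewrite !coef_map; have [c ->] := PF i; rewrite /= bar_alg.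
have [bM [bME bMw]] := un_lift M (f := embbar) Pbw.
(* [P] is irreducible, and its derivative is not 0 because the derivative of [pb] is nonzero at
   [a]. *)
have sepP : separable_poly P.
  have irrP : irreducible_poly P by apply: (lift_irreducible hvE ipb).
  rewrite unlock (irreducible_poly_coprime _ irrP); apply/negP => dP.
  have P0 : P^`() != 0.
    apply/eqP => P0; have := separable_deriv_root (irr_separable rho ipb mpb).
    have spb' := irr_separable rho ipb mpb.
    have : (map_poly rho pb)^`().[a] != 0 by apply: separable_deriv_root; rewrite ?separable_map.
    rewrite deriv_map -rP -(res_deriv hvE vP) P0.
    have -> : map_poly resE 0 = 0 by apply/polyP=> i; rewrite (coef_res hvE) !coef0 (res0 hvE).
    by rewrite rmorph0 horner0 eqxx.
  have := dvdp_leq P0 dP; rewrite leqNgt lt_size_deriv // monic_neq0 //.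
have [w0 Pw0] : exists w0, root (map_poly iota P) w0.
  apply: (sep_closed hL); first by rewrite separable_map.
  by rewrite size_map_poly; case: (lift_irreducible hvE ipb mP vP rP).
have [incl [inclE inclw]] := un_lift M (f := iota) Pw0.
have ext (K : fieldType) (h1 h2 : {rmorphism M -> K}) :
    (forall c, h1 (emb c) = h2 (emb c)) -> h1 w = h2 w -> h1 =1 h2.
  move=> hE' h12 x; have [g ->] := un_span x; rewrite -!horner_map /= h12.
  by rewrite -!map_poly_comp; congr (_.[_]); apply: eq_map_poly => c /=.
have unitM (x : M) : x != 0 -> exists m y, [/\ x = emb piE ^ m * y, vge vM 0 y, vM y = 0 & y != 0].
  move=> x0; have [p0 vp] := hpiE.
  have ep0 : emb piE != 0 by rewrite fmorph_eq0.
  have vp' : vM (emb piE) = 1 by rewrite vext // vp.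
  have vpz m : vM (emb piE ^ m) = m.
    case: m => m; first by rewrite -exprnP (vX hM) // vp' natz.
    by rewrite NegzE -exprnN (vV hM) ?expf_neq0 // (vX hM) // vp' natz.
  have pz m : emb piE ^ m != 0 by rewrite expfz_neq0.
  exists (vM x), (emb piE ^ (- vM x) * x).
  have v0 : vM (emb piE ^ (- vM x) * x) = 0 by rewrite (val_mul (vd_val hM)) // vpz addNr.
  split=> //; last by rewrite mulf_neq0.
    by rewrite mulrA -expfzDr // subrr mul1r.
  by rewrite vgeE ?v0 ?mulf_neq0.
have vN1z (m : int) : vM ((-1) ^ m) = 0.
  have n10 : (-1 : M) != 0 by rewrite oppr_eq0 oner_neq0.
  case: m => m; first by rewrite -exprnP (vX hM) // (vN hM) (v1 hM) mul0rn.
  by rewrite NegzE -exprnN (vV hM) ?expf_neq0 // (vX hM) // (vN hM) (v1 hM) mul0rn oppr0.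
(* Every nonzero element is a power of [piE] times a unit, so preserving the integers together with
   units, and [piE] up to sign, is enough. The exponent [e] is q for [phi] and 1 for [bM]. *)
have vpres (h : {rmorphism M -> M}) e : (0 < e)%N -> (h (emb piE) = emb piE \/ h (emb piE) = - emb piE) ->
    (forall x, vge vM 0 x -> vge vM 0 (h x) /\ rM (h x) = rM x ^+ e) ->
    forall x, vM (h x) = vM x.
  move=> e0 hpi hint x; have [->|x0] := eqVneq x 0; first by rewrite rmorph0.
  have [m [y [-> hy vy y0]]] := unitM _ x0.
  have ep0 : emb piE != 0 by rewrite fmorph_eq0; case: hpiE.
  have hy0 : h y != 0 by rewrite fmorph_eq0.
  have vhy : vM (h y) = 0.
    have [h1 h2] := hint _ hy; have [_ ry] := unit_res hM y0 vy.
    by have [] := res_unit hM h1; rewrite ?h2 ?expf_neq0.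
  have vhp : vM (emb piE ^ m) = vM (h (emb piE) ^ m).
    case: hpi => ->; first by [].
    rewrite -mulN1r expfzMl (val_mul (vd_val hM)) ?expfz_neq0 ?oppr_eq0 ?oner_neq0 //.
    by rewrite vN1z add0r.
  have [p0 _] := hpiE.
  rewrite rmorphM fmorphXz !(val_mul (vd_val hM)) ?expfz_neq0 ?fmorph_eq0 //.
  by rewrite vhy vy vhp.
have span x : exists g : {poly E}, [/\ (size g < size pb)%N & x = (map_poly emb g).[w]].
  have [g ->] := un_span x; exists (g %% P).
  have P0 : P != 0 by rewrite monic_neq0.
  rewrite -(size_lift hvE mP rP) ltn_modp P0; split=> //.
  rewrite {1}(divp_eq g P) rmorphD rmorphM hornerD hornerM.
  by rewrite (eqP (un_root M)) mulr0 add0r.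
have wpb : root (map_poly rho pb) (rM w) by rewrite rw.
have spanint x : vge vM 0 x -> exists g : {poly E}, vpoly vE 0 g /\ x = (map_poly emb g).[w].
  move=> hx; have [g [sg Ex]] := span x; exists g; split=> //.
  by apply/(gauss_vge hvE hM vext rext hw ipb wpb 0 sg); rewrite -Ex.
have phiint x : vge vM 0 x -> vge vM 0 (phi x) /\ rM (phi x) = rM x ^+ q.
  move=> hx; have [g [vg ->]] := spanint x hx.
  have E1 : phi (map_poly emb g).[w] = (map_poly emb g).[w'].
    rewrite -horner_map /= phiw -map_poly_comp; congr (_.[_]).
    by apply: eq_map_poly => c /=.
  have vg' : vpoly vM 0 (map_poly emb g) by apply: (vpoly_ext vext).
  rewrite E1; split; first exact: (vge_horner hM).
  rewrite !(res_horner hM) // (res_poly_ext hvE hM rext) // rw rw'.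
  by have := frob_horner rho (map_poly resE g) a 1; rewrite expn1.
have vbarE := v_bar k2 hE hdim hram hpiE hbar.
have barint x : vge vM 0 x -> vge vM 0 (bM x) /\ rM (bM x) = rM x ^+ 1.
  move=> hx; have [g [vg ->]] := spanint x hx.
  have E1 : bM (map_poly emb g).[w] = (map_poly emb (map_poly bar g)).[w].
    rewrite -horner_map /= bMw -!map_poly_comp; congr (_.[_]).
    by apply: eq_map_poly => c /=.
  have vbg : vpoly vE 0 (map_poly bar g).
    by move=> i; rewrite coef_map /vge fmorph_eq0 vbarE; apply: vg.
  have vg' : vpoly vM 0 (map_poly emb g) by apply: (vpoly_ext vext).
  have vg'' : vpoly vM 0 (map_poly emb (map_poly bar g)) by apply: (vpoly_ext vext).
  rewrite E1; split; first exact: (vge_horner hM).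
  rewrite !(res_horner hM) // !(res_poly_ext hvE hM rext) // expr1.
  congr (map_poly rho _).[_]; apply/polyP=> i; rewrite !(coef_res hvE) coef_map /=.
  exact: (res_bar k2 hE hdim hram hpiE hbar).
have phiv : forall x, vM (phi x) = vM x.
  by apply: (vpres phi q) => //; [apply: q_gt0|left; rewrite phiE].
have barv : forall x, vM (bM x) = vM x.
  by apply: (vpres bM 1%N) => //; right; rewrite bME /= hbar rmorphN.
have phir r : vge vM 0 (iter r phi w) /\ rM (iter r phi w) = a ^+ (q ^ r).
  elim: r => [|r [IH1 IH2]]; first by rewrite expn0 expr1.
  by have [h1 h2] := phiint _ IH1; rewrite /= h2 IH2 -exprM -expnSr.
have phiroot r : (map_poly emb P).[iter r phi w] = 0.
  elim: r => [|r IH]; first exact/eqP/(un_root M).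
  have : phi (map_poly emb P).[iter r phi w] = 0 by rewrite IH rmorph0.
  rewrite -horner_map /= -map_poly_comp => <-; congr (_.[_]).
  by apply: eq_map_poly => c /=.
(* [s] permutes the roots of [P], and these are the N Frobenius iterates of [w], distinct because
   their residues are. *)
have inclroot (s : {rmorphism L -> L}) : (forall c : F, s (iota c%:A) = iota c%:A) ->
    exists r, s (incl w) = incl (iter r phi w).
  move=> sF; pose rs := [seq iter r phi w | r <- seq.iota 0 N].
  have : root (map_poly iota P) (s (incl w)).
    have E1 : map_poly iota P = map_poly (s \o incl \o emb) P.
      apply/polyP=> i; rewrite !coef_map; have [c ->] := PF i => /=.
      by rewrite inclE sF.
    rewrite E1 !map_poly_comp rootE !horner_map /=.
    by rewrite (eqP (un_root M)) !rmorph0.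
  have urs : uniq rs.
    apply: (@map_uniq _ _ rM); rewrite -map_comp.
    have := conj_uniq ipb mpb pba; rewrite spb /= /frob_orbit; congr uniq.
    by apply: eq_map => r /=; rewrite (phir r).2.
  have -> : map_poly iota P = map_poly incl (map_poly emb P).
    by rewrite -map_poly_comp; apply: eq_map_poly => c /=.
  have mPE : map_poly emb P \is monic by rewrite map_monic.
  rewrite (@all_roots_prod_XsubC _ (map_poly emb P) rs) ?(monicP mPE) ?scale1r //; last first.
  - by rewrite uniq_rootsE.
  - by apply/allP => y /mapP[r _ ->]; apply/eqP.
  - by rewrite size_map_poly (size_lift hvE mP rP) spb size_map size_iota.
  rewrite rmorph_prod /= => /eqP; rewrite horner_prod => /eqP.
  rewrite prodf_seq_eq0 => /hasP[y /mapP[r _ ->] /=].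
  rewrite rmorphB /= map_polyX map_polyC hornerXsubC subr_eq0 => /eqP ->.
  by exists r.
constructor.
apply: (URData (ud_M := M) (ud_v := vM) (ud_res := rM) (ud_emb := emb) (ud_phi := phi) (ud_bar := bM)
  (ud_incl := incl)) => //.
- move=> x /surj[h ->]; have [g [vg <-]] := lift_any h.
  have vg' : vpoly vM 0 (map_poly emb g) by apply: (vpoly_ext vext).
  exists (map_poly emb g).[w]; first exact: (vge_horner hM).
  by rewrite (res_horner hM) // (res_poly_ext hvE hM rext) // rw.
- by move=> x /phiint[].
- by move=> x /barint[_ ->]; rewrite expr1.
- apply: (ext _ (bM \o bM) idfun) => [c|] /=; last by rewrite !bMw.
  by rewrite bME /= bME /= (barK k2 hE hdim hpiE hbar).
- apply: (ext _ (phi \o bM) (bM \o phi)) => [c|] /=.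
    by rewrite phiE !bME /= phiE.
  rewrite bMw phiw; have [h1 h2] := barint _ hw'.
  have h3 : rM w' = rM (bM w') by rewrite h2 expr1.
  apply: (uni _ _ hw' h1 Pw' _ h3).
  have : bM (map_poly emb P).[w'] = 0 by rewrite Pw' rmorph0.
  rewrite -horner_map /= => <-; congr (_.[_]).
  apply/polyP=> i; rewrite !coef_map; have [c ->] := PF i => /=.
  by rewrite bME /= bar_alg.
- move=> s Gs; have [r sr] := inclroot s Gs.2; exists r.
  have [h hr] := iter_rmorph phi r.
  have hE' c : h (emb c) = emb c by rewrite hr; elim: (r) => //= r' ->.
  have [sE|sE] := gal_E k2 hE hdim hpiE hbar Gs; [left|right]; split=> //.
    move=> x; rewrite -hr; apply: (ext _ (s \o incl) (incl \o h)) => [c|] /=.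
      by rewrite hE' inclE.
    by rewrite sr hr.
  move=> x; rewrite -hr; apply: (ext _ (s \o incl) (incl \o h \o bM)) => [c|] /=.
    by rewrite bME /= hE' !inclE.
  by rewrite sr bMw hr.
- move=> r b; have [h hr] := iter_rmorph phi r.
  pose h' : {rmorphism M -> M} := if b then (h \o bM : {rmorphism M -> M}) else h.
  have h'E x : h' x = iter r phi (if b then bM x else x).
    by rewrite -hr /h'; case: (b).
  have h'F (c : F) : h' (emb c%:A) = emb c%:A.
    rewrite h'E; have -> : (if b then bM (emb c%:A) else emb c%:A) = emb c%:A.
      by case: (b) => //; rewrite bME /= bar_alg.
    by elim: (r) => //= r' ->.
  (* Graph of the automorphism on the copy of [M] inside [L], to be prolonged by [extend_aut]. *)
  pose G0 : set (L * L) := fun z => exists x, z = (incl x, incl (h' x)).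
  have pG0 : pgraph (iota \o in_alg E) G0.
    split.
    + by move=> c /=; exists (emb c%:A); rewrite h'F !inclE.
    + by move=> _ _ [x ->] [y ->]; exists (x - y); rewrite !rmorphB.
    + by move=> _ _ [x ->] [y ->]; exists (x * y); rewrite !rmorphM.
    + move=> z [x [/esym/eqP]]; rewrite fmorph_eq0 => /eqP -> ->.
      by rewrite !rmorph0.
  have [s [bs sF sG]] := extend_aut hL pG0.
  exists s; first by split.
  by move=> x; rewrite -h'E; apply: (sG (incl x, incl (h' x))); exists x.
(* An element outside [M] is moved by some automorphism that fixes [M]. *)
- move=> y hy; apply: contrapT => ny.
  pose K : set L := fun z => exists x, z = incl x.
  have hK : subfield_set (iota \o in_alg E) K.
    split.
    + by move=> c /=; exists (emb c%:A); rewrite inclE.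
    + by move=> _ _ [x ->] [z ->]; exists (x - z); rewrite rmorphB.
    + by move=> _ _ [x ->] [z ->]; exists (x * z); rewrite rmorphM.
  have [s [bs sF sK sy]] := moving_aut hL hK ny.
  apply: (negP sy); apply/eqP/hy; first by split.
  by move=> x; apply: sK; exists x.
Qed.
End Existence.

(** * The standard form in terms of its Gram matrix *)

Section Hermitian.
Variables (A : comPzRingType) (n : nat).

(** Gram matrix of [herm], symmetric and of square 1, so that duals are explicit. *)
Definition antidiag : 'M[A]_n := \matrix_(i, j) (j == rev_ord i)%:R.

Lemma antidiag_tr : antidiag^T = antidiag.
Proof.
apply/matrixP=> i j; rewrite !mxE; congr (_%:R).
by rewrite -(can_eq rev_ordK i) rev_ordK eq_sym.
Qed.

Lemma antidiag_mul m (B : 'M[A]_(n, m)) i j : (antidiag *m B) i j = B (rev_ord i) j.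
Proof.
rewrite mxE (bigD1 (rev_ord i)) //= mxE eqxx mul1r big1 ?addr0 // => l ne.
by rewrite mxE (negbTE ne) mul0r.
Qed.

Lemma antidiag_sq : antidiag *m antidiag = 1%:M.
Proof.
apply/matrixP=> i j; rewrite antidiag_mul !mxE rev_ordK eq_sym //.
Qed.

Variable c : {rmorphism A -> A}.

Lemma hermE (x y : 'cV[A]_n) : herm c x y = (x^T *m antidiag *m map_mx c y) 0 0.
Proof.
rewrite -mulmxA mxE /herm; apply: eq_bigr => i _.
by rewrite antidiag_mul !mxE !ord1.
Qed.

Lemma herm_delta (X Y : 'M[A]_n) i j :
  herm c (X *m delta_mx i ord0) (Y *m delta_mx j ord0) = (X^T *m antidiag *m map_mx c Y) i j.
Proof.
rewrite hermE; set M := X^T *m antidiag *m map_mx c Y.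
have -> : (X *m delta_mx i ord0)^T *m antidiag *m map_mx c (Y *m delta_mx j ord0) =
    delta_mx (0 : 'I_1) i *m M *m delta_mx j (0 : 'I_1).
  by rewrite /M trmx_mul map_mxM map_delta_mx trmx_delta !mulmxA.
by rewrite -rowE -colE !mxE.
Qed.

Lemma isom_grpE g : isom_grp c g <-> g^T *m antidiag *m map_mx c g = antidiag.
Proof.
split=> [h|h x y]; last first.
  by rewrite !hermE map_mxM trmx_mul !mulmxA -(mulmxA _ _ antidiag) -(mulmxA _ _ (map_mx c g)) h.
apply/matrixP=> i j; rewrite -herm_delta h.
have := herm_delta 1%:M 1%:M i j; rewrite !mul1mx => ->.
by rewrite trmx1 mul1mx map_mx1 mulmx1.
Qed.

Lemma isom_lieE X : isom_lie c X <-> X^T *m antidiag + antidiag *m map_mx c X = 0.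
Proof.
have hE x y : herm c (X *m x) y + herm c x (X *m y) =
    (x^T *m (X^T *m antidiag + antidiag *m map_mx c X) *m map_mx c y) 0 0.
  by rewrite !hermE mulmxDr mulmxDl [RHS]mxE map_mxM trmx_mul !mulmxA.
split=> [h|h x y]; last by rewrite hE h mulmx0 mul0mx mxE.
apply/matrixP=> i j; rewrite [RHS]mxE -(h (delta_mx i ord0) (delta_mx j ord0)) hE.
by rewrite map_delta_mx trmx_delta -rowE -colE !mxE.
Qed.

Lemma isom_grpM (g h : 'M[A]_n) : isom_grp c g -> isom_grp c h -> isom_grp c (g *m h).
Proof. by move=> hg hh x y; rewrite -!mulmxA hg hh. Qed.

End Hermitian.

(** * Matrices over E ⊗ L as pairs of matrices over [L] *)

Section PairMatrix.
Variables (L : fieldType) (n : nat).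
Local Notation EL := (L * L)%type.
Local Notation J := (antidiag L n).

Fact barEL_zmod : zmod_morphism (@barEL L).
Proof. by []. Qed.
Fact barEL_monoid : monoid_morphism (@barEL L).
Proof. by []. Qed.
HB.instance Definition _ := GRing.isZmodMorphism.Build EL EL (@barEL L) barEL_zmod.
HB.instance Definition _ := GRing.isMonoidMorphism.Build EL EL (@barEL L) barEL_monoid.

(** The first component determines a unitary matrix and can be any invertible one; likewise for the
    Lie algebra. This is the identification of the unitary group over [L] with GL_n. *)
Definition fm (X : 'M[EL]_n) : 'M[L]_n := map_mx fst X.
Definition sm (X : 'M[EL]_n) : 'M[L]_n := map_mx snd X.
Definition pm (X Y : 'M[L]_n) : 'M[EL]_n := \matrix_(i, j) (X i j, Y i j).

Lemma fm_pm X Y : fm (pm X Y) = X.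
Proof. by apply/matrixP=> i j; rewrite !mxE. Qed.

Lemma sm_pm X Y : sm (pm X Y) = Y.
Proof. by apply/matrixP=> i j; rewrite !mxE. Qed.

Lemma pmP X Y : fm X = fm Y -> sm X = sm Y -> X = Y.
Proof.
move=> /matrixP h1 /matrixP h2; apply/matrixP=> i j.
have := h1 i j; have := h2 i j; rewrite !mxE.
by case: (X i j) (Y i j) => ? ? [? ?] /= -> ->.
Qed.

Lemma fmM X Y : fm (X *m Y) = fm X *m fm Y. Proof. exact: map_mxM. Qed.
Lemma smM X Y : sm (X *m Y) = sm X *m sm Y. Proof. exact: map_mxM. Qed.
Lemma fmB X Y : fm (X - Y) = fm X - fm Y. Proof. exact: map_mxB. Qed.
Lemma smB X Y : sm (X - Y) = sm X - sm Y. Proof. exact: map_mxB. Qed.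
Lemma fm0 : fm 0 = 0. Proof. exact: map_mx0. Qed.
Lemma sm0 : sm 0 = 0. Proof. exact: map_mx0. Qed.

Lemma fm_scale a X : fm (scaleL a X) = a *: fm X.
Proof. by apply/matrixP=> i j; rewrite !mxE. Qed.

Lemma sm_scale a X : sm (scaleL a X) = a *: sm X.
Proof. by apply/matrixP=> i j; rewrite !mxE. Qed.

Lemma isom_grpEL g : isom_grp (@barEL L) g <-> (fm g)^T *m J *m sm g = J.
Proof.
rewrite isom_grpE; split=> [h|h].
  have := congr1 fm h; rewrite !fmM /fm map_trmx -!map_mx_comp.
  have -> : map_mx fst (antidiag EL n) = J.
    by apply/matrixP=> i j; rewrite !mxE; case: (_ == _).
  have -> // : map_mx (fst \o @barEL L) g = sm g.
  by apply/matrixP=> i j; rewrite !mxE.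
have E1 : map_mx fst (antidiag EL n) = J.
  by apply/matrixP=> i j; rewrite !mxE; case: (_ == _).
have E2 : map_mx snd (antidiag EL n) = J.
  by apply/matrixP=> i j; rewrite !mxE; case: (_ == _).
have E3 : map_mx (fst \o @barEL L) g = sm g.
  by apply/matrixP=> i j; rewrite !mxE.
have E4 : map_mx (snd \o @barEL L) g = fm g.
  by apply/matrixP=> i j; rewrite !mxE.
apply: pmP; rewrite ?fmM ?smM /fm /sm -!map_trmx -!map_mx_comp ?E1 ?E2 ?E3 ?E4 //.
by apply: trmx_inj; rewrite !trmx_mul trmxK antidiag_tr mulmxA.
Qed.

Lemma isom_lieEL X : isom_lie (@barEL L) X <-> (fm X)^T *m J + J *m sm X = 0.
Proof.
have E1 : map_mx fst (antidiag EL n) = J.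
  by apply/matrixP=> i j; rewrite !mxE; case: (_ == _).
have E2 : map_mx snd (antidiag EL n) = J.
  by apply/matrixP=> i j; rewrite !mxE; case: (_ == _).
have E3 : map_mx fst (map_mx (@barEL L) X) = sm X.
  by apply/matrixP=> i j; rewrite !mxE.
have E4 : map_mx snd (map_mx (@barEL L) X) = fm X.
  by apply/matrixP=> i j; rewrite !mxE.
rewrite isom_lieE; split=> h.
  have := congr1 fm h.
  by rewrite /fm map_mxD !map_mxM -map_trmx E1 E3 map_mx0.
apply: pmP; rewrite /fm /sm map_mxD !map_mxM -map_trmx ?E1 ?E2 ?E3 ?E4 map_mx0 //.
by apply: trmx_inj; rewrite trmx0 raddfD /= !trmx_mul trmxK antidiag_tr addrC.
Qed.

Lemma isom_fm_unit g : isom_grp (@barEL L) g -> fm g \in unitmx /\ sm g \in unitmx.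
Proof.
move=> /isom_grpEL h; have uJ : J \in unitmx by case: (mulmx1_unit (antidiag_sq L n)).
have : (fm g)^T *m J *m sm g \in unitmx by rewrite h.
by rewrite !unitmx_mul unitmx_tr => /andP[/andP[-> _] ->].
Qed.

Lemma isom_ext g h : isom_grp (@barEL L) g -> isom_grp (@barEL L) h -> fm g = fm h -> g = h.
Proof.
move=> hg hh E; apply: pmP => //.
have [ug _] := isom_fm_unit hg.
have uJ : J \in unitmx by case: (mulmx1_unit (antidiag_sq L n)).
have u : (fm g)^T *m J \in unitmx by rewrite unitmx_mul unitmx_tr ug.
apply: (can_inj (mulKmx u)).
by move/isom_grpEL: hg => ->; move/isom_grpEL: hh; rewrite -E => ->.
Qed.

Lemma isom_lift (g : 'M[L]_n) : g \in unitmx -> exists2 w, isom_grp (@barEL L) w & fm w = g.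
Proof.
move=> ug; exists (pm g (J *m (invmx g)^T *m J)); last exact: fm_pm.
apply/isom_grpEL; rewrite fm_pm sm_pm !mulmxA -(mulmxA _ J J) antidiag_sq mulmx1.
by rewrite -trmx_mul mulVmx // trmx1 mul1mx.
Qed.

Lemma lie_ext X Y : isom_lie (@barEL L) X -> isom_lie (@barEL L) Y -> fm X = fm Y -> X = Y.
Proof.
move=> /isom_lieEL hX /isom_lieEL hY E; apply: pmP => //.
have uJ : J \in unitmx by case: (mulmx1_unit (antidiag_sq L n)).
apply: (can_inj (mulKmx uJ)); apply: (@addrI _ ((fm X)^T *m J)).
by rewrite hX E hY.
Qed.
End PairMatrix.

(** * Roots and toral invariants *)

(** The expansion of a cocharacter in [cocharacter] is a list, hence not unique; this shows that the
    differential read off from it is. *)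
Lemma laurent0 (L : fieldType) (hinf : forall s : seq L, exists t, t \notin s)
    (r : seq (int * L)) :
  (forall t, t != 0 -> \sum_(e <- r) t ^ e.1 * e.2 = 0) ->
  \sum_(e <- r) e.2 *~ e.1 = 0.
Proof.
move=> hr; pose K := (\sum_(e <- r) `|e.1|)%N.
have hK e : e \in r -> 0 <= e.1 + K%:Z.
  move=> er; have : (`|e.1| <= K)%N.
    by rewrite /K (perm_big _ (perm_to_rem er)) big_cons leq_addr.
  by lia.
pose P : {poly L} := \sum_(e <- r) e.2 *: 'X^(`|e.1 + K%:Z|).
have Pt t : t != 0 -> P.[t] = 0.
  move=> t0; rewrite horner_sum; apply: (@mulIf _ (t ^ (- K%:Z))); first by rewrite expfz_neq0.
  rewrite mul0r mulr_suml -[RHS](hr t t0) big_seq [RHS]big_seq; apply: eq_bigr => e er.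
  rewrite hornerZ hornerXn -mulrA mulrC; congr (_ * _).
  by rewrite exprnP gez0_abs ?hK // -expfzDr // addrK.
have P0 : P = 0.
  apply/eqP; apply: contraT => n0.
  have long m : exists s : seq L, [/\ uniq s, size s = m & 0 \notin s].
    elim: m => [|m [s [us ss s0]]]; first by exists [::].
    have [t] := hinf (0 :: s); rewrite inE negb_or => /andP[t0 ts].
    by exists (t :: s); rewrite /= ts us ss inE negb_or eq_sym t0 s0.
  have [s [us ss s0]] := long (size P).
  have := max_poly_roots n0 _ us; rewrite ss ltnn => -> //.
  apply/allP => t ts; apply/eqP/Pt; apply: contraNneq s0 => <- //.
(* Multiplying by t^K to clear negative exponents adds K times this sum to the derivative at 1. *)
have P1 : \sum_(e <- r) e.2 = 0.
  have := congr1 (fun p => p.[1]) P0; rewrite horner0 horner_sum => E1.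
  by rewrite -[RHS]E1; apply: eq_bigr => e _; rewrite hornerZ hornerXn expr1n mulr1.
have := congr1 (fun p => p^`().[1]) P0; rewrite deriv0 horner0 (raddf_sum (@deriv L)) horner_sum.
have -> : \sum_(e <- r) (deriv (e.2 *: 'X^(`|e.1 + K%:Z|))).[1] =
    \sum_(e <- r) (e.2 *~ e.1 + e.2 *+ K).
  rewrite big_seq [RHS]big_seq; apply: eq_bigr => e er.
  by rewrite derivZ derivXn hornerZ hornerMn hornerXn expr1n mulr_natr pmulrn gez0_abs ?hK // mulrzDr.
by rewrite big_split /= sumrMnl P1 mul0rn addr0.
Qed.

Section Roots.
Variables (F : fieldType) (E : fieldExtType F) (bar : {lrmorphism E -> E}).
Variables (L : fieldType) (iota : {rmorphism E -> L}) (n : nat).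
Hypothesis barK : forall e, bar (bar e) = e.
Hypothesis iota_bar : ~ (forall e, iota (bar e) = iota e).
Hypothesis hinf : forall s : seq L, exists t, t \notin s.
Variables (T : 'M[E]_n) (W W2 : 'M[L]_n) (h y : 'rV[L]_n) (pi : 'S_n).
Local Notation EL := (L * L)%type.
Local Notation J := (antidiag L n).
Hypothesis hT : isom_lie bar T.
Hypothesis hW : W^T *m J *m W2 = diag_mx h.
Hypothesis h0 : forall c, h 0 c != 0.
Hypothesis hy : map_mx iota T *m W = W *m diag_mx y.
Hypothesis y_inj : forall c d, y 0 c = y 0 d -> c = d.

(** The flag [b] says whether [s] conjugates [E]; in that case it exchanges the eigenbasis [W] with
    its conjugate [W2], besides permuting the vectors. *)
Definition gact (s : L -> L) (r : nat) (b : bool) : Prop :=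
  (forall e, s (iota e) = iota (if b then bar e else e)) /\
  forall i c, s (W i c) = (if b then W2 else W) i ((pi ^+ r)%g c) /\
              s (W2 i c) = (if b then W else W2) i ((pi ^+ r)%g c).

Hypothesis hgal : forall s : {rmorphism L -> L}, Defs.Gal iota s -> exists r b, gact s r b.
Hypothesis hext : forall r b, exists2 s : {rmorphism L -> L}, Defs.Gal iota s & gact s r b.

Local Notation T1 := (map_mx iota T).
Local Notation T2 := (map_mx (iota \o bar) T).
Local Notation torus := (torusL bar iota T).

Lemma unitJ : J \in unitmx.
Proof. by case: (mulmx1_unit (antidiag_sq L n)). Qed.

Lemma unith : diag_mx h \in unitmx.
Proof. by rewrite unitmxE det_diag unitfE; apply/prodf_neq0 => c _. Qed.

Lemma unitW : W \in unitmx /\ W2 \in unitmx.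
Proof.
have := unith; rewrite -hW !unitmx_mul unitmx_tr => /andP[/andP[-> _] ->] //.
Qed.

Lemma unitWJ : W^T *m J \in unitmx.
Proof. by rewrite unitmx_mul unitmx_tr unitW.1 unitJ. Qed.

Lemma fmT : fm (map_mx (toEL bar iota) T) = T1.
Proof. by apply/matrixP=> i j; rewrite !mxE. Qed.

Lemma smT : sm (map_mx (toEL bar iota) T) = T2.
Proof. by apply/matrixP=> i j; rewrite !mxE. Qed.

Lemma lieT : T1^T *m J + J *m T2 = 0.
Proof.
move/isom_lieE: hT => /(congr1 (map_mx iota)); rewrite map_mx0 map_mxD !map_mxM.
have -> : map_mx iota (antidiag E n) = J.
  by apply/matrixP=> i j; rewrite !mxE rmorph_nat.
by rewrite -map_trmx -map_mx_comp.
Qed.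

Lemma diagC (d e : 'rV[L]_n) : diag_mx d *m diag_mx e = diag_mx e *m diag_mx d.
Proof. by rewrite !mulmx_diag; congr diag_mx; apply/rowP=> j; rewrite !mxE mulrC. Qed.

(** [W2] is dual to [W] up to the units [h], and [T] is skew-adjoint. *)
Lemma T2W2 : T2 *m W2 = - (W2 *m diag_mx y).
Proof.
apply: (can_inj (mulKmx unitWJ)).
have E1 : J *m T2 = - (T1^T *m J) by apply/eqP; rewrite -addr_eq0 addrC lieT.
have E2 : W^T *m J *m T2 = - (diag_mx y *m W^T *m J).
  by rewrite -mulmxA E1 mulmxN mulmxA -trmx_mul hy trmx_mul tr_diag_mx.
rewrite mulmxA E2 mulNmx mulmxN mulmxA hW; congr (- _).
by rewrite -!mulmxA (mulmxA W^T) hW diagC.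
Qed.

Definition vinv (x : 'rV[L]_n) : 'rV[L]_n := map_mx GRing.inv x.

Lemma vinvM (x : 'rV[L]_n) : (forall c, x 0 c != 0) -> diag_mx x *m diag_mx (vinv x) = 1%:M.
Proof.
move=> x0; rewrite mulmx_diag -diag_const_mx; congr diag_mx.
by apply/rowP=> j; rewrite !mxE mulfV.
Qed.

Lemma comm_diag (D : 'M[L]_n) : D *m diag_mx y = diag_mx y *m D ->
  D = diag_mx (\row_c D c c).
Proof.
move=> hD; apply/matrixP=> i j; rewrite !mxE; have [->|ne] := eqVneq i j; first by rewrite mulr1n.
have /matrixP/(_ i j) := hD; rewrite mul_mx_diag mul_diag_mx !mxE mulrC => /eqP.
rewrite -subr_eq0 -mulrBl mulf_eq0 subr_eq0 mulr0n => /orP[/eqP/y_inj E1|/eqP //].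
by rewrite E1 eqxx in ne.
Qed.

Lemma isom_sm (s : 'M[EL]_n) (x : 'rV[L]_n) : isom_grp (@barEL L) s -> (forall c, x 0 c != 0) ->
  fm s *m W = W *m diag_mx x -> sm s *m W2 = W2 *m diag_mx (vinv x).
Proof.
move=> /isom_grpEL hs x0 hx; apply: (can_inj (mulKmx unitWJ)).
have ux : diag_mx x \in unitmx by have [] := mulmx1_unit (vinvM x0).
apply: (can_inj (mulKmx ux)).
have -> : diag_mx x *m (W^T *m J *m (sm s *m W2)) = W^T *m ((fm s)^T *m J *m sm s) *m W2.
  by rewrite !mulmxA -[W^T *m (fm s)^T]trmx_mul hx trmx_mul tr_diag_mx.
rewrite hs hW (mulmxA (W^T *m J)) hW mulmxA diagC.
by rewrite -mulmxA vinvM // mulmx1.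
Qed.

(** The eigenvalues [y] being distinct, commuting with [T] means being diagonal in the basis [W];
    unitarity then gives the inverse on the dual basis. *)
Lemma torusP s : torus s -> exists x : 'rV[L]_n, [/\ forall c, x 0 c != 0,
  fm s *m W = W *m diag_mx x & sm s *m W2 = W2 *m diag_mx (vinv x)].
Proof.
move=> [hs hc]; have [uW uW2] := unitW.
have c1 : fm s *m T1 = T1 *m fm s by have := congr1 (@fm L n) hc; rewrite !fmM fmT.
pose D := invmx W *m fm s *m W.
have hD : D *m diag_mx y = diag_mx y *m D.
  have yE : diag_mx y = invmx W *m T1 *m W by rewrite -mulmxA hy mulKmx.
  by rewrite {2}yE /D -!mulmxA -hy mulKVmx // (mulmxA T1) -c1 -mulmxA.
have ED := comm_diag hD.
have E1 : fm s *m W = W *m diag_mx (\row_c D c c) by rewrite -ED /D -mulmxA mulKVmx.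
have x0 c : (\row_c D c c) 0 c != 0.
  have uD : D \in unitmx by rewrite /D !unitmx_mul unitmx_inv uW (isom_fm_unit hs).1.
  have := congr1 determinant ED; rewrite det_diag => detD.
  by move: uD; rewrite unitmxE detD unitfE => /prodf_neq0/(_ c isT).
by exists (\row_c D c c); split=> //; apply: isom_sm.
Qed.

Lemma torus_mk (x : 'rV[L]_n) : (forall c, x 0 c != 0) ->
  exists2 s, torus s & fm s *m W = W *m diag_mx x.
Proof.
move=> x0; have [uW uW2] := unitW.
have ux : diag_mx x \in unitmx by have [] := mulmx1_unit (vinvM x0).
have ug : W *m diag_mx x *m invmx W \in unitmx by rewrite !unitmx_mul uW ux unitmx_inv.
have [s hs fs] := isom_lift ug.
have E1 : fm s *m W = W *m diag_mx x by rewrite fs mulmxKV.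
exists s => //; split=> //; have E2 := isom_sm hs x0 E1.
apply: pmP; rewrite ?fmM ?smM ?fmT ?smT.
  apply: (can_inj (mulmxK uW)); rewrite -!mulmxA hy E1 (mulmxA (fm s)) E1 mulmxA hy.
  by rewrite -!mulmxA diagC.
apply: (can_inj (mulmxK uW2)); rewrite -!mulmxA T2W2 E2 mulmxN (mulmxA (sm s)) E2 mulmxA T2W2.
by rewrite mulNmx -!mulmxA diagC.
Qed.

Definition chi (c : 'I_n) (s : 'M[EL]_n) : L := (invmx W *m fm s *m W) c c.

Lemma chiE c s (x : 'rV[L]_n) : fm s *m W = W *m diag_mx x -> chi c s = x 0 c.
Proof. by move=> E1; rewrite /chi -mulmxA E1 mulKmx ?unitW.1 // !mxE eqxx mulr1n. Qed.

Lemma chi_fm s : torus s -> fm s *m W = W *m diag_mx (\row_c chi c s) /\ forall c, chi c s != 0.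
Proof.
move=> /torusP[x [x0 E1 _]]; have Ex : \row_c chi c s = x.
  by apply/rowP=> c; rewrite mxE (chiE c E1).
by rewrite Ex; split=> // c; rewrite (chiE c E1).
Qed.

(** The value 0 outside S(L) follows the convention of [is_root], so that roots can be equal as
    functions. *)
Definition al (a b : 'I_n) (s : 'M[EL]_n) : L :=
  if `[< torus s >] then chi a s / chi b s else 0.

Lemma alE a b s (x : 'rV[L]_n) : torus s -> fm s *m W = W *m diag_mx x -> al a b s = x 0 a / x 0 b.
Proof. by move=> ts E1; rewrite /al; case: asboolP => // _; rewrite !(chiE _ E1). Qed.

(** A torus element with the single entry [t] different from 1 then separates the characters
    [al a b]. *)
Lemma exists_t : exists t : L, [/\ t != 0, t != 1 & t ^+ 2 != 1].
Proof.
have [t] := hinf [:: 0; 1; -1]; rewrite !inE !negb_or => /and3P[t0 t1 t2].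
by exists t; split=> //; rewrite sqrf_eq1 negb_or t1.
Qed.

Definition vone (c : 'I_n) (t : L) : 'rV[L]_n := \row_j if j == c then t else 1.

Lemma vone_neq0 c t : t != 0 -> forall j, vone c t 0 j != 0.
Proof. by move=> t0 j; rewrite mxE; case: ifP => // _; apply: oner_neq0. Qed.

Lemma al_inj a b a' b' : a != b -> al a b = al a' b' -> a = a' /\ b = b'.
Proof.
move=> ab E1; have [t [t0 t1 t2]] := exists_t.
have key c : (if a == c then t else 1) / (if b == c then t else 1) =
    (if a' == c then t else 1) / (if b' == c then t else 1).
  have [s ts Es] := torus_mk (vone_neq0 c t0).
  by have := congr1 (fun f => f s) E1; rewrite !(alE _ _ ts Es) !mxE.
have tn : t != t^-1.
  by apply: contra_neq t2 => Et; rewrite expr2 {1}Et mulVf.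
split; apply/eqP; apply: contraT => ne.
  have := key a; rewrite eqxx (eq_sym b) (negbTE ab) (eq_sym a') (negbTE ne) divr1 div1r.
  case: (b' == a) => /eqP; first by rewrite (negbTE tn).
  by rewrite invr1 (negbTE t1).
have := key b; rewrite eqxx (negbTE ab) (eq_sym b') (negbTE ne) divr1 div1r.
case: (a' == b) => /eqP; first by rewrite eq_sym (negbTE tn).
by rewrite -[1]invr1 (inj_eq invr_inj) (negbTE t1).
Qed.

(** The use of [W2^T J] in place of the inverse of [W] makes Galois permute these vectors up to
    sign, so they are defined over F_alpha; the price is the factor [h 0 b] in [X_W]. The second
    component is forced by [isom_lie]. *)
Definition X_ (a b : 'I_n) : 'M[EL]_n :=
  pm (W *m delta_mx a b *m W2^T *m J) (- (W2 *m delta_mx b a *m W^T *m J)).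

Lemma hW' : W2^T *m J *m W = diag_mx h.
Proof. by apply: trmx_inj; rewrite tr_diag_mx -hW !trmx_mul trmxK antidiag_tr mulmxA. Qed.

Lemma X_W a b : fm (X_ a b) *m W = h 0 b *: (W *m delta_mx a b).
Proof.
rewrite fm_pm -!mulmxA (mulmxA W2^T) hW' scalemxAr; congr (_ *m _).
apply/matrixP=> i j; rewrite mul_mx_diag !mxE mulrC.
by case: (j =P b) => [->|]; rewrite ?andbF ?mulr0.
Qed.

Lemma X_neq0 a b : X_ a b != 0.
Proof.
apply/eqP => E0; have := X_W a b; rewrite E0 fm0 mul0mx => /esym/eqP.
rewrite scaler_eq0 (negbTE (h0 b)) /= => /eqP E1.
have := congr1 (mulmx (invmx W)) E1; rewrite mulKmx ?unitW.1 // mulmx0.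
by move=> /matrixP/(_ a b)/eqP; rewrite !mxE !eqxx oner_eq0.
Qed.

Lemma X_lie a b : isom_lie (@barEL L) (X_ a b).
Proof.
apply/isom_lieEL; rewrite fm_pm sm_pm !trmx_mul trmxK antidiag_tr trmx_delta mulmxN.
by rewrite !mulmxA subrr.
Qed.

Lemma scaleL_lie u (X : 'M[EL]_n) : isom_lie (@barEL L) X -> isom_lie (@barEL L) (scaleL u X).
Proof.
move/isom_lieEL => hX; apply/isom_lieEL; rewrite fm_scale sm_scale.
by rewrite linearZ /= -scalemxAl -scalemxAr -scalerDr hX scaler0.
Qed.

Lemma diag_delta (x : 'rV[L]_n) (a b : 'I_n) : diag_mx x *m delta_mx a b = x 0 a *: delta_mx a b.
Proof.
apply/matrixP=> i j; rewrite mul_diag_mx !mxE.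
by case: (i =P a) => [->|]; rewrite ?mulr0.
Qed.

Lemma delta_diag (x : 'rV[L]_n) (a b : 'I_n) : delta_mx a b *m diag_mx x = x 0 b *: delta_mx a b.
Proof. by apply: trmx_inj; rewrite trmx_mul tr_diag_mx linearZ /= !trmx_delta diag_delta. Qed.

Lemma torus_left (s : 'M[EL]_n) (x : 'rV[L]_n) : fm s *m W = W *m diag_mx x ->
  W2^T *m J *m fm s = diag_mx x *m (W2^T *m J).
Proof.
move=> E1; apply: (can_inj (mulmxK unitW.1)).
by rewrite -(mulmxA _ (fm s)) E1 mulmxA hW' -[RHS]mulmxA hW' diagC.
Qed.

Lemma torus_left2 (s : 'M[EL]_n) (x : 'rV[L]_n) : sm s *m W2 = W2 *m diag_mx x ->
  W^T *m J *m sm s = diag_mx x *m (W^T *m J).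
Proof.
move=> E1; apply: (can_inj (mulmxK unitW.2)).
by rewrite -(mulmxA _ (sm s)) E1 mulmxA hW -[RHS]mulmxA hW diagC.
Qed.

Lemma root_space_X a b : root_space bar iota T (al a b) (X_ a b).
Proof.
split; first exact: X_lie.
move=> s ts; have [x [x0 E1 E2]] := torusP ts; rewrite (alE _ _ ts E1).
apply: pmP; rewrite ?fm_scale ?sm_scale ?fmM ?smM ?fm_pm ?sm_pm.
  rewrite -[in RHS]mulmxA -[in RHS]mulmxA (mulmxA W2^T) (torus_left E1) !mulmxA E1.
  rewrite -!mulmxA (mulmxA (diag_mx x)) diag_delta (mulmxA (delta_mx a b) (diag_mx x)) delta_diag.
  by rewrite -!scalemxAl -!scalemxAr scalerA divfK.
rewrite mulmxN mulNmx scalerN; congr (- _).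
have -> : W2 *m delta_mx b a *m W^T *m J *m sm s = W2 *m delta_mx b a *m (W^T *m J *m sm s).
  by rewrite !mulmxA.
rewrite (torus_left2 E2) !mulmxA E2.
rewrite -!mulmxA (mulmxA (diag_mx _) (delta_mx b a)) diag_delta (mulmxA (delta_mx b a) (diag_mx _)) delta_diag.
by rewrite -!scalemxAl -!scalemxAr scalerA !mxE mulrAC mulfV // mul1r.
Qed.

Lemma root_spaceE alpha X s (x : 'rV[L]_n) i j : root_space bar iota T alpha X -> torus s ->
  fm s *m W = W *m diag_mx x ->
  x 0 i * (invmx W *m fm X *m W) i j = alpha s * ((invmx W *m fm X *m W) i j * x 0 j).
Proof.
move=> [_ hX] ts E1; have uW := unitW.1.
have := congr1 (@fm L n) (hX s ts); rewrite fm_scale !fmM => E2.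
have E3 : diag_mx x *m (invmx W *m fm X *m W) =
    alpha s *: ((invmx W *m fm X *m W) *m diag_mx x).
  have -> : diag_mx x = invmx W *m fm s *m W by rewrite -mulmxA E1 mulKmx.
  by rewrite -!mulmxA !mulKVmx // (mulmxA (fm s)) E2 -!scalemxAl -!scalemxAr -!mulmxA.
move: (invmx W *m fm X *m W) E3 => D /matrixP/(_ i j).
by rewrite mul_diag_mx mul_mx_diag !mxE.
Qed.

Lemma fm_lie_neq0 (X : 'M[EL]_n) : isom_lie (@barEL L) X -> X != 0 ->
  exists i j, (invmx W *m fm X *m W) i j != 0.
Proof.
move=> lX X0; apply: contrapT => /forallNP H.
have D0 : invmx W *m fm X *m W = 0.
  apply/matrixP=> i j; rewrite [RHS]mxE; apply/eqP; apply: contraT => n0.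
  by have /forallNP/(_ j) := H i.
case/negP: X0; apply/eqP; apply: lie_ext => //.
  by apply/isom_lieEL; rewrite fm0 sm0 trmx0 mul0mx mulmx0 addr0.
rewrite fm0; have uW := unitW.1; apply: (can_inj (mulmxK uW)).
by rewrite mul0mx -[LHS](mulKVmx uW) (mulmxA (invmx W)) D0 mulmx0.
Qed.

(** Written in the basis [W], a weight vector has a nonzero entry (i, j), on which the torus acts
    through [al i j]. *)
Lemma is_rootP alpha : is_root bar iota T alpha -> exists a b, a != b /\ alpha = al a b.
Proof.
move=> [off [s0 ts0 as0] [X X0 rX]]; have [i [j Dij]] := fm_lie_neq0 rX.1 X0.
have E1 s : torus s -> alpha s = al i j s.
  move=> ts; have [x [x0 Es _]] := torusP ts.
  rewrite (alE _ _ ts Es); apply: (mulIf (x0 j)); rewrite divfK //.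
  apply: (mulIf Dij); rewrite (root_spaceE i j rX ts Es).
  by rewrite -mulrA [in RHS](mulrC _ (x 0 j)).
exists i, j; split.
  apply: contraNneq as0 => ij; rewrite E1 // ij; have [x [x0 Es _]] := torusP ts0.
  by rewrite (alE _ _ ts0 Es) divff.
apply: funext => s; case: (pselect (torus s)) => [/E1//|nt].
by rewrite off // /al; case: asboolP.
Qed.

Lemma is_root_al a b : a != b -> is_root bar iota T (al a b).
Proof.
move=> ab; have [t [t0 t1 t2]] := exists_t; split.
- by move=> s nt; rewrite /al; case: asboolP.
- have [s ts Es] := torus_mk (vone_neq0 a t0); exists s => //.
  by rewrite (alE _ _ ts Es) !mxE eqxx (eq_sym b) (negbTE ab) divr1.
- by exists (X_ a b); [apply: X_neq0|apply: root_space_X].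
Qed.

Lemma cross_ratio (xi xj xa xb d : L) : xb != 0 -> d != 0 ->
  xi * d = xa / xb * (d * xj) -> xi * xb = xa * xj.
Proof.
move=> b0 d0 E1; apply: (mulIf d0); rewrite mulrAC E1 mulrAC divfK //.
by rewrite -!mulrA (mulrC d).
Qed.

(** An entry away from (a, b) belongs to another weight, as the elements [vone a t] and [vone b t]
    show. *)
Lemma root_space_al a b X : a != b -> root_space bar iota T (al a b) X ->
  exists u, X = scaleL u (X_ a b).
Proof.
move=> ab rX; have [t [t0 t1 t2]] := exists_t; have uW := unitW.1.
pose D := invmx W *m fm X *m W.
have D0 i j : (i, j) != (a, b) -> D i j = 0.
  move=> ne; apply/eqP; apply: contraT => Dij.
  have key c : (if i == c then t else 1) * (if b == c then t else 1) =
      (if a == c then t else 1) * (if j == c then t else 1).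
    have [s ts Es] := torus_mk (vone_neq0 c t0).
    have := root_spaceE i j rX ts Es; rewrite -/D (alE _ _ ts Es) => E1.
    have := cross_ratio (vone_neq0 c t0 b) Dij E1.
    by rewrite !mxE.
  have [ia|ia] := eqVneq i a.
    have jb : b != j by apply: contraNneq ne => bj; rewrite ia bj.
    have := key b; rewrite ia eqxx (eq_sym j) (negbTE jb) (negbTE ab) mul1r mulr1 => /eqP.
    by rewrite (negbTE t1).
  have := key a; rewrite (negbTE ia) eqxx (eq_sym b) (negbTE ab) mulr1 => /esym/eqP.
  by case: (j == a); rewrite -?expr2 ?(negbTE t2) // mulr1 (negbTE t1).
exists (D a b / h 0 b); apply: lie_ext; [exact: rX.1|exact/scaleL_lie/X_lie|].
apply: (can_inj (mulmxK uW)); rewrite fm_scale -scalemxAl X_W scalerA divfK //.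
rewrite -[LHS](mulKVmx uW) (mulmxA (invmx W)) -/D scalemxAr; congr (_ *m _).
clearbody D; apply/matrixP=> i j; rewrite !mxE.
have [->|ia] := eqVneq i a; last by rewrite mulr0 D0 //; apply: contra_neq ia => -[].
have [->|jb] := eqVneq j b; first by rewrite mulr1.
by rewrite mulr0 D0 //; apply: contra_neq jb => -[].
Qed.

Local Notation gal := (gal_mx iota).

Lemma gal_comp (s : L -> L) r f (X : 'M[EL]_n) : gact s r f ->
  fm (gal s X) = map_mx s (if f then sm X else fm X) /\
  sm (gal s X) = map_mx s (if f then fm X else sm X).
Proof.
move=> [sE _]; have galE x : galEL iota s x = if f then (s x.2, s x.1) else (s x.1, s x.2).
  rewrite /galEL; case: asboolP; case: f sE => sE h1 //.
  by case: iota_bar => e; rewrite -sE h1.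
by split; apply/matrixP=> i j; rewrite !mxE galE; case: f {sE galE}; rewrite !mxE.
Qed.

Lemma gact_T (s : L -> L) r f : gact s r f ->
  map_mx s T1 = (if f then T2 else T1) /\ map_mx s T2 = (if f then T1 else T2).
Proof.
move=> [sE _]; split; apply/matrixP=> i j; rewrite !mxE /= sE; case: f {sE}; rewrite !mxE //=.
by rewrite barK.
Qed.

Lemma torusE X : torus X <-> [/\ (fm X)^T *m J *m sm X = J, fm X *m T1 = T1 *m fm X
  & sm X *m T2 = T2 *m sm X].
Proof.
split=> [[/isom_grpEL h1 h2]|[h1 h2 h3]].
  by split=> //; [have := congr1 (@fm L n) h2|have := congr1 (@sm L n) h2];
    rewrite ?fmM ?smM ?fmT ?smT.
split; first exact/isom_grpEL.
by apply: pmP; rewrite ?fmM ?smM ?fmT ?smT.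
Qed.

Lemma map_J (s : {rmorphism L -> L}) : map_mx s J = J.
Proof. by apply/matrixP=> i j; rewrite !mxE rmorph_nat. Qed.

Lemma gal_torus (s : {rmorphism L -> L}) r f X : gact s r f -> torus (gal s X) <-> torus X.
Proof.
move=> gs; have [g1 g2] := gal_comp X gs; have [t1 t2] := gact_T gs.
have inj (A B : 'M[L]_n) : map_mx s A = map_mx s B <-> A = B.
  by split=> [/map_mx_inj|->].
have trJ (A B : 'M[L]_n) : A^T *m J *m B = J <-> B^T *m J *m A = J.
  by split=> E1; apply: trmx_inj; rewrite !trmx_mul trmxK antidiag_tr mulmxA.
have c1 (A B : 'M[L]_n) :
    map_mx s A *m map_mx s B = map_mx s B *m map_mx s A <-> A *m B = B *m A.
  by rewrite -!map_mxM; apply: inj.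
have j1 (A B : 'M[L]_n) : (map_mx s A)^T *m J *m map_mx s B = J <-> A^T *m J *m B = J.
  by rewrite -{1 2}(map_J s) map_trmx -!map_mxM; apply: inj.
rewrite !torusE g1 g2; case: f gs g1 g2 t1 t2 => gs g1 g2 t1 t2.
  have k1 A : map_mx s A *m T1 = T1 *m map_mx s A <-> A *m T2 = T2 *m A by rewrite -t2; apply: c1.
  have k2 A : map_mx s A *m T2 = T2 *m map_mx s A <-> A *m T1 = T1 *m A by rewrite -t1; apply: c1.
  split=> -[a1 a2 a3]; split.
  - exact/trJ/j1.
  - exact/k2.
  - exact/k1.
  - exact/j1/trJ.
  - exact/k1.
  - exact/k2.
have k1 A : map_mx s A *m T1 = T1 *m map_mx s A <-> A *m T1 = T1 *m A by rewrite -{1 2}t1; apply: c1.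
have k2 A : map_mx s A *m T2 = T2 *m map_mx s A <-> A *m T2 = T2 *m A by rewrite -{1 2}t2; apply: c1.
split=> -[a1 a2 a3]; split.
- exact/j1.
- exact/k1.
- exact/k2.
- exact/j1.
- exact/k1.
- exact/k2.
Qed.

(** When [s] conjugates [E], the second component takes the place of the first, and its eigenvalues
    are the inverses. *)
Lemma gal_ev (s : {rmorphism L -> L}) r f X (x : 'rV[L]_n) : gact s r f -> torus X ->
  fm X *m W = W *m diag_mx x -> forall c,
  chi ((pi ^+ r)%g c) (gal s X) = s (if f then (x 0 c)^-1 else x 0 c).
Proof.
move=> gs tX Ex c; set p := (pi ^+ r)%g.
have [x' [x'0 Ex' Ex2]] := torusP tX.
have xx' : x' = x by apply/rowP=> d; rewrite -(chiE d Ex') (chiE d Ex).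
rewrite {}xx' {x'} in x'0 Ex' Ex2.
have [g1 _] := gal_comp X gs; have [_ sW] := gs.
pose z : 'rV[L]_n := \row_d s (if f then (x 0 ((p^-1)%g d))^-1 else x 0 ((p^-1)%g d)).
have Ez : fm (gal s X) *m W = W *m diag_mx z.
  rewrite g1; apply/matrixP=> i d; rewrite mul_mx_diag !mxE.
  have Wd j : W j d = s ((if f then W2 else W) j ((p^-1)%g d)).
    by case: f gs sW {z g1} => gs sW; have [h1 h2] := sW j ((p^-1)%g d);
      rewrite ?h1 ?h2 permKV.
  transitivity (\sum_j s ((if f then sm X else fm X) i j * (if f then W2 else W) j ((p^-1)%g d))).
    by apply: eq_bigr => j _; rewrite mxE Wd rmorphM.
  rewrite -rmorph_sum Wd -rmorphM; congr (s _).
  case: f gs sW {g1 z Wd} => gs sW.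
    by have /matrixP/(_ i ((p^-1)%g d)) := Ex2; rewrite mul_mx_diag !mxE.
  by have /matrixP/(_ i ((p^-1)%g d)) := Ex; rewrite mul_mx_diag !mxE.
by rewrite (chiE _ Ez) mxE permK.
Qed.

(** The Galois image of [al a b]; conjugating [E] inverts characters, hence the exchange of the two
    indices. *)
Definition twist (r : nat) (f : bool) (a b : 'I_n) : 'M[EL]_n -> L :=
  if f then al ((pi ^+ r)%g b) ((pi ^+ r)%g a) else al ((pi ^+ r)%g a) ((pi ^+ r)%g b).

Lemma al_gal (s : {rmorphism L -> L}) r f a b X : gact s r f ->
  twist r f a b (gal s X) = s (al a b X).
Proof.
move=> gs; case: (pselect (torus X)) => tX; last first.
  have ntg : ~ torus (gal s X) by move/(gal_torus X gs).
  by rewrite /twist; case: (f); rewrite /al; case: asboolP => // _; case: asboolP; rewrite ?rmorph0.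
have tg : torus (gal s X) by apply/(gal_torus X gs).
have [x [x0 Ex _]] := torusP tX.
rewrite (alE _ _ tX Ex) /twist; case: f gs => gs; rewrite /al; case: asboolP => // _.
  by rewrite !(gal_ev gs tX Ex) !fmorphV invrK mulrC fmorph_div.
by rewrite !(gal_ev gs tX Ex) fmorph_div.
Qed.

Lemma gal_surj (s : {rmorphism L -> L}) r f : gact s r f -> bijective s ->
  forall Y : 'M[EL]_n, exists X, gal s X = Y.
Proof.
move=> gs [g sK gK] Y.
exists (if f then pm (map_mx g (sm Y)) (map_mx g (fm Y)) else pm (map_mx g (fm Y)) (map_mx g (sm Y))).
by apply: pmP; [rewrite (gal_comp _ gs).1|rewrite (gal_comp _ gs).2];
  case: (f); rewrite ?fm_pm ?sm_pm -map_mx_comp; apply/matrixP=> i j; rewrite mxE /= gK.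
Qed.

Lemma gal_rootE (s : {rmorphism L -> L}) r f a b beta : gact s r f -> bijective s ->
  gal_root iota s (al a b) beta <-> beta = twist r f a b.
Proof.
move=> gs bs; split=> [hb|-> X]; last exact: al_gal.
apply: funext => Y; have [X <-] := gal_surj gs bs Y.
by rewrite hb -(al_gal _ _ _ gs).
Qed.

Lemma gal_orbitE a b beta : gal_orbit iota (al a b) beta <-> exists r f, beta = twist r f a b.
Proof.
split=> [[s Gs hb]|[r [f ->]]].
  by have [r [f gs]] := hgal Gs; exists r, f; apply: (gal_rootE a b beta gs Gs.1).1.
by have [s Gs gs] := hext r f; exists s => //; apply: (gal_rootE a b _ gs Gs.1).2.
Qed.

Lemma rootN_al a b : Defs.rootN (al a b) = al b a.
Proof.
apply: funext => s; rewrite /Defs.rootN /al; case: asboolP => _; last by rewrite invr0.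
by rewrite invfM invrK mulrC.
Qed.

Lemma outerE (A B : 'M[L]_n) (a b : 'I_n) :
  A *m delta_mx a b *m B^T = col a A *m (col b B)^T.
Proof.
have -> : delta_mx a b = delta_mx a (0 : 'I_1) *m delta_mx (0 : 'I_1) b :> 'M[L]_n.
  by rewrite mul_delta_mx.
by rewrite mulmxA -colE -mulmxA -rowE tr_col.
Qed.

(** The sign is that of the second component of [X_]; it is the origin of the minus sign in - h_a
    h_b. *)
Lemma gal_X (s : {rmorphism L -> L}) r f a b : gact s r f -> gal s (X_ a b) =
  if f then scaleL (-1) (X_ ((pi ^+ r)%g b) ((pi ^+ r)%g a))
  else X_ ((pi ^+ r)%g a) ((pi ^+ r)%g b).
Proof.
move=> gs; have [_ sW] := gs; set p := (pi ^+ r)%g.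
have sW1 c : map_mx s (col c W) = col (p c) (if f then W2 else W).
  by apply/matrixP=> i j; rewrite !mxE; have [-> _] := sW i c.
have sW2 c : map_mx s (col c W2) = col (p c) (if f then W else W2).
  by apply/matrixP=> i j; rewrite !mxE; have [_ ->] := sW i c.
have [g1 g2] := gal_comp (X_ a b) gs.
have e1 : map_mx s (W *m delta_mx a b *m W2^T *m J) =
    col (p a) (if f then W2 else W) *m (col (p b) (if f then W else W2))^T *m J.
  by rewrite outerE !map_mxM map_J -map_trmx sW1 sW2.
have e2 : map_mx s (- (W2 *m delta_mx b a *m W^T *m J)) =
    - (col (p b) (if f then W else W2) *m (col (p a) (if f then W2 else W))^T *m J).
  by rewrite map_mxN outerE !map_mxM map_J -map_trmx sW1 sW2.
apply: pmP; rewrite ?g1 ?g2; case: f gs sW sW1 sW2 g1 g2 e1 e2 => _ _ _ _ _ _ e1 e2;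
  rewrite ?fm_scale ?sm_scale /X_ ?fm_pm ?sm_pm ?e1 ?e2 -?outerE ?scaleN1r ?opprK //.
Qed.

(** Under this condition stabilizing the root forces trivial action on [E], and negating it forces
    conjugation ([stabP], [flipP]). *)
Definition noswap (a b : 'I_n) := forall r, ~ ((pi ^+ r)%g a = b /\ (pi ^+ r)%g b = a).

Lemma stabP a b (s : {rmorphism L -> L}) : a != b -> noswap a b -> Defs.stab iota (al a b) s ->
  exists r, [/\ gact s r false, (pi ^+ r)%g a = a & (pi ^+ r)%g b = b].
Proof.
move=> ab ns [Gs hs]; have [r [f gs]] := hgal Gs; exists r.
have := (gal_rootE a b (al a b) gs Gs.1).1 hs; case: f gs => gs /(al_inj ab)[E1 E2] //.
by case: (ns r).
Qed.

Lemma flipP a b (s : {rmorphism L -> L}) : a != b -> noswap a b -> Defs.flip iota (al a b) s ->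
  exists r, [/\ gact s r true, (pi ^+ r)%g a = a & (pi ^+ r)%g b = b].
Proof.
move=> ab ns [Gs]; rewrite rootN_al => hs; have [r [f gs]] := hgal Gs; exists r.
have ba : b != a by rewrite eq_sym.
have := (gal_rootE a b (al b a) gs Gs.1).1 hs; case: f gs => gs /(al_inj ba)[E1 E2] //.
by case: (ns r).
Qed.

Lemma flip_exists a b : exists s : {rmorphism L -> L}, Defs.flip iota (al a b) s.
Proof.
have [s Gs gs] := hext 0 true; exists s; split=> //; rewrite rootN_al.
by apply/(gal_rootE a b _ gs Gs.1); rewrite /twist expg0 !perm1.
Qed.

(** Differential of the coroot: through first components it is e_a - e_b on the diagonal torus. *)
Definition Hd (a b : 'I_n) : 'M[EL]_n :=
  pm (W *m (delta_mx a a - delta_mx b b) *m invmx W)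
     (- (W2 *m (delta_mx a a - delta_mx b b) *m invmx W2)).

Lemma Hd_W a b : fm (Hd a b) *m W = W *m (delta_mx a a - delta_mx b b).
Proof. by rewrite fm_pm mulmxKV ?unitW.1. Qed.

Lemma Hd_neq0 a b : a != b -> fm (Hd a b) != 0.
Proof.
move=> ab; apply/eqP => E0; have := Hd_W a b; rewrite E0 mul0mx => /esym E1.
have := congr1 (mulmx (invmx W)) E1; rewrite mulKmx ?unitW.1 // mulmx0.
move=> /matrixP/(_ a a)/eqP; rewrite !mxE !eqxx (negbTE ab) subr0 oner_eq0 //.
Qed.

Lemma delta_sub_diag (a b : 'I_n) : delta_mx a a - delta_mx b b =
  diag_mx (\row_c ((c == a)%:R - (c == b)%:R)) :> 'M[L]_n.
Proof.
apply/matrixP=> i j; rewrite !mxE; have [->|ne] := eqVneq i j.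
  by rewrite !andbb mulr1n.
rewrite mulr0n; have H c : (i == c) && (j == c) = false.
  by apply/negP => /andP[/eqP ei /eqP ej]; rewrite ei ej eqxx in ne.
by rewrite !H subrr.
Qed.

Lemma Hd_lie a b : isom_lie (@barEL L) (Hd a b).
Proof.
apply/isom_lieEL; rewrite fm_pm sm_pm delta_sub_diag; set D := diag_mx _.
have [uW uW2] := unitW; have uWT : W^T \in unitmx by rewrite unitmx_tr.
apply: (can_inj (mulKmx uWT)); apply: (can_inj (mulmxK uW2)).
rewrite mulmx0 mul0mx mulmxDr mulmxDl mulmxN mulmxN mulNmx !trmx_mul tr_diag_mx.
rewrite !mulmxA -trmx_mul mulVmx // trmx1 mul1mx mulmxKV // -!mulmxA (mulmxA W^T) hW.
by rewrite (mulmxA W^T) (mulmxA (W^T *m J)) hW /D diagC subrr.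
Qed.

Lemma bracket_lie (X Y : 'M[EL]_n) : isom_lie (@barEL L) X -> isom_lie (@barEL L) Y ->
  isom_lie (@barEL L) (mx_bracket X Y).
Proof.
move=> /isom_lieEL hX /isom_lieEL hY; apply/isom_lieEL.
have eX : (fm X)^T *m J = - (J *m sm X) by apply/eqP; rewrite -addr_eq0 hX.
have eY : (fm Y)^T *m J = - (J *m sm Y) by apply/eqP; rewrite -addr_eq0 hY.
rewrite /mx_bracket fmB smB !fmM !smM linearB /= !trmx_mul mulmxBl mulmxBr -!mulmxA eX eY.
rewrite !mulmxN !mulmxA eX eY !mulNmx !opprK.
by rewrite addrC addrA subrK subrr.
Qed.

Lemma bracket_X a b : a != b ->
  mx_bracket (X_ a b) (scaleL (-1) (X_ b a)) = scaleL (- (h 0 a * h 0 b)) (Hd a b).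
Proof.
move=> ab; apply: lie_ext.
- by apply: bracket_lie; [|apply: scaleL_lie]; apply: X_lie.
- by apply: scaleL_lie; apply: Hd_lie.
apply: (can_inj (mulmxK unitW.1)).
have XX c d : fm (X_ c d) *m fm (X_ d c) *m W = (h 0 c * h 0 d) *: (W *m delta_mx c c).
  by rewrite -mulmxA X_W -scalemxAr mulmxA X_W -scalemxAl -mulmxA mul_delta_mx scalerA.
rewrite /mx_bracket fmB !fmM !fm_scale -[RHS]scalemxAl Hd_W mulmxBl -scalemxAr -!scalemxAl !XX.
by rewrite (mulrC (h 0 b)) !scaleN1r -opprD -scalerBr -mulmxBr scaleNr.
Qed.

Lemma chiM c (s1 s2 : 'M[EL]_n) : torus s1 -> torus s2 -> chi c (s1 *m s2) = chi c s1 * chi c s2.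
Proof.
move=> t1 t2; have [x [_ E1 _]] := torusP t1; have [z [_ E2 _]] := torusP t2.
rewrite (chiE c E1) (chiE c E2) (@chiE c _ (\row_d (x 0 d * z 0 d))) ?mxE //.
by rewrite fmM -mulmxA E2 mulmxA E1 -mulmxA mulmx_diag.
Qed.

Lemma unit_col (V : 'M[L]_n) j : V \in unitmx -> exists i, V i j != 0.
Proof.
move=> uV; apply: contrapT => /forallNP H.
have V0 : V *m delta_mx j (0 : 'I_1) = 0.
  rewrite -colE; apply/matrixP=> i l; rewrite !mxE; apply/eqP.
  by apply: contraT => n0; case: (H i).
have := congr1 (mulmx (invmx V)) V0; rewrite mulKmx // mulmx0.
by move=> /matrixP/(_ j 0)/eqP; rewrite !mxE !eqxx oner_eq0.
Qed.

(* The reflection identity forces [w] to permute the lines of the eigenbasis as the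
   transposition (a b), which determines the coroot. *)
Lemma coroot_torus a b mu H : a != b -> cocharacter bar iota T mu H ->
  (forall t, t != 0 -> al a b (mu t) = t ^+ 2) ->
  (exists2 w, isom_grp (@barEL L) w & forall s, torus s ->
     w *m s = s *m mu (al a b s)^-1 *m w) ->
  forall t c, t != 0 -> chi c (mu t) = if c == a then t else if c == b then t^-1 else 1.
Proof.
move=> ab [tm mm _] am [w hw ww]; have [t0 [t00 t01 t02]] := exists_t.
pose m t c := chi c (mu t).
have mE t : t != 0 -> fm (mu t) *m W = W *m diag_mx (\row_c m t c) /\ forall c, m t c != 0.
  by move=> /tm/chi_fm.
have m1 c : m 1 c = 1.
  have n1 := oner_neq0 L; have := mm 1 1 n1 n1; rewrite mulr1 => /(congr1 (chi c)).
  rewrite (chiM c (tm 1 n1) (tm 1 n1)) -/(m 1 c) => E1; apply: (mulfI ((mE 1 n1).2 c)).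
  by rewrite -E1 mulr1.
pose V := invmx W *m fm w *m W.
have uW := unitW.1.
have uV : V \in unitmx by rewrite /V !unitmx_mul unitmx_inv uW (isom_fm_unit hw).1.
have key i j : V i j != 0 -> forall x : 'rV[L]_n, (forall c, x 0 c != 0) ->
    x 0 j = x 0 i * m (x 0 b / x 0 a) i.
  move=> Vij x x0; have [s ts Es] := torus_mk x0.
  have z0 : x 0 b / x 0 a != 0 by rewrite mulf_neq0 ?invr_eq0.
  have := congr1 (@fm L n) (ww s ts); rewrite !fmM (alE _ _ ts Es) invf_div => E1.
  have E2 : V *m diag_mx x = diag_mx x *m diag_mx (\row_c m (x 0 b / x 0 a) c) *m V.
    set Mz := diag_mx (\row_c _); set Dx := diag_mx x.
    have e1 : V *m Dx = invmx W *m (fm w *m fm s) *m W by rewrite /V -!mulmxA -Es.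
    have e2 : fm (mu (x 0 b / x 0 a)) = W *m Mz *m invmx W by rewrite -(mE _ z0).1 mulmxK.
    have e3 : fm s = W *m Dx *m invmx W by rewrite -Es mulmxK.
    by rewrite e1 E1 e2 {1}e3 /V -!mulmxA !mulKmx.
  have := E2; rewrite mulmx_diag mul_diag_mx mul_mx_diag; clearbody V.
  move=> /matrixP/(_ i j); rewrite !mxE => E3.
  by apply: (mulfI Vij); rewrite E3 mulrC.
have voneE c t d : vone c t 0 d = if d == c then t else 1 by rewrite mxE.
have amE t : t != 0 -> m t a / m t b = t ^+ 2.
  by move=> n0; rewrite -am // (alE _ _ (tm t n0) (mE t n0).1) !mxE.
have ba : b != a by rewrite eq_sym.
have inab j : (j == a) || (j == b) -> forall i, V i j != 0 -> (i == a) || (i == b).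
  move=> jab i Vij; apply: contraT; rewrite negb_or => /andP[ia ib].
  have ij : j != i by apply: contraTneq jab => ->; rewrite negb_or ia.
  have := key i j Vij _ (vone_neq0 i t00); rewrite !voneE eqxx (negbTE ij).
  rewrite (eq_sym b) (negbTE ib) (eq_sym a) (negbTE ia) divr1 m1 mulr1 => /esym/eqP.
  by rewrite (negbTE t01).
have [i Via] := unit_col a uV.
have {i Via} [ia|ib] : V a a != 0 \/ V b a != 0.
- have H1 := inab a; rewrite eqxx in H1.
  by have /orP[/eqP ei|/eqP ei] := H1 isT i Via; rewrite ei in Via; [left|right].
(* If [w] kept the line of a, [mu] would be trivial there; column b then yields either t0 = 1 or
   [m t0 b] = 1, the latter against the pairing 2 with the root. *)
- have ma t : t != 0 -> m t a = 1.
    move=> n0; have := key a a ia _ (vone_neq0 b n0).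
    by rewrite !voneE eqxx (negbTE ab) divr1 mul1r => ->.
  have [i Vib] := unit_col b uV.
  have H1 := inab b; rewrite eqxx orbT in H1.
  have /orP[/eqP ei|/eqP ei] := H1 isT i Vib.
    have := key i b Vib _ (vone_neq0 b t00); rewrite ei !voneE eqxx (negbTE ab) divr1 mul1r ma //.
    by move/eqP; rewrite (negbTE t01).
  have t0i : t0^-1 != 0 by rewrite invr_eq0.
  have := key i b Vib _ (vone_neq0 a t0i); rewrite ei !voneE eqxx (negbTE ba) div1r mul1r invrK => mb.
  by have := amE t0 t00; rewrite ma // -mb divr1 => /esym/eqP; rewrite (negbTE t02).
- have mb t : t != 0 -> m t b = t^-1.
    move=> n0; have := key b a ib _ (vone_neq0 b n0).
    rewrite !voneE eqxx (negbTE ab) divr1 => E1.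
    by apply: (mulfI n0); rewrite -E1 mulfV.
  move=> t c n0; have [->|ca] := eqVneq c a.
    have := amE t n0; rewrite mb // invrK => E1.
    by apply: (mulIf n0); rewrite E1 expr2.
  have [->|cb] := eqVneq c b; first exact: mb.
  have [i Vic] := unit_col c uV.
  have ic : i = c.
    have := key i c Vic _ (vone_neq0 c t00); rewrite !voneE eqxx.
    rewrite (eq_sym b) (negbTE cb) (eq_sym a) (negbTE ca) divr1 m1 mulr1.
    by case: eqP => // _ /eqP; rewrite (negbTE t01).
  have := key i c Vic _ (vone_neq0 b n0); rewrite ic !voneE eqxx (negbTE cb) (negbTE ab) divr1 mul1r.
  by move/esym.
Qed.

Lemma diag_split (a b : 'I_n) (x z : L) : a != b ->
  diag_mx (\row_c (if c == a then x else if c == b then z else 1)) =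
  x *: delta_mx a a + z *: delta_mx b b + (1%:M - delta_mx a a - delta_mx b b) :> 'M[L]_n.
Proof.
move=> ab; apply/matrixP=> i j; rewrite !mxE; have [->|ne] := eqVneq i j.
  rewrite !andbb; have [ja|ja] := eqVneq j a.
    by rewrite ja (negbTE ab) !mulr0 !mulr1 ?mulr1n subrr subr0 !addr0.
  have [jb|jb] := eqVneq j b; first by rewrite !mulr0 mulr1 ?mulr1n subr0 subrr addr0 add0r.
  by rewrite !mulr0 !subr0 !add0r ?mulr1n.
have H c : (i == c) && (j == c) = false.
  by apply/negP => /andP[/eqP ei /eqP ej]; rewrite ei ej eqxx in ne.
by rewrite !H !mulr0 !subr0 !addr0 !mulr0n.
Qed.

Lemma laurent_entry (r : seq (int * L)) (A B C : L) :
  (forall t, t != 0 -> \sum_(e <- r) t ^ e.1 * e.2 = t * A + t^-1 * B + C) ->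
  \sum_(e <- r) e.2 *~ e.1 = A - B.
Proof.
move=> H; have := @laurent0 L hinf (r ++ [:: (1, - A); (-1, - B); (0, - C)]).
rewrite big_cat /= !big_cons big_nil /= mulr1z mulrN1z mulr0z opprK !addr0 => H1.
apply/eqP; rewrite -subr_eq0 opprB addrC (addrC B); apply/eqP; rewrite addrC.
apply: H1 => t t0; rewrite big_cat /= H // !big_cons big_nil /= expr1z exprN1 expr0z.
ring.
Qed.

(** [coroot_torus] fixes the values of [mu], and each entry of [H] is then the derivative at 1 of a
    known Laurent polynomial. *)
Lemma coroot_uniq a b H : a != b -> coroot_diff bar iota T (al a b) H -> H = Hd a b.
Proof.
move=> ab [mu [hmu am hw]]; have muE := coroot_torus ab hmu am hw.
have [tm mm [r [mr HE]]] := hmu; have [uW uW2] := unitW.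
pose x t : 'rV[L]_n := \row_c (if c == a then t else if c == b then t^-1 else 1).
have fmu t : t != 0 -> fm (mu t) = W *m diag_mx (x t) *m invmx W.
  move=> n0; have [E1 _] := chi_fm (tm t n0); rewrite -[LHS](mulmxK uW) E1.
  by congr (_ *m diag_mx _ *m _); apply/rowP=> c; rewrite !mxE muE.
have smu t : t != 0 -> sm (mu t) = W2 *m diag_mx (x t^-1) *m invmx W2.
  move=> n0; have x0 c : x t 0 c != 0.
    by rewrite mxE; case: ifP => // _; case: ifP => // _; rewrite ?invr_eq0 ?oner_neq0.
  have E1 : fm (mu t) *m W = W *m diag_mx (x t) by rewrite fmu // mulmxKV.
  have E2 := isom_sm (tm t n0).1 x0 E1; rewrite -[LHS](mulmxK uW2) E2.
  congr (_ *m diag_mx _ *m _); apply/rowP=> c; rewrite !mxE.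
  by case: ifP => // _; case: ifP => // _; rewrite invr1.
have lin (U V M1 M2 M3 : 'M[L]_n) (z1 z2 : L) i j :
    (U *m (z1 *: M1 + z2 *: M2 + M3) *m V) i j =
    z1 * (U *m M1 *m V) i j + z2 * (U *m M2 *m V) i j + (U *m M3 *m V) i j.
  by rewrite !mulmxDr !mulmxDl -!scalemxAr -!scalemxAl !mxE.
have fsum (r' : seq (int * 'M[EL]_n)) t : fm (\sum_(e <- r') scaleL (t ^ e.1) e.2) =
    \sum_(e <- r') t ^ e.1 *: fm e.2.
  by rewrite /fm raddf_sum; apply: eq_bigr => e _; apply: fm_scale.
have ssum (r' : seq (int * 'M[EL]_n)) t : sm (\sum_(e <- r') scaleL (t ^ e.1) e.2) =
    \sum_(e <- r') t ^ e.1 *: sm e.2.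
  by rewrite /sm raddf_sum; apply: eq_bigr => e _; apply: sm_scale.
apply: pmP; rewrite HE ?fm_pm ?sm_pm.
  rewrite /fm raddf_sum; apply/matrixP=> i j; rewrite summxE.
  have -> : \sum_(e <- r) map_mx fst (e.2 *~ e.1) i j =
      \sum_(e <- [seq (e.1, fm e.2 i j) | e <- r]) e.2 *~ e.1.
    rewrite big_map; apply: eq_bigr => e _ /=.
    by rewrite raddfMz -!scaler_int !mxE mulrzl.
  rewrite (@laurent_entry _ ((W *m delta_mx a a *m invmx W) i j)
     ((W *m delta_mx b b *m invmx W) i j)
     ((W *m (1%:M - delta_mx a a - delta_mx b b) *m invmx W) i j)).
    by rewrite mulmxBr mulmxBl !mxE.
  move=> t n0; rewrite -lin -diag_split // -/(x t) -fmu // mr // fsum summxE big_map.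
  by apply: eq_bigr => e _; rewrite !mxE.
rewrite /sm raddf_sum; apply/matrixP=> i j; rewrite summxE.
have -> : \sum_(e <- r) map_mx snd (e.2 *~ e.1) i j =
    \sum_(e <- [seq (e.1, sm e.2 i j) | e <- r]) e.2 *~ e.1.
  rewrite big_map; apply: eq_bigr => e _ /=.
  by rewrite raddfMz -!scaler_int !mxE mulrzl.
rewrite (@laurent_entry _ ((W2 *m delta_mx b b *m invmx W2) i j)
   ((W2 *m delta_mx a a *m invmx W2) i j)
   ((W2 *m (1%:M - delta_mx a a - delta_mx b b) *m invmx W2) i j)).
  by rewrite mulmxBr mulmxBl opprB !mxE.
move=> t n0; rewrite (addrC (t * _)) -lin -diag_split //.
have <- : x t^-1 = \row_c (if c == a then t^-1 else if c == b then t else 1) by rewrite /x invrK.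
rewrite -smu // mr // ssum summxE big_map.
by apply: eq_bigr => e _; rewrite !mxE.
Qed.

Lemma coroot_exists a b : a != b -> coroot_diff bar iota T (al a b) (Hd a b).
Proof.
move=> ab; have [uW uW2] := unitW.
pose x t : 'rV[L]_n := \row_c (if c == a then t else if c == b then t^-1 else 1).
have x0 t c : t != 0 -> x t 0 c != 0.
  by move=> n0; rewrite mxE; case: ifP => // _; case: ifP => // _; rewrite ?invr_eq0 ?oner_neq0.
have ba : b != a by rewrite eq_sym.
have ex t : exists s, t != 0 -> torus s /\ fm s *m W = W *m diag_mx (x t).
  have [->|n0] := eqVneq t 0; first by exists 0.
  by have [s ts Es] := torus_mk (fun c => x0 t c n0); exists s.
have [mu hmu] := choice ex; exists mu.
have chimu t c : t != 0 -> chi c (mu t) = x t 0 c.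
  by move=> n0; rewrite (chiE c (hmu t n0).2).
have torus_ext s1 s2 : torus s1 -> torus s2 -> (forall c, chi c s1 = chi c s2) -> s1 = s2.
  move=> t1 t2 E1; apply: (isom_ext t1.1 t2.1); apply: (can_inj (mulmxK uW)).
  rewrite (chi_fm t1).1 (chi_fm t2).1; congr (_ *m diag_mx _).
  by apply/rowP=> c; rewrite !mxE.
have torusM s1 s2 : torus s1 -> torus s2 -> torus (s1 *m s2).
  move=> [h1 c1] [h2 c2]; split; first exact: isom_grpM.
  by rewrite -mulmxA c2 !mulmxA c1.
have fmu t : t != 0 -> fm (mu t) = W *m diag_mx (x t) *m invmx W.
  by move=> n0; rewrite -(hmu t n0).2 mulmxK.
have smu t : t != 0 -> sm (mu t) = W2 *m diag_mx (x t^-1) *m invmx W2.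
  move=> n0; have E2 := isom_sm (hmu t n0).1.1 (fun c => x0 t c n0) (hmu t n0).2.
  rewrite -[LHS](mulmxK uW2) E2.
  congr (_ *m diag_mx _ *m _); apply/rowP=> c; rewrite !mxE.
  by case: ifP => // _; case: ifP => // _; rewrite invr1.
split.
- split.
  + by move=> t n0; apply: (hmu t n0).1.
  + move=> t u n0 u0; have tu0 : t * u != 0 by rewrite mulf_neq0.
    apply: torus_ext; [exact: (hmu _ tu0).1|by apply: torusM; [apply: (hmu _ n0).1|apply: (hmu _ u0).1]|].
    move=> c; rewrite (chiM c (hmu _ n0).1 (hmu _ u0).1) !chimu // !mxE.
    by case: ifP => // _; case: ifP => // _; rewrite ?invfM ?mulr1.
  + pose Ma := pm (W *m delta_mx a a *m invmx W) (W2 *m delta_mx b b *m invmx W2).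
    pose Mb := pm (W *m delta_mx b b *m invmx W) (W2 *m delta_mx a a *m invmx W2).
    pose Mc := pm (W *m (1%:M - delta_mx a a - delta_mx b b) *m invmx W)
                  (W2 *m (1%:M - delta_mx a a - delta_mx b b) *m invmx W2).
    exists [:: (1, Ma); (-1, Mb); (0, Mc)]; split.
      move=> t n0; rewrite !big_cons big_nil addr0 /= expr1z exprN1 expr0z.
      apply: pmP; rewrite /fm /sm !map_mxD -!/(fm _) -!/(sm _) ?fm_scale ?sm_scale ?fm_pm ?sm_pm.
        by rewrite fmu // /x diag_split // !mulmxDr !mulmxDl -!scalemxAr -!scalemxAl scale1r -addrA.
      rewrite smu // /x diag_split // invrK !mulmxDr !mulmxDl -!scalemxAr -!scalemxAl scale1r.
      by rewrite (addrC (t^-1 *: _)) -addrA.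
    rewrite !big_cons big_nil /= mulr1z mulrN1z mulr0z !addr0.
    by apply: pmP; rewrite ?fmB ?smB !(fm_pm, sm_pm) mulmxBr mulmxBl ?opprB.
- by move=> t n0; rewrite (alE _ _ (hmu t n0).1 (hmu t n0).2) !mxE eqxx (negbTE ba) eqxx invrK expr2.
(* In GL_n the reflection comes from the permutation matrix of the transposition, here in the
   eigenbasis. *)
pose Q : 'M[L]_n := perm_mx (tperm a b).
have uQ : Q \in unitmx by apply: unitmx_perm.
have uw : W *m Q *m invmx W \in unitmx by rewrite !unitmx_mul uW uQ unitmx_inv.
have [w hw fw] := isom_lift uw; exists w => // s ts.
have [z [z0 Es _]] := torusP ts.
have al0 : al a b s != 0 by rewrite (alE _ _ ts Es) mulf_neq0 ?invr_eq0.
have ali0 : (al a b s)^-1 != 0 by rewrite invr_eq0.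
have hm := hmu _ ali0.
apply: isom_ext.
- by apply: isom_grpM => //; apply: ts.1.
- by apply: isom_grpM => //; apply: isom_grpM; [apply: ts.1|apply: hm.1.1].
rewrite !fmM fw fmu //.
have fs : fm s = W *m diag_mx z *m invmx W by rewrite -Es mulmxK.
rewrite fs -!mulmxA !mulKmx // !mulmxA; congr (_ *m _); rewrite -!mulmxA; congr (_ *m _).
have zE : z 0 a / z 0 b = al a b s by rewrite (alE _ _ ts Es).
rewrite mulmxA mulmx_diag /Q mul_diag_mx mul_mx_diag; apply/matrixP=> i j; rewrite !mxE.
have [<-|ne] := eqVneq (tperm a b i) j; last by rewrite mul0r mulr0.
rewrite mul1r mulr1 -zE invf_div invf_div.
have [->|ia] := eqVneq i a; first by rewrite tpermL mulrCA mulfV // mulr1.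
have [->|ib] := eqVneq i b; first by rewrite tpermR mulrCA mulfV // mulr1.
by rewrite tpermD 1?eq_sym // mulr1.
Qed.

Lemma gal_scale (s : {rmorphism L -> L}) u (X : 'M[EL]_n) : gal s (scaleL u X) = scaleL (s u) (gal s X).
Proof.
apply/matrixP=> i j; rewrite !mxE /galEL.
by case: ifP => _; apply: (congr2 pair); rewrite /= rmorphM.
Qed.

Lemma bracket_scale u v (X Y : 'M[EL]_n) :
  mx_bracket (scaleL u X) (scaleL v Y) = scaleL (u * v) (mx_bracket X Y).
Proof.
rewrite /mx_bracket; apply: pmP.
  by rewrite fm_scale !fmB !fmM !fm_scale -!scalemxAl -!scalemxAr !scalerA (mulrC v) scalerBr.
by rewrite sm_scale !smB !smM !sm_scale -!scalemxAl -!scalemxAr !scalerA (mulrC v) scalerBr.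
Qed.

Lemma scaleLA u v (X : 'M[EL]_n) : scaleL u (scaleL v X) = scaleL (u * v) X.
Proof. by rewrite /scaleL scalerA. Qed.

Lemma scaleL_inj (X : 'M[EL]_n) u v : fm X != 0 -> scaleL u X = scaleL v X -> u = v.
Proof.
move=> X0 /(congr1 (@fm L n)); rewrite !fm_scale => /eqP.
by rewrite -subr_eq0 -scalerBl scaler_eq0 (negbTE X0) orbF subr_eq0 => /eqP.
Qed.

Lemma fmX_neq0 a b : fm (X_ a b) != 0.
Proof.
apply: contraNneq (X_neq0 a b) => E0; apply/eqP/lie_ext; [exact: X_lie| |by rewrite fm0].
by apply/isom_lieEL; rewrite fm0 sm0 trmx0 mul0mx mulmx0 addr0.
Qed.

Lemma stab_X a b (s : {rmorphism L -> L}) : a != b -> noswap a b ->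
  Defs.stab iota (al a b) s -> gal s (X_ a b) = X_ a b.
Proof.
by move=> ab ns /(stabP ab ns)[r [gs pa pb]]; rewrite (gal_X a b gs) pa pb.
Qed.

Lemma flip_X a b (s : {rmorphism L -> L}) : a != b -> noswap a b ->
  Defs.flip iota (al a b) s -> gal s (X_ a b) = scaleL (-1) (X_ b a).
Proof.
by move=> ab ns /(flipP ab ns)[r [gs pa pb]]; rewrite (gal_X a b gs) pa pb.
Qed.

(** A vector of g_alpha(F_alpha) is u [X_ a b] with u in F_alpha, and the bracket scales by the norm
    of u. The ratio is thus one class modulo norms. *)
Lemma toral_ratioP a b z : a != b -> noswap a b ->
  toral_ratio bar iota T (al a b) z <-> exists u (s : {rmorphism L -> L}),
    [/\ Falpha iota (al a b) u, u != 0, Defs.flip iota (al a b) s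
      & z = - (h 0 a * h 0 b) * (u * s u)].
Proof.
move=> ab ns; split=> [[X [s [H [[rX sX] X0 fs cH br]]]]|[u [s [Fu u0 fs ->]]]].
  have [u Eu] := root_space_al ab rX; exists u, s.
  have u0 : u != 0.
    apply: contraNneq X0 => u0; rewrite Eu u0; apply/eqP/pmP; rewrite ?fm_scale ?sm_scale scale0r ?fm0 ?sm0 //.
  split=> //.
    move=> s' hs'; apply: (scaleL_inj (fmX_neq0 a b)).
    by have := sX s' hs'; rewrite Eu gal_scale (stab_X ab ns hs').
  apply: (scaleL_inj (Hd_neq0 ab)).
  rewrite -{1}(coroot_uniq ab cH) -br Eu gal_scale (flip_X ab ns fs) bracket_scale bracket_X //.
  by rewrite scaleLA mulrC.
exists (scaleL u (X_ a b)), s, (Hd a b); split=> //.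
- split.
    split; first exact/scaleL_lie/X_lie.
    move=> s' ts'; have [_ /(_ s' ts') E1] := root_space_X a b.
    by rewrite /scaleL -scalemxAr -scalemxAl -/(scaleL _ _) E1 /scaleL !scalerA mulrC.
  by move=> s' hs'; rewrite gal_scale (stab_X ab ns hs') Fu.
- apply: contraNneq (fmX_neq0 a b) => /(congr1 (@fm L n)).
  by rewrite fm_scale fm0 => /eqP; rewrite scaler_eq0 (negbTE u0).
- exact: coroot_exists.
- by rewrite gal_scale (flip_X ab ns fs) bracket_scale bracket_X // scaleLA mulrC.
Qed.

(** [kappa] is unchanged by a norm, so the ratio chosen by [xget] does not matter. The last
    hypothesis says that all flips induce one automorphism of F_alpha, which makes norms
    multiplicative. *)
Theorem toral_invE a b : a != b -> noswap a b ->
  (forall u (s s' : {rmorphism L -> L}), Falpha iota (al a b) u ->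
     Defs.flip iota (al a b) s -> Defs.flip iota (al a b) s' -> s u = s' u) ->
  toral_inv bar iota T (al a b) = kappa iota (al a b) (- (h 0 a * h 0 b)).
Proof.
move=> ab ns agree; rewrite /toral_inv; set c := - (h 0 a * h 0 b).
(* The default value of [xget] does not occur: u = 1 gives a ratio. *)
case: xgetP => [z _ /(toral_ratioP _ ab ns)[u [s [Fu u0 fs ->]]]|nor]; last first.
  have [s fs] := flip_exists a b; case: (nor (c * (1 * s 1))); apply/(toral_ratioP _ ab ns).
  exists 1, s; split=> //; last exact: oner_neq0.
  by move=> s' _; rewrite rmorph1.
have us0 : u * s u != 0 by rewrite mulf_neq0 // fmorph_eq0.
rewrite /kappa; congr (if _ then _ else _); apply: asbool_equiv_eq.
split=> [[y' [s' [Fy y0 fs' E1]]]|[y' [s' [Fy y0 fs' E1]]]].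
  exists (y' / u), s'; split=> //; last 2 first.
  - by rewrite mulf_neq0 ?invr_eq0.
  - rewrite rmorphM fmorphV (agree u s' s Fu fs' fs) mulrACA -invfM -E1 -/c mulfK //.
  by move=> s'' hs; rewrite rmorphM fmorphV Fy // Fu.
exists (y' * u), s'; split=> //; last 2 first.
- by rewrite mulf_neq0.
- by rewrite rmorphM (agree u s' s Fu fs' fs) mulrACA -E1.
by move=> s'' hs; rewrite rmorphM Fy // Fu.
Qed.

(** * Galois orbits of roots and the product over them *)

Section Orbits.
Variables (I : {set 'I_n}) (g : 'M[E]_n).
Hypothesis two_neq0 : (2%:R : L) != 0.
Hypothesis piI : forall c, (pi c \in I) = (c \in I).
Hypothesis tg : torus (map_mx (toEL bar iota) g).
Hypothesis Eg : map_mx iota g *m W = W *m diag_mx (\row_c (if c \in I then -1 else 1)).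

Lemma piXI r c : ((pi ^+ r)%g c \in I) = (c \in I).
Proof.
elim: r => [|r IH]; first by rewrite expg0 perm1.
by rewrite expgSr permM piI.
Qed.

Lemma al_g a b : al a b (map_mx (toEL bar iota) g) =
  (if a \in I then -1 else 1) / (if b \in I then -1 else 1).
Proof.
have E1 : fm (map_mx (toEL bar iota) g) *m W = W *m diag_mx (\row_c (if c \in I then -1 else 1)).
  by rewrite -Eg; congr (_ *m _); apply/matrixP=> i j; rewrite !mxE.
by rewrite (alE a b tg E1) !mxE.
Qed.

Lemma al_g_neq1 a b : (al a b (map_mx (toEL bar iota) g) != 1) = ((a \in I) != (b \in I)).
Proof.
have n11 : (-1 : L) != 1.
  by rewrite eq_sym -addr_eq0 -mulr2n.
rewrite al_g; case: (a \in I); case: (b \in I) => /=; rewrite ?divr1 ?div1r ?n11 ?divff ?oppr_eq0 ?oner_eq0 ?eqxx //.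
by rewrite invrN invr1 n11.
Qed.

Lemma orbit_refl a b : gal_orbit iota (al a b) (al a b).
Proof. by apply/gal_orbitE; exists 0, false; rewrite /twist expg0 !perm1. Qed.

Lemma twist_orbit r f a b beta : gal_orbit iota (twist r f a b) beta <->
  gal_orbit iota (al a b) beta.
Proof.
have h1 r' f' c d : (gal_orbit iota (twist r' f' c d) `<=` gal_orbit iota (al c d))%classic.
  move=> bt; rewrite /twist; case: f' => /gal_orbitE[r2 [f2 ->]]; apply/gal_orbitE;
    exists (r' + r2)%N; [exists (~~ f2)|exists f2]; rewrite /twist -!permM -expgD;
    by case: f2.
split; first exact: h1.
(* [r'] makes r + r' a multiple of the order of [pi], so that the inverse of a power is again a
   power with natural exponent. *)
pose N := #[pi]%g; pose r' := (r * N.-1)%N.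
have rr c : (pi ^+ r')%g ((pi ^+ r)%g c) = c.
  rewrite -permM -expgD /r' -mulnS prednK ?order_gt0 // mulnC expgM expg_order expg1n perm1 //.
have E1 : al a b = if f then twist r' f ((pi ^+ r)%g b) ((pi ^+ r)%g a)
                   else twist r' f ((pi ^+ r)%g a) ((pi ^+ r)%g b).
  by rewrite /twist; case: (f); rewrite !rr.
move=> hb; rewrite {1}E1 in hb; move: hb; rewrite {3}/twist; case: (f) => hb; exact: h1 hb.
Qed.

Definition pi2 : {perm 'I_n * 'I_n} :=
  perm (can_inj (g := fun z => ((pi^-1)%g z.1, (pi^-1)%g z.2))
    (fun z : 'I_n * 'I_n => etrans (congr2 pair (permK pi z.1) (permK pi z.2)) (esym (surjective_pairing z))
      : (fun z => ((pi^-1)%g z.1, (pi^-1)%g z.2)) ((fun z => (pi z.1, pi z.2)) z) = z)).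

Lemma pi2E a b : pi2 (a, b) = (pi a, pi b).
Proof. by rewrite permE. Qed.

Lemma pi2X r a b : (pi2 ^+ r)%g (a, b) = ((pi ^+ r)%g a, (pi ^+ r)%g b).
Proof.
elim: r => [|r IH]; first by rewrite !expg0 !perm1.
by rewrite !expgSr !permM IH pi2E.
Qed.

Definition mixed : {set 'I_n * 'I_n} := finset (fun z => (z.1 \in I) && (z.2 \notin I)).

Lemma in_mixed a b : ((a, b) \in mixed) = (a \in I) && (b \notin I).
Proof. by rewrite /mixed inE. Qed.

(** [pick] depends on the orbit as a set alone, so this is constant on orbits ([orep_eq]). *)
Definition orep (z : 'I_n * 'I_n) := odflt z [pick w in porbit pi2 z].

Lemma orep_porbit z : orep z \in porbit pi2 z.
Proof. by rewrite /orep; case: pickP => //= _; apply: porbit_id. Qed.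

Lemma orep_eq z w : w \in porbit pi2 z -> orep w = orep z.
Proof.
move=> wz; have E1 : porbit pi2 w = porbit pi2 z by apply/eqP; rewrite eq_porbit_mem porbit_sym in wz *.
rewrite /orep E1; case: pickP => //= H.
by have := H z; rewrite porbit_id.
Qed.

Definition oreps := [set orep z | z in mixed].

Lemma mixed_porbit z w : z \in mixed -> w \in porbit pi2 z -> w \in mixed.
Proof.
case: z => a b; rewrite in_mixed => /andP[aI bI] /porbitP[r ->].
by rewrite pi2X in_mixed !piXI aI.
Qed.

Lemma orep_mixed z : z \in mixed -> orep z \in mixed.
Proof. by move=> zm; apply: mixed_porbit zm (orep_porbit z). Qed.

(** A Galois orbit is the [pi2]-orbit of (a, b) together with that of (b, a). When exactly one index
    is in [I], one of these two orbits lies in [mixed] and the other is disjoint from it, so Galois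
    orbits correspond to [oreps]. *)
Lemma prod_root_orbits (fz : 'I_n * 'I_n -> int) :
  (forall a b, (a \in I) != (b \in I) -> toral_inv bar iota T (al a b) = fz (a, b)) ->
  (forall a b, fz (pi a, pi b) = fz (a, b)) -> (forall a b, fz (b, a) = fz (a, b)) ->
  \big[*%R/1]_(O \in root_orbits bar iota T g) toral_inv bar iota T (xget (fun=> 0) O) =
  \prod_(z in oreps) fz z.
Proof.
move=> hf fpi fsw; pose G (z : 'I_n * 'I_n) := gal_orbit iota (al z.1 z.2).
have fX r a b : fz ((pi ^+ r)%g a, (pi ^+ r)%g b) = fz (a, b).
  elim: r => [|r IH]; first by rewrite expg0 !perm1.
  by rewrite expgSr !permM fpi.
have Gtwist r f a b : gal_orbit iota (twist r f a b) = G (a, b).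
  by apply/seteqP; split=> bt /twist_orbit.
have rootsE : root_orbits bar iota T g = (G @` [set` oreps])%classic.
  apply/seteqP; split=> [O [alpha [ra ag ->]]|O [z zo <-]].
    have [a [b [ab Ea]]] := is_rootP ra; move: ag; rewrite Ea al_g_neq1 => aIb.
    have [z [zm Ez]] : exists z, z \in mixed /\ gal_orbit iota (al a b) = G z.
      case aI : (a \in I) aIb => bI.
        by exists (a, b); rewrite in_mixed aI; split=> //; case: (b \in I) bI.
      exists (b, a); rewrite in_mixed aI andbT; split=> //; first by case: (b \in I) bI.
      by rewrite -(Gtwist 0 true) /twist expg0 !perm1.
    exists (orep z); first by rewrite /= imset_f.
    rewrite Ez; case: z zm {Ez} => c d zm; have := orep_porbit (c, d).
    case/porbitP=> r ->; rewrite pi2X.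
    by rewrite -(Gtwist r false c d).
  have /imsetP[z' z'm Ez] := zo; have zm := orep_mixed z'm; rewrite -Ez in zm.
  case: z zm {zo Ez} => a b; rewrite in_mixed => /andP[aI bI].
  have ab : a != b by apply: contraNneq bI => <-.
  exists (al a b); split=> //; first exact: is_root_al.
  by rewrite al_g_neq1 aI (negbTE bI).
have Ginj : set_inj [set` oreps] G.
  move=> z w; rewrite !inE /= => /imsetP[z' z'm Ez] /imsetP[w' w'm Ew] EG.
  have zm := orep_mixed z'm; have wm := orep_mixed w'm.
  have oz : orep z = z by rewrite Ez; apply: orep_eq; apply: orep_porbit.
  have ow : orep w = w by rewrite Ew; apply: orep_eq; apply: orep_porbit.
  rewrite -Ez in zm; rewrite -Ew in wm; rewrite -oz -ow; apply/esym/orep_eq.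
  case: z w EG zm wm {Ez Ew oz ow} => a b [c d] EG; rewrite !in_mixed => /andP[aI bI] /andP[cI dI].
  have : G (a, b) (al c d) by rewrite EG; apply: orbit_refl.
  have cd : c != d by apply: contraNneq dI => <-.
  move=> /gal_orbitE[r [f]]; rewrite /twist; case: f => /(al_inj cd)[E1 E2].
    by move: cI; rewrite E1 piXI (negbTE bI).
  by rewrite E1 E2 -pi2X mem_porbit.
rewrite rootsE fsbig_image //.
have -> : [set` oreps]%classic = [set` enum oreps]%classic.
  by apply/seteqP; split=> z /=; rewrite mem_enum.
rewrite -fsbig_seq ?enum_uniq // big_enum /=; apply: eq_bigr => z /imsetP[z' z'm Ez].
have := orep_mixed z'm; rewrite -Ez; case: z {Ez} => a b; rewrite in_mixed => /andP[aI bI].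
case: xgetP => [beta _ /gal_orbitE[r [f ->]]|/(_ (al a b))[]]; last exact: orbit_refl.
by rewrite /twist; case: f; rewrite hf ?piXI ?aI ?(negbTE bI) // fX.
Qed.

(** (q^l - 1)/2 is (q - 1)/2 times 1 + q + ... + q^(l-1), and the latter exponent produces the
    product of [c] over an orbit of length l. *)
Lemma oreps_prod (K : comNzRingType) (c : 'I_n * 'I_n -> K) (q : nat) : odd q ->
  (forall z, c (pi2 z) = c z ^+ q) ->
  \prod_(z in oreps) c z ^+ ((q ^ #|porbit pi2 z|).-1)./2 = (\prod_(z in mixed) c z) ^+ (q.-1)./2.
Proof.
move=> oq hc.
have half l : ((q ^ l).-1)./2 = ((q.-1)./2 * \sum_(i < l) q ^ i)%N.
  rewrite predn_exp -{1}(odd_double_half q.-1).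
  have -> : odd q.-1 = false by case: q oq {hc} => //= q' /negbTE.
  by rewrite add0n -doubleMl doubleK.
have cX z r : c ((pi2 ^+ r)%g z) = c z ^+ (q ^ r).
  elim: r => [|r IH]; first by rewrite expg0 perm1 expr1.
  by rewrite expgSr permM hc IH -exprM -expnSr.
have prodE z : \prod_(w in porbit pi2 z) c w = c z ^+ (\sum_(i < #|porbit pi2 z|) q ^ i).
  transitivity (\prod_(w <- traject pi2 z #|porbit pi2 z|) c w).
    rewrite big_uniq ?uniq_traject_porbit //=; apply: eq_bigl => w.
    by rewrite porbit_traject.
  rewrite -prodrXr -(big_mkord predT (fun i => c z ^+ (q ^ i))) /index_iota subn0.
  have -> : traject pi2 z #|porbit pi2 z| = [seq (pi2 ^+ i)%g z | i <- seq.iota 0 #|porbit pi2 z|].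
    apply: (@eq_from_nth _ z); first by rewrite size_traject size_map size_iota.
    move=> i; rewrite size_traject => il; rewrite nth_traject //.
    by rewrite (nth_map 0%N) ?size_iota // nth_iota // permX.
  by rewrite big_map; apply: eq_bigr => i _; apply: cX.
have -> : \prod_(z in oreps) c z ^+ ((q ^ #|porbit pi2 z|).-1)./2 =
    (\prod_(z in oreps) \prod_(w in porbit pi2 z) c w) ^+ (q.-1)./2.
  by rewrite -prodrXl; apply: eq_bigr => z _; rewrite half mulnC exprM prodE.
congr (_ ^+ _); rewrite [RHS](partition_big orep (mem oreps)) /=; last first.
  by move=> z zm; apply: imset_f.
apply: eq_bigr => z zo; apply: eq_bigl => w; apply/idP/andP => [wz|[wm /eqP <-]].
  have /imsetP[z' z'm Ez] := zo; have zm := orep_mixed z'm; rewrite -Ez in zm.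
  split; first exact: mixed_porbit zm wz.
  by rewrite (orep_eq wz) Ez; apply/eqP/orep_eq/orep_porbit.
by rewrite porbit_sym orep_porbit.
Qed.

End Orbits.

End Roots.

(** * Eigenvectors in a single block *)

(** A unit congruent to 1 has m-th roots for every m that is 1 modulo p, so m divides its image for
    arbitrarily large m; any unit has a power of this kind. It is used to see that units of F_i
    remain units in E_i along [up_incl]. *)
Lemma hom_units (K : fieldType) (kappa : finFieldType) (v : K -> int) (res : K -> kappa)
    (hK : local_field v res) (w : K -> int) :
  (forall x y, x != 0 -> y != 0 -> w (x * y) = w x + w y) ->
  forall u, u != 0 -> v u = 0 -> w u = 0.
Proof.
move=> wM; have hv := valued_local hK.
have w1 : w 1 = 0.
  have := wM 1 1 (oner_neq0 K) (oner_neq0 K); rewrite mulr1.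
  by rewrite -[in LHS](addr0 (w 1)) => /addrI.
have wX x m : x != 0 -> w (x ^+ m) = w x *+ m.
  move=> x0; elim: m => [|m IH]; first by rewrite expr0 w1.
  by rewrite exprS mulrS wM ?expf_neq0 // IH.
have one_unit x : x != 0 -> vge v 0 x -> res x = 1 -> w x = 0.
  move=> x0 hx rx; have [p pp pk] := finPcharP kappa.
  (* Equal to 1 in the residue field, so that X^m - x has a simple root there, and larger than
     [|w x|] as soon as w x is nonzero. *)
  pose m := (p * `|w x|).+1.
  have rm : (m%:R : kappa) = 1 by rewrite /m -addn1 natrD natrM (pcharf0 pk) mul0r add0r.
  have vP : vpoly v 0 ('X^m - x%:P).
    apply: (vpolyD hv); last by apply: (vpolyN hv); apply: vpolyC.
    by move=> i; rewrite coefXn; apply: (vge_nat hv).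
  have rP : map_poly res ('X^m - x%:P) = 'X^m - 1.
    apply/polyP=> i; rewrite (coef_res hv) !coefB !coefXn coefC coef1.
    case: i => [|i]; rewrite ?subr0 ?(res_nat hv) //=.
    by rewrite (resB hv) ?(vge_nat hv) // (res_nat hv) rx.
  have [||z [hz rz]] := hensel hv (lf_complete hK) vP (vge_1 hv).
  - by rewrite rP (vd_one hv) hornerD hornerN hornerXn hornerC expr1n subrr.
  - rewrite rP (vd_one hv) derivB derivXn derivC subr0 hornerMn hornerXn expr1n rm.
    exact: oner_neq0.
  rewrite hornerD hornerN hornerXn hornerC => /eqP; rewrite subr_eq0 => /eqP zm.
  have z0 : z != 0 by apply: contra_neq x0 => z0; rewrite -zm z0 expr0n.
  have : w x = w z *+ m by rewrite -zm wX.
  rewrite -mulr_natr natz => E1.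
  have [wz|wz] := eqVneq (w z) 0; first by rewrite E1 wz mul0r.
  have pp0 := prime_gt0 pp.
  have : (`|w x| = `|w z| * m)%N by rewrite E1 abszM.
  have wz1 : (0 < `|w z|)%N by rewrite absz_gt0.
  move=> E2; have : (m <= `|w x|)%N by rewrite E2 leq_pmull.
  rewrite /m ltnNge; have -> : (`|w x| <= p * `|w x|)%N by rewrite leq_pmull.
  by [].
move=> u u0 vu; have [hu ru] := unit_res hv u0 vu.
have := one_unit (u ^+ #|kappa|.-1).
rewrite expf_neq0 // (vge_exp hv) // (resX hv) //.
have q1 := finRing_gt1 kappa.
have -> : res u ^+ #|kappa|.-1 = 1.
  by apply: (mulfI ru); rewrite -exprS prednK ?expf_card ?mulr1 // ltnW.
move=> /(_ isT isT erefl); rewrite wX // => /eqP; rewrite mulrn_eq0 => /orP[|/eqP //].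
by rewrite -leqn0 leqNgt -ltnS prednK ?q1 // ltnW.
Qed.

Lemma odd_card (K : finFieldType) : (2%:R : K) != 0 -> odd #|K|.
Proof.
move=> k2; have [p pp pk] := finPcharP K.
have := card_pprimeChar pk; rewrite -[#|pPrimeCharType pk|]/#|K| => ->.
rewrite oddX; case: (even_prime pp) => [p2|->]; last by rewrite orbT.
by move: pk; rewrite p2 inE (negbTE k2).
Qed.

(** Euler's criterion; if the power is 1, the exponent of [x] on a primitive root is even. *)
Lemma euler_qchar (K : finFieldType) (x : K) : (2%:R : K) != 0 -> x != 0 ->
  (qchar x)%:~R = x ^+ (#|K|.-1)./2 /\ (qchar x = 1 \/ qchar x = -1).
Proof.
move=> k2 x0; set h := (#|K|.-1)./2; have q1 := finRing_gt1 K.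
have hh : h.*2 = #|K|.-1.
  rewrite -[RHS]odd_double_half -/h.
  by have := odd_card k2; rewrite -{1}(prednK (ltnW q1)) /= => /negbTE ->.
have xQ (z : K) : z != 0 -> z ^+ #|K|.-1 = 1.
  by move=> z0; apply: (mulfI z0); rewrite -exprS prednK ?expf_card ?mulr1 // ltnW.
rewrite /qchar (negbTE x0); case: existsP => [[z /eqP zx]|nsq].
  have z0 : z != 0 by apply: contra_neq x0 => z0; rewrite -zx z0 expr0n.
  by split; [rewrite -zx -exprM mul2n hh xQ|left].
split; last by right.
have : (x ^+ h - 1) * (x ^+ h + 1) = 0.
  by rewrite -subr_sqr -exprM muln2 hh xQ // expr1n subrr.
move/eqP; rewrite mulf_eq0 subr_eq0 addr_eq0 => /orP[/eqP xh|/eqP -> //].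
exfalso; apply: nsq.
have m0 : (0 < #|K|.-1)%N by rewrite -ltnS prednK // ltnW.
pose rs := enum (predC1 (0 : K)).
have ars : all (#|K|.-1).-unity_root rs.
  by apply/allP => z; rewrite mem_enum /= => z0; apply/unity_rootP/xQ.
have szrs : (#|K|.-1 <= size rs)%N by rewrite -cardE cardC1.
have /hasP[g _ pg] := cyclic.has_prim_root m0 ars (enum_uniq _) szrs.
have [[e eQ] /= xe] := prim_rootP pg (xQ x x0).
have h0 : (0 < h)%N by rewrite -double_gt0 hh.
have : (h.*2 %| e * h)%N by rewrite hh (prim_order_dvd pg) exprM -xe xh.
rewrite -mul2n dvdn_pmul2r // => /dvdnP[e' ee]; exists (g ^+ e').
by rewrite -exprM -ee xe.
Qed.

Section HermLinear.
Variables (A : comPzRingType) (c : {rmorphism A -> A}) (n : nat).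
Implicit Types (x y : 'cV[A]_n).

Lemma herm0l y : herm c 0 y = 0.
Proof. by apply: big1 => i _; rewrite mxE mul0r. Qed.

Lemma herm0r x : herm c x 0 = 0.
Proof. by apply: big1 => i _; rewrite mxE rmorph0 mulr0. Qed.

Lemma hermDl x x' y : herm c (x + x') y = herm c x y + herm c x' y.
Proof. by rewrite /herm -big_split; apply: eq_bigr => i _; rewrite mxE mulrDl. Qed.

Lemma hermDr x y y' : herm c x (y + y') = herm c x y + herm c x y'.
Proof. by rewrite /herm -big_split; apply: eq_bigr => i _; rewrite mxE rmorphD mulrDr. Qed.

Lemma hermZl a x y : herm c (a *: x) y = a * herm c x y.
Proof. by rewrite /herm mulr_sumr; apply: eq_bigr => i _; rewrite mxE mulrA. Qed.

Lemma hermZr a x y : herm c x (a *: y) = c a * herm c x y.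
Proof. by rewrite /herm mulr_sumr; apply: eq_bigr => i _; rewrite mxE rmorphM mulrCA. Qed.

Lemma herm_suml I (r : seq I) (P : pred I) (G : I -> 'cV[A]_n) y :
  herm c (\sum_(i <- r | P i) G i) y = \sum_(i <- r | P i) herm c (G i) y.
Proof.
by elim/big_rec2: _ => [|i a b _ <-]; [apply: herm0l|apply: hermDl].
Qed.

Lemma herm_sumr I (r : seq I) (P : pred I) (G : I -> 'cV[A]_n) x :
  herm c x (\sum_(i <- r | P i) G i) = \sum_(i <- r | P i) herm c x (G i).
Proof.
by elim/big_rec2: _ => [|i a b _ <-]; [apply: herm0r|apply: hermDr].
Qed.

Lemma herm_sym x y : (forall a, c (c a) = a) -> herm c x y = c (herm c y x).
Proof.
move=> cK; rewrite /herm rmorph_sum (reindex_inj rev_ord_inj); apply: eq_bigr => i _.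
by rewrite rmorphM cK mulrC rev_ordK.
Qed.

Lemma herm_nondeg (z : 'cV[A]_n) : (forall x, herm c x z = 0) -> injective c -> z = 0.
Proof.
move=> h ci; apply/colP=> i; have := h (delta_mx (rev_ord i) 0).
rewrite /herm (bigD1 (rev_ord i)) //= mxE !eqxx mul1r rev_ordK big1 ?addr0.
  by move=> E; apply: ci; rewrite E mxE rmorph0.
by move=> j ne; rewrite mxE (negbTE ne) mul0r.
Qed.
End HermLinear.

Lemma herm_map (A A' : comPzRingType) (f : {rmorphism A -> A'}) (c : A -> A) (c' : A' -> A') n
    (x y : 'cV[A]_n) : (forall a, c' (f a) = f (c a)) ->
  herm c' (map_mx f x) (map_mx f y) = f (herm c x y).
Proof.
by move=> h; rewrite /herm rmorph_sum; apply: eq_bigr => i _; rewrite !mxE h rmorphM.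
Qed.

(** An eigenvector [v] of one block, with eigenvalue [piE] times [tau] and value [H] of the form.
    The eigenvalue equation is stated weakly, against the vectors of the block ([bs_eigen]);
    [bs_res] ties [H] to the sign [e]. *)
Record block_spec (F : fieldType) (E : fieldExtType F) (k : finFieldType) (vE : E -> int)
    (resE : E -> k) (bar : E -> E) (kbar : closedFieldType) (rho : {rmorphism k -> kbar})
    (L : fieldType) (iota : {rmorphism E -> L}) (N : nat) (D : urdata vE resE bar rho iota N)
    (piE : E) (pj : {poly k}) (n : nat) (Ej : fieldType) (phi : Ej -> 'cV[E]_n) (th : Ej)
    (d : nat) (e : int) (v : 'cV[D]_n) (tau H : D) : Prop := {
  bs_tau : vge (@ud_v _ _ _ _ _ _ _ _ _ _ _ D) 0 tau;
  bs_root : root (map_poly rho pj) (ud_res tau);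
  bs_tau_fr : iter d (ud_phi D) tau = tau;
  bs_tau_bar : ud_bar D tau = tau;
  bs_v_fr : map_mx (iter d (ud_phi D)) v = v;
  bs_span : exists (a : 'I_d -> D) (x : 'I_d -> Ej),
    v = \sum_i a i *: map_mx (ud_emb D) (phi (x i));
  bs_eigen : forall x, herm (ud_bar D) (map_mx (ud_emb D) (phi (th * x))) v =
    ud_emb D piE * tau * herm (ud_bar D) (map_mx (ud_emb D) (phi x)) v;
  bs_form : herm (ud_bar D) v v = H;
  bs_H0 : H != 0;
  bs_vH : ud_v H = 0;
  bs_H_bar : ud_bar D H = H;
  bs_H_fr : iter d (ud_phi D) H = H;
  bs_sign : e = 1 \/ e = -1;
  bs_res : ud_res H ^+ ((#|k| ^ d).-1)./2 = e%:~R }.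

Section Block.
Variables (F : fieldType) (k : finFieldType) (vF : F -> int) (resF : F -> k).
Hypothesis hF : local_field vF resF.
Hypothesis k2 : (2%:R : k) != 0.
Variables (E : fieldExtType F) (vE : E -> int) (resE : E -> k).
Hypothesis hE : local_field vE resE.
Hypothesis hdim : \dim {: E} = 2%N.
Hypothesis hram : val_ext (in_alg E) vF vE 2.
Hypothesis hres : res_ext (in_alg E) id vF resF resE.
Variables (bar : {lrmorphism E -> E}) (piE : E).
Hypothesis hpiE : uniformizer vE piE.
Hypothesis hbar : bar piE = - piE.
Variables (pj : {poly k}).
Hypotheses (mpj : pj \is monic) (ipj : irreducible_poly pj).
Variable B : unram_pair vF resF vE resE bar (size pj).-1.
Local Notation Ej := (up_E B).
Local Notation d := (size pj).-1.
Variables (n : nat) (Y : 'M[E]_n) (phi : {linear Ej -> 'cV[E]_n}) (th : Ej) (et : up_F B).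
Hypothesis hY : isom_lie bar Y.
Hypothesis et0 : et != 0.
Hypothesis hform : forall x y, (herm bar (phi x) (phi y))%:A =
  galTrace 1 {: Ej} (up_incl B et * x * up_bar B y).
Hypothesis hstab : forall x, Y *m phi x = phi (th * x).
Hypothesis hfac : vge (@up_vE _ _ _ _ _ _ _ _ _ B) 0 (piE^-1 *: th) /\
  root (map_poly (up_rho B) pj) (up_resE (piE^-1 *: th)).

Let hvE := valued_local hE.
Let vj := @up_vE _ _ _ _ _ _ _ _ _ B.
Let rj := @up_resE _ _ _ _ _ _ _ _ _ B.
Let hv : valued vj rj := valued_local (up_lfE B).
Let ia : {rmorphism E -> Ej} := in_alg Ej.
Let t : Ej := piE^-1 *: th.
Let ubar := up_bar B.
Let vext : val_ext ia vE vj 1 := up_unramE B.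
Let rext : res_ext ia (up_rho B) vE resE rj := up_rhoE B.

Lemma size_pj : (1 < size pj)%N. Proof. by case: ipj. Qed.

Lemma d_gt0 : (0 < d)%N.
Proof. by rewrite -ltnS prednK ?size_pj // ltnW ?size_pj. Qed.

Lemma size_ltd (g : {poly E}) : (size g <= d)%N = (size g < size pj)%N.
Proof. by rewrite -(prednK (ltnW size_pj)) ltnS. Qed.

Lemma t_int : vge vj 0 t. Proof. by case: hfac. Qed.

Lemma t_root : root (map_poly (up_rho B) pj) (rj t). Proof. by case: hfac. Qed.

Lemma t_vge m (g : {poly E}) : (size g < size pj)%N -> vge vj m (map_poly ia g).[t] <-> vpoly vE m g.
Proof. exact: (gauss_vge hvE hv vext rext t_int ipj t_root m). Qed.

Lemma t_inj (g : {poly E}) : (size g < size pj)%N -> (map_poly ia g).[t] = 0 -> g = 0.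
Proof. exact: (gauss_inj hvE hv vext rext t_int ipj t_root). Qed.

(** The first d powers of [t] are independent by the Gauss norm, and E_i has degree d. *)
Lemma t_span (x : Ej) : exists g : {poly E}, (size g < size pj)%N /\ x = (map_poly ia g).[t].
Proof.
pose X := [tuple t ^+ i | i < d].
have hs (c : 'I_d -> E) : \sum_i c i *: X`_i = (map_poly ia (\poly_(i < d) (if insub i is Some j then c j else 0))).[t].
  rewrite (@horner_coef_wide _ d); last by rewrite size_map_poly size_poly.
  apply: eq_bigr => i _; rewrite coef_map coef_poly ltn_ord valK /= mulr_algl.
  by rewrite (nth_mktuple (fun i : 'I_d => t ^+ i)).
have fX : free X.
  apply/freeP => c; rewrite hs => /t_inj; rewrite -size_ltd size_poly => /(_ isT) E0 i.
  by have := congr1 (fun p : {poly E} => p`_i) E0; rewrite coef_poly ltn_ord valK coef0.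
have bX : basis_of {: Ej} X.
  by rewrite basisEfree fX subvf size_tuple up_dimE leqnn.
have := coord_basis bX (memvf x); rewrite hs => E1.
by eexists; split; last exact: E1; rewrite -size_ltd size_poly.
Qed.

Lemma min_poly : exists P : {poly E}, [/\ P \is monic, vpoly vE 0 P, map_poly resE P = pj &
  (map_poly ia P).[t] = 0].
Proof.
have [g [sg Eg]] := t_span (t ^+ d).
have vg : vpoly vE 0 g by apply/(t_vge 0 sg); rewrite -Eg; apply: (vge_exp hv); apply: t_int.
rewrite -size_ltd in sg.
pose P : {poly E} := 'X^d - g.
have mP : P \is monic by rewrite monicE lead_coefDl ?lead_coefXn // size_polyN size_polyXn ltnS.
have sP : size P = size pj.
  by rewrite /P size_polyDl ?size_polyXn ?size_polyN ?ltnS // prednK // ltnW // size_pj.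
have vP : vpoly vE 0 P.
  apply: (vpolyD hvE); last exact: (vpolyN hvE).
  by move=> i; rewrite coefXn; apply: (vge_nat hvE).
have Pt : (map_poly ia P).[t] = 0.
  by rewrite rmorphB /= map_polyXn hornerD hornerN hornerXn -Eg subrr.
have [mrP srP] := monic_res hvE mP.
exists P; split=> //; apply/eqP; rewrite eq_sym -eqp_monic //.
rewrite -dvdp_size_eqp ?srP ?sP //; apply: (irr_root_dvd ipj t_root).
rewrite -(res_poly_ext hvE hv rext vP) rootE -(res_horner hv) ?Pt ?(res0 hv) //; last exact: t_int.
exact: (vpoly_ext vext).
Qed.

Section Lift.
Variables (kbar : closedFieldType) (rho : {rmorphism k -> kbar}).
Variable P : {poly E}.
Hypotheses (mP : P \is monic) (vP : vpoly vE 0 P) (rP : map_poly resE P = pj).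
Hypothesis Pt : (map_poly ia P).[t] = 0.

Lemma size_P : size P = size pj.
Proof. by rewrite -rP; have [_ ->] := monic_res hvE mP. Qed.

Lemma deriv_Pt : (map_poly ia P)^`().[t] != 0.
Proof.
have vP' : vpoly vj 0 (map_poly ia P) := vpoly_ext vext vP.
have [] := @res_unit _ _ _ _ hv (map_poly ia P)^`().[t] => //.
  by apply: (vge_horner hv); [apply: (vpoly_deriv hv)|apply: t_int].
rewrite (res_horner hv (vpoly_deriv hv vP') t_int).
rewrite (res_deriv hv) // (res_poly_ext hvE hv rext) // rP.
apply: separable_deriv_root t_root; rewrite separable_map.
exact: (irr_separable rho ipj mpj).
Qed.

Lemma gal_t_id (g : gal_of {: Ej}) : g \in 'Gal({: Ej} / 1)%g -> g t = t -> g = 1%g.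
Proof.
move=> hg gt; apply/eqP/gal_eqP => x _; rewrite gal_id; have [f [_ ->]] := t_span x.
rewrite -horner_map /= gt -map_poly_comp; congr (_.[t]); apply: eq_map_poly => e /=.
by rewrite (fixed_gal (sub1v _) hg) // rpredZ // mem1v.
Qed.

(** The coefficients of [Q] form the basis dual to the powers of [t] for the trace: the sum is that
    of g(y) Q(g t) over Galois elements g, and [Q] vanishes at the conjugates other than [t]. *)
Lemma lagrange : exists (Q : {poly Ej}) b, [/\ (size Q <= d)%N, Q.[t] = 1,
  Q * ('X - t%:P) = b *: map_poly ia P &
  forall y, \sum_(i < d) Q`_i * galTrace 1 {: Ej} (y * t ^+ i) = y].
Proof.
have rt : root (map_poly ia P) t by apply/rootP.
have [Q0 EQ] := factor_theorem _ _ rt.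
have Q0t : Q0.[t] != 0.
  by have := deriv_Pt; rewrite EQ derivM hornerD !hornerM derivXsubC !hornerE ?subrr ?mul0r ?mulr0 ?add0r ?addr0.
exists (Q0.[t]^-1 *: Q0), Q0.[t]^-1.
have sQ : (size Q0 <= d)%N.
  have := size_map_poly ia P; rewrite size_P.
  have Q00 : Q0 != 0 by apply: contraNneq Q0t => ->; rewrite horner0.
  rewrite EQ size_Mmonic ?monicXsubC // size_XsubC addn2 /= => sQ.
  by have := leqnn d; rewrite -{1}sQ.
have sQ' : (size (Q0.[t]^-1 *: Q0) <= d)%N by rewrite (leq_trans (size_scale_leq _ _)).
split=> [//|||y]; [by rewrite hornerZ mulVf|by rewrite EQ scalerAl|].
under eq_bigr => i _ do rewrite /galTrace mulr_sumr.
rewrite exchange_big /= (bigD1 1%g) ?group1 //= [X in _ + X]big1 => [|g /andP[hg g1]].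
  rewrite addr0; under eq_bigr => i _ do rewrite gal_id mulrCA.
  by rewrite -mulr_sumr -horner_coef_wide // hornerZ mulVf ?mulr1.
under eq_bigr => i _ do rewrite rmorphM rmorphXn mulrCA.
rewrite -mulr_sumr -horner_coef_wide // hornerZ.
suff -> : Q0.[g t] = 0 by rewrite !mulr0.
have : (map_poly ia P).[g t] = 0.
  rewrite -[map_poly ia P](_ : map_poly g (map_poly ia P) = _) ?horner_map ?Pt ?rmorph0 //.
  rewrite -map_poly_comp; apply: eq_map_poly => e /=.
  by rewrite (fixed_gal (sub1v _) hg) // rpredZ // mem1v.
rewrite EQ hornerM hornerXsubC => /eqP; rewrite mulf_eq0 subr_eq0 => /orP[/eqP //|/eqP gt].
by rewrite (gal_t_id hg gt) eqxx in g1.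
Qed.

Lemma ubarZ e x : ubar (e *: x) = bar e *: ubar x.
Proof. by rewrite -mulr_algl rmorphM /= up_barE mulr_algl. Qed.

(** Skew-adjointness of [Y] makes eta ([th] + its conjugate) orthogonal to all powers of [t] for the
    trace, hence 0; and [piE] changes sign as well. *)
Lemma ubar_t : ubar t = t.
Proof.
have [Q [b [_ _ _ HQ]]] := lagrange.
pose w := up_incl B et * (th + ubar th).
have [pi0 _] := hpiE.
have w0 : w = 0.
  rewrite -(HQ w); apply: big1 => i _; suff -> : galTrace 1 {: Ej} (w * t ^+ i) = 0 by rewrite mulr0.
  have := hY (phi (t ^+ i)) (phi 1); rewrite !hstab => /(congr1 ia) /=.
  rewrite scale0r scalerDl !hform -raddfD /= rmorphM !rmorph1 /= => <-; congr (galTrace _ _ _).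
  by rewrite /w /ubar; ring.
have : w == 0 by apply/eqP.
rewrite mulf_eq0 fmorph_eq0 (negbTE et0) /= addrC addr_eq0 => /eqP thN.
by rewrite /t ubarZ thN fmorphV /= hbar invrN scaleNr scalerN opprK.
Qed.

Lemma bar_P : map_poly bar P = P.
Proof.
apply/eqP; rewrite -subr_eq0; apply/eqP; apply: t_inj.
  have sP := size_P; rewrite -size_ltd; apply/leq_sizeP => i di; rewrite coefB coef_map.
  have [i_d|ne] := eqVneq i d; last first.
    by rewrite /= nth_default ?rmorph0 ?subrr // size_P -(prednK (ltnW size_pj)) ltn_neqAle eq_sym ne.
  have : lead_coef P = 1 := monicP mP.
  rewrite /lead_coef size_P -i_d => ->; apply/eqP; rewrite subr_eq0; apply/eqP; exact: (rmorph1 bar).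
rewrite rmorphB /= hornerD hornerN Pt subr0 -map_poly_comp -ubar_t.
have -> : map_poly (ia \o bar) P = map_poly ubar (map_poly ia P).
  by rewrite -map_poly_comp; apply: eq_map_poly => e /=; rewrite /ubar up_barE.
by rewrite horner_map Pt rmorph0.
Qed.

Section Embed.
Variables (L : fieldType) (iota : {rmorphism E -> L}) (N : nat).
Variable D : urdata vE resE bar rho iota N.
Hypothesis dN : (d %| N)%N.
Let vM := @ud_v _ _ _ _ _ _ _ _ _ _ _ D.
Let rM := @ud_res _ _ _ _ _ _ _ _ _ _ _ D.
Let hvM : valued vM rM := ud_valued D.
Let emb := ud_emb D.
Let fr := ud_phi D.
Let bM := ud_bar D.

Lemma iter_fr_emb r e : iter r fr (emb e) = emb e.
Proof. by elim: r => //= r ->; apply: ud_phi_emb. Qed.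

(** Since d divides N, a root of [pj] lifts to [D]. The lift is the only root of [P] with its
    residue, so it is fixed by conjugation and by the d-th power of Frobenius, which fix that
    residue. *)
Lemma exists_tau : exists tau : D, [/\ vge vM 0 tau, root (map_poly rho pj) (rM tau),
  (map_poly emb P).[tau] = 0, iter d fr tau = tau & bM tau = tau].
Proof.
have vP' : vpoly vM 0 (map_poly emb P) := vpoly_ext (@ud_vext _ _ _ _ _ _ _ _ _ _ _ D) vP.
have rP' : map_poly rM (map_poly emb P) = map_poly rho pj.
  by rewrite (res_poly_ext hvE hvM (@ud_rext _ _ _ _ _ _ _ _ _ _ _ D)) // rP.
have : size (map_poly rho pj) != 1 by rewrite size_map_poly neq_ltn size_pj orbT.
move=> /closed_rootP[x0 hx0]; have x0d := irr_root_period ipj mpj hx0.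
have [|y0 hy0 ry0] := @ud_surj _ _ _ _ _ _ _ _ _ _ _ D x0.
  by case/dvdnP: dN => s ->; apply: frob_period.
have dne y : rM y = x0 -> (map_poly rM (map_poly emb P))^`().[rM y] != 0.
  move=> ->; rewrite rP'; apply: separable_deriv_root => //.
  by rewrite separable_map; apply: (irr_separable rho).
have [||tau [htau rtau Ptau]] := hensel hvM (@ud_complete _ _ _ _ _ _ _ _ _ _ _ D) vP' hy0.
- by rewrite rP' [X in _.[X]]ry0; apply/rootP.
- exact: dne.
have rt : rM tau = x0 by rewrite [LHS]rtau.
have uniq y : vge vM 0 y -> (map_poly emb P).[y] = 0 -> rM y = x0 -> y = tau.
  by move=> hy Py ry; apply: (hensel_unique hvM vP') => //; [rewrite [LHS]ry|apply: dne].
have it r : [/\ vge vM 0 (iter r fr tau), (map_poly emb P).[iter r fr tau] = 0 &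
    rM (iter r fr tau) = x0 ^+ (#|k| ^ r)].
  elim: r => [|r [IH1 IH2 IH3]]; first by rewrite expr1.
  split=> /=.
  - by move: IH1; rewrite /vge fmorph_eq0 /vM ud_phi_v.
  - have -> : map_poly emb P = map_poly fr (map_poly emb P).
      by rewrite -map_poly_comp; apply: eq_map_poly => e /=; rewrite [RHS]ud_phi_emb.
    by rewrite horner_map IH2 rmorph0.
  - by rewrite [LHS]ud_phi_res // -/rM IH3 -exprM expnSr.
exists tau; split=> //; first by rewrite rt.
  by have [h1 h2 h3] := it d; apply: uniq; rewrite ?h3.
apply: uniq; first by move: htau; rewrite /vge fmorph_eq0 /vM ud_bar_v.
  have -> : map_poly emb P = map_poly bM (map_poly emb P).
    rewrite -{1}bar_P -!map_poly_comp; apply: eq_map_poly => e /=.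
    by rewrite [RHS]ud_bar_emb.
  by rewrite horner_map Ptau rmorph0.
by rewrite [LHS]ud_bar_res.
Qed.

Section Hom.
Variable tau : D.
Hypotheses (vtau : vge vM 0 tau) (Ptau : (map_poly emb P).[tau] = 0).
Hypotheses (itau : iter d fr tau = tau) (btau : bM tau = tau).
Hypothesis rtau : root (map_poly rho pj) (rM tau).

Lemma exists_hom : exists s : {rmorphism Ej -> D},
  forall g, s (map_poly ia g).[t] = (map_poly emb g).[tau].
Proof.
have P0 : P != 0 := monic_neq0 mP.
have mod_t g : (map_poly ia (g %% P)).[t] = (map_poly ia g).[t].
  by rewrite [in RHS](divp_eq g P) rmorphD rmorphM /= hornerD hornerM Pt mulr0 add0r.
have mod_tau g : (map_poly emb (g %% P)).[tau] = (map_poly emb g).[tau].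
  by rewrite [in RHS](divp_eq g P) rmorphD rmorphM /= hornerD hornerM Ptau mulr0 add0r.
have key g h : (map_poly ia g).[t] = (map_poly ia h).[t] ->
    (map_poly emb g).[tau] = (map_poly emb h).[tau].
  move=> E0; apply/eqP; rewrite -subr_eq0 -hornerN -hornerD -rmorphB -mod_tau.
  rewrite (_ : (g - h) %% P = 0) ?rmorph0 ?horner0 //.
  apply: t_inj; first by rewrite -size_P ltn_modp.
  by rewrite mod_t rmorphB /= hornerD hornerN E0 subrr.
pose gx x := sval (cid (t_span x)).
have gxP x : x = (map_poly ia (gx x)).[t] by rewrite /gx; case: cid => g [].
pose s x := (map_poly emb (gx x)).[tau].
have sE g : s (map_poly ia g).[t] = (map_poly emb g).[tau] by apply: key; rewrite -gxP.
have sB : {morph s : x y / x - y}.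
  move=> x y; rewrite {1}(gxP x) {1}(gxP y) -hornerN -hornerD -rmorphN -rmorphD /= sE.
  by rewrite rmorphB /= hornerD hornerN.
have sM : {morph s : x y / x * y}.
  by move=> x y; rewrite {1}(gxP x) {1}(gxP y) -hornerM -rmorphM /= sE rmorphM hornerM.
have s1 : s 1 = 1.
  by have := sE 1; rewrite !rmorph1 !hornerC.
pose sA := GRing.isZmodMorphism.Build Ej D s sB.
pose sM' := GRing.isMonoidMorphism.Build Ej D s (conj s1 sM).
pose s' : {rmorphism Ej -> D} := HB.pack s sA sM'.
by exists s'.
Qed.

Variable s : {rmorphism Ej -> D}.
Hypothesis sE : forall g, s (map_poly ia g).[t] = (map_poly emb g).[tau].

Lemma s_ia e : s (ia e) = emb e.
Proof. by have := sE e%:P; rewrite !map_polyC !hornerC. Qed.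

Lemma s_t : s t = tau.
Proof. by have := sE 'X; rewrite !map_polyX !hornerX. Qed.

Lemma s_bar x : bM (s x) = s (ubar x).
Proof.
have [g [_ ->]] := t_span x; rewrite sE -[LHS]horner_map btau -[in RHS]horner_map /= ubar_t.
have -> : map_poly ubar (map_poly ia g) = map_poly ia (map_poly bar g).
  by rewrite -!map_poly_comp; apply: eq_map_poly => e /=; rewrite /ubar up_barE.
rewrite sE -!map_poly_comp; congr (_.[_]); apply: eq_map_poly => e /=.
exact: ud_bar_emb.
Qed.

Lemma s_fr x : iter d fr (s x) = s x.
Proof.
have [g [_ ->]] := t_span x; rewrite sE -[in RHS]itau; elim: d => //= r ->.
rewrite -[LHS]horner_map -map_poly_comp; congr (_.[_]); apply: eq_map_poly => e /=.
exact: ud_phi_emb.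
Qed.

Lemma s_vge m x : vge vj m x -> vge vM m (s x).
Proof.
have [g [sg ->]] := t_span x => /(t_vge m sg) vg; rewrite sE.
by apply: (vge_horner hvM) => //; apply: (vpoly_ext (@ud_vext _ _ _ _ _ _ _ _ _ _ _ D)).
Qed.

Lemma s_unit x : x != 0 -> vj x = 0 -> vM (s x) = 0.
Proof.
move=> x0 vx; have sx0 : s x != 0 by rewrite fmorph_eq0.
have /s_vge : vge vj 0 x by rewrite vgeE // vx.
have /s_vge : vge vj 0 x^-1 by rewrite vgeE ?invr_eq0 // (vV hv) // vx.
rewrite fmorphV !vgeE ?invr_eq0 // (vV hvM) //.
by rewrite oppr_ge0 => h1 h2; apply/eqP; rewrite eq_le h1.
Qed.

(** In place of a map between residue fields, the identity is moved as the congruence x^h = e modulo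
    the maximal ideal, which [s] respects. *)
Lemma s_res_sign x (e : int) h : vge vj 0 x -> rj x ^+ h = e%:~R -> e = 1 \/ e = -1 ->
  rM (s x) ^+ h = e%:~R.
Proof.
move=> hx rx he; have hsx := s_vge hx.
have vN1 (K kappa : fieldType) (v : K -> int) (r : K -> kappa) :
    valued v r -> vge v 0 e%:~R /\ r e%:~R = e%:~R.
  move=> h'; case: he => ->; rewrite ?mulr1z ?mulrN1z.
    by rewrite (vge_1 h') (vd_one h').
  by rewrite (vgeN h') (vge_1 h') (resN h') ?(vge_1 h') // (vd_one h').
have [v1 r1] := vN1 _ _ _ _ hv; have [v2 r2] := vN1 _ _ _ _ hvM.
have : vge vj 1 (x ^+ h - e%:~R).
  by rewrite -(res_eq hv) ?(vge_exp hv) // (resX hv) // rx [in eqbRHS]r1.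
move/s_vge; rewrite rmorphB rmorphXn rmorph_int -(res_eq hvM) ?(vge_exp hvM) //.
by rewrite (resX hvM) // => /eqP ->; rewrite -[RHS]r2.
Qed.

(** Polynomials of degree less than d over [k], evaluated at the residue of [t], give each residue
    exactly once. *)
Lemma card_up_k : #|up_k B| = (#|k| ^ d)%N.
Proof.
pose pl (f : {ffun 'I_d -> k}) := \poly_(i < d) (if insub i is Some j then f j else 0).
pose ev f := (map_poly (up_rho B) (pl f)).[rj t].
have ev_inj : injective ev.
  move=> f f' E0; have : root (map_poly (up_rho B) (pl f - pl f')) (rj t).
    by apply/rootP; rewrite rmorphB /= hornerD hornerN [X in X - _]E0 subrr.
  move/(irr_root_dvd ipj t_root) => dv; have : pl f - pl f' == 0.
    apply: contraTT dv => /dvdp_leq h; apply/negP => /h; rewrite leqNgt => /negP; apply.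
    rewrite -(prednK (ltnW size_pj)) ltnS (leq_trans (size_polyD _ _)) // geq_max.
    by rewrite size_polyN !size_poly.
  rewrite subr_eq0 => /eqP Ep; apply/ffunP=> i.
  by have := congr1 (fun p : {poly k} => p`_i) Ep; rewrite !coef_poly ltn_ord valK.
have ev_surj a : exists f, ev f = a.
  have [x hx rx] := res_surj (lf_res (up_lfE B)) a.
  have [g [sg Eg]] := t_span x; have vg : vpoly vE 0 g by apply/(t_vge 0 sg); rewrite -Eg.
  exists [ffun i : 'I_d => resE g`_i]; rewrite -rx Eg [RHS](res_horner hv) ?t_int //; last first.
    exact: (vpoly_ext vext).
  rewrite (res_poly_ext hvE hv rext) //; congr ((map_poly _ _).[_]); apply/polyP => i.
  rewrite coef_poly (coef_res hvE); case: ltnP => [li|di].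
    by rewrite insubT ffunE.
  by rewrite nth_default ?(res0 hvE) // (leq_trans _ di) // size_ltd.
have bij : bijective ev.
  pose inv a := sval (cid (ev_surj a)).
  have invK a : ev (inv a) = a by rewrite /inv; case: cid.
  by exists inv => // f; apply: ev_inj; rewrite invK.
by rewrite -(bij_eq_card bij) card_ffun card_ord.
Qed.

(** The set behind [eta_bar] is inhabited: - [piE]^2 is at once a norm and a uniformizer of [F], so
    a power of it brings [et] to a unit. *)
Lemma eta_bar_spec : exists u z, [/\ u != 0, @up_vF _ _ _ _ _ _ _ _ _ B u = 0, z != 0,
  up_incl B et = up_incl B u * (z * ubar z) & eta_bar et = @up_resF _ _ _ _ _ _ _ _ _ B u].
Proof.
rewrite /eta_bar; set S := (X in xget 0 X).
suff [a Sa] : exists a, S a by have [u [z [*]]] := xgetI 0 Sa; exists u, z.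
have [pi0 vpi] := hpiE.
have [c Ec] : exists c : F, piE ^+ 2 = c%:A.
  by apply: (bar_fix k2 hE hdim hpiE hbar); rewrite rmorphXn /= hbar sqrrN.
have c0 : c != 0.
  by apply: contraNneq pi0 => c0; have := Ec; rewrite c0 scale0r => /eqP; rewrite expf_eq0.
have vc : vF c = 1.
  have := hram c0; rewrite -[in_alg E c]/(c%:A : E) -Ec (vX hvE) // vpi.
  by move/(pmulrnI (isT : (0 < 2)%N)).
have hvF' := valued_local (up_lfF B).
pose w : up_F B := (- c)%:A.
have w0 : w != 0 by rewrite scaler_eq0 oppr_eq0 (negbTE c0) oner_eq0.
have vw : @up_vF _ _ _ _ _ _ _ _ _ B w = 1.
  have nc0 : - c != 0 by rewrite oppr_eq0.
  by rewrite [LHS](up_unramF B nc0) (vN (valued_local hF)) vc.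
set m := @up_vF _ _ _ _ _ _ _ _ _ B et.
have vXz (x : up_F B) (e : int) : x != 0 ->
    @up_vF _ _ _ _ _ _ _ _ _ B (x ^ e) = @up_vF _ _ _ _ _ _ _ _ _ B x *~ e.
  move=> x0; case: e => e; first exact: (vX hvF').
  by rewrite NegzE -exprnN (vV hvF') ?expf_neq0 // (vX hvF') // mulrNz.
pose z : Ej := (ia piE) ^ m; pose u := et * w ^ (- m).
have z0 : z != 0 by rewrite expfz_neq0 // fmorph_eq0.
exists (@up_resF _ _ _ _ _ _ _ _ _ B u), u, z; split=> //.
- by rewrite mulf_neq0 ?expfz_neq0.
- rewrite (val_mul (vd_val hvF')) ?expfz_neq0 // vXz // vw -/m.
  by rewrite intz subrr.
- have -> : z * up_bar B z = up_incl B (w ^ m).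
    have -> : up_bar B z = (up_bar B (ia piE)) ^ m := fmorphXz _ _ _.
    have -> : up_incl B (w ^ m) = (up_incl B w) ^ m := fmorphXz _ _ _.
    rewrite -expfzMl; congr (_ ^ _); rewrite [up_bar B _](up_barE B piE) hbar up_inclF.
    rewrite -[ia piE]/(piE%:A : Ej) -scalerAl mul1r scalerA mulrN -expr2 Ec.
    by rewrite !scaleNr.
  by rewrite -rmorphM -mulrA -expfzDr // addNr expr0z mulr1.
Qed.

(* With [Q] the Lagrange polynomial of [t] among its conjugates, the vector
   [sum_k s(Q_k) phi(t^k)] pairs with [phi x] to [s(eta x)]. *)
Lemma block_vector : exists (v : 'cV[D]_n) (H : D),
  block_spec piE pj phi th d (qchar (eta_bar et)) v tau H.
Proof.
have [Q [b [sQ Qt Eb HQ]]] := lagrange.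
have [u [z [u0 vu z0 Eu Ea]]] := eta_bar_spec.
have [h hh] := iter_rmorph fr d.
pose v0 : 'cV[D]_n := \sum_(i < d) s Q`_i *: map_mx emb (phi (t ^+ i)).
have bK x : bM (bM x) = x := ud_barK x.
have herm_emb x y : herm bM (map_mx emb (phi x)) (map_mx emb (phi y)) =
    s (galTrace 1 {: Ej} (up_incl B et * x * ubar y)).
  by rewrite -hform -[_%:A]/(ia _) s_ia; apply: herm_map => e; apply: ud_bar_emb.
have mapQ : map_poly ubar Q = Q.
  have EQ' : map_poly ubar Q * ('X - t%:P) = ubar b *: map_poly ia P.
    have := congr1 (map_poly ubar) Eb.
    rewrite rmorphM rmorphB /= map_polyX map_polyC /= [up_bar B t]ubar_t => ->.
    rewrite map_polyZ /= -[in RHS]bar_P -!map_poly_comp; congr (_ *: _).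
    by apply: eq_map_poly => f /=; rewrite /ubar up_barE.
  have Xt0 : 'X - t%:P != 0 by rewrite polyXsubC_eq0.
  have E1 : b *: map_poly ubar Q = ubar b *: Q.
    by apply: (mulIf Xt0); rewrite -!scalerAl EQ' Eb !scalerA mulrC.
  have b0 : b != 0.
    apply/eqP => b0; move: Eb; rewrite b0 scale0r => /eqP; rewrite mulf_eq0 (negbTE Xt0) orbF.
    by move/eqP => Q0; move: Qt; rewrite Q0 horner0 => /esym/eqP; rewrite oner_eq0.
  have E2 : ubar b = b.
    have := congr1 (fun g : {poly Ej} => g.[t]) E1.
    have -> : (b *: map_poly ubar Q).[t] = b * (map_poly ubar Q).[ubar t].
      by rewrite hornerZ ubar_t.
    by rewrite horner_map hornerZ /= Qt rmorph1 !mulr1.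
  by apply: (scalerI b0); rewrite E1 E2.
have ubQ i : ubar Q`_i = Q`_i by rewrite -[in RHS]mapQ coef_map.
have form_v0 x : herm bM (map_mx emb (phi x)) v0 = s (up_incl B et * x).
  rewrite herm_sumr -[in RHS](HQ (up_incl B et * x)) rmorph_sum; apply: eq_bigr => i _.
  rewrite hermZr herm_emb s_bar ubQ -rmorphM; congr (s (_ * galTrace _ _ (_ * _))).
  by rewrite /ubar rmorphXn /= [up_bar B t]ubar_t.
have form_v : herm bM v0 v0 = s (up_incl B et).
  rewrite {1}/v0 herm_suml.
  under eq_bigr => i _ do rewrite hermZl form_v0 -rmorphM mulrCA.
  by rewrite -rmorph_sum -mulr_sumr -horner_coef_wide // Qt mulr1.
have sz0 : s z != 0 by rewrite fmorph_eq0.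
have iu : up_incl B u != 0 by rewrite fmorph_eq0.
have vu' : vj (up_incl B u) = 0.
  apply: (hom_units (up_lfF B) (w := vj \o up_incl B)) => // x y x0 y0 /=.
  by rewrite rmorphM (val_mul (vd_val hv)) ?fmorph_eq0.
have hu : vge vj 0 (up_incl B u) by rewrite vgeE // vu'.
have h2 : (2%:R : up_k B) != 0 by rewrite -(rmorph_nat (up_rho B)) fmorph_eq0.
have uF : vge (@up_vF _ _ _ _ _ _ _ _ _ B) 0 u by rewrite vgeE // vu.
have ru : @up_resF _ _ _ _ _ _ _ _ _ B u != 0 by have [] := unit_res (valued_local (up_lfF B)) u0 vu.
have [Eq sq] := euler_qchar h2 ru.
(* [v0] has form value [s] of eta = u z [ubar z]; dividing by [s z] leaves the unit part u. *)
pose v := (s z)^-1 *: v0; exists v, (s (up_incl B u)); split=> //.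
- apply/colP=> i; rewrite !mxE -hh !summxE rmorphM fmorphV rmorph_sum /=.
  rewrite [h (s z)]hh s_fr; congr (_ * _); apply: eq_bigr => j _.
  by rewrite !mxE rmorphM /= [h (s _)]hh s_fr hh iter_fr_emb.
- exists (fun i => (s z)^-1 * s Q`_i), (fun i => t ^+ i).
  by rewrite /v scaler_sumr; apply: eq_bigr => i _; rewrite scalerA.
- move=> x; rewrite !hermZr !form_v0.
  have -> : emb piE * tau = s th.
    have [pi0 _] := hpiE; have -> : th = ia piE * t; last by rewrite rmorphM s_ia s_t.
    by rewrite /t -[ia piE]/(piE%:A : Ej) -scalerAl mul1r scalerA mulfV // scale1r.
  by rewrite (mulrCA (up_incl B et)) (rmorphM s th) [LHS]mulrCA.
- rewrite hermZl hermZr form_v Eu !rmorphM fmorphV s_bar /=.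
  have sz0' : s (ubar z) != 0 by rewrite !fmorph_eq0.
  by rewrite [s (up_incl B u) * _]mulrC -mulrA mulrCA !mulrA; field; rewrite sz0 sz0'.
- by rewrite fmorph_eq0.
- exact: s_unit.
- by rewrite s_bar [ubar _]up_barF.
- exact: s_fr.
- by rewrite Ea.
- rewrite Ea; apply: s_res_sign => //.
  by rewrite [rj _](up_resEF uF) /= Eq card_up_k.
Qed.

End Hom.
End Embed.
End Lift.

End Block.

Lemma block_exists (F : fieldType) (k : finFieldType) (vF : F -> int) (resF : F -> k)
    (hF : local_field vF resF) (k2 : (2%:R : k) != 0) (E : fieldExtType F) (vE : E -> int)
    (resE : E -> k) (hE : local_field vE resE) (hdim : \dim {: E} = 2%N)
    (hram : val_ext (in_alg E) vF vE 2) (bar : {lrmorphism E -> E})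
    (piE : E) (hpiE : uniformizer vE piE) (hbar : bar piE = - piE)
    (kbar : closedFieldType) (rho : {rmorphism k -> kbar})
    (L : fieldType) (iota : {rmorphism E -> L}) (N : nat) (D : urdata vE resE bar rho iota N)
    (pj : {poly k}) (mpj : pj \is monic) (ipj : irreducible_poly pj)
    (B : unram_pair vF resF vE resE bar (size pj).-1) (n : nat) (Y : 'M[E]_n.+1)
    (phi : {linear up_E B -> 'cV[E]_n.+1}) (th : up_E B) (et : up_F B) :
  isom_lie bar Y -> et != 0 ->
  (forall x y, (herm bar (phi x) (phi y))%:A =
    galTrace 1 {: up_E B} (up_incl B et * x * up_bar B y)) ->
  (forall x, Y *m phi x = phi (th * x)) ->
  vge (@up_vE _ _ _ _ _ _ _ _ _ B) 0 (piE^-1 *: th) /\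
    root (map_poly (up_rho B) pj) (up_resE (piE^-1 *: th)) ->
  ((size pj).-1 %| N)%N ->
  exists (P : {poly E}) (v : 'cV[D]_n.+1) (tau H : D), [/\ P \is monic, vpoly vE 0 P,
    map_poly resE P = pj,
    (forall x, horner_mx (piE^-1 *: Y) P *m phi x = 0) /\
      (map_poly (ud_emb D) P).[tau] = 0 &
    block_spec piE pj phi th (size pj).-1 (qchar (eta_bar et)) v tau H].
Proof.
move=> hY et0 hform hstab hfac dN.
have [P [mP vP rP Pt]] := min_poly hE mpj ipj hfac.
have [tau [vt rt Pt' it bt]] := exists_tau hE hpiE hbar mpj ipj hY et0 hform hstab hfac
  (rho := rho) mP vP rP Pt D dN.
have [s sE] := exists_hom hE ipj hfac (rho := rho) mP rP Pt Pt'.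
have [v [H h]] := block_vector hF k2 hE hdim hram hpiE hbar mpj ipj hY et0 hform hstab hfac
  mP vP rP Pt vt it bt rt sE.
have XP x : (piE^-1 *: Y) *m phi x = phi (piE^-1 *: th * x).
  by rewrite -scalemxAl hstab -linearZ /= scalerAl.
exists P, v, tau, H; split=> //; split=> // x.
have -> : horner_mx (piE^-1 *: Y) P *m phi x =
    phi ((map_poly (in_alg (up_E B)) P).[piE^-1 *: th] * x); last by rewrite Pt mul0r linear0.
elim/poly_ind: P x {mP vP rP Pt Pt' sE} => [|p c IH] x.
  by rewrite !rmorph0 horner0 mul0r linear0 mul0mx.
rewrite !rmorphD !rmorphM /= horner_mx_X horner_mx_C map_polyX map_polyC /= !hornerE.
rewrite mulmxDl -[_ * _]/(_ *m _) -mulmxA XP IH mul_scalar_mx -linearZ -linearD /=.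
by rewrite mulrDl mulr_algl mulrA.
Qed.

(** * Stability and reduction of matrices *)

Lemma closed_infinite (K : closedFieldType) (s : seq K) : exists t, t \notin s.
Proof.
pose p : {poly K} := \prod_(z <- 0 :: s) ('X - z%:P) + 1.
have sp : size p != 1.
  have sz : size (\prod_(z <- 0 :: s) ('X - z%:P)) = (size s).+2 by rewrite size_prod_XsubC.
  by rewrite /p size_polyDl ?sz // size_poly1.
have /closed_rootP[t] := sp; rewrite /root hornerD hornerC => pt; exists t.
apply/negP => ts; move: pt; rewrite (_ : _.[t] = 0) ?add0r ?oner_eq0 //.
by apply/rootP; rewrite root_prod_XsubC inE ts orbT.
Qed.

Lemma infinite_family (K : closedFieldType) (V : choiceType) (S : set V) (bad : seq K) (f : K -> V) :
  (forall t, t \notin bad -> S (f t)) ->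
  (forall t t', t \notin bad -> t' \notin bad -> f t = f t' -> t = t') -> ~ finite_set S.
Proof.
move=> hS hf /finite_seqP[s Es].
have [ts [uts bts sts]] : exists ts : seq K,
    [/\ uniq ts, {in ts, forall t, t \notin bad} & size ts = (size s).+1].
  elim: (size s).+1 => [|e [ts [uts bts sts]]]; first by exists [::].
  have [t] := closed_infinite (bad ++ ts); rewrite mem_cat negb_or => /andP[tb tt].
  exists (t :: ts); rewrite /= tt uts sts; split=> // x; rewrite inE => /orP[/eqP -> //|].
  exact: bts.
have : (size (map f ts) <= size s)%N.
  apply: uniq_leq_size.
    by rewrite map_inj_in_uniq // => x y hx hy; apply: hf; apply: bts.
  by move=> _ /mapP[t tts ->]; have := hS t (bts t tts); rewrite Es.
by rewrite size_map sts ltnn.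
Qed.

Section Eigenplane.
Variables (K : closedFieldType) (n : nat) (A : 'M[K]_n) (x : K).
Hypothesis K2 : (2%:R : K) != 0.
Hypothesis hA : A^T *m antidiag K n = antidiag K n *m A.
Local Notation J := (antidiag K n).
Local Notation b := (herm (@idfun K)).
Implicit Types u v w y z : 'cV[K]_n.

Lemma rank1E v w y : v *m (w^T *m J) *m y = b w y *: v.
Proof.
rewrite -mulmxA [w^T *m J *m y]mx11_scalar mul_mx_scalar; congr (_ *: _).
rewrite (hermE idfun) (_ : map_mx idfun y = y) //; apply/matrixP=> i j; rewrite mxE //.
Qed.

Lemma bC v w : b v w = b w v. Proof. exact: (herm_sym v w (c := idfun)). Qed.

Lemma comm_rank1 v w : A *m v = x *: v -> A *m w = x *: w ->
  A *m (v *m (w^T *m J)) = (v *m (w^T *m J)) *m A.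
Proof.
move=> hv hw; rewrite mulmxA hv -!mulmxA -hA (mulmxA _ A^T) -trmx_mul hw linearZ /=.
by rewrite -!scalemxAl -scalemxAr.
Qed.

Lemma indep_swap u w : (forall a c, a *: u + c *: w = 0 -> a = 0 /\ c = 0) ->
  forall a c, a *: w + c *: u = 0 -> a = 0 /\ c = 0.
Proof. by move=> ind a c; rewrite addrC => /ind[]. Qed.

Lemma reflection_isom v y z : b v v != 0 ->
  b (y - (2%:R / b v v * b v y) *: v) (z - (2%:R / b v v * b v z) *: v) = b y z.
Proof.
move=> q0; rewrite -!scaleNr !hermDl !hermDr !hermZl !hermZr /= (bC y v).
by field.
Qed.

(** Reflections in the anisotropic vectors u + t w commute with the self-adjoint [A]; all but
    finitely many t qualify, and distinct t give distinct reflections. *)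
Lemma reflections_infinite u w : A *m u = x *: u -> A *m w = x *: w ->
  (forall a c, a *: u + c *: w = 0 -> a = 0 /\ c = 0) -> b u u != 0 ->
  ~ finite_set (isom_cent id A).
Proof.
move=> hu hw ind q0.
pose v t := u + t *: w.
pose pq : {poly K} := (b w w) *: 'X^2 + (2%:R * b u w) *: 'X + (b u u)%:P.
have qE t : b (v t) (v t) = pq.[t].
  rewrite /v !hermDl !hermDr !hermZl !hermZr (bC w u) /=.
  by rewrite !hornerD !hornerZ hornerXn hornerX hornerC; ring.
have pq0 : pq != 0.
  by apply: contraNneq q0 => E0; have := qE 0; rewrite E0 horner0 /v scale0r addr0 => ->.
have [rs Ers] := closed_field_poly_normal pq.
have qn0 t : t \notin rs -> b (v t) (v t) != 0.
  move=> ht; rewrite qE; apply: contra ht; rewrite Ers hornerZ mulf_eq0 lead_coef_eq0 (negbTE pq0).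
  by rewrite -[_ == 0]/(root _ t) root_prod_XsubC.
have hv t : A *m v t = x *: v t.
  by rewrite mulmxDr -scalemxAr hu hw scalerDr !scalerA mulrC.
pose g t := 1%:M - (2%:R / b (v t) (v t)) *: (v t *m ((v t)^T *m J)).
have gE t y : g t *m y = y - (2%:R / b (v t) (v t) * b (v t) y) *: v t.
  by rewrite mulmxBl mul1mx -scalemxAl rank1E scalerA.
apply: (infinite_family (bad := rs) (f := g)) => [t ht|t t' ht ht' Eg].
  split=> [y z|].
    by rewrite !gE; apply: reflection_isom; apply: qn0.
  by rewrite mulmxBl mulmxBr mul1mx mulmx1 -scalemxAl -scalemxAr (comm_rank1 (hv t) (hv t)).
have := gE t (v t); rewrite Eg gE divfK ?qn0 // => /eqP.
rewrite (inj_eq (addrI _)) eqr_opp -subr_eq0 /v !scalerDr !scalerA.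
set e := _ * _ => /eqP E1.
have [|E2 E3] := ind (e - 2%:R) (e * t' - 2%:R * t).
  by rewrite -E1 !scalerBl opprD addrACA.
have E4 : e = 2%:R by apply/eqP; rewrite -subr_eq0 E2.
by move: E3; rewrite E4 -mulrBr => /eqP; rewrite mulf_eq0 (negbTE K2) subr_eq0 => /eqP.
Qed.

(** If one of u, w, u + w is anisotropic, reflections do. Otherwise the plane is totally isotropic
    and carries a one-parameter family of orthogonal transvections. *)
Lemma eigenplane_infinite u w : A *m u = x *: u -> A *m w = x *: w ->
  (forall a c, a *: u + c *: w = 0 -> a = 0 /\ c = 0) -> ~ finite_set (isom_cent id A).
Proof.
move=> hu hw ind.
have [qu|qu] := eqVneq (b u u) 0; last exact: (reflections_infinite hu hw).
have [qw|qw] := eqVneq (b w w) 0; last exact: (reflections_infinite hw hu (indep_swap ind)).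
have [quw|quw] := eqVneq (b u w) 0; last first.
  apply: (@reflections_infinite (u + w) w) => //.
  - by rewrite mulmxDr hu hw scalerDr.
  - move=> a c; rewrite scalerDr -addrA -scalerDl => /ind[a0]; rewrite a0 add0r => c0.
    by split.
  - by rewrite !hermDl !hermDr (bC w u) qu qw addr0 add0r -mulr2n -mulr_natl mulf_neq0.
pose M := w *m (u^T *m J) - u *m (w^T *m J).
have ME y : M *m y = b u y *: w - b w y *: u by rewrite mulmxBl !rank1E.
pose g t := 1%:M + t *: M.
have gE t y : g t *m y = y + t *: (b u y *: w) - t *: (b w y *: u).
  by rewrite mulmxDl mul1mx -scalemxAl ME scalerBr addrA.
have bN y z a : b (- (a *: y)) z = - (a * b y z) by rewrite -scaleNr hermZl mulNr.
have bN' y z a : b y (- (a *: z)) = - (a * b y z) by rewrite -scaleNr hermZr mulNr.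
apply: (infinite_family (bad := [::]) (f := g)) => [t _|t t' _ _ Eg].
  split=> [y z|].
    rewrite -[herm id]/b !gE !hermDl !hermDr !bN !bN' !hermZl !hermZr /= (bC w u) (bC y u) (bC y w).
    by rewrite qu qw quw; ring.
  rewrite mulmxDl mulmxDr mul1mx mulmx1 -scalemxAl -scalemxAr mulmxBl mulmxBr.
  by rewrite (comm_rank1 hu hw) (comm_rank1 hw hu).
have : (t - t') *: M = 0 by rewrite scalerBl; apply/eqP; rewrite subr_eq0; apply/eqP/(addrI 1%:M).
move/eqP; rewrite scaler_eq0 subr_eq0 => /orP[/eqP //|/eqP M0].
have u0 : u = 0.
  apply: (@herm_nondeg _ idfun) => // y; have := ME y; rewrite M0 mul0mx => /esym.
  by rewrite addrC -scaleNr => /ind[_]; rewrite bC.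
by have [] := ind 1 0; rewrite ?u0 ?scaler0 ?scale0r ?addr0 // => /eqP; rewrite oner_eq0.
Qed.

End Eigenplane.

(** Coranks of a product add up at most, so if each of the at most n factors had corank at most 1,
    their product would not vanish in size n + 1. *)
Lemma prod_eigenplane (K : fieldType) n (A : 'M[K]_n.+1) (s : seq K) : (size s <= n)%N ->
  \prod_(x <- s) (A - x%:M) = 0 -> exists x (u w : 'cV[K]_n.+1), [/\ A *m u = x *: u, A *m w = x *: w &
  forall a c, a *: u + c *: w = 0 -> a = 0 /\ c = 0].
Proof.
move=> sn P0.
have [x hx] : exists x, (\rank (A - x%:M)%R < n)%N.
  apply: contrapT => /forallNP H.
  have rk x : (n <= \rank (A - x%:M)%R)%N by rewrite leqNgt; apply/negP/H.
  have : (n.+1 - size s <= \rank (\prod_(x <- s) (A - x%:M))%R)%N.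
    elim: s {sn P0} => [|x s IH]; first by rewrite big_nil subn0 mxrank1.
    rewrite big_cons -[_ * _]/(_ *m _) /=.
    have := mxrank_mul_min (A - x%:M) (\prod_(y <- s) (A - y%:M)); have := rk x.
    move: IH; set r1 := \rank (\prod_(y <- s) _)%R; set r2 := \rank (_ - _)%R; set r3 := \rank (_ *m _).
    by move: r1 r2 r3 => r1 r2 r3; lia.
  by rewrite P0 mxrank0; lia.
pose Kx := kermx (A - x%:M)^T.
have rk : (1 < \rank Kx)%N by rewrite mxrank_ker mxrank_tr; lia.
pose rw i := (row i (row_base Kx))^T.
have eig i : A *m rw i = x *: rw i.
  have : (row i (row_base Kx) <= Kx)%MS by rewrite (submx_trans (row_sub _ _)) ?eq_row_base.
  move/sub_kermxP => E0; apply: trmx_inj; rewrite trmx_mul linearZ /= trmxK.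
  move: E0; rewrite linearB /= mulmxBr tr_scalar_mx mul_mx_scalar => /eqP.
  by rewrite subr_eq0 => /eqP.
pose i0 : 'I_(\rank Kx) := Ordinal (ltnW rk); pose i1 : 'I_(\rank Kx) := Ordinal rk.
exists x, (rw i0), (rw i1); split=> // a c E0.
pose y : 'rV[K]_(\rank Kx) := a *: delta_mx 0 i0 + c *: delta_mx 0 i1.
have y0 : y = 0.
  apply: (row_free_inj (row_base_free Kx)); rewrite mul0mx mulmxDl -!scalemxAl -!rowE.
  by apply: trmx_inj; rewrite linearD !linearZ /= E0 trmx0.
have i01 : (i0 == i1) = false by [].
by split; [move/rowP/(_ i0): y0|move/rowP/(_ i1): y0];
  rewrite !mxE !eqxx /= ?i01 ?(eq_sym i1) ?i01 ?mulr1 ?mulr0 ?addr0 ?add0r.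
Qed.

(** * Integral matrices and their reduction *)

Section Reduction.
Variables (K kappa : fieldType) (v : K -> int) (res : K -> kappa).
Hypothesis hv : valued v res.
Definition integral_mx m n (X : 'M[K]_(m, n)) := forall i j, vge v 0 (X i j).

Lemma int_mxM m n p (X : 'M_(m, n)) (Y : 'M_(n, p)) :
  integral_mx X -> integral_mx Y -> integral_mx (X *m Y).
Proof. by move=> hX hY i j; rewrite mxE; apply: (vge_sum hv) => l _; apply: (vge_mull hv). Qed.

Lemma res_mxM m n p (X : 'M_(m, n)) (Y : 'M_(n, p)) : integral_mx X -> integral_mx Y ->
  map_mx res (X *m Y) = map_mx res X *m map_mx res Y.
Proof.
move=> hX hY; apply/matrixP=> i j; rewrite !mxE (res_sum hv) => [|l _]; last exact: (vge_mull hv).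
by apply: eq_bigr => l _; rewrite !mxE (vd_mul hv).
Qed.

Lemma int_scalar n a : vge v 0 a -> integral_mx (a%:M : 'M_n).
Proof. by move=> ha i j; rewrite mxE; case: eqP => _; rewrite ?mulr1n ?mulr0n ?vge0. Qed.

Lemma res_scalar n a : map_mx res (a%:M : 'M_n) = (res a)%:M.
Proof.
by apply/matrixP=> i j; rewrite !mxE; case: eqP => _; rewrite ?mulr1n ?mulr0n ?(res0 hv).
Qed.

Lemma int_mxD m n (X Y : 'M_(m, n)) : integral_mx X -> integral_mx Y -> integral_mx (X + Y).
Proof. by move=> hX hY i j; rewrite mxE; apply: (vge_add hv). Qed.

Lemma res_mxD m n (X Y : 'M_(m, n)) : integral_mx X -> integral_mx Y ->
  map_mx res (X + Y) = map_mx res X + map_mx res Y.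
Proof. by move=> hX hY; apply/matrixP=> i j; rewrite !mxE (vd_add hv). Qed.

Lemma int_mxN m n (X : 'M_(m, n)) : integral_mx X -> integral_mx (- X).
Proof. by move=> hX i j; rewrite mxE (vgeN hv). Qed.

Lemma res_mxN m n (X : 'M_(m, n)) : integral_mx X -> map_mx res (- X) = - map_mx res X.
Proof. by move=> hX; apply/matrixP=> i j; rewrite !mxE (resN hv). Qed.

Lemma res_horner_mx n (X : 'M_n.+1) (P : {poly K}) : integral_mx X -> vpoly v 0 P ->
  integral_mx (horner_mx X P) /\
  map_mx res (horner_mx X P) = horner_mx (map_mx res X) (map_poly res P).
Proof.
move=> hX; elim/poly_ind: P => [|P c IH] hP.
  rewrite !rmorph0 map_polyE /= ?polyseq0 /= /Poly /= rmorph0; split=> [i j|].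
    by rewrite mxE vge0.
  by apply/matrixP=> i j; rewrite !mxE (res0 hv).
have hPi : vpoly v 0 P by move=> i; have := hP i.+1; rewrite coefD coefMX coefC addr0.
have hc : vge v 0 c by have := hP 0; rewrite coefD coefMX coefC add0r.
have [I1 I2] := IH hPi.
rewrite !rmorphD !rmorphM /= horner_mx_X horner_mx_C -[_ * X]/(_ *m X).
have I3 := int_mxM I1 hX; have I4 := @int_scalar n.+1 _ hc.
split; first exact: int_mxD.
rewrite res_mxD // res_mxM // res_scalar I2 (res_polyD hv) ?(res_polyM hv) //; last first.
- exact: vpolyC.
- by apply: (vpoly0M hv) => //; apply: (vpolyX hv).
- exact: (vpolyX hv).
by rewrite (res_polyX hv) (res_polyC hv) rmorphD rmorphM /= horner_mx_X horner_mx_C.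
Qed.

(* [Pr] rescaled to be primitive would be killed by both residual polynomials. *)
Lemma proj_integral n (X Pr : 'M[K]_n.+1) (P Q : {poly K}) : integral_mx X -> vpoly v 0 P ->
  vpoly v 0 Q -> coprimep (map_poly res P) (map_poly res Q) ->
  horner_mx X P *m Pr = 0 -> horner_mx X Q *m (1%:M - Pr) = 0 -> integral_mx Pr.
Proof.
move=> hX hP hQ cPQ EP EQ.
have [[i0 [j0 n0]]|/forallNP al0] := pselect (exists i j, Pr i j != 0); last first.
  move=> i j; have -> : Pr i j = 0; last exact: vge0.
  by apply/eqP/negPn/negP => ne; apply: (al0 i); exists j.
case: (@arg_minP _ _ _ (i0, j0) (fun z => Pr z.1 z.2 != 0) (fun z => v (Pr z.1 z.2)) n0).
move=> [i1 j1] /=; set a := Pr i1 j1 => a0 amin.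
have amin' i j : vge v (v a) (Pr i j).
  rewrite /vge; have [//|ne] := eqVneq (Pr i j) 0; exact: (amin (i, j)).
have [va|va] := leP 0 (v a); first by move=> i j; apply: (vge_le va).
exfalso; pose Pr' := a^-1 *: Pr.
have hai : vge v 1 a^-1 by rewrite vgeE ?invr_eq0 // (vV hv) //; lia.
have hPr' : integral_mx Pr'.
  move=> i j; rewrite mxE; have := vge_mul hv (_ : vge v (- v a) a^-1) (amin' i j).
  by rewrite addNr; apply; rewrite vgeE ?invr_eq0 // (vV hv).
have [I1 R1] := res_horner_mx hX hP; have [I2 R2] := res_horner_mx hX hQ.
have E1 : horner_mx (map_mx res X) (map_poly res P) *m map_mx res Pr' = 0.
  rewrite -R1 -res_mxM // /Pr' -scalemxAr EP scaler0.
  by apply/matrixP=> i j; rewrite !mxE (res0 hv).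
have E2 : horner_mx (map_mx res X) (map_poly res Q) *m map_mx res Pr' = 0.
  have E3 : horner_mx X Q *m Pr' = a^-1 *: horner_mx X Q.
    rewrite /Pr' -scalemxAr; congr (_ *: _).
    by move/eqP: EQ; rewrite mulmxBr mulmx1 subr_eq0 => /eqP.
  rewrite -R2 -res_mxM // E3; apply/matrixP=> i j; rewrite !mxE.
  have h1 := vge_mulr hv hai (I2 i j).
  by apply/eqP; rewrite (vd_ker hv) //; apply: vge10.
have [[u w] /= /eqP Buw] := Bezout_eq1_coprimepP _ _ cPQ.
have : map_mx res Pr' = 0.
  rewrite -[LHS]mul1mx -[1%:M]/(1 : 'M_n.+1) -(rmorph1 (horner_mx (map_mx res X))) -(eqP Buw).
  rewrite rmorphD !rmorphM /= mulmxDl -!mulmxE -!mulmxA E1 E2 !mulmx0 addr0 //.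
move/matrixP/(_ i1 j1); rewrite !mxE -/a mulVf // (vd_one hv) => /eqP.
by rewrite oner_eq0.
Qed.

End Reduction.

(** A polynomial in the self-adjoint [A] is self-adjoint, and being orthogonal it squares to 1. So c
    - 1 has powers proportional to itself and cannot be a nonzero nilpotent on the image of 1 -
    [Pr]; on that of [Pr], c is -1. *)
Lemma unipotent_reduction (k : fieldType) n (A Pr : 'M[k]_n.+1) (p q u : {poly k}) m :
  (2%:R : k) != 0 -> A^T *m antidiag k n.+1 = antidiag k n.+1 *m A ->
  isom_grp id (horner_mx A u) -> horner_mx A p *m Pr = 0 -> horner_mx A q *m (1%:M - Pr) = 0 ->
  p %| u + 1 -> q %| (u - 1) ^+ m -> horner_mx A u = 1%:M - 2%:R *: Pr.
Proof.
move=> k2 hA hc EP EQ /dvdpP[p' Ep] /dvdpP[q' Eq]; set c := horner_mx A u in hc *.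
set J := antidiag k n.+1 in hA.
have hJ : c^T *m J = J *m c.
  rewrite /c; elim/poly_ind: (u) => [|f a IH]; first by rewrite rmorph0 trmx0 mul0mx mulmx0.
  rewrite rmorphD rmorphM /= horner_mx_X horner_mx_C -mulmxE linearD /= trmx_mul mulmxDl mulmxDr.
  rewrite tr_scalar_mx -scalar_mxC; congr (_ + _).
  by rewrite -mulmxA IH mulmxA hA -!mulmxA; congr (_ *m _); apply: comm_mx_horner.
have c2 : c * c = 1.
  have := (isom_grpE idfun c).1 hc; rewrite map_mx_id // hJ -mulmxA => E1.
  have := congr1 (mulmx J) E1; rewrite [LHS]mulmxA antidiag_sq mul1mx => E2.
  exact: E2.
have cP : (c + 1) *m Pr = 0.
  have -> : c + 1 = horner_mx A (u + 1) by rewrite rmorphD rmorph1.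
  by rewrite Ep rmorphM -mulmxE -mulmxA EP mulmx0.
have cm e : (c - 1) ^+ e.+1 = (- 2%:R) ^+ e *: (c - 1).
  elim: e => [|e IH]; first by rewrite expr1 expr0 scale1r.
  rewrite exprS IH -scalerAr exprSr -scalerA; congr (_ *: _).
  by rewrite mulrBl mulrBr c2 !mulr1 mul1r scaleNr scaler_nat mulr2n -(opprB c 1) -opprD.
have cQ : (c - 1) *m (1%:M - Pr) = 0.
  have E1 : (c - 1) ^+ m.+1 *m (1%:M - Pr) = 0.
    have -> : c - 1 = horner_mx A (u - 1) by rewrite rmorphB rmorph1.
    by rewrite exprS -rmorphXn -mulmxE -mulmxA /= Eq rmorphM -mulmxE -mulmxA EQ !mulmx0.
  have := E1; rewrite cm -scalemxAl => /eqP; rewrite scaler_eq0 expf_eq0 oppr_eq0 (negbTE k2) andbF.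
  by move/eqP.
have E1 : c *m Pr = - Pr by apply/eqP; rewrite -addr_eq0 -[X in _ + X]mul1mx -mulmxDl cP.
move: cQ; rewrite mulmxBr mulmx1 mulmxBl E1 mul1mx => /eqP.
rewrite subr_eq0 -opprD => /eqP E2.
by rewrite -[LHS](subrK 1) E2 addrC scaler_nat mulr2n.
Qed.

Lemma porbit_dvd (T : finType) (s : {perm T}) x r : (s ^+ r)%g x = x -> (#|porbit s x| %| r)%N.
Proof.
move=> sr; set l := #|porbit s x|.
have l0 : (0 < l)%N by apply/card_gt0P; exists x; apply: porbit_id.
have sl : (s ^+ l)%g x = x by rewrite permX iter_porbit.
have slX e : (s ^+ (e * l))%g x = x.
  elim: e => [|e IH]; first by rewrite mul0n expg0 perm1.
  by rewrite mulSn expgD permM sl IH.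
have : (s ^+ (r %% l))%g x = x.
  by move: sr; rewrite {1}(divn_eq r l) expgD permM slX.
rewrite permX => rl; have ml := ltn_pmod r l0.
have := nth_uniq x _ _ (uniq_traject_porbit s x); rewrite size_traject => /(_ _ _ ml l0).
by rewrite !nth_traject // rl eqxx => /esym/eqP/eqP.
Qed.

(** * Toral invariants as powers of residues in [kbar] *)

Section EigenData.
Variables (F : fieldType) (E : fieldExtType F) (k : finFieldType) (vE : E -> int) (resE : E -> k).
Variables (bar : {lrmorphism E -> E}) (kbar : closedFieldType) (rho : {rmorphism k -> kbar}).
Variables (L : fieldType) (iota : {rmorphism E -> L}) (N : nat).
Variable D : urdata vE resE bar rho iota N.
Hypothesis k2 : (2%:R : k) != 0.
Hypothesis barK : forall e, bar (bar e) = e.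
Hypothesis iota_bar : ~ (forall e, iota (bar e) = iota e).
Hypothesis hinf : forall s : seq L, exists t, t \notin s.
Hypothesis two_neq0 : (2%:R : L) != 0.
Variables (n : nat) (T : 'M[E]_n) (W : 'M[D]_n) (H y : 'I_n -> D) (pi : 'S_n).
Local Notation emb := (ud_emb D).
Local Notation fr := (ud_phi D).
Local Notation bM := (ud_bar D).
Local Notation incl := (ud_incl D).
Local Notation vM := (@ud_v _ _ _ _ _ _ _ _ _ _ _ D).
Local Notation rM := (@ud_res _ _ _ _ _ _ _ _ _ _ _ D).
Local Notation q := #|k|.
Let hvM : valued vM rM := ud_valued D.
Hypothesis hT : isom_lie bar T.
Hypothesis W_fr : forall i c, fr (W i c) = W i (pi c).
Hypothesis H_fr : forall c, fr (H c) = H (pi c).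
Hypothesis H_bar : forall c, bM (H c) = H c.
Hypothesis H0 : forall c, H c != 0.
Hypothesis vH : forall c, vM (H c) = 0.
Hypothesis W_form : W^T *m antidiag D n *m map_mx bM W = diag_mx (\row_c H c).
Hypothesis W_eig : map_mx emb T *m W = W *m diag_mx (\row_c y c).
Hypothesis y_inj : injective y.
Hypothesis piN : (pi ^+ N)%g = 1%g.

Local Notation WL := (map_mx incl W).
Local Notation W2 := (map_mx (incl \o bM) W).
Local Notation h := (\row_c incl (H c)).
Local Notation yL := (\row_c incl (y c)).
Local Notation hb := (fun c => rM (H c)).

Lemma eig_W : WL^T *m antidiag L n *m W2 = diag_mx h.
Proof.
have := congr1 (map_mx incl) W_form; rewrite !map_mxM map_trmx -map_mx_comp.
have -> : map_mx incl (antidiag D n) = antidiag L n.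
  by apply/matrixP=> i j; rewrite !mxE rmorph_nat.
by rewrite map_diag_mx => ->; congr diag_mx; apply/rowP=> c; rewrite !mxE.
Qed.

Lemma eig_h0 c : h 0 c != 0.
Proof. by rewrite mxE fmorph_eq0. Qed.

Lemma eig_y : map_mx iota T *m WL = WL *m diag_mx yL.
Proof.
have := congr1 (map_mx incl) W_eig; rewrite !map_mxM map_diag_mx -map_mx_comp.
have -> : map_mx (incl \o emb) T = map_mx iota T.
  by apply/matrixP=> i j; rewrite !mxE /= ud_incl_emb.
by move=> ->; congr (_ *m diag_mx _); apply/rowP=> c; rewrite !mxE.
Qed.

Lemma eig_y_inj c d : yL 0 c = yL 0 d -> c = d.
Proof. by rewrite !mxE => /fmorph_inj/y_inj. Qed.

Lemma W_iter r i c : iter r fr (W i c) = W i ((pi ^+ r)%g c).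
Proof. by elim: r => [|r IH]; rewrite ?expg0 ?perm1 //= IH W_fr expgSr permM. Qed.

Lemma H_iter r c : iter r fr (H c) = H ((pi ^+ r)%g c).
Proof. by elim: r => [|r IH]; rewrite ?expg0 ?perm1 //= IH H_fr expgSr permM. Qed.

Lemma iter_bar r x : iter r fr (bM x) = bM (iter r fr x).
Proof. by elim: r => //= r ->; apply: ud_comm. Qed.

Lemma iter_emb r e : iter r fr (emb e) = emb e.
Proof. by elim: r => //= r ->; apply: ud_phi_emb. Qed.

Definition gincl (s : L -> L) r (b : bool) : Prop :=
  forall x, s (incl x) = incl (iter r fr (if b then bM x else x)).

Lemma gincl_gact s r b : gincl s r b -> gact bar iota WL W2 pi s r b.
Proof.
move=> hs; split=> [e|i c].
  rewrite -!(@ud_incl_emb _ _ _ _ _ _ _ _ _ _ _ D) hs; congr (incl _).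
  by case: b {hs}; rewrite ?ud_bar_emb iter_emb.
rewrite !mxE /= !hs; case: b {hs}; rewrite !mxE /= ?ud_barK ?iter_bar W_iter //.
Qed.

Lemma Gal_gincl (s : {rmorphism L -> L}) : Defs.Gal iota s -> exists r b, gincl s r b.
Proof.
by move/(@ud_gal _ _ _ _ _ _ _ _ _ _ _ D) => [r [[_ hs]|[_ hs]]]; exists r; [exists false|exists true].
Qed.

Lemma eig_gal (s : {rmorphism L -> L}) : Defs.Gal iota s ->
  exists r b, gact bar iota WL W2 pi s r b.
Proof. by case/Gal_gincl => r [b /gincl_gact]; exists r, b. Qed.

Lemma eig_ext r b : exists2 s : {rmorphism L -> L}, Defs.Gal iota s &
  gact bar iota WL W2 pi s r b.
Proof.
by have [s Gs hs] := ud_ext D r b; exists s => //; exact: (@gincl_gact s r b).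
Qed.

Local Notation al := (al bar iota T WL).
Local Notation rootE := (gal_rootE barK iota_bar eig_W eig_h0 eig_y eig_y_inj).
Local Notation alI := (al_inj hinf hT eig_W eig_h0 eig_y).

Lemma fr_fixed l r x : iter l fr x = x -> (l %| r)%N -> iter r fr x = x.
Proof.
move=> hl /dvdnP[e ->]; elim: e => // e IH; by rewrite mulSn iterD IH.
Qed.

Section Pair.
Variables a b : 'I_n.
Hypotheses (ab : a != b) (ns : noswap pi a b).
Local Notation l := #|porbit (pi2 pi) (a, b)|.

Lemma pair_period : (pi ^+ l)%g a = a /\ (pi ^+ l)%g b = b.
Proof.
have := iter_porbit (pi2 pi) (a, b); rewrite -permX pi2X => E1.
by split; [have := congr1 fst E1|have := congr1 snd E1].
Qed.

Lemma pair_dvd r : (pi ^+ r)%g a = a -> (pi ^+ r)%g b = b -> (l %| r)%N.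
Proof. by move=> ra rb; apply: porbit_dvd; rewrite pi2X ra rb. Qed.

Lemma stab_incl (s : {rmorphism L -> L}) : Defs.stab iota (al a b) s ->
  exists2 r, (l %| r)%N & forall x, s (incl x) = incl (iter r fr x).
Proof.
move=> [Gs hs]; have [r [f gs]] := Gal_gincl Gs.
have := (rootE a b (al a b) (gincl_gact gs) Gs.1).1 hs.
case: f gs => gs /(alI ab) [E1 E2]; first by case: (@ns r); split.
by exists r; [apply: pair_dvd; apply: esym|exact: gs].
Qed.

Lemma flip_incl (s : {rmorphism L -> L}) : Defs.flip iota (al a b) s ->
  exists2 r, (l %| r)%N & forall x, s (incl x) = incl (iter r fr (bM x)).
Proof.
move=> [Gs]; rewrite rootN_al => hs; have [r [f gs]] := Gal_gincl Gs.
have ba : b != a by rewrite eq_sym.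
have := (rootE a b (al b a) (gincl_gact gs) Gs.1).1 hs.
case: f gs => gs /(alI ba) [E1 E2]; last by case: (@ns r); split.
by exists r; [apply: pair_dvd; apply: esym|exact: gs].
Qed.

(** Gal(L/M) stabilizes the root, so F_alpha lies in [M] by [ud_fixed]; on [M] the stabilizer acts
    through powers of Frobenius divisible by the orbit length. *)
Lemma FalphaP u : Falpha iota (al a b) u <-> exists2 x, u = incl x & iter l fr x = x.
Proof.
have [la lb] := pair_period; split=> [hu|[x -> hx] s].
  have [x Ex] : exists x, u = incl x.
    apply: (@ud_fixed _ _ _ _ _ _ _ _ _ _ _ D) => s Gs hs; apply: hu; split=> //.
    have gs : gincl s 0 false by move=> x; rewrite hs.
    apply/(rootE a b _ (gincl_gact gs) Gs.1).
    by rewrite /twist expg0 !perm1.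
  exists x => //; have [s Gs hs] := ud_ext D l false.
  have hst : Defs.stab iota (al a b) s.
    have gs : gincl s l false := hs.
    split=> //; apply/(rootE a b _ (gincl_gact gs) Gs.1).
    by rewrite /twist la lb.
  by have := hu s hst; rewrite Ex hs => /fmorph_inj.
by move/stab_incl => [r lr ->]; rewrite (fr_fixed hx lr).
Qed.

Lemma flip_Falpha x (s : {rmorphism L -> L}) : iter l fr x = x -> Defs.flip iota (al a b) s ->
  s (incl x) = incl (bM x).
Proof.
move=> hx /flip_incl[r lr ->]; rewrite iter_bar (fr_fixed hx lr) //.
Qed.

Lemma res_iter r x : vge vM 0 x -> vge vM 0 (iter r fr x) /\ rM (iter r fr x) = rM x ^+ (q ^ r).
Proof.
move=> hx; elim: r => [|r [IH1 IH2]]; first by rewrite expr1.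
split=> /=; last by rewrite ud_phi_res // IH2 -exprM expnSr.
by move: IH1; rewrite /vge fmorph_eq0 ud_phi_v.
Qed.

Lemma H_int c : vge vM 0 (H c). Proof. by rewrite vgeE // vH. Qed.

Local Notation u := (- (H a * H b)).
Local Notation ub := (- (hb a * hb b)).

Lemma u_unit : [/\ u != 0, vM u = 0, vge vM 0 u & rM u = ub].
Proof.
have u0 : u != 0 by rewrite oppr_eq0 mulf_neq0.
have vu : vM u = 0 by rewrite (vN hvM) (val_mul (vd_val hvM)) ?H0 // !vH addr0.
split=> //; first by rewrite vgeE // vu.
by rewrite (resN hvM) ?(vd_mul hvM) ?(vge_mull hvM) ?H_int.
Qed.

Lemma u_res0 : ub != 0.
Proof. by have [u0 vu _ <-] := u_unit; have [] := unit_res hvM u0 vu. Qed.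

Lemma u_fr : iter l fr u = u.
Proof.
have [la lb] := pair_period; have [hh hE] := iter_rmorph fr l.
by rewrite -hE rmorphN rmorphM /= !hE !H_iter la lb.
Qed.

Lemma ub_fr : ub ^+ (q ^ l) = ub.
Proof. by have [_ _ iu <-] := u_unit; rewrite -(res_iter l iu).2 u_fr. Qed.

Lemma half_double : (((q ^ l).-1)./2).*2 = (q ^ l).-1.
Proof.
have oq : odd (q ^ l) by rewrite oddX (odd_card k2) orbT.
have q0 : (0 < q ^ l)%N by rewrite expn_gt0 (q_gt0 k).
rewrite -[RHS]odd_double_half; have -> : odd (q ^ l).-1 = false; last by rewrite add0n.
by move: oq; rewrite -{1}(prednK q0) /= => /negbTE.
Qed.

Lemma unity_fr (w : kbar) : w != 0 -> (w ^+ (q ^ l).-1 = 1) <-> (w ^+ (q ^ l) = w).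
Proof.
move=> w0; have q0 : (0 < q ^ l)%N by rewrite expn_gt0 (q_gt0 k).
rewrite -{2}(prednK q0) exprS; split=> [->|h1]; first by rewrite mulr1.
by apply: (mulfI w0); rewrite mulr1.
Qed.

(* A unit of [F_(+-alpha)] is a norm from the ramified extension [F_alpha] iff its residue is a
   square. *)
Lemma kappa_iff : (exists z sigma, [/\ Falpha iota (al a b) z, z != 0,
    Defs.flip iota (al a b) sigma & - (h 0 a * h 0 b) = z * sigma z]) <->
  ub ^+ ((q ^ l).-1)./2 = 1.
Proof.
have [u0 vu iu ru] := u_unit; have ub0 := u_res0; rewrite !mxE.
split=> [[z [s [/FalphaP[x Ez fx] z0 fs]]]|h1].
  rewrite Ez (flip_Falpha fx fs) -!rmorphM -rmorphN => /fmorph_inj Eu.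
  have x0 : x != 0 by move: z0; rewrite Ez fmorph_eq0.
  have vx : vM x = 0.
    have := vu; rewrite Eu (val_mul (vd_val hvM)) ?fmorph_eq0 // ud_bar_v -mulr2n => /eqP.
    by rewrite mulrn_eq0 => /eqP.
  have [ix rx0] := unit_res hvM x0 vx.
  have ibx : vge vM 0 (bM x) by rewrite vgeE ?fmorph_eq0 // ud_bar_v vx.
  have Eub : ub = rM x ^+ 2 by rewrite -ru Eu (vd_mul hvM) // ud_bar_res.
  rewrite Eub -exprM mul2n half_double; apply/unity_fr => //.
  by rewrite -(res_iter l ix).2 fx.
have [w Ew] : exists w : kbar, w ^+ 2 = ub.
  have : size ('X^2 - ub%:P) != 1 by rewrite size_XnsubC.
  by case/closed_rootP=> w; rewrite /root !hornerE subr_eq0 => /eqP; exists w.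
have w0 : w != 0 by apply: contraNneq ub0 => w0; rewrite -Ew w0 expr0n.
have wl : w ^+ (q ^ l) = w.
  by apply/unity_fr => //; rewrite -half_double -mul2n exprM Ew.
have wN : w ^+ (q ^ N) = w.
  have /dvdnP[e ->] : (l %| N)%N by apply: pair_dvd; rewrite piN perm1.
  exact: frob_period.
have [x0 ix0 rx0] := @ud_surj _ _ _ _ _ _ _ _ _ _ _ D w wN.
have vP : vpoly vM 0 ('X^2 - u%:P).
  apply: (vpolyD hvM); last by apply/(vpolyN hvM)/vpolyC.
  by move=> i; rewrite coefXn; apply: (vge_nat hvM).
have rP : map_poly rM ('X^2 - u%:P) = 'X^2 - ub%:P.
  apply/polyP=> i; rewrite (coef_res hvM) !coefB !coefXn !coefC.
  by case: i => [|i]; rewrite ?subr0 ?(res_nat hvM) //= !sub0r (resN hvM) // ru.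
have rP0 : (map_poly rM ('X^2 - u%:P)).[w] = 0.
  by rewrite rP !hornerE ?Ew ?subrr // -expr2 Ew subrr.
have kb2 : (2%:R : kbar) != 0 by rewrite -(rmorph_nat rho) fmorph_eq0.
have rP1 : (map_poly rM ('X^2 - u%:P))^`().[w] != 0.
  by rewrite rP derivB derivXn derivC subr0 hornerMn !hornerE -mulr_natl mulf_neq0.
(* This square root of u is determined by its residue [w], hence fixed by conjugation and by the
   l-th power of Frobenius; so it lies in F_alpha and its norm is z^2 = u. *)
have [||z [iz rz Pz]] := hensel hvM (@ud_complete _ _ _ _ _ _ _ _ _ _ _ D) vP ix0; rewrite ?rx0 //.
have rootz x : (('X^2 - u%:P).[x] = 0) <-> (x ^+ 2 = u).
  by rewrite !hornerE; split=> [/eqP|->]; rewrite ?subrr // subr_eq0 => /eqP.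
have zu := (rootz z).1 Pz; rewrite rx0 in rz.
have uniqz x : vge vM 0 x -> rM x = w -> x ^+ 2 = u -> x = z.
  by move=> ix rx xu; apply: (hensel_unique hvM vP) => //; rewrite ?rx ?rz //; apply/rootz.
have zl : iter l fr z = z.
  have [h2 h3] := res_iter l iz; apply: uniqz => //; first by rewrite h3 rz.
  by have [hh hE] := iter_rmorph fr l; rewrite -hE -rmorphXn /= zu hE u_fr.
have zb : bM z = z.
  apply: uniqz; first by move: iz; rewrite /vge fmorph_eq0 ud_bar_v.
    by rewrite ud_bar_res.
  by rewrite -rmorphXn /= zu rmorphN rmorphM /= !H_bar.
have [s Gs hs] := ud_ext D 0 true.
exists (incl z), s; split.
- by apply/FalphaP; exists z.
- by rewrite fmorph_eq0; apply: contraNneq u0 => z0; rewrite -zu z0 expr0n.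
- have gs : gincl s 0 true := hs.
  split=> //; rewrite rootN_al; apply/(rootE a b _ (gincl_gact gs) Gs.1).
  by rewrite /twist expg0 !perm1.
- by rewrite hs /= zb -!rmorphM -rmorphN -expr2 zu.
Qed.

Definition half_sign (z : kbar) : int := if z == 1 then 1 else -1.

Lemma eig_toral : toral_inv bar iota T (al a b) = half_sign (ub ^+ ((q ^ l).-1)./2).
Proof.
rewrite (toral_invE barK iota_bar hinf hT eig_W eig_h0 eig_y eig_y_inj eig_gal eig_ext ab ns).
  rewrite /kappa /half_sign; case: asboolP => [/kappa_iff ->|nk]; first by rewrite eqxx.
  by case: eqP => // /kappa_iff.
by move=> v s s' /FalphaP[x -> fx] fs fs'; rewrite !(flip_Falpha fx).
Qed.

Lemma half_signE : (half_sign (ub ^+ ((q ^ l).-1)./2))%:~R = ub ^+ ((q ^ l).-1)./2.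
Proof.
rewrite /half_sign; case: eqP => [->|/eqP ne]; first by [].
have : (ub ^+ ((q ^ l).-1)./2) ^+ 2 == 1.
  by rewrite -exprM muln2 half_double; apply/eqP/unity_fr; [apply: u_res0|apply: ub_fr].
by rewrite sqrf_eq1 (negbTE ne) /= => /eqP ->.
Qed.

End Pair.
Section Mixed.
Variables (I : {set 'I_n}) (g : 'M[E]_n).
Hypothesis piI : forall c, (pi c \in I) = (c \in I).
Hypothesis tg : torusF bar T g.
Hypothesis Eg : map_mx emb g *m W = W *m diag_mx (\row_c (if c \in I then -1 else 1)).

Lemma torusFL : torusL bar iota T (map_mx (toEL bar iota) g).
Proof.
have [/isom_grpE hg gT] := tg.
have mapE : map_mx (toEL bar iota) g = pm (map_mx iota g) (map_mx (iota \o bar) g).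
  by apply/matrixP=> i j; rewrite !mxE.
apply/torusE; rewrite mapE fm_pm sm_pm; split.
- have := congr1 (map_mx iota) hg; rewrite !map_mxM map_trmx -map_mx_comp.
  have -> // : map_mx iota (antidiag E n) = antidiag L n.
  by apply/matrixP=> i j; rewrite !mxE rmorph_nat.
- by rewrite -!map_mxM gT.
- have iE (X : 'M[E]_n) : map_mx (iota \o bar) X = map_mx iota (map_mx bar X).
    exact: map_mx_comp.
  by rewrite !iE -!map_mxM gT.
Qed.

Lemma eig_Eg : map_mx iota g *m WL = WL *m diag_mx (\row_c (if c \in I then -1 else 1)).
Proof.
have := congr1 (map_mx incl) Eg; rewrite !map_mxM map_diag_mx -map_mx_comp.
have -> : map_mx (incl \o emb) g = map_mx iota g.
  by apply/matrixP=> i j; rewrite !mxE /= ud_incl_emb.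
move=> ->; congr (_ *m diag_mx _); apply/rowP=> c; rewrite !mxE.
by case: ifP => _; rewrite ?rmorphN rmorph1.
Qed.

Let u (z : 'I_n * 'I_n) : kbar := - (hb z.1 * hb z.2).
Let ell z := #|porbit (pi2 pi) z|.
Let fz z := half_sign (u z ^+ ((q ^ ell z).-1)./2).

Lemma porbit_swap_le a b : (#|porbit (pi2 pi) (a, b)| <= #|porbit (pi2 pi) (b, a)|)%N.
Proof.
pose sw (z : 'I_n * 'I_n) := (z.2, z.1).
have swI : injective sw by case=> [x1 x2] [y1 y2] [-> ->].
rewrite -(card_imset (mem (porbit (pi2 pi) (a, b))) swI); apply/subset_leq_card/fintype.subsetP=> z.
case/imsetP=> w /porbitP[r ->] ->; apply/porbitP; exists r.
by rewrite !pi2X.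
Qed.

Lemma u_pi z : u (pi2 pi z) = u z ^+ q.
Proof.
case: z => a b; rewrite pi2E /u /= -!H_fr (frobN rho) exprMn.
by rewrite !ud_phi_res ?H_int.
Qed.

Lemma mixed_noswap a b : (a \in I) != (b \in I) -> a != b /\ noswap pi a b.
Proof.
move=> mx; split; first by apply: contraNneq mx => ->.
by move=> r [Ea _]; move: mx; rewrite -Ea piXI // eqxx.
Qed.

(** The product is an integer sign and the formula lives in [kbar]; the second clause later recovers
    the sign from its image there. *)
Lemma eig_prod :
  let P := \big[*%R/1]_(O \in root_orbits bar iota T g) toral_inv bar iota T (xget (fun=> 0) O) in
  P%:~R = (\prod_(z in mixed I) u z) ^+ (q.-1)./2 /\ (P = 1 \/ P = -1).
Proof.
move=> P; have -> : P = \prod_(z in oreps pi I) fz z.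
  rewrite /P; apply: (prod_root_orbits barK iota_bar hinf hT eig_W eig_h0 eig_y eig_y_inj
    eig_gal eig_ext two_neq0 piI torusFL eig_Eg) => a b.
  - by move=> /mixed_noswap[ab ns]; apply: eig_toral.
  - have -> : (pi a, pi b) = pi2 pi (a, b) by rewrite pi2E.
    rewrite /fz; have -> : ell (pi2 pi (a, b)) = ell (a, b).
      suff E1 : porbit (pi2 pi) (pi2 pi (a, b)) = porbit (pi2 pi) (a, b) by rewrite /ell E1.
      by apply/eqP; rewrite eq_porbit_mem; have := mem_porbit (pi2 pi) 1 (a, b); rewrite expg1.
    rewrite u_pi -exprM mulnC exprM /half_sign; congr (if _ then _ else _).
    apply/eqP/eqP => [E1|->]; last by rewrite expr1n.
    by apply: (@frob_inj k kbar rho 1); rewrite /= expn1 expr1n.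
  - have ellE : ell (b, a) = ell (a, b).
      by apply/eqP; rewrite eqn_leq !porbit_swap_le.
    by rewrite /fz ellE /u /= mulrC.
split; last first.
  apply: (big_ind (fun x => x = 1 \/ x = -1)); first by left.
    by move=> x x' [->|->] [->|->]; rewrite ?mulrNN ?mulr1 ?mul1r; auto.
  by move=> z _; rewrite /fz /half_sign; case: ifP; auto.
rewrite rmorph_prod -(oreps_prod (pi := pi) piI (odd_card k2) u_pi).
by apply: eq_bigr => -[a b] _; exact: half_signE.
Qed.

End Mixed.
End EigenData.

(** * The eigenbasis *)

Section Index.
Variables (m n : nat) (d : 'I_m -> nat).
Hypothesis d_gt0 : forall j, (0 < d j)%N.
Hypothesis sum_d : (\sum_j d j = n)%N.

Definition block_index := {j : 'I_m & 'I_(d j)}.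

Lemma card_block_index : #|{: block_index}| = n.
Proof.
rewrite card_tagged sumnE big_map big_enum /= -sum_d.
by apply: eq_bigr => j _; rewrite card_ord.
Qed.

Definition dec (c : 'I_n) : block_index := enum_val (cast_ord (esym card_block_index) c).
Definition enc (z : block_index) : 'I_n := cast_ord card_block_index (enum_rank z).

Lemma decK : cancel dec enc.
Proof. by move=> c; rewrite /enc /dec enum_valK cast_ordKV. Qed.

Lemma encK : cancel enc dec.
Proof. by move=> z; rewrite /enc /dec cast_ordK enum_rankK. Qed.

Definition blk c : 'I_m := tag (dec c).
Definition ix c : nat := tagged (dec c).

Definition shift (z : block_index) : block_index :=
  Tagged (fun j => 'I_(d j)) (ordS (tagged z)).

Lemma shift_inj : injective (fun c => enc (shift (dec c))).
Proof.
have sK : cancel shift (fun z => Tagged (fun j => 'I_(d j)) (ord_pred (tagged z))).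
  by case=> j r; rewrite /shift /= ordSK.
by move=> c c' /(can_inj encK)/(can_inj sK)/(can_inj decK).
Qed.

Definition shift_perm : 'S_n := perm shift_inj.

Lemma dec_shift c : dec (shift_perm c) = shift (dec c).
Proof. by rewrite permE encK. Qed.

Lemma blk_shift c : blk (shift_perm c) = blk c.
Proof. by rewrite /blk dec_shift. Qed.

Lemma ix_lt c : (ix c < d (blk c))%N.
Proof. exact: ltn_ord. Qed.

Lemma ix_shift c : ix (shift_perm c) = ((ix c).+1 %% d (blk c))%N.
Proof. by rewrite /ix dec_shift. Qed.

(** At the last index of a block the permutation returns to 0, which the period d_j of [x j]
    matches. *)
Lemma iter_shift (V : Type) (f : V -> V) (x : 'I_m -> V) : (forall j, iter (d j) f (x j) = x j) ->
  forall c, f (iter (ix c) f (x (blk c))) = iter (ix (shift_perm c)) f (x (blk (shift_perm c))).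
Proof.
move=> hx c; rewrite blk_shift ix_shift -iterS.
have := ix_lt c; rewrite leq_eqVlt => /orP[/eqP E1|h]; last by rewrite modn_small.
by rewrite E1 modnn /= hx.
Qed.

Lemma blk_ix_inj c c' : blk c = blk c' -> ix c = ix c' -> c = c'.
Proof.
rewrite /blk /ix => E1 E2; apply: (can_inj decK).
case: (dec c) (dec c') E1 E2 => j r [j' r'] /= E1; rewrite E1 in r * => E2.
by congr existT; apply: val_inj.
Qed.

Lemma shift_iter r c : ix ((shift_perm ^+ r)%g c) = ((ix c + r) %% d (blk c))%N /\
  blk ((shift_perm ^+ r)%g c) = blk c.
Proof.
elim: r => [|r [IH1 IH2]]; first by rewrite expg0 perm1 addn0 (modn_small (ix_lt c)).
by rewrite expgSr permM ix_shift blk_shift IH2 IH1 addnS -addn1 modnDml addn1.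
Qed.

Lemma shift_exp N : (forall j, d j %| N)%N -> (shift_perm ^+ N)%g = 1%g.
Proof.
move=> dN; apply/permP=> c; rewrite perm1; have [E1 E2] := shift_iter N c.
apply: blk_ix_inj => //; rewrite E1 -modnDmr (eqP (dN _)) addn0 modn_small //; exact: ix_lt.
Qed.

Lemma porbit_shift c : porbit shift_perm c = [set c' | blk c' == blk c].
Proof.
apply/setP=> c'; rewrite inE; apply/porbitP/eqP=> [[r ->]|E1].
  by have [] := shift_iter r c.
exists (ix c' + (d (blk c) - ix c))%N; have [E2 E3] := shift_iter (ix c' + (d (blk c) - ix c)) c.
apply: blk_ix_inj; first by rewrite E3.
rewrite E2 addnCA subnKC; last exact: ltnW (ix_lt c).
by rewrite modnDr modn_small // -E1 ix_lt.
Qed.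

Lemma card_porbits_shift : #|porbits shift_perm| = m.
Proof.
pose f (j : 'I_m) := porbit shift_perm (enc (Tagged (fun j => 'I_(d j)) (Ordinal (d_gt0 j)))).
have blkE j : blk (enc (Tagged (fun j => 'I_(d j)) (Ordinal (d_gt0 j)))) = j.
  by rewrite /blk encK.
have fI : injective f.
  move=> j j' E1; have : enc (Tagged (fun j => 'I_(d j)) (Ordinal (d_gt0 j))) \in f j'.
    by rewrite -E1 porbit_id.
  by rewrite /f porbit_shift inE !blkE => /eqP.
suff -> : porbits shift_perm = [set f j | j : 'I_m] by rewrite (card_imset _ fI) card_ord.
apply/setP=> X.
apply/imsetP/imsetP=> [[c _ ->]|[j _ ->]]; last by exists (enc (Tagged (fun j => 'I_(d j)) (Ordinal (d_gt0 j)))).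
by exists (blk c) => //; rewrite /f !porbit_shift blkE.
Qed.

(** The cycles are the m blocks, and the sign has the parity of n - m. *)
Lemma sign_shift (R : pzRingType) : (-1) ^+ shift_perm = \prod_j (-1) ^+ (d j).-1 :> R.
Proof.
have sm : (n = \sum_j (d j).-1 + m)%N.
  rewrite -sum_d -[X in (_ + X)%N]card_ord -sum1_card -big_split /=.
  by apply: eq_bigr => j _; rewrite addn1 prednK.
have op : odd_perm shift_perm = odd (\sum_j (d j).-1).
  rewrite /odd_perm card_porbits_shift card_ord.
  by rewrite [in odd n]sm oddD -addbA addbb addbF.
by rewrite op signr_odd prodrXr.
Qed.

Lemma big_block (R : Type) (idx : R) (op : Monoid.com_law idx) j (f : nat -> R) :
  \big[op/idx]_(c | blk c == j) f (ix c) = \big[op/idx]_(r < d j) f r.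
Proof.
have bd : bijective dec by exists enc; [exact: decK|exact: encK].
have -> : \big[op/idx]_(c | blk c == j) f (ix c) =
    \big[op/idx]_(z : block_index | tag z == j) f (tagged z).
  by rewrite [RHS](reindex dec) //; apply: onW_bij.
have := @sig_big_dep R idx op _ (fun j => 'I_(d j)) (pred1 j) (fun _ _ => true) (fun _ r => f r).
rewrite big_pred1_eq => ->; apply: eq_bigl => z; by rewrite andbT.
Qed.

Lemma card_block j : #|[set c | blk c == j]| = d j.
Proof.
rewrite -sum1_card -[RHS]card_ord -sum1_card.
by rewrite -(big_block _ j (fun=> 1%N)); apply: eq_bigl => c; rewrite inE.
Qed.

End Index.

(** * Assembly of the block vectors into an orthogonal eigenbasis *)

Section Blocks.
Variables (F : fieldType) (k : finFieldType) (vF : F -> int) (resF : F -> k).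
Variables (E : fieldExtType F) (vE : E -> int) (resE : E -> k).
Variables (bar : {lrmorphism E -> E}) (piE : E).
Hypothesis hE : local_field vE resE.
Hypothesis k2 : (2%:R : k) != 0.
Hypothesis barK : forall e, bar (bar e) = e.
Hypothesis hpi0 : piE != 0.
Hypothesis hbar : bar piE = - piE.
Variables (L : fieldType) (iota : {rmorphism E -> L}).
Variables (kbar : closedFieldType) (rho : {rmorphism k -> kbar}).
Variables (N : nat) (D : urdata vE resE bar rho iota N).
Variables (n : nat) (Y : 'M[E]_n.+1).
Hypothesis hY : isom_lie bar Y.
Variables (m : nat) (pl : 'I_m -> {poly k}).
Hypothesis hmonic : forall i, pl i \is monic.
Hypothesis hirr : forall i, irreducible_poly (pl i).
Local Notation d := (fun j : 'I_m => (size (pl j)).-1).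
Hypothesis sum_d : (\sum_j d j = n.+1)%N.
Variable B : forall i, unram_pair vF resF vE resE bar (size (pl i)).-1.
Variable phi : forall i, {linear up_E (B i) -> 'cV[E]_n.+1}.
Variables (theta : forall i, up_E (B i)) (eta : forall i, up_F (B i)).
Hypothesis hdec : orth_decomp piE Y phi theta eta.
Variables (P : 'I_m -> {poly E}) (v : 'I_m -> 'cV[D]_n.+1) (tau H : 'I_m -> D) (sg : 'I_m -> int).
Hypothesis P_monic : forall j, P j \is monic.
Hypothesis P_int : forall j, vpoly vE 0 (P j).
Hypothesis P_res : forall j, map_poly resE (P j) = pl j.
Hypothesis P_kill : forall j x, horner_mx (piE^-1 *: Y) (P j) *m phi j x = 0.
Hypothesis P_tau : forall j, (map_poly (ud_emb D) (P j)).[tau j] = 0.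
Hypothesis hspec : forall j, block_spec piE (pl j) (phi j) (theta j) (d j) (sg j) (v j) (tau j) (H j).

Local Notation emb := (ud_emb D).
Local Notation fr := (ud_phi D).
Local Notation bM := (ud_bar D).
Local Notation vM := (@ud_v _ _ _ _ _ _ _ _ _ _ _ D).
Local Notation rM := (@ud_res _ _ _ _ _ _ _ _ _ _ _ D).
Local Notation q := #|k|.
Let hvM : valued vM rM := ud_valued D.
Let hvE := valued_local hE.

Lemma deg_gt0 j : (0 < d j)%N.
Proof. by have [s1 _] := hirr j; rewrite -ltnS prednK // ltnW. Qed.

Local Notation blk := (blk sum_d).
Local Notation ix := (ix sum_d).
Local Notation pi := (shift_perm sum_d).

Definition evec c : 'cV[D]_n.+1 := iter (ix c) (map_mx fr) (v (blk c)).
Definition eval_ c : D := iter (ix c) fr (tau (blk c)).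
Definition eform c : D := iter (ix c) fr (H (blk c)).

Lemma evec_fr c : map_mx fr (evec c) = evec (pi c).
Proof.
apply: (iter_shift sum_d (V := 'cV[D]_n.+1)) => j; rewrite -[RHS](bs_v_fr (hspec j)).
elim: (d j) => [|r IH] /=; first by apply/matrixP=> a b; rewrite mxE.
by rewrite IH; apply/matrixP=> a b; rewrite !mxE.
Qed.

Lemma eform_fr c : fr (eform c) = eform (pi c).
Proof. by apply: (iter_shift sum_d) => j; apply: bs_H_fr (hspec j). Qed.

Lemma iter_ind (V : Type) (f : V -> V) (Q : V -> Prop) r x : (forall y, Q y -> Q (f y)) -> Q x ->
  Q (iter r f x).
Proof. by move=> hf hx; elim: r => //= r; apply: hf. Qed.

Lemma eval_bar c : bM (eval_ c) = eval_ c.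
Proof.
apply: (iter_ind (Q := fun x => bM x = x)); last exact: bs_tau_bar (hspec _).
by move=> y E1; rewrite -ud_comm E1.
Qed.

Lemma eform_bar c : bM (eform c) = eform c.
Proof.
apply: (iter_ind (Q := fun x => bM x = x)); last exact: bs_H_bar (hspec _).
by move=> y E1; rewrite -ud_comm E1.
Qed.

Lemma eform0 c : eform c != 0.
Proof.
apply: (iter_ind (Q := fun x => x != 0)); last exact: bs_H0 (hspec _).
by move=> y E1; rewrite fmorph_eq0.
Qed.

Lemma v_eform c : vM (eform c) = 0.
Proof.
apply: (iter_ind (Q := fun x => vM x = 0)); last exact: bs_vH (hspec _).
by move=> y E1; rewrite ud_phi_v.
Qed.

Lemma eval_int c : vge vM 0 (eval_ c).
Proof. by have [] := res_iter (ix c) (bs_tau (hspec (blk c))). Qed.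

Lemma eval_res c : rM (eval_ c) = rM (tau (blk c)) ^+ (q ^ ix c).
Proof. by have [] := res_iter (ix c) (bs_tau (hspec (blk c))). Qed.

Lemma eform_res c : rM (eform c) = rM (H (blk c)) ^+ (q ^ ix c).
Proof.
have h0 : vge vM 0 (H (blk c)) by rewrite vgeE ?(bs_vH (hspec _)) ?(bs_H0 (hspec _)).
by have [] := res_iter (ix c) h0.
Qed.

Lemma herm_fr (x y : 'cV[D]_n.+1) : herm bM (map_mx fr x) (map_mx fr y) = fr (herm bM x y) :> D.
Proof. by apply: herm_map => a; rewrite ud_comm. Qed.

Lemma evec_self c : herm bM (evec c) (evec c) = eform c.
Proof.
rewrite /evec /eform; elim: (ix c) => [|r IH] /=; first exact: bs_form (hspec _).
by rewrite herm_fr IH.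
Qed.

Lemma emb_herm (x y : 'cV[E]_n.+1) : herm bM (map_mx emb x) (map_mx emb y) = emb (herm bar x y).
Proof. by apply: herm_map => a; rewrite ud_bar_emb. Qed.

Definition in_span j (w : 'cV[D]_n.+1) := exists (a : 'I_(d j) -> D) (x : 'I_(d j) -> up_E (B j)),
  w = \sum_i a i *: map_mx emb (phi j (x i)).

Lemma evec_span c : in_span (blk c) (evec c).
Proof.
apply: (iter_ind (Q := in_span (blk c))); last exact: bs_span (hspec _).
move=> w [a [x ->]]; exists (fun i => fr (a i)), x; rewrite map_mx_sum.
apply: eq_bigr => i _; rewrite map_mxZ -map_mx_comp; congr (_ *: _).
by apply/matrixP=> b e; rewrite !mxE /= ud_phi_emb.
Qed.

Lemma span_orth j j' w w' : j != j' -> in_span j w -> in_span j' w' -> herm bM w w' = 0.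
Proof.
move=> jj [a [x ->]] [a' [x' ->]]; rewrite herm_suml big1 // => i _.
rewrite herm_sumr big1 // => i' _; rewrite hermZl hermZr emb_herm (od_orth hdec) //.
by rewrite rmorph0 !mulr0.
Qed.

Lemma lieM (x y : 'cV[D]_n.+1) : herm bM (map_mx emb Y *m x) y = - herm bM x (map_mx emb Y *m y).
Proof.
apply/eqP; rewrite -addr_eq0; apply/eqP; move: x y.
apply/isom_lieE; have /isom_lieE/(congr1 (map_mx emb)) := hY.
rewrite map_mx0 map_mxD !map_mxM map_trmx => <-.
have -> : map_mx emb (antidiag E n.+1) = antidiag D n.+1.
  by apply/matrixP=> i j; rewrite !mxE rmorph_nat.
by congr (_ + _ *m _); apply/matrixP=> i j; rewrite !mxE ud_bar_emb.
Qed.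

(** By nondegeneracy it is enough to pair with the images of the blocks: on block [j] this is
    [bs_eigen], the sign of skew-adjointness cancelling that of [bar piE], and on the other blocks
    both sides are 0. *)
Lemma block_eigen j : map_mx emb Y *m v j = (emb piE * tau j) *: v j.
Proof.
apply/eqP; rewrite -subr_eq0; apply/eqP; set z := _ - _.
suff key x : herm bM (map_mx emb x) z = 0.
  apply: (@herm_nondeg _ bM); last exact: fmorph_inj.
  move=> x; rewrite [x]matrix_sum_delta herm_suml big1 // => i _.
  rewrite herm_suml big1 // => l _; rewrite hermZl.
  have -> : delta_mx i l = map_mx emb (delta_mx i l) by rewrite map_delta_mx.
  by rewrite key mulr0.
have [x' ->] := od_span hdec x; rewrite map_mx_sum herm_suml big1 // => j' _.
have E1 : map_mx emb Y *m map_mx emb (phi j' (x' j')) = map_mx emb (phi j' (theta j' * x' j')).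
  by rewrite -map_mxM (od_stable hdec).
have [jj|jj] := eqVneq j' j; last first.
  have h (y : up_E (B j')) : herm bM (map_mx emb (phi j' y)) (v j) = 0.
    apply: (span_orth jj); last exact: bs_span (hspec j).
    have [i0 _] : exists i0 : 'I_(d j'), true by exists (Ordinal (deg_gt0 j')).
    exists (fun i => (i == i0)%:R), (fun=> y).
    by rewrite (bigD1 i0) //= eqxx scale1r big1 ?addr0 // => i /negbTE ->; rewrite scale0r.
  by rewrite /z hermDr -[X in _ + herm _ _ X]scaleN1r !hermZr h !mulr0 addr0 -[LHS]opprK -lieM E1 h oppr0.
rewrite jj in x' E1 *.
rewrite /z hermDr -scaleNr hermZr -[X in X + _]opprK -lieM E1 (bs_eigen (hspec j)).
by rewrite rmorphN rmorphM ud_bar_emb hbar (bs_tau_bar (hspec j)) rmorphN !mulNr opprK addNr.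
Qed.

Lemma evec_eigen c : map_mx emb Y *m evec c = (emb piE * eval_ c) *: evec c.
Proof.
rewrite /evec /eval_; elim: (ix c) => [|r IH] /=; first exact: block_eigen.
have -> : map_mx emb Y = map_mx fr (map_mx emb Y).
  by apply/matrixP=> i j; rewrite !mxE ud_phi_emb.
by rewrite -map_mxM IH map_mxZ rmorphM ud_phi_emb.
Qed.

Lemma root_tau j : root (map_poly rho (pl j)) (rM (tau j)).
Proof. exact: bs_root (hspec j). Qed.

Lemma res_inj_block c c' : blk c = blk c' -> rM (eval_ c) = rM (eval_ c') -> c = c'.
Proof.
move=> E1 E2; apply: (blk_ix_inj E1).
have := conj_uniq (hirr (blk c)) (hmonic _) (root_tau (blk c)); rewrite /frob_orbit => uq.
have i1 := ix_lt sum_d c; have i2 := ix_lt sum_d c'; rewrite -E1 in i2.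
apply/eqP; rewrite -(nth_uniq 0 _ _ uq) ?size_map ?size_iota // !(nth_map 0) ?size_iota //.
by rewrite !nth_iota // -eval_res E2 eval_res E1.
Qed.

Lemma evec_orth c c' : c != c' -> herm bM (evec c) (evec c') = 0.
Proof.
move=> cc; have [jj|jj] := eqVneq (blk c) (blk c'); last first.
  by apply: (span_orth jj); apply: evec_span.
have ne : eval_ c != eval_ c'.
  by apply: contraNneq cc => E1; apply/eqP/res_inj_block; rewrite // E1.
have := lieM (evec c) (evec c'); rewrite !evec_eigen hermZl hermZr rmorphM ud_bar_emb hbar eval_bar.
rewrite rmorphN mulNr mulNr opprK => /eqP; rewrite -subr_eq0 -mulrBl -mulrBr !mulf_eq0 fmorph_eq0.
by rewrite (negbTE hpi0) subr_eq0 (negbTE ne) /= => /eqP.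
Qed.

Definition emat : 'M[D]_n.+1 := \matrix_(i, c) evec c i 0.

Lemma col_emat c : col c emat = evec c.
Proof. by apply/colP=> i; rewrite !mxE. Qed.

Lemma emat_fr i c : fr (emat i c) = emat i (pi c).
Proof. by rewrite !mxE -evec_fr mxE. Qed.

Lemma emat_form : emat^T *m antidiag D n.+1 *m map_mx bM emat = diag_mx (\row_c eform c).
Proof.
apply/matrixP=> c c'; rewrite -herm_delta -!colE !col_emat !mxE.
by have [->|ne] := eqVneq c c'; rewrite ?evec_self ?mulr1n ?mulr0n ?evec_orth.
Qed.

Lemma emat_eigen : map_mx emb Y *m emat = emat *m diag_mx (\row_c (emb piE * eval_ c)).
Proof.
apply/matrixP=> i c.
have -> : (map_mx emb Y *m emat) i c = (map_mx emb Y *m evec c) i 0.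
  by rewrite -col_emat colE mulmxA -colE [RHS]mxE.
by rewrite evec_eigen mul_mx_diag !mxE mulrC.
Qed.

Hypothesis Y_int : forall i j, vge vE 0 ((piE^-1 *: Y) i j).
Hypothesis hfin : finite_set (isom_cent id (map_mx rho (map_mx resE (piE^-1 *: Y)))).
Hypothesis A_adj : (map_mx resE (piE^-1 *: Y))^T *m antidiag k n.+1 =
  antidiag k n.+1 *m map_mx resE (piE^-1 *: Y).

Lemma kill_all (Q : {poly E}) : (forall j x, horner_mx (piE^-1 *: Y) Q *m phi j x = 0) ->
  horner_mx (piE^-1 *: Y) Q = 0.
Proof.
move=> hQ; apply/matrixP=> i l; rewrite [RHS]mxE.
have -> : horner_mx (piE^-1 *: Y) Q i l = (horner_mx (piE^-1 *: Y) Q *m delta_mx l (0 : 'I_1)) i 0.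
  by rewrite -colE mxE.
by have [x ->] := od_span hdec (delta_mx l 0); rewrite mulmx_sumr big1 ?mxE // => j _; apply: hQ.
Qed.

Lemma roots_split (g : {poly k}) : g \is monic ->
  exists2 s : seq kbar, map_poly rho g = \prod_(x <- s) ('X - x%:P) & size s = (size g).-1.
Proof.
move=> mg; have [s Es] := closed_field_poly_normal (map_poly rho g).
have lc : lead_coef (map_poly rho g) = 1 by apply/monicP; rewrite map_monic.
exists s; first by rewrite [LHS]Es lc scale1r.
by rewrite -(size_map_poly rho) Es lc scale1r size_prod_XsubC.
Qed.

(* Equal eigenvalues in two blocks force [P j = P j'], so the self-adjoint reduction is
   annihilated by a polynomial of degree less than its size and has an eigenspace of dimension
   at least 2; its reflections or transvections make the stabilizer infinite. *)
Lemma eval_inj : injective eval_.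
Proof.
move=> c c' E1; have [jj|jj] := eqVneq (blk c) (blk c').
  by apply: res_inj_block => //; rewrite E1.
exfalso; set j := blk c in jj; set j' := blk c' in jj.
have rt c0 : (map_poly emb (P (blk c0))).[eval_ c0] = 0.
  apply: (iter_ind (Q := fun x => (map_poly emb (P (blk c0))).[x] = 0)) (P_tau _) => y Ey.
  have -> : map_poly emb (P (blk c0)) = map_poly fr (map_poly emb (P (blk c0))).
    by rewrite -map_poly_comp; apply: eq_map_poly => e /=; rewrite [RHS]ud_phi_emb.
  by rewrite horner_map Ey rmorph0.
have rr c0 : root (map_poly rho (pl (blk c0))) (rM (eval_ c0)).
  rewrite rootE eval_res (frob_horner rho) (rootP (root_tau _)) expr0n.
  by rewrite expn_eq0 eqn0Ngt (q_gt0 k).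
have Ep : pl j = pl j'.
  apply/eqP; rewrite -eqp_monic // /eqp.
  have h1 := rr c; have h2 := rr c'; rewrite -E1 in h2.
  by rewrite (irr_root_dvd (hirr j) h1 h2) (irr_root_dvd (hirr j') h2 h1).
have EP : P j = P j'.
  have sP i : size (P i) = size (pl i) by rewrite -P_res; have [_ ->] := monic_res hvE (P_monic i).
  have s1 := size_poly_gt0 (pl j); have pl0 := monic_neq0 (hmonic j).
  apply/eqP; rewrite -subr_eq0; apply/eqP.
  apply: (gauss_inj hvE hvM (@ud_vext _ _ _ _ _ _ _ _ _ _ _ D) (@ud_rext _ _ _ _ _ _ _ _ _ _ _ D)
    (eval_int c) (hirr j) (rr c)).
    rewrite -(prednK (_ : 0 < size (pl j))%N) ?size_poly_gt0 // ltnS; apply/leq_sizeP => i di.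
    have li : size (pl j) = (size (pl j)).-1.+1 by rewrite prednK // size_poly_gt0.
    have [i_d|ne] := eqVneq i (size (pl j)).-1.
      have m1 := monicP (P_monic j); have m2 := monicP (P_monic j').
      by move: m1 m2; rewrite /lead_coef !sP -Ep -i_d coefB => -> ->; rewrite subrr.
    have lt_i : (size (pl j) <= i)%N by rewrite li ltn_neqAle eq_sym ne.
    by rewrite coefB !nth_default ?subrr // sP -?Ep.
  by rewrite rmorphB hornerD hornerN rt E1 rt subrr.
pose R := \prod_(i | i != j') P i.
have R_int : vpoly vE 0 R by apply: (vpoly_prod hvE) => i _; apply: P_int.
(* Dropping [P j'] from the product is harmless, since the equal polynomial [P j] remains. *)
have R0 : horner_mx (piE^-1 *: Y) R = 0.
  apply: kill_all => i x.
  have [i0 i0j Pi] : exists2 i0, i0 != j' & P i0 = P i.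
    have [->|ne] := eqVneq i j'; last by exists i.
    by exists j.
  rewrite /R (bigD1 i0) //= mulrC rmorphM /= Pi -[_ * _]/(_ *m _) -mulmxA P_kill mulmx0 //.
have [_ ER] := res_horner_mx hvE Y_int R_int.
have R_res : map_poly resE R = \prod_(i | i != j') pl i.
  rewrite /R -big_filter (res_poly_prod hvE) // big_filter.
  by apply: eq_bigr => i _; rewrite P_res.
have mR : \prod_(i | i != j') pl i \is monic by apply: monic_prod => i _.
have [s Es ss] := roots_split mR.
have szR : (size s <= n)%N.
  have pl0 i : pl i != 0 by apply: monic_neq0.
  rewrite ss size_prod //.
  have E2 : (\sum_(i | i != j') size (pl i) = \sum_(i | i != j') d i + #|[pred i | i != j']|)%N.
    rewrite -sum1_card -big_split /=; apply: eq_bigr => i _.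
    by rewrite addn1 prednK // size_poly_gt0.
  rewrite E2 -addSn addnK /= -ltnS -sum_d [ltnRHS](bigD1 j') //=.
  by rewrite -[ltnLHS]add0n ltn_add2r deg_gt0.
pose Ab := map_mx rho (map_mx resE (piE^-1 *: Y)).
have P0 : \prod_(x <- s) (Ab - x%:M) = 0.
  have -> : \prod_(x <- s) (Ab - x%:M) = horner_mx Ab (\prod_(x <- s) ('X - x%:P)).
    rewrite rmorph_prod; apply: eq_bigr => x _.
    by rewrite rmorphB /= horner_mx_X horner_mx_C.
  rewrite -Es -[Ab]/(map_mx rho _) -map_horner_mx -R_res -ER R0.
  by apply/matrixP=> a b; rewrite !mxE (res0 hvE) rmorph0.
have [x [u [w [hu hw ind]]]] := prod_eigenplane szR P0.
apply: (eigenplane_infinite _ _ hu hw ind hfin).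
  by rewrite -(rmorph_nat rho) fmorph_eq0.
have := congr1 (map_mx rho) A_adj; rewrite !map_mxM map_trmx.
have -> : map_mx rho (antidiag k n.+1) = antidiag kbar n.+1.
  by apply/matrixP=> a b; rewrite !mxE rmorph_nat.
by rewrite /Ab !map_trmx.
Qed.

End Blocks.

(** * The involution and the final computation *)

Lemma det_antidiag (A : comNzRingType) n :
  \det (antidiag A n) = (\det (antidiag int n))%:~R.
Proof.
rewrite -(det_map_mx intr); congr (\det _); apply/matrixP=> i j; rewrite !mxE.
by case: eqP.
Qed.

Lemma det_antidiag_sign n : \det (antidiag int n) = 1 \/ \det (antidiag int n) = -1.
Proof.
have := congr1 determinant (antidiag_sq int n); rewrite det_mulmx det1 -expr2 => /eqP.
by rewrite sqrf_eq1 => /orP[/eqP|/eqP]; auto.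
Qed.

Lemma gram_antidiag (k : comNzRingType) n : gram (id : k -> k) n = antidiag k n.
Proof.
apply/matrixP=> i j; rewrite [LHS]mxE.
have := herm_delta (@idfun k) 1%:M 1%:M i j.
by rewrite !mul1mx trmx1 map_mx1 mulmx1 mul1mx.
Qed.

(** The product contributes [A] to the power n - |I|; completing the product over the complement to
    one over all indices takes |I| more, and n + |I| differs from n - |I| by an even number. *)
Lemma mixed_prod (K : fieldType) n (I : {set 'I_n}) (b : 'I_n -> K) h :
  let A := (\prod_(c in I) b c) ^+ h in A ^+ 2 = 1 ->
  (\prod_(z in mixed I) - (b z.1 * b z.2)) ^+ h =
  ((-1) ^+ h) ^+ (#|I| * (n - #|I|)) * A ^+ n * ((\prod_c b c) ^+ h) ^+ #|I|.
Proof.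
move=> A A2; set d := #|I|; set e := (n - d)%N.
have dn : (d <= n)%N by rewrite -[n]card_ord max_card.
have ce : #|~: I| = e by rewrite cardsCs finset.setCK card_ord.
set Bc := \prod_(c in ~: I) b c.
have -> : \prod_(z in mixed I) - (b z.1 * b z.2) = ((-1) ^+ d * \prod_(c in I) b c) ^+ e * Bc ^+ d.
  transitivity (\prod_(a in I) \prod_(c in ~: I) - (b a * b c)).
    by rewrite pair_big; apply: eq_bigl => -[a c]; rewrite in_mixed inE.
  have E1 a : \prod_(c in ~: I) - (b a * b c) = (-1 * b a) ^+ e * Bc.
    rewrite -ce -prodr_const -big_split /=; apply: eq_bigr => c _.
    by rewrite mulN1r mulNr.
  rewrite (eq_bigr _ (fun a _ => E1 a)) big_split /= prodr_const prodrXl; congr (_ ^+ _ * _).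
  by rewrite big_split /= prodr_const.
have -> : \prod_c b c = (\prod_(c in I) b c) * Bc.
  rewrite (bigID (mem I)) /=; congr (_ * _); apply: eq_bigl => c; by rewrite inE.
move: A2; rewrite {}/A; set a := \prod_(c in I) b c => a2.
have nE : (h * n + h * d = e * h + h * 2 * d)%N.
  have -> : n = (e + d)%N by rewrite subnK.
  by rewrite mulnDr (mulnC e) -(mulnA h) -addnA; congr (_ + _)%N; rewrite mulSn mul1n mulnDr.
have Ea : a ^+ (h * n) * a ^+ (h * d) = a ^+ (e * h).
  by rewrite -exprD nE exprD (exprM _ (h * 2)) (exprM _ h 2) a2 expr1n mulr1.
rewrite !exprMn -!exprM -Ea (_ : (d * (e * h) = h * (d * e))%N) ?(mulnC d h); last first.
  by rewrite mulnA mulnC.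
by rewrite !mulrA.
Qed.

(** * Quadratic character of the product of all form values *)

Section Determinant.
Variables (F : fieldType) (E : fieldExtType F) (k : finFieldType) (vE : E -> int) (resE : E -> k).
Variables (bar : {lrmorphism E -> E}) (kbar : closedFieldType) (rho : {rmorphism k -> kbar}).
Variables (L : fieldType) (iota : {rmorphism E -> L}) (N : nat).
Variable D : urdata vE resE bar rho iota N.
Hypothesis k2 : (2%:R : k) != 0.
Variables (n : nat) (W : 'M[D]_n) (H : 'I_n -> D) (pi : 'S_n).
Local Notation fr := (ud_phi D).
Local Notation bM := (ud_bar D).
Local Notation vM := (@ud_v _ _ _ _ _ _ _ _ _ _ _ D).
Local Notation rM := (@ud_res _ _ _ _ _ _ _ _ _ _ _ D).
Local Notation q := #|k|.
Let hvM : valued vM rM := ud_valued D.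
Hypothesis W_fr : forall i c, fr (W i c) = W i (pi c).
Hypothesis H0 : forall c, H c != 0.
Hypothesis vH : forall c, vM (H c) = 0.
Hypothesis W_form : W^T *m antidiag D n *m map_mx bM W = diag_mx (\row_c H c).

Lemma half_card : ((q.-1)./2).*2 = q.-1.
Proof.
rewrite -[RHS]odd_double_half; have -> : odd q.-1 = false; last by rewrite add0n.
by have := odd_card k2; rewrite -{1}(prednK (q_gt0 k)) /= => /negbTE.
Qed.

Lemma sign_prod : (\prod_c rM (H c)) ^+ (q.-1)./2 =
  (-1) ^+ pi * rho (\det (gram (id : k -> k) n)) ^+ (q.-1)./2.
Proof.
rewrite gram_antidiag det_antidiag rmorph_int; set z := \det (antidiag int n).
have hz : z = 1 \/ z = -1 := det_antidiag_sign n.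
have vz : (z%:~R : D) != 0 /\ vge vM 0 z%:~R /\ rM z%:~R = z%:~R.
  case: hz => ->; rewrite ?mulrN1z ?mulr1z ?oppr_eq0 oner_neq0.
    by rewrite (vge_1 hvM) (vd_one hvM).
  by rewrite (vgeN hvM) (vge_1 hvM) (resN hvM) ?(vge_1 hvM) // (vd_one hvM).
have [z0 [iz rz]] := vz.
set w := \det W.
have E1 : w * z%:~R * bM w = \prod_c H c.
  have := congr1 determinant W_form; rewrite !det_mulmx det_tr det_diag det_antidiag.
  by rewrite det_map_mx -/w => ->; apply: eq_bigr => c _; rewrite mxE.
have iH c : vge vM 0 (H c) by rewrite vgeE // vH.
have rH0 c : rM (H c) != 0 by have [] := unit_res hvM (H0 c) (vH c).
have rP : rM (\prod_c H c) = \prod_c rM (H c) by rewrite (res_prod hvM).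
have [P0 vP] : \prod_c H c != 0 /\ vM (\prod_c H c) = 0.
  apply: (res_unit hvM); first exact: (vge_prod hvM).
  by rewrite rP; apply/prodf_neq0 => c _.
have w0 : w != 0 by apply: contraNneq P0 => w0; rewrite -E1 w0 !mul0r.
have vz0 : vM z%:~R = 0.
  have rz0 : rM z%:~R != 0.
    by rewrite rz; case: hz => ->; rewrite ?mulrN1z ?mulr1z ?oppr_eq0 oner_neq0.
  by have [] := res_unit hvM iz rz0.
have vw : vM w = 0.
  move: vP; rewrite -E1 !(val_mul (vd_val hvM)) ?mulf_neq0 ?fmorph_eq0 // ud_bar_v vz0 addr0.
  by rewrite -mulr2n => /eqP; rewrite mulrn_eq0 => /eqP.
have [iw rw0] := unit_res hvM w0 vw.
have ibw : vge vM 0 (bM w) by rewrite vgeE ?fmorph_eq0 // ud_bar_v vw.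
have E2 : rM w ^+ 2 * z%:~R = \prod_c rM (H c).
  by rewrite -rP -E1 !(vd_mul hvM) ?(vge_mull hvM) // rz ud_bar_res // expr2 mulrAC.
have E3 : fr w = w * (-1) ^+ pi.
  rewrite -det_map_mx (_ : map_mx fr W = col_perm pi W); last by apply/matrixP=> i j; rewrite !mxE W_fr.
  by rewrite col_permE det_mulmx det_perm odd_permV.
have E4 : rM w ^+ q = rM w * (-1) ^+ pi.
  rewrite -ud_phi_res // E3; case: (odd_perm pi); last by rewrite !expr0 !mulr1.
  by rewrite !expr1 !mulrN1 (resN hvM).
have E5 : rM w ^+ q.-1 = (-1) ^+ pi.
  by apply: (mulfI rw0); rewrite -exprS prednK ?(q_gt0 k).
by rewrite -E2 exprMn -exprM mul2n half_card E5.
Qed.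

End Determinant.

(** * Lifting c_i to an involution of the torus *)

Section Involution.
Variables (F : fieldType) (k : finFieldType) (vF : F -> int) (resF : F -> k).
Variables (E : fieldExtType F) (vE : E -> int) (resE : E -> k).
Variables (bar : {lrmorphism E -> E}) (piE : E).
Variables (n : nat) (Y : 'M[E]_n.+1).
Variables (m : nat) (pl : 'I_m -> {poly k}).
Variable B : forall i, unram_pair vF resF vE resE bar (size (pl i)).-1.
Variable phi : forall i, {linear up_E (B i) -> 'cV[E]_n.+1}.
Variables (theta : forall i, up_E (B i)) (eta : forall i, up_F (B i)).
Hypothesis hdec : orth_decomp piE Y phi theta eta.
Variable i : 'I_m.

Lemma block_mx_ext (M M' : 'M[E]_n.+1) :
  (forall j x, M *m phi j x = M' *m phi j x) -> M = M'.
Proof.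
move=> h; apply/matrixP=> a b.
have e X : (X : 'M[E]_n.+1) a b = (X *m delta_mx b (0 : 'I_1)) a 0 by rewrite -colE mxE.
have [x Ex] := od_span hdec (delta_mx b 0).
by rewrite (e M) (e M') Ex !mulmx_sumr; congr (fun_of_matrix _ _ _); apply: eq_bigr => j _.
Qed.

Lemma exists_proj : exists Pr : 'M[E]_n.+1, (forall x, Pr *m phi i x = phi i x) /\
  forall j x, j != i -> Pr *m phi j x = 0.
Proof.
pose cx u : forall j, up_E (B j) := sval (cid (od_span hdec u)).
have cxP u : u = \sum_j phi j (cx u j) by rewrite /cx; case: cid.
have cxU u (x : forall j, up_E (B j)) : u = \sum_j phi j (x j) -> forall j, cx u j = x j.
  move=> Eu j; apply/eqP; rewrite -subr_eq0; apply/eqP.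
  apply: (od_free hdec (x := fun j => cx u j - x j)).
  under eq_bigr => l _ do rewrite linearB.
  by rewrite /= sumrB -cxP -Eu subrr.
have cxL a u w : cx (a *: u + w) i = a *: cx u i + cx w i.
  apply: (cxU _ (fun j => a *: cx u j + cx w j)).
  under eq_bigr => l _ do rewrite linearP.
  by rewrite /= big_split -scaler_sumr -!cxP.
have cx0 : cx 0 i = 0.
  by apply: (cxU 0 (fun=> 0)); rewrite big1 // => j _; rewrite linear0.
have cxZ a u : cx (a *: u) i = a *: cx u i by rewrite -[X in cx X]addr0 cxL cx0 addr0.
have cxD u w : cx (u + w) i = cx u i + cx w i by rewrite -[u in LHS]scale1r cxL scale1r.
pose Pr := \matrix_(a, b) phi i (cx (delta_mx b (0 : 'I_1)) i) a 0.
have PrE u : Pr *m u = phi i (cx u i).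
  have E1 : u = \sum_b u b 0 *: delta_mx b 0.
    by rewrite [LHS]matrix_sum_delta; apply: eq_bigr => b _; rewrite big_ord1.
  have -> : cx u i = \sum_b u b 0 *: cx (delta_mx b 0) i.
    rewrite {1}E1 (big_morph (fun w => cx w i) cxD cx0); apply: eq_bigr => b _; exact: cxZ.
  apply/colP=> a; rewrite linear_sum summxE mxE; apply: eq_bigr => b _.
  by rewrite linearZ !mxE mulrC.
have single j (x : up_E (B j)) : phi j x = \sum_l phi l (dfwith (fun l => 0 : up_E (B l)) x l).
  rewrite (bigD1 j) //= dfwith_in big1 ?addr0 // => l lj.
  by rewrite dfwith_out ?linear0 // eq_sym.
exists Pr; split=> [x|j x ji]; rewrite PrE (cxU _ _ (single _ _)) ?dfwith_in //.
by rewrite dfwith_out ?linear0.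
Qed.

Variable Pr : 'M[E]_n.+1.
Hypothesis Pr_i : forall x, Pr *m phi i x = phi i x.
Hypothesis Pr_j : forall j x, j != i -> Pr *m phi j x = 0.

(** The 2-torsion element of S(F) that is -1 on V_i and 1 on the other blocks, to which [tc_val]
    applies. *)
Definition invol : 'M[E]_n.+1 := 1%:M - 2%:R *: Pr.
Local Notation sgn := (fun j : 'I_m => if j == i then -1 else 1).

Lemma invol_phi j x : invol *m phi j x = sgn j *: phi j x.
Proof.
rewrite mulmxBl mul1mx -scalemxAl; case: eqVneq => [ji|ji].
  by rewrite ji in x *; rewrite Pr_i scaleN1r scaler_nat mulr2n opprD addrA subrr add0r.
by rewrite Pr_j // scaler0 subr0 scale1r.
Qed.

Lemma invol_torus : torusF bar Y invol.
Proof.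
split=> [u w|]; last first.
  apply: block_mx_ext => j x; rewrite -!mulmxA invol_phi (od_stable hdec) -scalemxAr.
  by rewrite (od_stable hdec) invol_phi.
have [x ->] := od_span hdec u; have [y ->] := od_span hdec w.
rewrite !mulmx_sumr !herm_suml; apply: eq_bigr => j _; rewrite !herm_sumr; apply: eq_bigr => l _.
rewrite !invol_phi hermZl hermZr; have [jl|jl] := eqVneq j l; last by rewrite (od_orth hdec) // !mulr0.
rewrite jl; case: eqP => _; last by rewrite (rmorph1 bar) !mul1r.
by rewrite rmorphN (rmorph1 bar) !mulN1r opprK.
Qed.

Lemma invol_sq : invol *m invol = 1%:M.
Proof.
apply: block_mx_ext => j x; rewrite -mulmxA invol_phi -scalemxAr invol_phi mul1mx scalerA.
by case: eqP => _; rewrite ?mulrNN mulr1 scale1r.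
Qed.

Variable P : 'I_m -> {poly E}.
Hypothesis P_kill : forall j x, horner_mx (piE^-1 *: Y) (P j) *m phi j x = 0.

Lemma kill_proj : horner_mx (piE^-1 *: Y) (P i) *m Pr = 0.
Proof.
apply: block_mx_ext => j x; rewrite -mulmxA mul0mx; have [ji|ji] := eqVneq j i.
  by rewrite ji in x *; rewrite Pr_i P_kill.
by rewrite Pr_j // mulmx0.
Qed.

Lemma kill_coproj : horner_mx (piE^-1 *: Y) (\prod_(j | j != i) P j) *m (1%:M - Pr) = 0.
Proof.
apply: block_mx_ext => j x; rewrite -mulmxA mul0mx mulmxBl mul1mx; have [ji|ji] := eqVneq j i.
  by rewrite ji in x *; rewrite Pr_i subrr mulmx0.
by rewrite Pr_j // subr0 (bigD1 j) //= mulrC rmorphM /= -[_ * _]/(_ *m _) -mulmxA P_kill mulmx0.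
Qed.

Hypothesis hE : local_field vE resE.
Hypothesis k2 : (2%:R : k) != 0.
Hypothesis P_int : forall j, vpoly vE 0 (P j).
Hypothesis P_res : forall j, map_poly resE (P j) = pl j.
Hypothesis Y_int : integral_mx vE (piE^-1 *: Y).
Local Notation A := (map_mx resE (piE^-1 *: Y)).
Hypothesis A_adj : A^T *m antidiag k n.+1 = antidiag k n.+1 *m A.
Variable u : {poly k}.
Hypotheses (u_i : pl i %| u + 1) (u_j : forall j, j != i -> pl j %| u - 1).
Hypothesis u_isom : isom_grp id (horner_mx A u).
Let hvE := valued_local hE.

(** The reductions of [P i] and [Q] divide u + 1 and a power of u - 1, which are coprime as 2 is
    invertible; so the projection is integral ([proj_integral]), and its reduction is identified by
    [unipotent_reduction]. *)
Lemma invol_red : integral_mx vE invol /\ map_mx resE invol = horner_mx A u.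
Proof.
pose Q := \prod_(j | j != i) P j.
have Q_int : vpoly vE 0 Q by apply: (vpoly_prod hvE) => j _; apply: P_int.
have Q_res : map_poly resE Q = \prod_(j | j != i) pl j.
  rewrite /Q -big_filter (res_poly_prod hvE) // big_filter.
  by apply: eq_bigr => j _; rewrite P_res.
have Qdv : map_poly resE Q %| (u - 1) ^+ #|[pred j | j != i]|.
  rewrite Q_res -prodr_const; apply: (big_ind2 (fun a b => a %| b)) => //.
    by move=> a a' b b' h h'; apply: dvdp_mul.
have cop : coprimep (map_poly resE (P i)) (map_poly resE Q).
  rewrite P_res; apply: (coprimep_dvdr u_i); apply: (coprimep_dvdl Qdv); apply: coprimep_expr.
  apply/Bezout_eq1_coprimepP; exists ((2%:R^-1)%:P, - (2%:R^-1)%:P) => /=.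
  rewrite mulNr -mulrBr (_ : u + 1 - (u - 1) = 1 + 1); last by ring.
  by rewrite -polyC1 -polyCD -polyCM -mulr2n mulVf.
have iPr : integral_mx vE Pr.
  exact: (proj_integral hvE Y_int (P_int i) Q_int cop kill_proj kill_coproj).
have i1 : integral_mx vE (1%:M : 'M[E]_n.+1) by apply/int_scalar/(vge_1 hvE).
have i2 : integral_mx vE (2%:R *: Pr).
  by move=> a b; rewrite mxE; apply: (vge_mull hvE) => //; apply: (vge_nat hvE).
have i3 := int_mxN hvE i2.
have rPr : map_mx resE (2%:R *: Pr) = 2%:R *: map_mx resE Pr.
  by apply/matrixP=> a b; rewrite !mxE (vd_mul hvE) ?(vge_nat hvE) // (res_nat hvE).
have r1 : map_mx resE (1%:M : 'M[E]_n.+1) = 1%:M by rewrite (res_scalar hvE) (vd_one hvE).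
split; first exact: (int_mxD hvE).
rewrite (res_mxD hvE) // (res_mxN hvE) // rPr r1; apply/esym.
have [J1 J2] := res_horner_mx hvE Y_int (P_int i).
have [J3 J4] := res_horner_mx hvE Y_int Q_int.
have z0 : map_mx resE (0 : 'M[E]_n.+1) = 0 by apply/matrixP=> a b; rewrite !mxE (res0 hvE).
apply: (unipotent_reduction k2 A_adj u_isom _ _ u_i Qdv).
  by rewrite -P_res -J2 -(res_mxM hvE) // kill_proj z0.
rewrite -J4 -r1 -(res_mxN hvE) // -(res_mxD hvE) //; last exact: (int_mxN hvE).
by rewrite -(res_mxM hvE) ?kill_coproj //; apply: (int_mxD hvE) => //; apply: (int_mxN hvE).
Qed.

End Involution.

Lemma sign_eq (K : fieldType) (x y : int) : (2%:R : K) != 0 -> x = 1 \/ x = -1 -> y = 1 \/ y = -1 ->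
  x%:~R = y%:~R :> K -> x = y.
Proof.
have h : (2%:R : K) != 0 -> (1 : K) <> -1.
  by move=> K2 E1; move: K2; rewrite -[2%:R]/(1 + 1) [X in _ + X]E1 subrr eqxx.
by move=> K2 [->|->] [->|->] //; rewrite mulr1z mulrN1z; [|move/esym]; move/(h K2).
Qed.

Lemma sum_degrees (k : fieldType) n (A : 'M[k]_n) m (pl : 'I_m -> {poly k}) :
  (forall i, irreducible_poly (pl i)) -> char_poly A = \prod_(i < m) pl i ->
  (\sum_j (size (pl j)).-1 = n)%N.
Proof.
move=> hirr hprod; have s0 i : (0 < size (pl i))%N by case: (hirr i) => /ltnW.
have := size_char_poly A; rewrite hprod size_prod => [|i _]; last by rewrite -size_poly_gt0.
have -> : (\sum_(i < m) size (pl i) = \sum_j (size (pl j)).-1 + #|'I_m|)%N.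
  by rewrite -sum1_card -big_split /=; apply: eq_bigr => i _; rewrite addn1 prednK.
by rewrite -addSn addnK => -[].
Qed.

Lemma horner_mx_coef (k : comNzRingType) n (A : 'M[k]_n.+1) (u : {poly k}) :
  horner_mx A u = \sum_(l < size u) u`_l *: A ^+ l.
Proof.
rewrite -[in LHS](coefK u) poly_def rmorph_sum; apply: eq_bigr => l _.
by rewrite /= horner_mxZ rmorphXn /= horner_mx_X.
Qed.

Lemma half_geometric (k : finFieldType) l : (2%:R : k) != 0 ->
  ((#|k| ^ l).-1)./2 = (\sum_(r < l) #|k| ^ r * (#|k|.-1)./2)%N.
Proof.
move=> k2; rewrite predn_exp -{1}(half_card k2) -doubleMl doubleK big_distrr /=.
by apply: eq_bigr => r _; rewrite mulnC.
Qed.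

Lemma infinite_extension (K L : fieldType) (kappa : fieldType) (v : K -> int) (r : K -> kappa)
    (f : {rmorphism K -> L}) (x : K) : valued v r -> x != 0 -> v x = 1 ->
  forall s : seq L, exists t, t \notin s.
Proof.
move=> hv x0 vx s; apply: contrapT => /forallNP H.
pose g e := f (x ^+ e).
have gI : injective g.
  move=> e e' /fmorph_inj/(congr1 v); rewrite !(vX hv) // vx.
  by apply: mulrIn; rewrite oner_eq0.
have : (size [seq g e | e <- seq.iota 0 (size s).+1] <= size s)%N.
  apply: uniq_leq_size; first by rewrite map_inj_uniq ?iota_uniq.
  by move=> _ /mapP[e _ ->]; apply/negPn/negP/H.
by rewrite size_map size_iota ltnn.
Qed.

Theorem corollary5p8
  (F : fieldType) (k : finFieldType) (vF : F -> int) (resF : F -> k)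
  (hF : local_field vF resF)
  (p : nat) (hp : p \in [pchar k]) (hp2 : (2 < p)%N)
  (piF : F) (hpiF : uniformizer vF piF)
  (E : fieldExtType F) (vE : E -> int) (resE : E -> k)
  (hE : local_field vE resE)
  (hdim : \dim {: E} = 2%N)
  (hram : val_ext (in_alg E) vF vE 2)
  (hres : res_ext (in_alg E) id vF resF resE)
  (bar : {lrmorphism E -> E})
  (piE : E) (hpiE : uniformizer vE piE) (hbar : bar piE = - piE)
  (Fbar : fieldType) (iota : {rmorphism E -> Fbar})
  (hFbar : separable_closure (iota \o in_alg E))
  (kbar : closedFieldType) (rho : {rmorphism k -> kbar})
  (hkbar : algebraic_ext rho)
  (n : nat) (lam : 'M[E]_n -> k)
  (hlam : functional vF resF vE bar lam)
  (lamt : 'M[E]_n) (hlamt : lifts vE resE bar piF lam lamt)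
  (hstable : stable rho (red_op resE piE lamt))
  (m : nat) (pl : 'I_m -> {poly k})
  (hmonic : forall i, pl i \is monic)
  (hirr : forall i, irreducible_poly (pl i))
  (hprod : char_poly (red_op resE piE lamt) = \prod_(i < m) pl i)
  (B : forall i, unram_pair vF resF vE resE bar (size (pl i)).-1)
  (phi : forall i, {linear up_E (B i) -> 'cV[E]_n})
  (theta : forall i, up_E (B i)) (eta : forall i, up_F (B i))
  (hdec : orth_decomp piE lamt phi theta eta)
  (eps : 'M[E]_n -> int) (heps : toral_char bar iota lamt vE eps)
  (i : 'I_m) (c : 'M[k]_n) (hc : is_ci (red_op resE piE lamt) pl i c)
  (g : 'M[E]_n) (hg : torusF bar lamt g)
  (hgint : forall a b, vge vE 0 (g a b)) (hgc : map_mx resE g = c) :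
  let d j := (size (pl j)).-1 in
  let D := \det (gram (id : k -> k) n) in
  eps g = qchar (-1 : k) ^+ (d i * (n - d i))
          * (\prod_(j < m) (-1) ^+ (d j).-1) ^+ d i
          * qchar (eta_bar (eta i)) ^+ n
          * qchar D ^+ d i.
Proof.
have sum_d := sum_degrees hirr hprod.
have dgt j : (0 < (size (pl j)).-1)%N by rewrite -ltnS prednK; case: (hirr j) => // /ltnW.
have n0 : (0 < n)%N by rewrite -sum_d (bigD1 i) //= addn_gt0 dgt.
destruct n as [|n']; first by [].
move=> d dsc.
have k2 : (2%:R : k) != 0 by rewrite -(dvdn_pcharf hp) gtnNdvd.
have bK := barK k2 hE hdim hpiE hbar.
have [pi0 vpi] := hpiE; have hvE := valued_local hE.
have iota_bar := iota_bar_neq k2 hE hpiE hbar (iota := iota).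
have [hY Y1] := hlamt.1.
have Y_int : integral_mx vE (piE^-1 *: lamt).
  move=> a b; rewrite mxE -[0](_ : -1 + 1 = 0) //; apply: (vge_mul hvE); last exact: Y1.
  by rewrite vgeE ?invr_eq0 // (vV hvE) // vpi.
(* [lamt] is skew-adjoint and [bar] negates [piE], so the quotient is self-adjoint; on residues
   [bar] is trivial and the form becomes the symmetric one. *)
have A_adj : (map_mx resE (piE^-1 *: lamt))^T *m antidiag k n'.+1 =
    antidiag k n'.+1 *m map_mx resE (piE^-1 *: lamt).
  have E1 : (piE^-1 *: lamt)^T *m antidiag E n'.+1 =
      antidiag E n'.+1 *m map_mx bar (piE^-1 *: lamt).
    rewrite map_mxZ fmorphV /= hbar invrN linearZ /= -scalemxAl -scalemxAr scaleNr -scalerN.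
    by congr (_ *: _); apply/eqP; rewrite -addr_eq0; apply/eqP/isom_lieE.
  have iJ : integral_mx vE (antidiag E n'.+1) by move=> a b; rewrite mxE (vge_nat hvE).
  have rJ : map_mx resE (antidiag E n'.+1) = antidiag k n'.+1.
    by apply/matrixP=> a b; rewrite !mxE (res_nat hvE).
  have ib : integral_mx vE (map_mx bar (piE^-1 *: lamt)).
    by move=> a b; rewrite mxE (vge_bar k2 hE hdim hram hpiE hbar).
  have iT : integral_mx vE (piE^-1 *: lamt)^T by move=> a b; rewrite mxE.
  have := congr1 (map_mx resE) E1; rewrite !(res_mxM hvE) // rJ map_trmx => ->.
  congr (_ *m _); apply/matrixP=> a b; rewrite !mxE (res_bar k2 hE hdim hram hpiE hbar) //.
  by have := Y_int a b; rewrite mxE.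
(* A common multiple of the degrees, so that one extension contains the eigenvalues of every
   block. *)
pose N := (\prod_j (size (pl j)).-1)%N.
have dN j : ((size (pl j)).-1 %| N)%N by rewrite /N (bigD1 j) //= dvdn_mulr.
have N0 : (0 < N)%N by rewrite prodn_gt0.
have [D] := urdata_exists hF k2 hE hdim hram hres hpiE hbar hFbar rho N0.
have hb j := block_exists hF k2 hE hdim hram hpiE hbar D (hmonic j) (hirr j) hY
  (od_eta hdec j) (od_form hdec (i := j)) (od_stable hdec (i := j)) (od_factor hdec j) (dN j).
have [P /choice[v /choice[tau /choice[H hH]]]] := choice hb.
have P_monic j : P j \is monic by case: (hH j).
have P_int j : vpoly vE 0 (P j) by case: (hH j).
have P_res j : map_poly resE (P j) = pl j by case: (hH j).
have P_kill j x : horner_mx (piE^-1 *: lamt) (P j) *m phi j x = 0 by case: (hH j) => _ _ _ [].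
have P_tau j : (map_poly (ud_emb D) (P j)).[tau j] = 0 by case: (hH j) => _ _ _ [].
have hspec j : block_spec piE (pl j) (phi j) (theta j) (size (pl j)).-1 (qchar (eta_bar (eta j)))
  (v j) (tau j) (H j) by case: (hH j).
clear hb hH.
pose W := emat sum_d v; pose y c0 := ud_emb D piE * eval_ sum_d tau c0.
pose Hc := eform sum_d H; pose pi := shift_perm sum_d.
pose I := [set c0 | blk sum_d c0 == i].
have piI c0 : (pi c0 \in I) = (c0 \in I) by rewrite !inE blk_shift.
have W_fr := emat_fr sum_d hspec.
have W_form := emat_form pi0 hbar hY hmonic hirr sum_d hdec hspec.
have W_eig := emat_eigen hbar hY hirr sum_d hdec hspec.
have H0 := eform0 sum_d hspec; have vH := v_eform sum_d hspec.
have y_inj : injective y.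
  move=> a b; rewrite /y => /mulfI; rewrite fmorph_eq0 => /(_ pi0).
  exact: (eval_inj hE k2 hmonic hirr hdec P_monic P_int P_res P_kill P_tau hspec Y_int hstable.1 A_adj).
have [u [Ec ui uj]] := hc; rewrite -horner_mx_coef in Ec.
have [Pr [Pr_i Pr_j]] := exists_proj hdec i.
have c_isom : isom_grp id (horner_mx (red_op resE piE lamt) u).
  rewrite -Ec -hgc; apply/(isom_grpE idfun); have /isom_grpE/(congr1 (map_mx resE)) := hg.1.
  have iJ : integral_mx vE (antidiag E n'.+1) by move=> a b; rewrite mxE (vge_nat hvE).
  have rJ : map_mx resE (antidiag E n'.+1) = antidiag k n'.+1.
    by apply/matrixP=> a b; rewrite !mxE (res_nat hvE).
  have ib : integral_mx vE (map_mx bar g).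
    by move=> a b; rewrite mxE (vge_bar k2 hE hdim hram hpiE hbar).
  have iT : integral_mx vE g^T by move=> a b; rewrite mxE.
  rewrite (res_mxM hvE (int_mxM hvE iT iJ) ib) (res_mxM hvE iT iJ) rJ => {2}<-; rewrite map_trmx; congr (_ *m _); apply/matrixP=> a b.
  by rewrite !mxE (res_bar k2 hE hdim hram hpiE hbar).
pose ga := invol Pr.
have [ga_int ga_res] := invol_red hdec Pr_i Pr_j P_kill hE k2 P_int P_res Y_int A_adj ui uj c_isom.
have tga := invol_torus hdec Pr_i Pr_j.
have ga2 := invol_sq hdec Pr_i Pr_j.
have ga_W : map_mx (ud_emb D) ga *m W = W *m diag_mx (\row_c0 (if c0 \in I then -1 else 1)).
  apply/matrixP=> a c0; rewrite mul_mx_diag.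
  have -> : (map_mx (ud_emb D) ga *m W) a c0 = (map_mx (ud_emb D) ga *m evec sum_d v c0) a 0.
    by rewrite -col_emat colE mulmxA -colE [RHS]mxE.
  have -> : map_mx (ud_emb D) ga *m evec sum_d v c0 =
      (if c0 \in I then -1 else 1) *: evec sum_d v c0.
    have [al [x ->]] := evec_span sum_d hspec c0.
    rewrite mulmx_sumr scaler_sumr; apply: eq_bigr => l _; rewrite -scalemxAr -map_mxM.
    rewrite (invol_phi Pr_i Pr_j) map_mxZ !scalerA mulrC; congr (_ * _ *: _).
    by rewrite inE; case: eqP => _; rewrite ?rmorphN rmorph1.
  by rewrite !mxE mulrC.
have [two0 vtwo] := two_unitE k2 hE.
have hinf := infinite_extension iota hvE pi0 vpi.
have two_L : (2%:R : Fbar) != 0 by rewrite -(rmorph_nat iota) fmorph_eq0.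
have [EP sP] := eig_prod k2 bK iota_bar hinf two_L (y := y) hY W_fr (eform_fr sum_d hspec)
  (eform_bar sum_d hspec) H0 vH W_form W_eig y_inj (shift_exp sum_d dN) piI tga ga_W.
pose h := (#|k|.-1)./2; pose b c0 := ud_res (Hc c0).
set e := qchar (eta_bar (eta i)) in hspec *.
have hsgn : e = 1 \/ e = -1 := bs_sign (hspec i).
have AE : (\prod_(c0 in I) b c0) ^+ h = e%:~R.
  (* The residues on block [i] are the Frobenius conjugates of that of [H i]; their product turns
     the exponent (q - 1)/2 into the (q^d - 1)/2 of [bs_res]. *)
  have -> : \prod_(c0 in I) b c0 = \prod_(r < (size (pl i)).-1) ud_res (H i) ^+ (#|k| ^ r).
    rewrite -(big_block sum_d _ i (fun r => ud_res (H i) ^+ (#|k| ^ r))).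
    by apply: eq_big => [c0|c0]; rewrite inE // => /eqP E1; rewrite /b (eform_res sum_d hspec) E1.
  rewrite -prodrXl -(bs_res (hspec i)) (half_geometric _ k2) -prodrXr.
  by apply: eq_bigr => r _; rewrite exprM.
have e2 : ((\prod_(c0 in I) b c0) ^+ h) ^+ 2 = 1.
  by rewrite AE -rmorphXn; case: hsgn => ->.
have mix := mixed_prod e2; rewrite AE in mix.
have CE := sign_prod k2 W_fr H0 vH W_form.
rewrite (sign_shift dgt) in CE.
have kb2 : (2%:R : kbar) != 0 by rewrite -(rmorph_nat rho) fmorph_eq0.
have dsc0 : dsc != 0.
  by rewrite /dsc gram_antidiag det_antidiag; case: (det_antidiag_sign n'.+1) => ->;
    rewrite ?mulrN1z ?mulr1z ?oppr_eq0 oner_neq0.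
have [Ed sd] := euler_qchar k2 dsc0.
have N1 : (-1 : k) != 0 by rewrite oppr_eq0 oner_neq0.
have [En sn] := euler_qchar k2 N1.
(* Both elements reduce to [c], so their product reduces to the square of [ga], which is 1, and
   [tc_triv] applies; [eps ga] is its own inverse. *)
have gE : eps g = eps ga.
  have tgg : torusF bar lamt (g *m ga).
    split; first by apply: isom_grpM; [exact: hg.1|exact: tga.1].
    by rewrite -mulmxA tga.2 !mulmxA hg.2.
  have h1 : eps (g *m ga) = 1.
    apply: (tc_triv heps) => //; split; first exact: tgg.1.
    have cc : map_mx resE (g *m ga) = 1%:M.
      rewrite (res_mxM hvE) // hgc Ec -ga_res -(res_mxM hvE) // ga2.
      by rewrite (res_scalar hvE) (vd_one hvE).
    have i1 : integral_mx vE (1%:M : 'M[E]_n'.+1) by apply/int_scalar/(vge_1 hvE).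
    have i2 := int_mxM hvE hgint ga_int; move=> a a'.
    have i3 := int_mxD hvE i2 (int_mxN hvE i1).
    rewrite -(vd_ker hvE); last exact: i3.
    have := res_mxD hvE i2 (int_mxN hvE i1); rewrite (res_mxN hvE i1) cc (res_scalar hvE) (vd_one hvE) subrr.
    by move/matrixP/(_ a a'); rewrite !mxE => ->.
  have h2 : eps ga = 1 \/ eps ga = -1 by rewrite (tc_val heps tga ga2).
  have := tc_mul heps hg tga; rewrite h1.
  by case: h2 => ->; [rewrite mulr1 => <-|rewrite mulrN1 => E1; rewrite E1 opprK].
have sgnM (x z : int) : x = 1 \/ x = -1 -> z = 1 \/ z = -1 -> x * z = 1 \/ x * z = -1.
  by case=> ->; case=> ->; rewrite ?mulrNN ?mulr1 ?mul1r; auto.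
have sgnX (x : int) r : x = 1 \/ x = -1 -> x ^+ r = 1 \/ x ^+ r = -1.
  by move=> hx; elim: r => [|r IH]; [left|rewrite exprS; apply: sgnM].
have sgnP (f : 'I_m -> int) : (forall j, f j = 1 \/ f j = -1) ->
    \prod_j f j = 1 \/ \prod_j f j = -1.
  by move=> hf; apply: (big_ind (fun x : int => x = 1 \/ x = -1)) => //; left.
(* Both sides are signs, and 1 and -1 differ in [kbar]; it is enough to compare images there. *)
rewrite gE (tc_val heps tga ga2); apply: (sign_eq kb2) => //.
  apply: (sgnM _ _ (sgnM _ _ (sgnM _ _ (sgnX _ _ sn) (sgnX _ _ _)) (sgnX _ _ hsgn)) (sgnX _ _ sd)).
  by apply: sgnP => j; apply: sgnX; right.
rewrite [LHS]EP [LHS]mix CE !rmorphM !rmorphXn rmorph_prod /= card_block.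
have rE (x : int) : x%:~R = rho x%:~R by rewrite rmorph_int.
rewrite [in RHS](rE (qchar (-1))) [in RHS](rE (qchar dsc)) En Ed !rmorphXn rmorphN1.
have -> : \prod_(j < m) ((-1) ^+ (d j).-1)%:~R = \prod_(j < m) (-1) ^+ (d j).-1 :> kbar.
  by apply: eq_bigr => j _; rewrite rmorphXn /= mulrN1z.
by rewrite exprMn; ring.
Qed.
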